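(* Let $d\ge1$, let $\Phi\colon(0,\infty)\to\mathbb{R}$ be smooth, and let $(p,\kappa,s,q)$ be admissible parameters. For all $j,n\in\mathbb{N}$ there exist constants $C_{j,n},L_{j,n}\in(0,\infty)$ such that $$\|F^{(j)}(u)\|_{X_0}\le C_{j,n}\|u\|_{X^{\mathrm{Tr}}_{\kappa,p}},\qquad \|F^{(j)}(u)-F^{(j)}(v)\|_{X_0}\le L_{j,n}\|u-v\|_{X^{\mathrm{Tr}}_{\kappa,p}}$$ for all $u,v\in X^{\mathrm{Tr}}_{\kappa,p}$ with $\|u\|_{X^{\mathrm{Tr}}_{\kappa,p}},\|v\|_{X^{\mathrm{Tr}}_{\kappa,p}}\le n$, where $F^{(j)}(u)=\operatorname{div}(\Phi_j(u)\nabla u)$.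
   Context: $\mathbb{T}^d=\mathbb{R}^d/\mathbb{Z}^d$; $H^{s,q}$ and $B^s_{q,p}$ are the Bessel potential and Besov spaces. $X_0=H^{s-2,q}(\mathbb{T}^d)$, $X^{\mathrm{Tr}}_{\kappa,p}=B^{s+2-4\frac{1+\kappa}{p}}_{q,p}(\mathbb{T}^d)$. Admissible parameters: $s\in(-\tfrac12,\infty)$, $p,q\in[2,\infty)$, $\kappa\in[0,\infty)$ with: (a) either $p\in(2,\infty)$ and $\kappa\in[0,\tfrac p2-1)$, or $q=p=2$ and $\kappa=0$; (b) $s+2-4\tfrac{1+\kappa}{p}-\tfrac dq>0$; (c) $s+2-4\tfrac{1+\kappa}{p}>1-s$. Regularized coefficient: fix a smooth increasing $\eta\colon\mathbb{R}\to\mathbb{R}$ with $\eta(r)=1$ for $r\ge2$ and $\eta(r)=0$ for $r\le1$, and set $\eta_j(r)=\eta(jr)$ and $\Phi_j(r)=\eta_j(r)\Phi(r)$ for $r\in\mathbb{R}$ (with $\Phi_j:=0$ where $\eta_j=0$); $\Phi_j\colon\mathbb{R}\to\mathbb{R}$ is smooth. If $s<1$, the product $\Phi_j(u)\nabla u$ is understood in the sense of Sobolev pointwise multipliers. *)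

(* Defs.v *)
From HB Require Import structures.
From mathcomp Require Import all_boot all_order all_algebra.
From mathcomp Require Import all_classical all_reals all_analysis.
Set Implicit Arguments.
Unset Strict Implicit.
Unset Printing Implicit Defensive.
Import Order.TTheory GRing.Theory Num.Theory.
Import numFieldNormedType.Exports.
Local Open Scope classical_set_scope.
Local Open Scope ring_scope.

(* Functions on T^d = R^d / Z^d are functions on 'rV[R]_d: test functions are
   Z^d-periodic, whereas L^q functions only matter through their restriction
   to the fundamental domain [0,1]^d. *)

Section TorusMeasure.
Context {R : realType}.

Definition row_of_tuple d (t : d.-tuple R) : 'rV[R]_d := \row_i tnth t i.

Definition cons_pair d (x : measurableTypeR R * d.-tuple (measurableTypeR R))
    : d.+1.-tuple (measurableTypeR R) :=
  [the d.+1.-tuple (measurableTypeR R) of x.1 :: x.2].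

Lemma measurable_cons_pair d : measurable_fun setT (@cons_pair d).
Proof.
exact: (measurable_cons measurable_fst measurable_snd).
Qed.

HB.instance Definition _ d :=
  isMeasurableFun.Build _ _ _ _ (@cons_pair d) (@measurable_cons_pair d).

(* Lebesgue measure on [0,1]^d, as the d-fold product of the one on [0,1]. *)
Fixpoint torus_measure (d : nat)
    : probability (d.-tuple (measurableTypeR R)) R :=
  match d with
  | 0 => \d_([tuple] : 0.-tuple (measurableTypeR R))
  | d'.+1 => distribution
      (uniform_prob (@ltr01 R) \x torus_measure d')%E (@cons_pair d')
  end.

Definition torus_integral d (f : 'rV[R]_d -> R) : R :=
  Rintegral (torus_measure d) setT (f \o @row_of_tuple d).

Definition in_Lq d (q : R) (f : 'rV[R]_d -> R) : Prop :=
  f \o @row_of_tuple d \in Lfun (torus_measure d) q%:E.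

Definition Lq_norm d (q : R) (f : 'rV[R]_d -> R) : \bar R :=
  Lnorm (torus_measure d) q%:E (EFin \o f \o @row_of_tuple d).

End TorusMeasure.

Section Distributions.
Context {R : realType} {d : nat}.

Definition partial (i : 'I_d) (phi : 'rV[R]_d -> R) : 'rV[R]_d -> R :=
  fun x => derive phi x (delta_mx 0 i).

Definition iter_partial (l : seq 'I_d) (phi : 'rV[R]_d -> R) :=
  foldr partial phi l.

Definition test_function (phi : 'rV[R]_d -> R) : Prop :=
  (forall (i : 'I_d) x, phi (x + delta_mx 0 i) = phi x) /\
  (forall (l : seq 'I_d) x, differentiable (iter_partial l phi) x).

(* Only the values on test functions matter. *)
Definition functional := ('rV[R]_d -> R) -> R.

Definition distribution_on_torus (T : functional) : Prop :=
  (forall (a : R) phi psi, test_function phi -> test_function psi ->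
     T (fun x => a * phi x + psi x) = a * T phi + T psi) /\
  (exists (N : nat) (C : R), forall phi (M : R), test_function phi ->
     (forall l x, (size l <= N)%N -> `|iter_partial l phi x| <= M) ->
     `|T phi| <= C * M).

Definition eq_distr (T S : functional) : Prop :=
  forall phi, test_function phi -> T phi = S phi.

Definition distr_of_fun (f : 'rV[R]_d -> R) : functional :=
  fun phi => torus_integral (fun x => f x * phi x).

Definition represents (f : 'rV[R]_d -> R) (T : functional) : Prop :=
  in_Lq 1 f /\ eq_distr T (distr_of_fun f).

Definition distr_partial (i : 'I_d) (T : functional) : functional :=
  fun phi => - T (partial i phi).

Definition distr_div (h : 'I_d -> functional) : functional :=
  fun phi => \sum_(i < d) distr_partial i (h i) phi.

End Distributions.
Arguments functional : clear implicits.

Section FunctionSpaces.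
Context {R : realType} {d : nat}.

Definition phase (k : 'rV[int]_d) (x : 'rV[R]_d) : R :=
  2 * pi * \sum_(i < d) (k 0 i)%:~R * x 0 i.

Definition freq_norm (k : 'rV[int]_d) : R :=
  Num.sqrt (\sum_(i < d) (k 0 i)%:~R ^+ 2).

(* g = F^{-1} ((1 + |k|^2)^{t/2} F T). For real-valued T, the k-th Fourier
   coefficient is T (cos (2 pi k.x)) - i T (sin (2 pi k.x)). *)
Definition bessel_potential (t : R) (T : functional R d)
    (g : 'rV[R]_d -> R) : Prop :=
  forall k : 'rV[int]_d,
    torus_integral (fun x => g x * cos (phase k x)) =
      (1 + freq_norm k ^+ 2) `^ (t / 2) * T (cos \o phase k) /\
    torus_integral (fun x => g x * sin (phase k x)) =
      (1 + freq_norm k ^+ 2) `^ (t / 2) * T (sin \o phase k).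

(* Norm of H^{t,q}(T^d). Such a g is unique almost everywhere; the value is
   +oo when there is none. *)
Definition H_norm (t q : R) (T : functional R d) : \bar R :=
  ereal_inf [set Lq_norm q g | g in
    [set g | in_Lq q g /\ bessel_potential t T g]].

Definition in_H (t q : R) (T : functional R d) : Prop :=
  distribution_on_torus T /\ (H_norm t q T < +oo)%E.

Definition smooth_on (A : set R) (f : R -> R) : Prop :=
  forall (n : nat) x, A x -> derivable (derive1n n f) x 1.

(* Radial profile generating a smooth dyadic partition of unity; different
   profiles give equivalent Besov norms. *)
Definition dyadic_profile (chi : R -> R) : Prop :=
  [/\ smooth_on setT chi, forall r, r <= 1 -> chi r = 1
    & forall r, 2 <= r -> chi r = 0].

Definition dyadic_symbol (chi : R -> R) (l : nat) (k : 'rV[int]_d) : R :=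
  if l is l'.+1 then
    chi (freq_norm k / 2 ^+ l) - chi (freq_norm k / 2 ^+ l')
  else chi (freq_norm k).

(* The real form of sum_k phi_l(k) F T(k) e^{2 pi i k.x}; the symbol is even
   with finite support. *)
Definition dyadic_block (chi : R -> R) (l : nat) (T : functional R d)
    : 'rV[R]_d -> R :=
  fun x => \sum_(k \in [set: 'rV[int]_d])
    (dyadic_symbol chi l k * T (fun y => cos (phase k (x - y)))).

(* Norm of B^t_{q,p}(T^d), in this order of arguments: q is integrability, p is summability. *)
Definition besov_norm (chi : R -> R) (t q p : R) (T : functional R d)
    : \bar R :=
  ((\sum_(0 <= l <oo)
      (((2 `^ (l%:R * t))%:E * Lq_norm q (dyadic_block chi l T)) `^ p))
    `^ p^-1)%E.

End FunctionSpaces.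

Section Nonlinearity.
Context {R : realType} {d : nat}.

(* h = f g in H^{t,q}: the value at g of the extension of phi |-> f phi from
   smooth functions to H^{t,q} by continuity. The limit of f phi_m is taken in
   the sense of distributions, which determines h because smooth functions are
   dense in H^{t,q}. *)
Definition multiplier_product (t q : R) (f : 'rV[R]_d -> R)
    (g h : functional R d) : Prop :=
  [/\ in_H t q g, in_H t q h &
    forall phi : nat -> 'rV[R]_d -> R, (forall m, test_function (phi m)) ->
      (fun m => H_norm t q (distr_of_fun (phi m) \- g)) @ \oo --> 0%E ->
      forall psi, test_function psi ->
        (fun m => distr_of_fun (fun x => f x * phi m x) psi) @ \oo --> h psi].

Definition pointwise_product (q : R) (f : 'rV[R]_d -> R)
    (g h : functional R d) : Prop :=
  exists2 g0, in_Lq q g0 /\ represents g0 g &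
    represents (fun x => f x * g0 x) h.

Definition eta_cutoff (eta : R -> R) : Prop :=
  [/\ smooth_on setT eta, {homo eta : x y / x <= y},
      forall r, 2 <= r -> eta r = 1 & forall r, r <= 1 -> eta r = 0].

(* The values of Phi outside (0, oo) are irrelevant, since eta (j r) = 0
   there. *)
Definition Phi_reg (eta Phi : R -> R) (j : nat) (r : R) : R :=
  eta (j%:R * r) * Phi r.

(* w = div (Phi_j(u) grad u), where f is u as a function (defined almost
   everywhere) and h is Phi_j(u) grad u. *)
Definition is_F (s q : R) (eta Phi : R -> R) (j : nat)
    (u w : functional R d) : Prop :=
  distribution_on_torus w /\
  exists2 f, represents f u &
  exists2 h : 'I_d -> functional R d,
    forall i, distribution_on_torus (h i) /\
      (if s < 1 then
         multiplier_product (s - 1) q (Phi_reg eta Phi j \o f)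
           (distr_partial i u) (h i)
       else
         pointwise_product q (Phi_reg eta Phi j \o f)
           (distr_partial i u) (h i)) &
    eq_distr w (distr_div h).

Definition trace_exponent (s p kappa : R) : R :=
  s + 2 - 4 * ((1 + kappa) / p).

Record admissible (s p q kappa : R) : Prop := Admissible {
  adm_s : - 2^-1 < s;
  adm_p : 2 <= p;
  adm_q : 2 <= q;
  adm_kappa : 0 <= kappa;
  adm_a : (2 < p /\ kappa < p / 2 - 1) \/ [/\ q = 2, p = 2 & kappa = 0];
  adm_b : 0 < trace_exponent s p kappa - d%:R / q;
  adm_c : 1 - s < trace_exponent s p kappa
}.

Definition X0_norm (s q : R) (T : functional R d) : \bar R :=
  H_norm (s - 2) q T.

Definition XTr_norm (chi : R -> R) (s p q kappa : R) (T : functional R d)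
    : \bar R :=
  besov_norm chi (trace_exponent s p kappa) q p T.

Definition in_XTr (chi : R -> R) (s p q kappa : R) (T : functional R d)
    : Prop :=
  distribution_on_torus T /\ (XTr_norm chi s p q kappa T < +oo)%E.

End Nonlinearity.
Arguments admissible {R} d s p q kappa.

(* Main.v *)
Require Import Defs.
From HB Require Import structures.
From mathcomp Require Import all_boot all_order all_algebra.
From mathcomp Require Import all_classical all_reals all_analysis.
From mathcomp Require Import measurable_realfun.
From mathcomp Require Import ring lra zify.
Set Implicit Arguments.
Unset Strict Implicit.
Unset Printing Implicit Defensive.
Import Order.TTheory GRing.Theory Num.Theory.
Import numFieldNormedType.Exports.
Local Open Scope classical_set_scope.
Local Open Scope ring_scope.

(* Let Psi be the antiderivative of Phi_j vanishing at 0, so that F^(j)(u) is the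
   Laplacian of Psi(u), and let theta = s + 2 - 4 (1 + kappa) / p > d / q. The
   dyadic partial sums S_l u converge uniformly, hence Psi(u) - Psi(v) is the sum
   of the blocks Psi(S_{l+1} u) - Psi(S_l u) - Psi(S_{l+1} v) + Psi(S_l v), and the
   derivatives of order a of the l-th block are bounded in L^q by 2^{la} c_l, where
   2^{l theta} c_l is bounded in l^p by the Besov norm of u - v. If theta > s, the
   blocks can be summed one by one in H^{s,q}, because each of them loses only an
   arbitrarily small power of 2^l; if theta = s, then q = p = 2 and the blocks are
   summed by Plancherel. Powers of 1 + |k|^2 are bounded on any translation invariant
   norm by subordination to the heat semigroup, which is itself a limit of averages
   of translations, since exp(- t k^2) = lim cos(k (2 t / n)^{1/2})^n.

   That Phi_j(u) grad u = grad Psi(u), in the sense of multipliers if s < 1, follows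
   by duality: for a test function psi, Phi_j(u) psi is a uniform limit of
   trigonometric polynomials bounded in H^{1-s,q} because 1 - s < theta, and
   int Phi_j(u) (d_i S_m u) psi tends to - int Psi(u) d_i psi because 2 theta > 1. *)

(** * Smooth functions and bounds for their derivatives *)

(** For multipliers on L^q nothing but translation invariance is used: symbols are built from
    averages of translations by products and limits. This yields Bernstein's inequality and Bessel
    potentials at one dyadic scale, but no square function; hence the summation block by block, and
    Plancherel when theta = s. Psi(S_l u) is not spectrally localised, so derivative bounds at scale
    2^l replace frequency supports throughout. The bound must be linear in u - v, so Psi is compared
    along l and between u and v at the same time: a second difference. The estimate for F^(j)(u)
    alone is the case v = 0, because Psi(0) = 0. Condition (b) makes uniform norms of blocks decay
    geometrically. Condition (a) gives s <= theta, with equality only for p = q = 2, and together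
    with (c) it gives 2 theta > 1. Both notions of product leave choices open: the representative of
    u and, if s < 1, the approximating sequence. The identity for the product is therefore proved
    for every choice, which needs that test functions separate integrable functions almost
    everywhere. *)

Section SmoothCalculus.
Context {R : realType} {d : nat}.
Implicit Types (f g : 'rV[R]_d -> R) (Psi : R -> R).

Lemma smooth_on_derive1 Psi : smooth_on setT Psi -> smooth_on setT (derive1 Psi).
Proof. by move=> sPsi n x _; have := sPsi n.+1 x I; rewrite derive1Sn. Qed.

Lemma smooth_on_derivable Psi x : smooth_on setT Psi -> derivable Psi x 1.
Proof. by move=> sPsi; exact: (sPsi 0%N x I). Qed.

Lemma smooth_on_continuous Psi : smooth_on setT Psi -> continuous Psi.
Proof.
move=> sPsi x; apply: differentiable_continuous; apply/derivable1_diffP.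
exact: smooth_on_derivable.
Qed.

Lemma partialE i f x : differentiable f x ->
  partial i f x = 'd f x (delta_mx 0 i).
Proof. by move=> df; rewrite /partial deriveE. Qed.

Lemma partialD i f g : (forall x, differentiable f x) ->
  (forall x, differentiable g x) ->
  partial i (fun x => f x + g x) = fun x => partial i f x + partial i g x.
Proof.
by move=> df dg; apply/funext => x; rewrite /partial deriveD//; exact: diff_derivable.
Qed.

Lemma partialN i f : (forall x, differentiable f x) ->
  partial i (fun x => - f x) = fun x => - partial i f x.
Proof.
by move=> df; apply/funext => x; rewrite /partial deriveN//; exact: diff_derivable.
Qed.

Lemma partialM i f g : (forall x, differentiable f x) ->
  (forall x, differentiable g x) ->
  partial i (fun x => f x * g x) =
  fun x => f x * partial i g x + g x * partial i f x.
Proof.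
by move=> df dg; apply/funext => x; rewrite /partial deriveM//; exact: diff_derivable.
Qed.

Lemma partial_cst i (c : R) : partial i (fun=> c) = (fun=> 0) :> ('rV[R]_d -> R).
Proof. by apply/funext => x; rewrite /partial derive_cst. Qed.

Lemma differentiable_smooth_comp Psi f x : smooth_on setT Psi ->
  differentiable f x -> differentiable (fun y => Psi (f y)) x.
Proof.
move=> sPsi df; apply: differentiable_comp => //.
by apply/derivable1_diffP; exact: smooth_on_derivable.
Qed.

Lemma partial_comp i Psi f : smooth_on setT Psi ->
  (forall x, differentiable f x) ->
  partial i (fun x => Psi (f x)) = fun x => derive1 Psi (f x) * partial i f x.
Proof.
move=> sPsi df; apply/funext => x.
have dP : derivable Psi (f x) 1 by exact: smooth_on_derivable.
have dP' : differentiable Psi (f x) by apply/derivable1_diffP.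
rewrite partialE; last exact: differentiable_smooth_comp.
rewrite (_ : (fun y => Psi (f y)) = Psi \o f)// diff_comp//=.
by rewrite deriv1E// partialE// mulrC.
Qed.

(** The recursion peels off the derivative applied first, so that an induction can pass to
    [partial i f]; [iter_partial] peels off the one applied last, which is why [test_functionP]
    works with [rcons]. *)
Fixpoint sm n f : Prop :=
  (forall x, differentiable f x) /\
  if n is n'.+1 then forall i : 'I_d, sm n' (partial i f) else True.

Lemma sm_diff n f x : sm n f -> differentiable f x.
Proof. by case: n => [|n] [+ _]; exact. Qed.

Lemma smS n f : sm n.+1 f -> sm n f.
Proof.
elim: n f => [|n IH] f [df sf]; split => // i.
by apply: IH; exact: sf.
Qed.

Lemma sm_partial n i f : sm n.+1 f -> sm n (partial i f).
Proof. by move=> [_ H]; exact: H. Qed.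

Lemma smD n f g : sm n f -> sm n g -> sm n (fun x => f x + g x).
Proof.
elim: n f g => [|n IH] f g [df sf] [dg sg]; split.
- by move=> x; exact: differentiableD.
- by [].
- by move=> x; exact: differentiableD.
- by move=> i; rewrite partialD//; apply: IH; [exact: sf|exact: sg].
Qed.

Lemma smN n f : sm n f -> sm n (fun x => - f x).
Proof.
elim: n f => [|n IH] f [df sf]; split.
- by move=> x; exact: differentiableN.
- by [].
- by move=> x; exact: differentiableN.
- by move=> i; rewrite partialN//; apply: IH; exact: sf.
Qed.

Lemma smB n f g : sm n f -> sm n g -> sm n (fun x => f x - g x).
Proof. by move=> sf sg; apply: smD => //; exact: smN. Qed.

Lemma smM n f g : sm n f -> sm n g -> sm n (fun x => f x * g x).
Proof.
elim: n f g => [|n IH] f g sf sg; split.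
- by move=> x; apply: differentiableM; [exact: sm_diff sf|exact: sm_diff sg].
- by [].
- by move=> x; apply: differentiableM; [exact: sm_diff sf|exact: sm_diff sg].
- move=> i; rewrite partialM; last 2 first.
    by move=> x; exact: sm_diff sf.
    by move=> x; exact: sm_diff sg.
  by apply: smD; apply: IH; (try exact: smS); exact: sm_partial.
Qed.

Lemma sm_cst n (c : R) : sm n (fun=> c).
Proof.
elim: n c => [|n IH] c; split => //; try by move=> x; exact: differentiable_cst.
by move=> i; rewrite partial_cst.
Qed.

Lemma smZ n (c : R) f : sm n f -> sm n (fun x => c * f x).
Proof. by move=> sf; apply: smM => //; exact: sm_cst. Qed.

Lemma sm_sum n (I : Type) (r : seq I) (F : I -> 'rV[R]_d -> R) :
  (forall i, sm n (F i)) -> sm n (fun x => \sum_(i <- r) F i x).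
Proof.
move=> sF; elim: r => [|i r IH].
  by under eq_fun do rewrite big_nil; exact: sm_cst.
by under eq_fun do rewrite big_cons; exact: smD.
Qed.

Lemma sm_comp n Psi f : smooth_on setT Psi -> sm n f -> sm n (fun x => Psi (f x)).
Proof.
elim: n Psi f => [|n IH] Psi f sPsi sf; split => //.
- by move=> x; apply: differentiable_smooth_comp => //; exact: sm_diff sf.
- by move=> x; apply: differentiable_smooth_comp => //; exact: sm_diff sf.
- move=> i; rewrite partial_comp//; last by move=> x; exact: sm_diff sf.
  apply: smM; last exact: sm_partial.
  by apply: IH; [exact: smooth_on_derive1|exact: smS].
Qed.

Definition Zperiodic f := forall (i : 'I_d) x, f (x + delta_mx 0 i) = f x.

Lemma test_functionP f : test_function f <-> Zperiodic f /\ forall n, sm n f.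
Proof.
split=> [[pf sf]|[pf sf]]; split => //.
  move=> n; elim: n f {pf} sf => [|n IH] f sf; split=> //; try by move=> x; exact: (sf [::]).
  by move=> i; apply: IH => l x; have := sf (rcons l i) x; rewrite /iter_partial foldr_rcons.
move=> l; elim/last_ind: l f {pf} sf => [|l i IH] f sf x.
  exact: (sm_diff _ (sf 0%N)).
rewrite /iter_partial foldr_rcons; apply: IH => n; exact: sm_partial (sf n.+1).
Qed.

Lemma test_sm f n : test_function f -> sm n f.
Proof. by case/test_functionP => _; exact. Qed.

Lemma periodic_partial i f : Zperiodic f -> Zperiodic (partial i f).
Proof.
move=> pf j x; rewrite /partial /derive.
set F := fun h : R => _; set G := fun h : R => h^-1 *: ((f \o shift x) _ - _).
by suff -> : F = G by []; apply/funext => h; rewrite /F /G /= addrA !pf.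
Qed.

Lemma test_partial i f : test_function f -> test_function (partial i f).
Proof.
move=> /test_functionP[pf sf]; apply/test_functionP; split.
  exact: periodic_partial.
by move=> n; exact: sm_partial (sf n.+1).
Qed.

Lemma test_diff f x : test_function f -> differentiable f x.
Proof. by move=> tf; exact: sm_diff (test_sm 0 tf). Qed.

Lemma testD f g : test_function f -> test_function g ->
  test_function (fun x => f x + g x).
Proof.
move=> /test_functionP[pf sf] /test_functionP[pg sg]; apply/test_functionP; split.
  by move=> i x; rewrite pf pg.
by move=> n; exact: smD.
Qed.

Lemma testM f g : test_function f -> test_function g ->
  test_function (fun x => f x * g x).
Proof.
move=> /test_functionP[pf sf] /test_functionP[pg sg]; apply/test_functionP; split.
  by move=> i x; rewrite pf pg.
by move=> n; exact: smM.
Qed.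

Lemma test_cst (c : R) : test_function (fun _ : 'rV[R]_d => c).
Proof. by apply/test_functionP; split => // n; exact: sm_cst. Qed.

Lemma testZ (c : R) f : test_function f -> test_function (fun x => c * f x).
Proof. by move=> tf; apply: testM => //; exact: test_cst. Qed.

Lemma testN f : test_function f -> test_function (fun x => - f x).
Proof. by move=> /(testZ (-1)); under eq_fun do rewrite mulN1r. Qed.

Lemma testB f g : test_function f -> test_function g ->
  test_function (fun x => f x - g x).
Proof. by move=> tf tg; apply: testD => //; exact: testN. Qed.

Lemma test_sum (I : Type) (r : seq I) (F : I -> 'rV[R]_d -> R) :
  (forall i, test_function (F i)) -> test_function (fun x => \sum_(i <- r) F i x).
Proof.
move=> sF; elim: r => [|i r IH].
  by under eq_fun do rewrite big_nil; exact: test_cst.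
by under eq_fun do rewrite big_cons; exact: testD.
Qed.

Lemma test_comp Psi f : smooth_on setT Psi -> test_function f ->
  test_function (fun x => Psi (f x)).
Proof.
move=> sPsi /test_functionP[pf sf]; apply/test_functionP; split.
  by move=> i x; rewrite pf.
by move=> n; exact: sm_comp.
Qed.

Lemma sm_continuous n f : sm n f -> continuous f.
Proof. by move=> sf x; apply: differentiable_continuous; exact: sm_diff sf. Qed.

Lemma test_continuous f : test_function f -> continuous f.
Proof. by move=> tf; exact: sm_continuous (test_sm 0 tf). Qed.

End SmoothCalculus.

(** * Closure properties of continuous functions *)

Section ContinuityRV.
Context {R : realType} {T : topologicalType}.
Implicit Types f g : T -> R.

Lemma cont_cst (c : R) : continuous (fun _ : T => c).
Proof. by move=> x; exact: cvg_cst. Qed.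

Lemma contD f g : continuous f -> continuous g -> continuous (fun x => f x + g x).
Proof. by move=> cf cg x; exact: cvgD (cf x) (cg x). Qed.

Lemma contB f g : continuous f -> continuous g -> continuous (fun x => f x - g x).
Proof. by move=> cf cg x; exact: cvgB (cf x) (cg x). Qed.

Lemma contM f g : continuous f -> continuous g -> continuous (fun x => f x * g x).
Proof. by move=> cf cg x; exact: cvgM (cf x) (cg x). Qed.

Lemma contZ (c : R) f : continuous f -> continuous (fun x => c * f x).
Proof. by move=> cf; apply: contM => //; exact: cont_cst. Qed.

Lemma cont_norm f : continuous f -> continuous (fun x => `|f x|).
Proof. by move=> cf x; exact: cvg_norm (cf x). Qed.

Lemma cont_sum (I : Type) (r : seq I) (F : I -> T -> R) :
  (forall i, continuous (F i)) -> continuous (fun x => \sum_(i <- r) F i x).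
Proof.
move=> cF; elim: r => [|i r IH].
  by under eq_fun do rewrite big_nil; exact: cont_cst.
by under eq_fun do rewrite big_cons; exact: contD.
Qed.

Lemma cont_comp (Psi : R -> R) f : continuous Psi -> continuous f ->
  continuous (fun x => Psi (f x)).
Proof. by move=> cP cf x; apply: continuous_comp; [exact: cf|exact: cP]. Qed.

End ContinuityRV.

(** * Norm-like classes and derivative bounds at a frequency scale *)

Section NormClasses.
Context {R : realType} {d : nat}.
Implicit Types (f g : 'rV[R]_d -> R) (Psi : R -> R) (B : ('rV[R]_d -> R) -> R -> Prop).

Definition supb f (c : R) : Prop := forall x, `|f x| <= c.

(* [B f c] reads "the norm of f is at most c". *)
Record norm_like B : Prop := NormLike {
  nl_ge0 : forall f c, B f c -> 0 <= c;
  nl_dom : forall f g c K, continuous f -> continuous g -> 0 <= K ->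
    B f c -> (forall x, `|g x| <= K * `|f x|) -> B g (K * c);
  nl_add : forall f g c c', continuous f -> continuous g ->
    B f c -> B g c' -> B (fun x => f x + g x) (c + c');
  nl_le : forall f c c', B f c -> c <= c' -> B f c' }.

(** Bernstein-type control at scale [lam]: derivatives of order a <= n are bounded in [B] by
    [c * lam ^+ a]. Dyadic blocks satisfy it with [lam] = 2^l, and so do smooth functions of partial
    sums, whose spectrum is unbounded. *)
Fixpoint bd B n (c lam : R) f : Prop :=
  B f c /\ if n is n'.+1 then forall i : 'I_d, bd B n' (c * lam) lam (partial i f)
           else True.

Lemma bd0 B n c lam f : bd B n c lam f -> B f c.
Proof. by case: n => [|n] []. Qed.

Lemma bdS B n c lam f : bd B n.+1 c lam f -> bd B n c lam f.
Proof.
elim: n c f => [|n IH] c f [Bf bf]; split => // i.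
by apply: IH; exact: bf.
Qed.

Lemma bd_partial B n c lam f i : bd B n.+1 c lam f -> bd B n (c * lam) lam (partial i f).
Proof. by move=> [_ H]; exact: H. Qed.

Lemma supb_norm_like : 'rV[R]_d -> norm_like supb.
Proof.
move=> x0; split.
- by move=> f c /(_ x0); exact: le_trans.
- move=> f g c K _ _ K0 fc fg x; apply: le_trans (fg x) _.
  by rewrite ler_wpM2l.
- by move=> f g c c' _ _ fc gc x; apply: le_trans (ler_normD _ _) _; rewrite lerD.
- by move=> f c c' fc cc x; exact: le_trans (fc x) cc.
Qed.

Section Generic.
Variables (B : ('rV[R]_d -> R) -> R -> Prop) (nB : norm_like B).
Variables (lam : R) (lam0 : 0 <= lam).

Lemma bd_le n c c' f : bd B n c lam f -> c <= c' -> bd B n c' lam f.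
Proof.
elim: n c c' f => [|n IH] c c' f [Bf bf] cc; split => //; try exact: nl_le Bf cc.
by move=> i; apply: IH (bf i) _; rewrite ler_wpM2r.
Qed.

Lemma bdD n c c' f g : sm n f -> sm n g -> bd B n c lam f -> bd B n c' lam g ->
  bd B n (c + c') lam (fun x => f x + g x).
Proof.
elim: n c c' f g => [|n IH] c c' f g sf sg [Bf bf] [Bg bg]; split => //;
  try by apply: (nl_add nB) => //; [exact: sm_continuous sf|exact: sm_continuous sg].
move=> i; rewrite partialD; last 2 first.
  by move=> x; exact: sm_diff sf.
  by move=> x; exact: sm_diff sg.
by rewrite mulrDl; apply: IH; [exact: sm_partial|exact: sm_partial|exact: bf|exact: bg].
Qed.

Lemma bdM n c c' f g : sm n f -> sm n g -> 0 <= c' ->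
  bd B n c lam f -> bd supb n c' lam g ->
  bd B n (2 ^+ n * c * c') lam (fun x => f x * g x).
Proof.
elim: n c c' f g => [|n IH] c c' f g sf sg c'0.
  move=> [Bf _] [Bg _]; split => //.
  rewrite expr0 mul1r mulrC; apply: (nl_dom nB) Bf _ => //.
  - exact: sm_continuous sf.
  - exact: sm_continuous (smM sf sg).
  - by move=> x; rewrite normrM mulrC ler_wpM2r.
move=> bf bg; split.
  have c0 := nl_ge0 nB (bd0 bf).
  apply: (nl_le nB) (_ : B _ (c' * c)) _.
    apply: (nl_dom nB) (bd0 bf) _ => //.
    - exact: sm_continuous sf.
    - exact: sm_continuous (smM sf sg).
    - by move=> x; rewrite normrM mulrC ler_wpM2r// (bd0 bg).
  rewrite mulrC -mulrA ler_peMl ?mulr_ge0//.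
  by rewrite exprn_ege1// ler1n.
move=> i; rewrite partialM; last 2 first.
  by move=> x; exact: sm_diff sf.
  by move=> x; exact: sm_diff sg.
have -> : 2 ^+ n.+1 * c * c' * lam = 2 ^+ n * c * (c' * lam) + 2 ^+ n * (c * lam) * c'.
  by rewrite exprS; ring.
apply: bdD.
- by apply: smM; [exact: smS|exact: sm_partial].
- by apply: smM; [exact: smS|exact: sm_partial].
- by apply: IH; [exact: smS|exact: sm_partial|rewrite mulr_ge0|exact: bdS|exact: bd_partial].
- rewrite (_ : (fun x => g x * _) = (fun x => partial i f x * g x)); last first.
    by apply/funext => x; rewrite mulrC.
  by apply: IH => //; [exact: sm_partial|exact: smS|exact: bd_partial|exact: bdS].
Qed.

Lemma bdN n c f : sm n f -> bd B n c lam f -> bd B n c lam (fun x => - f x).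
Proof.
elim: n c f => [|n IH] c f sf [Bf bf]; split => //;
  try by rewrite -[c]mul1r; apply: (nl_dom nB) Bf _ => //;
    [exact: sm_continuous sf|exact: sm_continuous (smN sf)|move=> x; rewrite mul1r normrN].
move=> i; rewrite partialN; last by move=> x; exact: sm_diff sf.
by apply: IH; [exact: sm_partial|exact: bf].
Qed.

End Generic.

Lemma supb_nl : norm_like (supb : ('rV[R]_d -> R) -> R -> Prop).
Proof. exact: supb_norm_like 0. Qed.

Lemma continuous_bounded Psi (c : R) : continuous Psi ->
  exists2 C : R, 0 <= C & forall x, `|x| <= c -> `|Psi x| <= C.
Proof.
move=> cPsi; have [c0|c0] := ltP c 0.
  by exists 0 => // x xc; have := le_lt_trans xc c0; rewrite ltNge normr_ge0.
have cP : {within `[- c, c], continuous (fun x => `|Psi x|)}.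
  apply: continuous_subspaceT => x; apply: cvg_norm; exact: cPsi.
have [|m _ hm] := @EVT_max R (fun x => `|Psi x|) (- c) c _ cP.
  by rewrite ge0_cp.
exists `|Psi m| => // x xc; apply: hm; rewrite in_itv/=.
by rewrite -ler_norml.
Qed.

(** The derivative of Psi(f) involves Psi'(f), so the induction runs over all smooth Psi at once.
    What matters is that [C] does not depend on [lam]: composition preserves the frequency scale. *)
Lemma bd_comp n Psi (c : R) : smooth_on setT Psi -> 0 <= c ->
  exists2 C : R, 0 <= C & forall lam f, 0 <= lam -> sm n f -> bd supb n c lam f ->
    bd supb n C lam (fun x => Psi (f x)).
Proof.
elim: n Psi => [|n IH] Psi sPsi c0.
  have [C C0 HC] := continuous_bounded c (smooth_on_continuous sPsi).
  by exists C => // lam f _ _ [Bf _]; split => // x; apply: HC; exact: Bf.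
have [C C0 HC] := continuous_bounded c (smooth_on_continuous sPsi).
have [C1 C10 HC1] := IH _ (smooth_on_derive1 sPsi) c0.
have C10' : 0 <= 2 ^+ n * C1 * c by rewrite !mulr_ge0 ?exprn_ge0.
exists (C + 2 ^+ n * C1 * c); first by rewrite addr_ge0.
move=> lam f lam0 sf bf; split.
  by move=> x; apply: le_trans (HC _ (bd0 bf x)) _; rewrite lerDl.
move=> i; rewrite partial_comp//; last by move=> x; exact: sm_diff sf.
apply: (@bd_le _ supb_nl _ lam0 n (2 ^+ n * C1 * (c * lam))); last first.
  by rewrite mulrA ler_wpM2r// lerDr.
apply: (bdM supb_nl) => //.
- by apply: sm_comp; [exact: smooth_on_derive1|exact: smS].
- exact: sm_partial.
- by rewrite mulr_ge0.
- by apply: HC1 => //; [exact: smS|exact: bdS].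
- exact: bd_partial.
Qed.

Lemma lipschitz_on Psi (c : R) : smooth_on setT Psi ->
  exists2 C : R, 0 <= C & forall x y, `|x| <= c -> `|y| <= c ->
    `|Psi x - Psi y| <= C * `|x - y|.
Proof.
move=> sPsi.
have [C C0 HC] := continuous_bounded c (smooth_on_continuous (smooth_on_derive1 sPsi)).
exists C => // x y xc yc.
wlog xy : x y xc yc / x <= y.
  by move=> W; case: (leP x y) => [|/ltW] xy; [|rewrite distrC (distrC x)]; apply: W.
have [z] := @MVT_segment R Psi (derive1 Psi) x y xy
  (fun z _ => DeriveDef (smooth_on_derivable sPsi) (esym (derive1E _ _)))
  (continuous_subspaceT (smooth_on_continuous sPsi)).
rewrite in_itv/= => /andP[xz zy].
rewrite distrC => ->; rewrite normrM (distrC x) ler_wpM2r// HC//.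
move: xc yc; rewrite !ler_norml => /andP[cx _] /andP[_ yc].
by rewrite (le_trans cx xz) (le_trans zy yc).
Qed.

Lemma partialB i f g : (forall x, differentiable f x) ->
  (forall x, differentiable g x) ->
  partial i (fun x => f x - g x) = fun x => partial i f x - partial i g x.
Proof.
move=> df dg; rewrite partialD ?partialN// => x; exact: differentiableN.
Qed.

Lemma bd_compB n Psi (c : R) : smooth_on setT Psi -> 0 <= c ->
  exists2 C : R, 0 <= C & forall B, norm_like B -> forall lam a b w, 0 <= lam ->
    sm n a -> sm n b -> bd supb n c lam a -> bd supb n c lam b ->
    bd B n w lam (fun x => a x - b x) ->
    bd B n (C * w) lam (fun x => Psi (a x) - Psi (b x)).
Proof.
elim: n Psi => [|n IH] Psi sPsi c0.
  have [C C0 HC] := lipschitz_on c sPsi.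
  exists C => // B nB lam a b w _ sa sb [ba _] [bb _] [bab _]; split => //.
  apply: (nl_dom nB) bab _ => //.
  - exact: sm_continuous (smB sa sb).
  - exact: sm_continuous (smB (sm_comp sPsi sa) (sm_comp sPsi sb)).
  - by move=> x; apply: HC; [exact: ba|exact: bb].
have sP := smooth_on_derive1 sPsi.
have [C C0 HC] := lipschitz_on c sPsi.
have [C1 C10 HC1] := bd_comp n sP c0.
have [C2 C20 HC2] := IH _ sP c0.
have M0 : 0 <= 2 ^+ n * (C1 + C2 * c) by rewrite mulr_ge0 ?exprn_ge0 ?addr_ge0 ?mulr_ge0.
exists (C + 2 ^+ n * (C1 + C2 * c)); first by rewrite addr_ge0.
move=> B nB lam a b w lam0 sa sb ba bb bab.
have w0 := nl_ge0 nB (bd0 bab).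
split.
  apply: (nl_le nB) (_ : B _ (C * w)) _; last by rewrite ler_wpM2r// lerDl.
  apply: (nl_dom nB) (bd0 bab) _ => //.
  - exact: sm_continuous (smB sa sb).
  - exact: sm_continuous (smB (sm_comp sPsi sa) (sm_comp sPsi sb)).
  - by move=> x; apply: HC; [exact: (bd0 ba)|exact: (bd0 bb)].
move=> i; rewrite partialB; last 2 first.
  by move=> x; exact: sm_diff (sm_comp sPsi sa).
  by move=> x; exact: sm_diff (sm_comp sPsi sb).
rewrite !partial_comp//; last 2 first.
  by move=> x; exact: sm_diff sb.
  by move=> x; exact: sm_diff sa.
(* Each product keeps exactly one difference, which is measured in [B]; its cofactor is bounded
   uniformly. *)
rewrite (_ : (fun x => _) = (fun x => (partial i a x - partial i b x) * derive1 Psi (a x)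
   + (derive1 Psi (a x) - derive1 Psi (b x)) * partial i b x)); last first.
  by apply/funext => x; ring.
have bdab : bd B n (w * lam) lam (fun x => partial i a x - partial i b x).
  have := bd_partial i bab; rewrite partialB//.
    by move=> x; exact: sm_diff sa.
  by move=> x; exact: sm_diff sb.
have sPa := sm_comp sP (smS sa); have sPb := sm_comp sP (smS sb).
have sda := sm_partial i sa; have sdb := sm_partial i sb.
have bPa : bd supb n C1 lam (fun x => derive1 Psi (a x)).
  by apply: HC1 => //; [exact: smS|exact: bdS].
have bPab : bd B n (C2 * w) lam (fun x => derive1 Psi (a x) - derive1 Psi (b x)).
  by apply: HC2 => //; (try exact: smS); exact: bdS.
apply: (@bd_le _ nB _ lam0 n (2 ^+ n * (w * lam) * C1 + 2 ^+ n * (C2 * w) * (c * lam))).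
  apply: bdD => //.
  - by apply: smM => //; exact: smB.
  - by apply: smM => //; exact: smB.
  - by apply: bdM => //; exact: smB.
  - by apply: bdM => //; [exact: smB|rewrite mulr_ge0|exact: bd_partial].
rewrite (_ : _ + _ = (2 ^+ n * (C1 + C2 * c)) * w * lam); last by ring.
by rewrite ler_wpM2r// ler_wpM2r// lerDr.
Qed.

(** The mean value theorem is applied once, to t |-> Psi(b + t (a - b)) - Psi(b' + t (a' - b')). The
    common parameter t makes the two intermediate points differ by a convex combination of a - a'
    and b - b', hence by at most e; two separate mean values would not be comparable. *)
Lemma second_difference Psi (c : R) : smooth_on setT Psi ->
  exists2 C : R, 0 <= C & forall a b a' b' e : R,
    `|a| <= c -> `|b| <= c -> `|a'| <= c -> `|b'| <= c ->
    `|a - a'| <= e -> `|b - b'| <= e ->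
    `|Psi a - Psi b - Psi a' + Psi b'| <=
      C * (`|a - b - a' + b'| + e * `|a' - b'|).
Proof.
move=> sPsi; have sP := smooth_on_derive1 sPsi.
have [C1 C10 HC1] := continuous_bounded c (smooth_on_continuous sP).
have [C2 C20 HC2] := lipschitz_on c sP.
exists (C1 + C2); first by rewrite addr_ge0.
move=> a b a' b' e ac bc a'c b'c aa' bb'.
have conv (x y t : R) : `|x| <= c -> `|y| <= c -> 0 <= t -> t <= 1 ->
    `|y + t * (x - y)| <= c.
  move=> xc yc t0 t1.
  rewrite (_ : _ + _ = t * x + (1 - t) * y); last by ring.
  apply: le_trans (ler_normD _ _) _; rewrite !normrM (ger0_norm t0).
  rewrite (@ger0_norm _ (1 - t)) ?subr_ge0//.
  apply: (@le_trans _ _ (t * c + (1 - t) * c)); last by lra.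
  by rewrite lerD ?ler_wpM2l ?subr_ge0.
pose F (t : R) : R := Psi (b + t * (a - b)) - Psi (b' + t * (a' - b')).
pose dF (t : R) : R := derive1 Psi (b + t * (a - b)) * (a - b) -
             derive1 Psi (b' + t * (a' - b')) * (a' - b').
have dlin (u v t : R) : is_derive t 1 (fun t : R => u + t * v) v.
  by apply: is_derive_eq; rewrite add0r mul1r scaler0 add0r /GRing.scale/= mulr1.
have dcomp (u v t : R) : is_derive t 1 (fun t : R => Psi (u + t * v))
    (derive1 Psi (u + t * v) * v).
  have hP : is_derive (u + t * v) 1 Psi (derive1 Psi (u + t * v)).
    by apply: DeriveDef; [exact: smooth_on_derivable|rewrite derive1E].
  by have := @is_derive1_comp _ Psi _ t _ _ hP (dlin u v t).
have isF (t : R) : is_derive t 1 F (dF t) by apply: is_deriveB; exact: dcomp.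
have cF : {within `[0, 1], continuous F}.
  apply: continuous_subspaceT => t; apply: differentiable_continuous.
  by apply/derivable1_diffP; have [] := isF t.
have [t] := @MVT_segment R F dF 0 1 ler01 (fun t _ => isF t) cF.
rewrite in_itv/= => /andP[t0 t1].
rewrite /F /dF !mul1r !mul0r subr0 mulr1 !addr0 (addrC b) subrK (addrC b') subrK => E.
rewrite (_ : Psi a - _ - _ + _ = Psi a - Psi a' - (Psi b - Psi b')); last by ring.
rewrite E; set p := b + _; set p' := b' + _.
rewrite (_ : _ - _ = derive1 Psi p * (a - b - a' + b') +
  (derive1 Psi p - derive1 Psi p') * (a' - b')); last by ring.
have pc : `|p| <= c by exact: conv.
have p'c : `|p'| <= c by exact: conv.
have pp' : `|p - p'| <= e.
  rewrite (_ : p - p' = t * (a - a') + (1 - t) * (b - b')); last by rewrite /p /p'; ring.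
  apply: le_trans (ler_normD _ _) _; rewrite !normrM (ger0_norm t0).
  rewrite (@ger0_norm _ (1 - t)) ?subr_ge0//.
  apply: (@le_trans _ _ (t * e + (1 - t) * e)); last by lra.
  by rewrite lerD ?ler_wpM2l ?subr_ge0.
apply: le_trans (ler_normD _ _) _; rewrite !normrM mulrDr lerD//.
  by rewrite ler_wpM2r// (le_trans (HC1 _ pc))// lerDl.
rewrite mulrA ler_wpM2r//; apply: le_trans (HC2 _ _ pc p'c) _.
apply: (@le_trans _ _ (C2 * e)); first by rewrite ler_wpM2l.
by rewrite ler_wpM2r ?lerDr// (le_trans _ pp').
Qed.

(** Here a, b and a', b' will be consecutive partial sums of u and of v: w bounds an increment in l
    in [B], e bounds u - v uniformly, and W bounds the increment of u - v in [B]. The hypothesis w *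
    e <= W lets a single quantity dominate every term. *)
Lemma bd_comp2 n Psi (c : R) : smooth_on setT Psi -> 0 <= c ->
  exists2 C : R, 0 <= C & forall B, norm_like B -> forall lam a b a' b' w e W, 0 <= lam ->
    sm n a -> sm n b -> sm n a' -> sm n b' ->
    bd supb n c lam a -> bd supb n c lam b ->
    bd supb n c lam a' -> bd supb n c lam b' ->
    bd supb n e lam (fun x => a x - a' x) -> bd supb n e lam (fun x => b x - b' x) ->
    bd B n w lam (fun x => a x - b x) -> bd B n w lam (fun x => a' x - b' x) ->
    bd B n W lam (fun x => a x - b x - a' x + b' x) -> w * e <= W ->
    bd B n (C * W) lam (fun x => Psi (a x) - Psi (b x) - Psi (a' x) + Psi (b' x)).
Proof.
have S4 m a b a' b' : sm m a -> sm m b -> sm m a' -> sm m b' ->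
    sm m (fun x : 'rV[R]_d => a x - b x - a' x + b' x).
  by move=> *; apply: smD => //; do 2 (apply: smB => //).
(* The estimate without derivatives is isolated because both the base case and the induction step
   need it, at different depths [m]. *)
have order0 Psi0 : smooth_on setT Psi0 -> exists2 C : R, 0 <= C & forall m B, norm_like B ->
    forall lam a b a' b' w e W,
    sm m a -> sm m b -> sm m a' -> sm m b' ->
    bd supb m c lam a -> bd supb m c lam b ->
    bd supb m c lam a' -> bd supb m c lam b' ->
    bd supb m e lam (fun x => a x - a' x) -> bd supb m e lam (fun x => b x - b' x) ->
    bd B m w lam (fun x => a' x - b' x) ->
    bd B m W lam (fun x => a x - b x - a' x + b' x) -> w * e <= W ->
    B (fun x => Psi0 (a x) - Psi0 (b x) - Psi0 (a' x) + Psi0 (b' x)) (C * W).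
  move=> sPsi; have [C C0 HC] := second_difference c sPsi.
  exists (C * 2); first by rewrite mulr_ge0.
  move=> m B nB lam a b a' b' w e W sa sb sa' sb' ba bb ba' bb' baa' bbb' ba'b' bD weW.
  have e0 : 0 <= e by exact: (nl_ge0 supb_nl (bd0 baa')).
  have cD : continuous (fun x => a x - b x - a' x + b' x) by exact: sm_continuous (S4 _ _ _ _ _ sa sb sa' sb').
  have ca'b' : continuous (fun x => a' x - b' x) by exact: sm_continuous (smB sa' sb').
  have B1 : B (fun x => `|a x - b x - a' x + b' x|) (1 * W).
    apply: (nl_dom nB) (bd0 bD) _ => //; first exact: cont_norm.
    by move=> x; rewrite normr_id mul1r.
  have B2 : B (fun x => e * `|a' x - b' x|) (e * w).
    apply: (nl_dom nB) (bd0 ba'b') _ => //.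
      exact: contZ (cont_norm ca'b').
    by move=> x; rewrite normrM normr_id ger0_norm.
  have B3 := nl_add nB (cont_norm cD) (@contZ _ _ e _ (cont_norm ca'b')) B1 B2.
  have {}B3 : B (fun x => `|a x - b x - a' x + b' x| + e * `|a' x - b' x|) (2 * W).
    apply: (nl_le nB) B3 _.
    by rewrite (mulrC e); lra.
  rewrite -mulrA; apply: (nl_dom nB) B3 _ => //.
  - exact: contD (cont_norm cD) (@contZ _ _ e _ (cont_norm ca'b')).
  - by apply: (@sm_continuous _ _ m); apply: S4; exact: sm_comp.
  - move=> x; rewrite [X in C * X]ger0_norm; last by rewrite addr_ge0 ?mulr_ge0.
    by apply: HC; [exact: (bd0 ba)|exact: (bd0 bb)|exact: (bd0 ba')|exact: (bd0 bb')|exact: (bd0 baa')|exact: (bd0 bbb')].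
elim: n Psi => [|n IH] Psi sPsi c0.
  have [C C0 HC] := order0 _ sPsi.
  exists C => // B nB lam a b a' b' w e W _ *; split => //.
  by apply: (HC 0%N _ nB lam _ _ _ _ w e).
have sP := smooth_on_derive1 sPsi.
have [C C0 HC] := order0 _ sPsi.
have [C1 C10 HC1] := bd_comp n sP c0.
have [C2 C20 HC2] := bd_compB n sP c0.
have [C3 C30 HC3] := IH _ sP c0.
have M0 : 0 <= 2 ^+ n * (C3 * c + C2 + C2 + C1).
  by rewrite mulr_ge0 ?exprn_ge0 ?addr_ge0 ?mulr_ge0.
exists (C + 2 ^+ n * (C3 * c + C2 + C2 + C1)); first by rewrite addr_ge0.
move=> B nB lam a b a' b' w e W lam0 sa sb sa' sb' ba bb ba' bb' baa' bbb' bab ba'b' bD weW.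
have W0 := nl_ge0 nB (bd0 bD).
have w0 := nl_ge0 nB (bd0 bab).
have e0 : 0 <= e by exact: (nl_ge0 supb_nl (bd0 baa')).
split.
  apply: (nl_le nB) (_ : B _ (C * W)) _; last by rewrite ler_wpM2r// lerDl.
  by apply: (HC n.+1 _ nB lam _ _ _ _ w e).
move=> i.
have df f : sm n.+1 f -> forall x, differentiable f x by move=> sf x; exact: sm_diff sf.
have P4 (u v u' v' : 'rV[R]_d -> R) : sm n.+1 u -> sm n.+1 v -> sm n.+1 u' -> sm n.+1 v' ->
    partial i (fun x => u x - v x - u' x + v' x) =
    fun x => partial i u x - partial i v x - partial i u' x + partial i v' x.
  move=> su sv su' sv'; rewrite partialD; [|by apply: df; do 2 (apply: smB => //)|exact: df].
  rewrite partialB; [|by apply: df; apply: smB|exact: df].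
  by rewrite partialB; [|exact: df|exact: df].
rewrite P4; (try exact: sm_comp); rewrite !partial_comp//; (try exact: df).
have sPa := sm_comp sP (smS sa); have sPb := sm_comp sP (smS sb).
have sPa' := sm_comp sP (smS sa'); have sPb' := sm_comp sP (smS sb').
have sda := sm_partial i sa; have sdb := sm_partial i sb.
have sda' := sm_partial i sa'; have sdb' := sm_partial i sb'.
(* Discrete Leibniz rule: every term carries either a second difference, bounded through W, or an
   increment in l times a difference between u and v, bounded through w * e. *)
rewrite (_ : (fun x => _) = (fun x =>
   (((derive1 Psi (a x) - derive1 Psi (b x) - derive1 Psi (a' x) + derive1 Psi (b' x)) * partial i a x
   + (partial i a x - partial i b x) * (derive1 Psi (b x) - derive1 Psi (b' x)))
   + (derive1 Psi (a' x) - derive1 Psi (b' x)) * (partial i a x - partial i a' x))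
   + (partial i a x - partial i b x - partial i a' x + partial i b' x) * derive1 Psi (b' x))); last first.
  by apply/funext => x; ring.
have bdab : bd B n (w * lam) lam (fun x => partial i a x - partial i b x).
  by have := bd_partial i bab; rewrite partialB//; exact: df.
have bdaa' : bd supb n (e * lam) lam (fun x => partial i a x - partial i a' x).
  by have := bd_partial i baa'; rewrite partialB//; exact: df.
have bdDD : bd B n (W * lam) lam (fun x => partial i a x - partial i b x - partial i a' x + partial i b' x).
  by have := bd_partial i bD; rewrite P4.
have H1 : bd B n (2 ^+ n * (C3 * W) * (c * lam)) lam (fun x => (derive1 Psi (a x) - derive1 Psi (b x) - derive1 Psi (a' x) + derive1 Psi (b' x)) * partial i a x).
  apply: bdM => //; [exact: S4|by rewrite mulr_ge0| |exact: bd_partial].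
  by apply: (HC3 _ nB lam _ _ _ _ w e) => //; (try exact: smS); exact: bdS.
have H2 : bd B n (2 ^+ n * (w * lam) * (C2 * e)) lam (fun x => (partial i a x - partial i b x) * (derive1 Psi (b x) - derive1 Psi (b' x))).
  apply: bdM => //; [exact: smB|exact: smB|by rewrite mulr_ge0|].
  by apply: HC2 => //; (try exact: supb_nl); (try exact: smS); exact: bdS.
have H3 : bd B n (2 ^+ n * (C2 * w) * (e * lam)) lam (fun x => (derive1 Psi (a' x) - derive1 Psi (b' x)) * (partial i a x - partial i a' x)).
  apply: bdM => //; [exact: smB|exact: smB|by rewrite mulr_ge0|].
  by apply: HC2 => //; (try exact: smS); exact: bdS.
have H4 : bd B n (2 ^+ n * (W * lam) * C1) lam (fun x => (partial i a x - partial i b x - partial i a' x + partial i b' x) * derive1 Psi (b' x)).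
  apply: bdM => //; [exact: S4|].
  by apply: HC1 => //; (try exact: smS); exact: bdS.
apply: (@bd_le _ nB _ lam0 n (2 ^+ n * (C3 * W) * (c * lam) + 2 ^+ n * (w * lam) * (C2 * e)
   + 2 ^+ n * (C2 * w) * (e * lam) + 2 ^+ n * (W * lam) * C1)).
  have s1 := smM (S4 _ _ _ _ _ sPa sPb sPa' sPb') sda.
  have s2 := smM (smB sda sdb) (smB sPb sPb').
  have s3 := smM (smB sPa' sPb') (smB sda sda').
  have s4 := smM (S4 _ _ _ _ _ sda sdb sda' sdb') sPb'.
  have s12 := smD s1 s2; have s123 := smD s12 s3.
  have H12 := bdD nB s1 s2 H1 H2.
  have H123 := bdD nB s12 s3 H12 H3.
  exact: (bdD nB s123 s4 H123 H4).
rewrite (_ : _ + _ = 2 ^+ n * (C3 * c * W + C2 * (w * e) + C2 * (w * e) + C1 * W) * lam); last by ring.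
rewrite ler_wpM2r// mulrDl; apply: (@le_trans _ _ (2 ^+ n * (C3 * c + C2 + C2 + C1) * W)).
  rewrite -!mulrA ler_wpM2l ?exprn_ge0// !mulrDl -!mulrA !lerD//; by rewrite ler_wpM2l.
by rewrite lerDr mulr_ge0.
Qed.

End NormClasses.

(** * Integration on the torus *)

Section TorusMeasureTheory.
Context {R : realType}.
Local Notation T d := (d.-tuple (measurableTypeR R)).

Definition mrow d (f : 'rV[R]_d -> R) :=
  measurable_fun [set: T d] (f \o @row_of_tuple R d).

Lemma measurable_floor_eq (c : R) (m : int) :
  measurable [set x : measurableTypeR R | Num.floor (c * x) = m].
Proof.
rewrite (_ : [set x | _] = (fun x => c * x) @^-1` `[m%:~R, (m + 1)%:~R[).
  rewrite -[X in measurable X]setTI; exact: mulrl_measurable.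
apply/seteqP; split => x /=; rewrite in_itv/=.
  by move=> <-; rewrite floor_le floorD1_gt.
by move=> h; apply: floor_def.
Qed.

Lemma measurable_grid d (c : R) (k : 'rV[int]_d) :
  measurable [set t : T d | forall i, Num.floor (c * tnth t i) = k 0 i].
Proof.
rewrite (_ : [set t | _] =
    ~` \bigcup_(i : 'I_d) [set t : T d | ~ (Num.floor (c * tnth t i) = k 0 i)]).
  apply: measurableC; apply: countable_bigcupT_measurable; first exact: countableP.
  move=> i; rewrite (_ : [set t | _] =
      ~` ((fun t : T d => tnth t i) @^-1` [set x | Num.floor (c * x) = k 0 i])).
    apply: measurableC; rewrite -[X in measurable X]setTI.
    by apply: measurable_tnth => //; exact: measurable_floor_eq.
  by apply/seteqP; split => t.
apply/seteqP; split => [t /= H [i _]|t /= H i]; first by apply; exact: H.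
by apply: contrapT => K; apply: H; exists i.
Qed.

(** Measurability refers to the product sigma-algebra on tuples, continuity to the topology of row
    vectors. Rounding coordinates down to multiples of 1/(n+1) gives functions with countably many
    values on measurable cells, and these converge pointwise to f. *)
Lemma measurable_continuous_row d (f : 'rV[R]_d -> R) : continuous f -> mrow f.
Proof.
move=> cf.
pose gr (n : nat) (t : T d) : 'rV[R]_d :=
  \row_i ((Num.floor (n.+1%:R * tnth t i))%:~R / n.+1%:R).
apply: (@measurable_fun_cvg _ _ _ _ (fun n t => f (gr n t))).
  move=> n _ Y mY; rewrite setTI.
  pose F (k : 'rV[int]_d) : set (T d) :=
    if `[< Y (f (\row_i ((k 0 i)%:~R / n.+1%:R))) >] then
    [set t : T d | forall i, Num.floor (n.+1%:R * tnth t i) = k 0 i] else set0.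
  rewrite (_ : _ @^-1` _ = \bigcup_k F k).
    apply: countable_bigcupT_measurable; first exact: countableP.
    by move=> k; rewrite /F; case: ifP => _; [exact: measurable_grid|exact: measurable0].
  apply/seteqP; split => t /=.
    move=> Yt; exists (\row_i Num.floor (n.+1%:R * tnth t i)) => //.
    rewrite /F; case: ifPn => [_ i|/asboolPn []]; first by rewrite mxE.
    rewrite (_ : \row_i _ = gr n t)//.
    by apply/rowP => i; rewrite !mxE.
  move=> [k _]; rewrite /F; case: ifPn => // /asboolP Yk /= H.
  rewrite (_ : gr n t = \row_i ((k 0 i)%:~R / n.+1%:R))//.
  by apply/rowP => i; rewrite !mxE H.
move=> t _; apply: (cvg_comp (gr ^~ t) f); last exact: cf.
apply/cvg_ballP => e e0; near=> n; split=> // i j.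
rewrite /ball/= !mxE.
have n0 : 0 < n.+1%:R :> R by rewrite ltr0n.
set x := tnth t j.
have h1 := floor_le (n.+1%:R * x); have h2 := floorD1_gt (n.+1%:R * x).
rewrite intrD in h2.
rewrite ger0_norm.
  rewrite ltrBlDr -(ltr_pM2l n0) mulrDr mulrCA divff ?gt_eqF// mulr1.
  apply: lt_trans h2 _; rewrite addrC ltrD2r.
  have h : e^-1 < n.+1%:R.
    by rewrite (lt_trans (_ : _ < n%:R))//; [near: n; exact: nbhs_infty_gtr|rewrite ltr_nat].
  by rewrite -(ltr_pM2l e0) mulfV ?gt_eqF// mulrC in h.
by rewrite subr_ge0 ler_pdivrMr// (mulrC x).
Unshelve. all: by end_near. Qed.

(** * Integrable functions on the torus and their integrals *)

Section Fixed.
Context {d : nat}.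
Local Notation mu := (torus_measure d : probability (T d) R).
Implicit Types f g : 'rV[R]_d -> R.

Definition integ f := mu.-integrable setT (EFin \o (f \o @row_of_tuple R d)).

Lemma in_Lq1P f : in_Lq 1 f <-> integ f.
Proof. exact: Lfun1_integrable. Qed.

Lemma integ_mrow f : integ f -> mrow f.
Proof. by move=> /integrableP[/measurable_EFinP]. Qed.

Lemma integ_bounded f (C : R) : mrow f -> (forall x, `|f x| <= C) -> integ f.
Proof.
move=> mf fC; apply: measurable_bounded_integrable => //.
  by rewrite (le_lt_trans (probability_le1 _ _))// ltry.
exists C; split; first exact: num_real.
by move=> M CM x _ /=; rewrite (le_trans (fC _))// ltW.
Qed.

Lemma integD f g : integ f -> integ g -> integ (fun x => f x + g x).
Proof. by move=> h1 h2; have := integrableD measurableT h1 h2. Qed.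

Lemma integZ (c : R) f : integ f -> integ (fun x => c * f x).
Proof. by move=> h1; have := integrableZl measurableT c h1. Qed.

Lemma integB f g : integ f -> integ g -> integ (fun x => f x - g x).
Proof. by move=> h1 h2; have := integrableB measurableT h1 h2. Qed.

Lemma integ_norm f : integ f -> integ (fun x => `|f x|).
Proof. by move=> h1; have := integrable_norm h1. Qed.

Lemma integ_cst (c : R) : integ (fun=> c).
Proof. by apply: (@integ_bounded _ `|c|) => //; exact: measurable_cst. Qed.

Lemma integ_sum (I : Type) (r : seq I) (F : I -> 'rV[R]_d -> R) :
  (forall i, integ (F i)) -> integ (fun x => \sum_(i <- r) F i x).
Proof.
move=> sF; elim: r => [|i r IH].
  by under eq_fun do rewrite big_nil; exact: integ_cst.
by under eq_fun do rewrite big_cons; exact: integD.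
Qed.

Lemma tintD f g : integ f -> integ g ->
  torus_integral (fun x => f x + g x) = torus_integral f + torus_integral g.
Proof. by move=> h1 h2; exact: RintegralD. Qed.

Lemma tintB f g : integ f -> integ g ->
  torus_integral (fun x => f x - g x) = torus_integral f - torus_integral g.
Proof. by move=> h1 h2; exact: RintegralB. Qed.

Lemma tintZ (c : R) f : integ f ->
  torus_integral (fun x => c * f x) = c * torus_integral f.
Proof. by move=> h1; exact: RintegralZl. Qed.

Lemma tint_cst (c : R) : torus_integral (fun _ : 'rV[R]_d => c) = c.
Proof.
rewrite /torus_integral /Rintegral.
rewrite (_ : (\int[_]_x _)%E = c%:E)//.
rewrite (eq_integral (cst c%:E)); last by move=> x _; exact: erefl.
rewrite integral_cst//.
transitivity (c%:E * 1)%E; [congr (_ * _)%E; exact: probability_setT|exact: mule1].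
Qed.

Lemma tint_sum (I : Type) (r : seq I) (F : I -> 'rV[R]_d -> R) :
  (forall i, integ (F i)) ->
  torus_integral (fun x => \sum_(i <- r) F i x) = \sum_(i <- r) torus_integral (F i).
Proof.
move=> sF; elim: r => [|i r IH].
  by under eq_fun do rewrite big_nil; rewrite tint_cst big_nil.
under eq_fun do rewrite big_cons.
by rewrite tintD ?big_cons ?IH//; exact: integ_sum.
Qed.

Lemma le_tint f g : integ f -> integ g -> (forall x, f x <= g x) ->
  torus_integral f <= torus_integral g.
Proof. by move=> h1 h2 fg; apply: le_Rintegral => // x _; exact: fg. Qed.

Lemma tint_ge0 f : (forall x, 0 <= f x) -> 0 <= torus_integral f.
Proof. by move=> f0; apply: Rintegral_ge0 => x _; exact: f0. Qed.

Lemma normr_tint f : integ f -> `|torus_integral f| <= torus_integral (fun x => `|f x|).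
Proof. by move=> h; exact: le_normr_Rintegral. Qed.

Lemma tint_bound f (C : R) : integ f -> (forall x, `|f x| <= C) ->
  `|torus_integral f| <= C.
Proof.
move=> h fC; apply: le_trans (normr_tint h) _.
by rewrite -[leRHS]tint_cst; apply: le_tint => //; [exact: integ_norm|exact: integ_cst].
Qed.

Lemma integM f g (C : R) : integ f -> mrow g -> (forall x, `|g x| <= C) ->
  integ (fun x => f x * g x).
Proof.
move=> hf mg gC; have C0 : 0 <= C := le_trans (normr_ge0 _) (gC 0).
apply: (le_integrable measurableT _ _ (integZ C (integ_norm hf))).
  by apply/measurable_EFinP; apply: measurable_funM => //; exact: integ_mrow.
move=> t _ /=; rewrite lee_fin normrM (ger0_norm (mulr_ge0 _ _))//.
by rewrite mulrC ler_wpM2r.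
Qed.

Lemma mrowM f g : mrow f -> mrow g -> mrow (fun x => f x * g x).
Proof. by move=> mf mg; apply: measurable_funM. Qed.

End Fixed.

Lemma cosDint (x : R) (m : int) : cos (x + 2 * pi * m%:~R) = cos x.
Proof.
have H (n : nat) y : cos (y + 2 * pi * n%:R) = cos y :> R.
  rewrite (mulr_natl pi 2) (mulr_natr _ n).
  by rewrite (periodicn (@cosD2pi R)).
case: m => n; first exact: H.
by rewrite NegzE mulrNz mulrN -(H n.+1 (x - _)) subrK.
Qed.

Lemma sinDint (x : R) (m : int) : sin (x + 2 * pi * m%:~R) = sin x.
Proof. by rewrite -!cosBpihalf addrAC cosDint. Qed.

(** * Phases and trigonometric test functions *)

Section Phase.
Context {d : nat}.
Implicit Types k : 'rV[int]_d.

Lemma phaseD k (x y : 'rV[R]_d) : phase k (x + y) = phase k x + phase k y.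
Proof.
rewrite /phase -mulrDr -big_split/=; congr (_ * _).
by apply: eq_bigr => i _; rewrite mxE mulrDr.
Qed.

Lemma phaseN k (x : 'rV[R]_d) : phase k (- x) = - phase k x.
Proof.
rewrite /phase -mulrN -sumrN; congr (_ * _).
by apply: eq_bigr => i _; rewrite mxE mulrN.
Qed.

Lemma phaseZ k (c : R) (x : 'rV[R]_d) : phase k (c *: x) = c * phase k x.
Proof.
rewrite /phase mulrCA; congr (_ * _); rewrite mulr_sumr.
by apply: eq_bigr => i _; rewrite mxE mulrCA.
Qed.

Lemma phase_delta k i : phase k (delta_mx 0 i : 'rV[R]_d) = 2 * pi * (k 0 i)%:~R.
Proof.
rewrite /phase (bigD1 i)//= big1 ?addr0; first by rewrite mxE !eqxx mulr1.
by move=> j ji; rewrite mxE (negbTE ji) andbF mulr0.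
Qed.

Lemma phaseDk k l (x : 'rV[R]_d) : phase (k + l) x = phase k x + phase l x.
Proof.
rewrite /phase -mulrDr -big_split/=; congr (_ * _).
by apply: eq_bigr => i _; rewrite mxE intrD mulrDl.
Qed.

Lemma phaseNk k (x : 'rV[R]_d) : phase (- k) x = - phase k x.
Proof.
rewrite /phase -mulrN -sumrN; congr (_ * _).
by apply: eq_bigr => i _; rewrite mxE mulrNz mulNr.
Qed.

Lemma phaseB k (x y : 'rV[R]_d) : phase k (x - y) = phase k x - phase k y.
Proof. by rewrite phaseD phaseN. Qed.

Lemma phase0 (x : 'rV[R]_d) : phase 0 x = 0.
Proof. by rewrite /phase big1 ?mulr0// => i _; rewrite mxE mul0r. Qed.

Lemma phase_is_linear k : linear (phase k : 'rV[R]_d -> R^o).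
Proof. by move=> c x y; rewrite phaseD phaseZ. Qed.

HB.instance Definition _ k := GRing.isLinear.Build _ _ _ _ _ (phase_is_linear k).

Lemma phase_continuous k : continuous (phase k : 'rV[R]_d -> R).
Proof.
apply: contZ; apply: cont_sum => i; apply: contZ.
by move=> x; apply: coord_continuous.
Qed.

Lemma phase_differentiable k (x : 'rV[R]_d) : differentiable (phase k : 'rV[R]_d -> R) x.
Proof. by apply: linear_differentiable; exact: phase_continuous. Qed.

Lemma partial_phase i k : partial i (phase k) = (fun=> 2 * pi * (k 0 i)%:~R) :> ('rV[R]_d -> R).
Proof.
apply/funext => x; rewrite partialE; last exact: phase_differentiable.
rewrite diff_lin; [exact: phase_delta|exact: phase_continuous].
Qed.

Lemma sm_phase n k : sm n (phase k : 'rV[R]_d -> R).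
Proof.
case: n => [|n]; split => //; try by move=> x; exact: phase_differentiable.
by move=> i; rewrite partial_phase; exact: sm_cst.
Qed.

(** The span of cos and sin is closed under differentiation, which makes the induction on the order
    immediate. *)
Lemma smooth_trig (a b : R) : smooth_on setT (fun x : R => a * cos x + b * sin x).
Proof.
move=> n x _; elim: n a b x => [|n IH] a b x.
  by apply: derivableD; apply: derivableM => //; try exact: derivable_cst.
rewrite derive1Sn (_ : derive1 _ = (fun x => b * cos x + - a * sin x)); first exact: IH.
apply/funext => y; rewrite derive1E.
have dc : is_derive y 1 (cos : R -> R) (- sin y) by exact: is_derive_cos.
have ds : is_derive y 1 (sin : R -> R) (cos y) by exact: is_derive_sin.
rewrite deriveD; last 2 first.
  by apply: derivableM => //; exact: derivable_cst.
  by apply: derivableM => //; exact: derivable_cst.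
rewrite !deriveMl ?derive_val; try exact: ex_derive.
by rewrite /GRing.scale/=; ring.
Qed.

Lemma smooth_cos : smooth_on setT (cos : R -> R).
Proof.
by have := @smooth_trig 1 0; under eq_fun do rewrite mul1r mul0r addr0.
Qed.

Lemma smooth_sin : smooth_on setT (sin : R -> R).
Proof.
by have := @smooth_trig 0 1; under eq_fun do rewrite mul1r mul0r add0r.
Qed.

Lemma derive1_cos : derive1 cos = (fun x : R => - sin x).
Proof. by apply/funext => x; rewrite derive1E derive_val. Qed.

Lemma derive1_sin : derive1 sin = (cos : R -> R).
Proof. by apply/funext => x; rewrite derive1E derive_val. Qed.

Lemma partial_cosp i k : partial i (fun x : 'rV[R]_d => cos (phase k x)) =
  fun x => - (2 * pi * (k 0 i)%:~R) * sin (phase k x).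
Proof.
rewrite partial_comp ?derive1_cos ?partial_phase.
- by apply/funext => x; rewrite mulNr mulrC mulNr.
- exact: smooth_cos.
- exact: phase_differentiable.
Qed.

Lemma partial_sinp i k : partial i (fun x : 'rV[R]_d => sin (phase k x)) =
  fun x => (2 * pi * (k 0 i)%:~R) * cos (phase k x).
Proof.
rewrite partial_comp ?derive1_sin ?partial_phase.
- by apply/funext => x; rewrite mulrC.
- exact: smooth_sin.
- exact: phase_differentiable.
Qed.

Lemma test_cosp k : test_function (fun x : 'rV[R]_d => cos (phase k x)).
Proof.
apply/test_functionP; split=> [i x|n]; first by rewrite phaseD phase_delta cosDint.
by apply: sm_comp; [exact: smooth_cos|exact: sm_phase].
Qed.

Lemma test_sinp k : test_function (fun x : 'rV[R]_d => sin (phase k x)).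
Proof.
apply/test_functionP; split=> [i x|n]; first by rewrite phaseD phase_delta sinDint.
by apply: sm_comp; [exact: smooth_sin|exact: sm_phase].
Qed.

Lemma integ_cosp k : integ (fun x : 'rV[R]_d => cos (phase k x)).
Proof.
apply: (@integ_bounded _ _ 1); last by move=> x; exact: cos_max.
by apply: measurable_continuous_row; exact: test_continuous (test_cosp k).
Qed.

Lemma integ_sinp k : integ (fun x : 'rV[R]_d => sin (phase k x)).
Proof.
apply: (@integ_bounded _ _ 1); last by move=> x; exact: sin_max.
by apply: measurable_continuous_row; exact: test_continuous (test_sinp k).
Qed.

End Phase.

Lemma integral_uniform_cos (c : R) (m : int) :
  (\int[uniform_prob (@ltr01 R)]_x (cos (c + 2 * pi * m%:~R * x))%:E =
   (if m == 0 then cos c else 0)%:E)%E.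
Proof.
have [->|m0] := eqVneq m 0.
  under eq_integral do rewrite mulr0 mul0r addr0.
  rewrite integral_cst//.
  transitivity ((cos c)%:E * 1)%E; [congr (_ * _)%E; exact: probability_setT|exact: mule1].
set w := 2 * pi * m%:~R.
have p0 : (pi : R) != 0 by rewrite gt_eqF ?pi_gt0.
have w0 : w != 0 by rewrite /w !mulf_neq0// intr_eq0.
have cf : continuous (fun x : R => cos (c + w * x)).
  by apply: cont_comp; [exact: continuous_cos|apply: contD; [exact: cont_cst|apply: contZ => x; exact: cvg_id]].
have mf : measurable_fun setT (fun x : R => cos (c + w * x)).
  exact: continuous_measurable_fun.
have if1 : (uniform_prob (@ltr01 R)).-integrable setT (fun x => (cos (c + w * x))%:E).
  apply: measurable_bounded_integrable => //.
    by rewrite (le_lt_trans (probability_le1 _ _))// ltry.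
  exists 1; split => // M M1 x _ /=.
  by rewrite (le_trans (cos_max _))// ltW.
pose F x := x + w^-1 * sin (c + w * x).
have dF (x : R) : is_derive x 1 F (1 + cos (c + w * x)).
  have dl : is_derive x 1 (fun x => c + w * x) w.
    by have := is_deriveD (is_derive_cst c x 1) (is_deriveZ w (is_derive_id x 1)); rewrite add0r /GRing.scale/= mulr1.
  have ds : is_derive (c + w * x) 1 (sin : R -> R) (cos (c + w * x)) by exact: is_derive_sin.
  have dc := @is_derive1_comp _ (sin : R -> R) (fun x => c + w * x) x _ _ ds dl.
  have := is_deriveD (is_derive_id x 1) (is_deriveZ w^-1 dc).
  by rewrite /GRing.scale/= mulrCA mulVf// mulr1.
(* The integral formula for the uniform law concerns nonnegative functions, hence 1 + cos; the
   constant is subtracted afterwards. *)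
have H : (\int[uniform_prob (@ltr01 R)]_x (1 + cos (c + w * x))%:E = 1)%E.
  rewrite integral_uniform; last 2 first.
    by apply/measurable_EFinP; apply: measurable_funD.
    by move=> x; rewrite lee_fin -lerBlDl sub0r cos_geN1.
  rewrite (@continuous_FTC2 _ _ F)//.
  - rewrite /F mulr0 addr0 mulr1 subr0 invr1 mul1e -EFinD add0r.
    by rewrite /w -[c + _]/(c + 2 * pi * m%:~R) sinDint addrK.
  - by apply: continuous_subspaceT; apply: contD; [exact: cont_cst|].
  - split.
    + by move=> x _; have [] := dF x.
    + by apply: cvg_at_right_filter; apply: differentiable_continuous;
        apply/derivable1_diffP; have [] := dF 0.
    + by apply: cvg_at_left_filter; apply: differentiable_continuous;
        apply/derivable1_diffP; have [] := dF 1.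
  - by move=> x _; rewrite derive1E; have [] := dF x.
have : (\int[uniform_prob (@ltr01 R)]_x (1%:E + (cos (c + w * x))%:E) = 1)%E.
  by rewrite -[RHS]H; apply: eq_integral.
rewrite integralD//; last first.
  by apply: measurable_bounded_integrable => //;
    [rewrite (le_lt_trans (probability_le1 _ _))// ltry|exists 1; split => // M M1 x _ /=; rewrite normr1 ltW].
have -> : (\int[uniform_prob (@ltr01 R)]_(_ in setT) 1 = 1)%E.
  rewrite integral_cst//.
  by transitivity (1%E * 1 : \bar R)%E; [congr (_ * _)%E; exact: probability_setT|exact: mule1].
have /fineK <- := integrable_fin_num measurableT if1.
rewrite -EFinD => h; have {}h := EFin_inj h; congr EFin.
by rewrite -[RHS](subrr 1) -[X in _ = X - _]h addrAC subrr add0r.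
Qed.

(** Orthogonality of characters, by Fubini and induction on [d]. The shift closes the induction: in
    the inner integral over the first coordinate, c plus the phase of the other coordinates acts as
    the constant. With c = - pi / 2 the lemma also covers the sine. *)
Lemma tint_cos_shift d (c : R) (k : 'rV[int]_d) :
  torus_integral (fun x : 'rV[R]_d => cos (c + phase k x)) =
  if k == 0 then cos c else 0.
Proof.
have mcont n (a : R) (l : 'rV[int]_n) : measurable_fun setT
    ((fun x : 'rV[R]_n => cos (a + phase l x)) \o @row_of_tuple R n : T n -> R).
  apply: measurable_continuous_row; apply: cont_comp; first exact: continuous_cos.
  by apply: contD; [exact: cont_cst|exact: phase_continuous].
have bint dd (TT : measurableType dd) (m : probability TT R) (g : TT -> R) :
    measurable_fun setT g -> (forall x, `|g x| <= 1) -> m.-integrable setT (EFin \o g).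
  move=> mg g1; apply: measurable_bounded_integrable => //.
    by rewrite (le_lt_trans (probability_le1 _ _))// ltry.
  by exists 1; split => // M M1 x _ /=; rewrite (le_trans (g1 _))// ltW.
rewrite /torus_integral /Rintegral; apply/EFin_inj.
suff H : (\int[torus_measure d]_x (cos (c + phase k (row_of_tuple x)))%:E =
    (if k == 0 then cos c else 0)%:E)%E by rewrite [X in fine X]H.
elim: d c k => [|d IH] c k.
  have -> : k = 0 by apply/rowP => -[].
  rewrite eqxx (eq_integral (cst (cos c)%:E)); last first.
    by move=> x _; rewrite phase0 addr0.
  rewrite integral_cst//.
  by transitivity ((cos c)%:E * 1)%E; [congr (_ * _)%E; exact: probability_setT|exact: mule1].
pose l : 'rV[int]_d := \row_i k 0 (lift ord0 i).
have phaseS (x : measurableTypeR R) (t : T d) :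
    phase k (row_of_tuple (cons_pair (x, t))) =
    2 * pi * (k 0 ord0)%:~R * x + phase l (row_of_tuple t).
  rewrite /phase big_ord_recl mulrDr !mxE tnth0 mulrA; congr (_ + _ * _).
  by apply: eq_bigr => i _; rewrite !mxE tnthS.
pose m1 : probability (measurableTypeR R) R := uniform_prob (@ltr01 R).
have mcp : measurable_fun setT (fun z : measurableTypeR R * T d =>
    cos (c + phase k (row_of_tuple (cons_pair z)))).
  by apply: (@measurableT_comp _ _ _ _ _ _ _ _ (@cons_pair R d) (mcont _ c k)); exact: measurable_cons_pair.
have icp : (m1 \x torus_measure d)%E.-integrable setT
    (EFin \o (fun z : measurableTypeR R * T d => cos (c + phase k (row_of_tuple (cons_pair z))))).
  by apply: bint => // z; exact: cos_max.
rewrite /= integral_distribution; [|by apply/measurable_EFinP; exact: mcont|exact: icp].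
transitivity (\int[m1 \x torus_measure d]_z
   (cos (c + phase k (row_of_tuple (cons_pair z))))%:E)%E; first by [].
rewrite -(integral21_prod_meas1 icp).
transitivity (\int[torus_measure d]_t
   ((if k 0 ord0 == 0 then cos (c + phase l (row_of_tuple t)) else 0)%:E))%E.
  apply: eq_integral => t _; rewrite /fubini_G/=.
  rewrite -integral_uniform_cos; apply: eq_integral => x _ /=.
  by rewrite phaseS addrCA addrC -addrA addrC.
have kE : (k == 0) = (k 0 ord0 == 0) && (l == 0).
  apply/eqP/andP => [k0|[/eqP k0 /eqP l0]].
    by split; apply/eqP; [rewrite k0 mxE|apply/rowP => i; rewrite !mxE k0 mxE].
  apply/rowP => i; rewrite mxE; have [j ->|->] := unliftP ord0 i; last by [].
  by have /rowP/(_ j) := l0; rewrite !mxE.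
rewrite kE; case: eqP => _ /=; first exact: IH.
by rewrite integral0.
Qed.

Lemma tint_cosp d (k : 'rV[int]_d) :
  torus_integral (fun x : 'rV[R]_d => cos (phase k x)) = (k == 0)%:R.
Proof.
have := tint_cos_shift 0 k; under eq_fun do rewrite add0r.
by move=> ->; rewrite cos0; case: eqP.
Qed.

Lemma tint_sinp d (k : 'rV[int]_d) :
  torus_integral (fun x : 'rV[R]_d => sin (phase k x)) = 0.
Proof.
have := tint_cos_shift (- (pi / 2)) k; under eq_fun do rewrite addrC cosBpihalf.
by move=> ->; rewrite cosN cos_pihalf if_same.
Qed.

End TorusMeasureTheory.

(** * Fejer means and density of trigonometric polynomials *)

Section Periodic.
Context {R : realType} {d : nat}.
Implicit Types (f g : 'rV[R]_d -> R) (k : 'rV[int]_d).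

Definition irow k : 'rV[R]_d := \row_i (k 0 i)%:~R.

Definition cper f := continuous f /\ Zperiodic f.

Lemma test_cper f : test_function f -> cper f.
Proof. by move=> tf; split; [exact: test_continuous|case/test_functionP: tf]. Qed.

Lemma periodic_irow f k x : Zperiodic f -> f (x + irow k) = f x.
Proof.
move=> pf.
have Hn (n : nat) i y : f (y + n%:R *: delta_mx 0 i) = f y.
  elim: n y => [|n IH] y; first by rewrite scale0r addr0.
  by rewrite -natr1 scalerDl scale1r addrA pf IH.
have Hz (m : int) i y : f (y + m%:~R *: delta_mx 0 i) = f y.
  case: m => n; first exact: Hn.
  by rewrite NegzE mulrNz scaleNr -(Hn n.+1 i (y - _)) subrK.
have -> : irow k = \sum_i (k 0 i)%:~R *: delta_mx 0 i.
  by rewrite [LHS]row_sum_delta; apply: eq_bigr => i _; rewrite mxE.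
elim: (index_enum _) x => [|i r IH] x; first by rewrite big_nil addr0.
by rewrite big_cons addrA IH Hz.
Qed.

Lemma floor_row (x : 'rV[R]_d) (c : R) :
  exists k, forall i, c <= (x - irow k) 0 i <= c + 1.
Proof.
exists (\row_i Num.floor (x 0 i - c)) => i; rewrite !mxE.
have h1 := floor_le (x 0 i - c); have h2 := floorD1_gt (x 0 i - c).
rewrite intrD in h2; move: h1 h2; set z := (Num.floor _)%:~R => h1 h2.
by apply/andP; split; lra.
Qed.

Let K := [set v : 'rV[R]_d | forall i, `[0, 1]%classic (v ord0 i)].

Let compactK : compact K.
Proof.
have := @rV_compact (R : ptopologicalType) d (fun=> `[0, 1]%classic).
by apply => i; exact: segment_compact.
Qed.

Let toK x : exists k, K (x - irow k).
Proof.
have [k hk] := floor_row x 0; exists k => i /=.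
by rewrite in_itv/=; have := hk i; rewrite add0r.
Qed.

Lemma periodicB f k x : Zperiodic f -> f (x - irow k) = f x.
Proof. by move=> pf; rewrite -(periodic_irow k (x - irow k) pf) subrK. Qed.

Lemma cper_bounded f : cper f -> exists2 C : R, 0 <= C & forall x, `|f x| <= C.
Proof.
move=> [cf pf].
have [||c _ hc] := @EVT_max_rV R d (fun x => `|f x|) K _ compactK.
- by exists 0 => i; rewrite /= mxE in_itv/= lexx ler01.
- by apply: continuous_subspaceT; exact: cont_norm.
exists `|f c| => // x; have [k hk] := toK x.
by rewrite -(periodicB k x pf); apply: hc; rewrite inE.
Qed.

Lemma cper_integ f : cper f -> integ f.
Proof.
move=> cf; have [C _ hC] := cper_bounded cf.
by apply: integ_bounded hC; apply: measurable_continuous_row; case: cf.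
Qed.

Lemma cper_comp (Psi : R -> R) f : continuous Psi -> cper f -> cper (fun x => Psi (f x)).
Proof.
by move=> cP [cf pf]; split; [exact: cont_comp|move=> i x; rewrite pf].
Qed.

Lemma shift_continuous (a : 'rV[R]_d) : continuous (fun x : 'rV[R]_d => x + a).
Proof. by move=> x; apply: (@cvgD R 'rV[R]_d _ (nbhs x) _ id (cst a) x a); [exact: cvg_id|exact: cvg_cst]. Qed.

Lemma cper_shift f a : cper f -> cper (fun x => f (x + a)).
Proof.
move=> [cf pf]; split; last by move=> i x; rewrite addrAC pf.
by move=> x; apply: continuous_comp; [exact: shift_continuous|exact: cf].
Qed.

(** By periodicity compactness of the unit cube suffices: g(x + z) - g(x) is jointly continuous,
    periodic in x, and vanishes at z = 0. *)
Lemma cper_unif g (e : R) : cper g -> 0 < e ->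
  exists2 r : R, 0 < r & forall x z : 'rV[R]_d, (forall i, `|z 0 i| < r) -> `|g (x + z) - g x| < e.
Proof.
move=> [cg pg] e0.
have ch : continuous (fun p : 'rV[R]_d * 'rV[R]_d => g (p.1 + p.2) - g p.1).
  apply: contB; last by move=> p; apply: continuous_comp; [exact: cvg_fst|exact: cg].
  move=> p; apply: (@continuous_comp _ _ _ (fun p : 'rV[R]_d * 'rV[R]_d => p.1 + p.2) g).
    exact: add_continuous.
  exact: cg.
have /compact_near_coveringP ncK := compactK.
have : \forall z \near (0 : 'rV[R]_d), K `<=` (fun x : 'rV[R]_d => `|g (x + z) - g x| < e).
  apply: (ncK _ (nbhs (0 : 'rV[R]_d)) (fun z x => `|g (x + z) - g x| < e)) => x _; have /cvgrPdist_lt/(_ e e0) := ch (x, 0).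
  rewrite /= addr0 subrr.
  by apply: filterS => -[x' z] /=; rewrite sub0r normrN.
move=> /nbhs_ballP[r /= r0 hr]; exists r => // x z zr.
have [k hk] := toK x.
rewrite -(periodicB k (x + z) pg) -(periodicB k x pg) addrAC.
apply: (hr z) => //.
by split => // i j; rewrite mxE /ball/= sub0r normrN ord1.
Qed.

Definition unitv (i : 'I_d) : 'rV[int]_d := delta_mx 0 i.

Lemma phase_unitv i (z : 'rV[R]_d) : phase (unitv i) z = 2 * pi * z 0 i.
Proof.
rewrite /phase (bigD1 i)//= big1 ?addr0; first by rewrite mxE !eqxx mul1r.
by move=> j ji; rewrite mxE (negbTE ji) andbF mul0r.
Qed.

Lemma phase_irow k l : exists m : int, phase k (irow l) = 2 * pi * m%:~R.
Proof.
exists (\sum_i k 0 i * l 0 i); rewrite /phase; congr (_ * _).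
by rewrite rmorph_sum/=; apply: eq_bigr => i _; rewrite mxE rmorphM.
Qed.

Lemma cos_away (r z : R) : 0 < r -> r <= 2^-1 -> r <= `|z| -> `|z| <= 2^-1 ->
  cos (2 * pi * z) <= cos (2 * pi * r) < 1.
Proof.
move=> r0 r2 rz z2; have p0 : 0 < (pi : R) := pi_gt0 R.
have -> : cos (2 * pi * z) = cos (2 * pi * `|z|).
  by have [_|_] := ger0P z; rewrite ?mulrN ?cosN.
have in0pi (t : R) : 0 <= t -> t <= 2^-1 -> 2 * pi * t \in `[0, pi].
  move=> t0 t2; rewrite in_itv/=; move: (pi : R) p0 => p p0.
  by apply/andP; split; nra.
have r0' : 0 <= r by exact: ltW.
apply/andP; split.
  rewrite leNgt ltr_cos; [|exact: in0pi|by apply: in0pi].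
  by rewrite -leNgt ler_wpM2l// mulr_ge0 ?ltW.
rewrite -[X in _ < X]cos0 ltr_cos; [|by rewrite in_itv/= lexx ltW|exact: in0pi].
by rewrite !mulr_gt0.
Qed.

(** Korovkin's inequality with the test functions 1 - cos. Modulo Z^d the coordinates of y - x have
    modulus at most 1/2. If all are below r', uniform continuity gives e; otherwise one summand is
    at least 1 - cos(2 pi r'), and [C] times it exceeds the oscillation 2 M. *)
Lemma cper_korovkin g (e : R) : cper g -> 0 < e ->
  exists2 C : R, 0 <= C & forall x y : 'rV[R]_d,
    `|g y - g x| <= e + C * \sum_i (1 - cos (phase (unitv i) (x - y))).
Proof.
move=> cg e0; have [M M0 hM] := cper_bounded cg.
have [r r0 hr] := cper_unif cg e0.
pose r' := Num.min r 2^-1.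
have r'0 : 0 < r' by rewrite lt_min r0/=.
have r'2 : r' <= 2^-1 by rewrite ge_min lexx orbT.
have r'n : `|r'| <= 2^-1 by rewrite gtr0_norm.
have /andP[_ c1] := cos_away r'0 r'2 (ler_norm r') r'n.
have c0 : 0 < 1 - cos (2 * pi * r') by rewrite subr_gt0.
exists (2 * M / (1 - cos (2 * pi * r'))); first by rewrite divr_ge0 ?mulr_ge0// ltW.
move=> x y.
have [k hk] := floor_row (y - x) (- 2^-1).
have zk i : `|(y - x - irow k) 0 i| <= 2^-1.
  rewrite ler_norml; have /andP[h1 h2] := hk i; rewrite h1/=.
  by rewrite (le_trans h2)//; lra.
have nn i : 0 <= 1 - cos (phase (unitv i) (x - y)) by rewrite subr_ge0 cos_le1.
have sn : 0 <= \sum_i (1 - cos (phase (unitv i) (x - y))) by apply: sumr_ge0.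
have [hs|/existsNP[i /negP]] := pselect (forall i, `|(y - x - irow k) 0 i| < r').
  have := hr x (y - x - irow k); rewrite addrA addrCA subrr addr0.
  case: cg => _ pg; rewrite periodicB// => H.
  apply: (@le_trans _ _ e); last first.
    by rewrite lerDl mulr_ge0// mulr_ge0 ?mulr_ge0// invr_ge0 ltW.
  by rewrite ltW// H// => i; rewrite (lt_le_trans (hs i))// ge_min lexx.
rewrite -leNgt => hi.
have /andP[ci _] := cos_away r'0 r'2 hi (zk i).
have ce : cos (phase (unitv i) (x - y)) <= cos (2 * pi * r').
  rewrite -opprB phaseN cosN -(subrK (irow k) (y - x)) phaseD.
  have [m ->] := phase_irow (unitv i) k.
  by rewrite cosDint phase_unitv.
apply: (@le_trans _ _ (2 * M)).
  by apply: le_trans (ler_normB _ _) _; rewrite mulr2n mulrDl !mul1r lerD.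
rewrite -[leLHS]add0r; apply: lerD; first exact: ltW.
rewrite mulrAC ler_pdivlMr// ler_wpM2l ?mulr_ge0// (bigD1 i)//=.
by rewrite (@le_trans _ _ (1 - cos (phase (unitv i) (x - y))))// ?lerB// lerDl sumr_ge0.
Qed.

(* The Fejer kernel n^-d |sum_(j in [n]^d) e^{2 pi i j.z}|^2 with n = N+1. *)
Section Fejer.
Variable N : nat.
Local Notation J := {ffun 'I_d -> 'I_N.+1}.

Definition freq (j : J) : 'rV[int]_d := \row_i (j i : nat)%:Z.

Definition fejer (z : 'rV[R]_d) : R :=
  (N.+1%:R ^+ d)^-1 * \sum_(p : J * J) cos (phase (freq p.1 - freq p.2) z).

Lemma fejer_ge0 z : 0 <= fejer z.
Proof.
rewrite /fejer mulr_ge0 ?invr_ge0 ?exprn_ge0//.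
have -> : \sum_(p : J * J) cos (phase (freq p.1 - freq p.2) z) =
    (\sum_j cos (phase (freq j) z)) ^+ 2 + (\sum_j sin (phase (freq j) z)) ^+ 2.
  rewrite !expr2 !big_distrlr/= !pair_big -big_split/=.
  by apply: eq_bigr => p _; rewrite phaseDk phaseNk cosB.
by rewrite addr_ge0 ?sqr_ge0.
Qed.

Lemma freq_inj : injective freq.
Proof.
move=> j j' /rowP h; apply/ffunP => i; apply/val_inj.
by have := h i; rewrite !mxE => -[].
Qed.

Lemma integ_shift_cos k (x : 'rV[R]_d) : integ (fun y => cos (phase k (x - y))).
Proof.
apply: cper_integ; apply: test_cper.
rewrite (_ : (fun y => _) = (fun y => cos (phase k x) * cos (phase k y) + sin (phase k x) * sin (phase k y))).
  by apply: testD; apply: testZ; [exact: test_cosp|exact: test_sinp].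
by apply/funext => y; rewrite phaseB cosB.
Qed.

Lemma tint_shift_cos k (x : 'rV[R]_d) :
  torus_integral (fun y => cos (phase k (x - y))) = (k == 0)%:R.
Proof.
under eq_fun do rewrite phaseB -phaseNk.
rewrite tint_cos_shift oppr_eq0; case: eqP => // ->.
by rewrite phase0 cos0.
Qed.

Lemma tint_fejer x : torus_integral (fun y => fejer (x - y)) = 1.
Proof.
rewrite tintZ; last by apply: integ_sum => p; exact: integ_shift_cos.
rewrite tint_sum; last by move=> p; exact: integ_shift_cos.
under eq_bigr do rewrite tint_shift_cos subr_eq0 (inj_eq freq_inj).
rewrite -(pair_big predT predT (fun j j' : J => (j == j')%:R))/=.
under eq_bigr.
  move=> j _; rewrite (bigD1 j)//= eqxx big1 ?addr0.
    by over.
  by move=> j'; rewrite eq_sym => /negbTE ->.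
rewrite sumr_const card_ffun !card_ord.
by rewrite natrX mulVf// expf_neq0.
Qed.

Lemma card_top (i : 'I_d) : #|[pred j : J | j i == ord_max]| = (N.+1 ^ d.-1)%N.
Proof.
have -> : #|[pred j : J | j i == ord_max]| =
    #|family (fun x : 'I_d => if x == i then pred1 (ord_max : 'I_N.+1) else predT)|.
  apply: eq_card => j; apply/idP/familyP => [/[!inE] /eqP ji x|/(_ i)].
    by case: eqP => [->|//]; rewrite inE ji.
  by rewrite eqxx !inE.
rewrite card_family foldrE big_map big_enum/= (bigD1 i)//= eqxx card1 mul1n.
rewrite (eq_bigr (fun=> N.+1)); last by move=> x /negbTE ->; rewrite card_ord.
by rewrite prod_nat_const cardC1 card_ord.
Qed.

(** After expansion, the mean of the cosine counts pairs of indices in [n]^d, n = N + 1, that differ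
    by the i-th unit vector. Only the layer with maximal i-th index lacks a partner, so the mean is
    at least 1 - 1/n. *)
Lemma tint_fejer_cos x i :
  torus_integral (fun y => fejer (x - y) * (1 - cos (phase (unitv i) (x - y)))) <= N.+1%:R^-1.
Proof.
pose KK := N.+1%:R ^+ d : R.
have K0 : 0 < KK by rewrite exprn_gt0.
have E : (fun y => fejer (x - y) * (1 - cos (phase (unitv i) (x - y)))) =
    (fun y => fejer (x - y) - KK^-1 * \sum_(p : J * J) (2^-1 *
      (cos (phase (freq p.1 - freq p.2 + unitv i) (x - y)) +
       cos (phase (freq p.1 - freq p.2 - unitv i) (x - y))))).
  apply/funext => y; rewrite mulrBr mulr1; congr (_ - _).
  rewrite /fejer -mulrA mulr_suml; congr (_ * _).
  apply: eq_bigr => p _; rewrite (phaseDk _ (unitv i)) (phaseDk _ (- unitv i)) phaseNk.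
  rewrite cosD cosB; set a := cos _; set b := cos _; set e := sin _; set f := sin _.
  by field.
have i1 (p : J * J) : integ (fun y => cos (phase (freq p.1 - freq p.2 + unitv i) (x - y)) +
       cos (phase (freq p.1 - freq p.2 - unitv i) (x - y))).
  by apply: integD; exact: integ_shift_cos.
have i2 : integ (fun y => fejer (x - y)).
  by apply: integZ; apply: integ_sum => p; exact: integ_shift_cos.
have i3 : integ (fun y => \sum_(p : J * J) (2^-1 *
      (cos (phase (freq p.1 - freq p.2 + unitv i) (x - y)) +
       cos (phase (freq p.1 - freq p.2 - unitv i) (x - y))))).
  by apply: integ_sum => p; exact: integZ.
rewrite E tintB//; last exact: integZ.
rewrite tint_fejer tintZ// tint_sum; last by move=> p; exact: integZ.
under eq_bigr => p _.
  rewrite tintZ// tintD; try exact: integ_shift_cos.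
  rewrite !tint_shift_cos; over.
pose B : pred J := [pred j : J | j i == ord_max].
have cardK : (#|predC B|%:R : R) = KK - KK / N.+1%:R.
  have := cardC B; rewrite card_ffun !card_ord card_top.
  move=> /(congr1 (fun n : nat => n%:R : R)); rewrite natrD !natrX => h.
  rewrite -[X in X - _]h addrAC.
  rewrite (_ : N.+1%:R ^+ d.-1 = KK / N.+1%:R) ?subrr ?add0r//.
  have d0 : (0 < d)%N by apply: leq_ltn_trans (ltn_ord i).
  by rewrite /KK -[in RHS](prednK d0) exprSr mulfK.
(* The partner of j, one step further in direction i; off the top layer [inord] does not
   truncate. *)
pose up (j : J) : J := [ffun x => if x == i then inord (j x).+1 else j x].
have upE j : j \in predC B -> freq (up j) = freq j + unitv i.
  rewrite !inE => jB; apply/rowP => l; rewrite !mxE ffunE eqxx/=.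
  have [->|xi] := eqVneq l i; last by rewrite addr0.
  rewrite inordK; first by rewrite -addn1 PoszD.
  rewrite ltnS ltn_neqAle -ltnS ltn_ord andbT.
  by apply: contraNneq jB => h; apply/eqP/val_inj.
have S1 : KK - KK / N.+1%:R <= \sum_(p : J * J) (freq p.1 - freq p.2 + unitv i == 0)%:R.
  rewrite -cardK -sum1_card natr_sum.
  rewrite -(pair_big predT predT (fun j j' : J => (freq j - freq j' + unitv i == 0)%:R))/=.
  rewrite [leRHS](bigID (mem (predC B)))/= -[leLHS]addr0 lerD//; last first.
    by apply: sumr_ge0 => j _; apply: sumr_ge0.
  apply: ler_sum => j jB; rewrite (bigD1 (up j))//= upE// addrAC subrr eqxx.
  by rewrite lerDl; apply: sumr_ge0.
have S2 : KK - KK / N.+1%:R <= \sum_(p : J * J) (freq p.1 - freq p.2 - unitv i == 0)%:R.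
  rewrite -cardK -sum1_card natr_sum.
  rewrite -(pair_big predT predT (fun j j' : J => (freq j - freq j' - unitv i == 0)%:R))/=.
  rewrite exchange_big/=.
  rewrite [leRHS](bigID (mem (predC B)))/= -[leLHS]addr0 lerD//; last first.
    by apply: sumr_ge0 => j _; apply: sumr_ge0.
  apply: ler_sum => j jB; rewrite (bigD1 (up j))//= upE// -addrA -opprD subrr eqxx.
  by rewrite lerDl; apply: sumr_ge0.
rewrite -mulr_sumr big_split/=.
have hm (a b c : R) : c <= a -> c <= b -> c <= 2^-1 * (a + b) by move=> *; lra.
have := hm _ _ _ S1 S2.
move=> /(ler_wpM2l (ltW (_ : 0 < KK^-1))) => /(_ _) h.
rewrite lerBlDr -lerBlDl; apply: le_trans (h _); last by rewrite invr_gt0.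
by rewrite mulrBr mulVf ?gt_eqF// mulrA mulVf ?gt_eqF// mul1r.
Qed.

End Fejer.

(* Trigonometric polynomials, as lists of frequencies with their cosine and sine coefficients. *)
Definition trig := seq ('rV[int]_d * (R * R)).

Definition tev (P : trig) (x : 'rV[R]_d) : R :=
  \sum_(t <- P) (t.2.1 * cos (phase t.1 x) + t.2.2 * sin (phase t.1 x)).

Lemma test_tev P : test_function (tev P).
Proof.
by apply: test_sum => t; apply: testD; apply: testZ; [exact: test_cosp|exact: test_sinp].
Qed.

Lemma tint_sin_shift (c : R) k :
  torus_integral (fun x : 'rV[R]_d => sin (c + phase k x)) = if k == 0 then sin c else 0.
Proof.
under eq_fun do rewrite -cosBpihalf addrAC.
by rewrite tint_cos_shift cosBpihalf.
Qed.

Lemma tev_shift_tint P a : torus_integral (fun x => tev P (x + a)) = torus_integral (tev P).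
Proof.
have ic k : integ (fun x : 'rV[R]_d => cos (phase k (x + a))).
  by apply: cper_integ; apply: (cper_shift (f := fun x => cos (phase k x))); apply: test_cper; exact: test_cosp.
have isn k : integ (fun x : 'rV[R]_d => sin (phase k (x + a))).
  by apply: cper_integ; apply: (cper_shift (f := fun x => sin (phase k x))); apply: test_cper; exact: test_sinp.
rewrite /tev tint_sum; last by move=> t; apply: integD; exact: integZ.
rewrite tint_sum; last by move=> t; apply: integD; apply: integZ; [exact: integ_cosp|exact: integ_sinp].
apply: eq_bigr => t _.
rewrite !tintD ?tintZ//; try exact: integZ.
- rewrite tint_cosp tint_sinp; congr (_ * _ + _ * _).
    under eq_fun do rewrite phaseD addrC.
    by rewrite tint_cos_shift; case: eqP => // ->; rewrite phase0 cos0.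
  under eq_fun do rewrite phaseD addrC.
  by rewrite tint_sin_shift; case: eqP => // ->; rewrite phase0 sin0.
- exact: integ_sinp.
- exact: integ_cosp.
- by apply: integZ; exact: integ_cosp.
- by apply: integZ; exact: integ_sinp.
Qed.

Definition fmean N f x := torus_integral (fun y => f y * fejer N (x - y)).

Definition fcos f k := torus_integral (fun y => f y * cos (phase k y)).
Definition fsin f k := torus_integral (fun y => f y * sin (phase k y)).

Lemma integ_fcos f k : integ f -> integ (fun y => f y * cos (phase k y)).
Proof.
move=> fi; apply: (@integM _ _ _ _ 1) => //; last by move=> x; exact: cos_max.
by apply: integ_mrow; exact: integ_cosp.
Qed.

Lemma integ_fsin f k : integ f -> integ (fun y => f y * sin (phase k y)).
Proof.
move=> fi; apply: (@integM _ _ _ _ 1) => //; last by move=> x; exact: sin_max.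
by apply: integ_mrow; exact: integ_sinp.
Qed.

Definition fmean_trig N f : trig :=
  [seq (freq p.1 - freq p.2,
        ((N.+1%:R ^+ d)^-1 * fcos f (freq p.1 - freq p.2),
         (N.+1%:R ^+ d)^-1 * fsin f (freq p.1 - freq p.2)))
  | p : {ffun 'I_d -> 'I_N.+1} * {ffun 'I_d -> 'I_N.+1}].

Lemma fmeanE N f : integ f -> fmean N f = tev (fmean_trig N f).
Proof.
move=> fi; apply/funext => x; rewrite /tev big_map big_enum/= /fmean.
have E y : f y * fejer N (x - y) = \sum_(p : {ffun 'I_d -> 'I_N.+1} * {ffun 'I_d -> 'I_N.+1})
   ((N.+1%:R ^+ d)^-1 * cos (phase (freq p.1 - freq p.2) x) * (f y * cos (phase (freq p.1 - freq p.2) y)) +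
   (N.+1%:R ^+ d)^-1 * sin (phase (freq p.1 - freq p.2) x) * (f y * sin (phase (freq p.1 - freq p.2) y))).
  rewrite /fejer mulrCA !mulr_sumr; apply: eq_bigr => p _.
  by rewrite phaseB cosB; set u := _^-1; ring.
under eq_fun do rewrite E.
rewrite tint_sum; last first.
  by move=> p; apply: integD; apply: integZ; [exact: integ_fcos|exact: integ_fsin].
apply: eq_bigr => p _ /=.
rewrite tintD; [|by apply: integZ; exact: integ_fcos|by apply: integZ; exact: integ_fsin].
rewrite !tintZ; [|exact: integ_fsin|exact: integ_fcos].
by rewrite /fcos /fsin; congr (_ + _); rewrite mulrAC.
Qed.

Lemma integ_fejer N x : integ (fun y => fejer N (x - y)).
Proof. by apply: integZ; apply: integ_sum => p; exact: integ_shift_cos. Qed.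

Lemma mrow_fejer N x : mrow (fun y => fejer N (x - y)).
Proof. by apply: integ_mrow; exact: integ_fejer. Qed.

Lemma fejer_bounded N z : `|fejer N z| <=
  (N.+1%:R ^+ d)^-1 * \sum_(p : {ffun 'I_d -> 'I_N.+1} * {ffun 'I_d -> 'I_N.+1}) 1.
Proof.
rewrite /fejer normrM ger0_norm ?invr_ge0 ?exprn_ge0//.
rewrite ler_wpM2l ?invr_ge0 ?exprn_ge0//.
by apply: le_trans (ler_norm_sum _ _ _) _; apply: ler_sum => p _; exact: cos_max.
Qed.

(** A positive kernel of mass 1 averages the Korovkin inequality. The terms 1 - cos contribute at
    most C d / (N + 1) in total, which the threshold makes at most e / 2. *)
Lemma fmean_cvg f (e : R) : cper f -> 0 < e ->
  exists N0, forall N, (N0 <= N)%N -> forall x, `|f x - fmean N f x| <= e.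
Proof.
move=> cf e0; have e20 : 0 < e / 2 by rewrite divr_gt0.
have [C C0 hC] := cper_korovkin cf e20.
have fi := cper_integ cf.
exists (Num.trunc (C * d%:R / (e / 2))) => N hN x.
have ffi : integ (fun y => f y * fejer N (x - y)).
  by apply: integM fi (mrow_fejer N x) _ => y; exact: fejer_bounded.
have i1 : integ (fun y => (f x - f y) * fejer N (x - y)).
  under eq_fun do rewrite mulrBl.
  by apply: integB => //; apply: integZ; exact: integ_fejer.
have i2 i : integ (fun y => fejer N (x - y) * (1 - cos (phase (unitv i) (x - y)))).
  apply: (@integM _ _ _ _ 2); first exact: integ_fejer.
    by apply: integ_mrow; apply: integB; [exact: integ_cst|exact: integ_shift_cos].
  move=> y; apply: le_trans (ler_normB _ _) _.
  by rewrite normr1 mulr2n lerD// cos_max.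
have i3 : integ (fun y => e / 2 * fejer N (x - y) + C * \sum_i (fejer N (x - y) * (1 - cos (phase (unitv i) (x - y))))).
  by apply: integD; apply: integZ; [exact: integ_fejer|exact: integ_sum].
have -> : f x - fmean N f x = torus_integral (fun y => (f x - f y) * fejer N (x - y)).
  under [in RHS]eq_fun do rewrite mulrBl.
  rewrite tintB//; last by apply: integZ; exact: integ_fejer.
  by rewrite tintZ ?tint_fejer ?mulr1//; exact: integ_fejer.
apply: le_trans (normr_tint i1) _.
apply: (@le_trans _ _ (torus_integral (fun y => e / 2 * fejer N (x - y) +
   C * \sum_i (fejer N (x - y) * (1 - cos (phase (unitv i) (x - y))))))).
  apply: le_tint => //; first exact: integ_norm.
  move=> y; rewrite normrM (ger0_norm (fejer_ge0 _ _)) -mulr_sumr (mulrCA C) (mulrC (e / 2)) -mulrDr.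
  by rewrite mulrC ler_wpM2l ?fejer_ge0// distrC hC.
rewrite tintD; [|by apply: integZ; exact: integ_fejer|by apply: integZ; exact: integ_sum].
rewrite (tintZ (e / 2) (integ_fejer N x)) (tintZ C); [|exact: integ_sum].
rewrite tint_fejer mulr1 tint_sum//.
rewrite [leRHS](splitr e) lerD2l.
apply: (@le_trans _ _ (C * \sum_(i < d) N.+1%:R^-1)).
  by rewrite ler_wpM2l//; apply: ler_sum => i _; exact: tint_fejer_cos.
move: hN; rewrite truncn_le_nat ltr_pdivrMr// => h.
rewrite sumr_const card_ord -[_ *+ d]mulr_natr mulrA mulrAC ler_pdivrMr//.
by rewrite (mulrC (e / 2)) ltW.
Qed.

(** The measure lives on the cube and is not translation invariant by construction. The mean of a
    trigonometric polynomial sees only frequency 0, which translations fix; uniform approximation by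
    Fejer means carries this over to continuous periodic functions. *)
Lemma tint_shift g a : cper g -> torus_integral (fun x => g (x + a)) = torus_integral g.
Proof.
move=> cg; apply/eqP; rewrite -subr_eq0 -normr_le0; apply/ler_addgt0Pr => e e0.
rewrite add0r; have e20 : 0 < e / 2 by rewrite divr_gt0.
have [N /(_ N (leqnn _)) hN] := fmean_cvg cg e20.
rewrite fmeanE in hN; last exact: cper_integ.
set P := fmean_trig _ _ in hN.
have ig := cper_integ cg; have iga := cper_integ (cper_shift a cg).
have cP := test_cper (test_tev P).
have iP := cper_integ cP; have iPa := cper_integ (cper_shift a cP).
rewrite (_ : _ - _ = torus_integral (fun x => g (x + a) - tev P (x + a)) -
   torus_integral (fun x => g x - tev P x)); last first.
  by rewrite !tintB// tev_shift_tint; ring.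
apply: le_trans (ler_normB _ _) _; rewrite [leRHS]splitr lerD//.
  by apply: tint_bound => //; exact: integB.
by apply: tint_bound => //; exact: integB.
Qed.

Lemma is_derive_line f (x v : 'rV[R]_d) (t : R) : differentiable f (x + t *: v) ->
  is_derive t 1 (fun t : R => f (x + t *: v)) ('D_v f (x + t *: v)).
Proof.
move=> df.
have E : (fun h : R => h^-1 *: (((fun t : R => f (x + t *: v)) \o shift t) (h *: 1) - f (x + t *: v))) =
         (fun h : R => h^-1 *: ((f \o shift (x + t *: v)) (h *: v) - f (x + t *: v))).
  by apply/funext => h /=; rewrite -[h%:A]/(h * 1) mulr1 scalerDl addrCA.
apply: DeriveDef.
  have : derivable f (x + t *: v) v by exact: diff_derivable.
  by rewrite /derivable E.
by rewrite /derive E.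
Qed.

Lemma mean_value_line f (x v : 'rV[R]_d) : (forall y, differentiable f y) ->
  exists2 t : R, 0 <= t <= 1 & f (x + v) - f x = 'D_v f (x + t *: v).
Proof.
move=> df.
have dF (t : R) : is_derive t 1 (fun t : R => f (x + t *: v)) ('D_v f (x + t *: v)).
  exact: is_derive_line.
have cF : {within `[0, 1], continuous (fun t : R => f (x + t *: v))}.
  apply: continuous_subspaceT => t; apply: differentiable_continuous.
  by apply/derivable1_diffP; have [] := dF t.
have [t] := @MVT_segment R _ _ 0 1 ler01 (fun t _ => dF t) cF.
rewrite in_itv/= scale1r scale0r addr0 subr0 mulr1 => /andP[t0 t1] E.
by exists t => //; rewrite t0 t1.
Qed.

(** The derivative is uniformly close to a difference quotient, whose integral vanishes by
    translation invariance; no boundary term of the cube appears. *)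
Lemma tint_partial i g : test_function g -> torus_integral (partial i g) = 0.
Proof.
move=> tg; apply/eqP; rewrite -normr_le0; apply/ler_addgt0Pr => e e0; rewrite add0r.
have cg := test_cper tg; have cpg := test_cper (test_partial i tg).
have [r r0 hr] := cper_unif cpg e0.
pose h := r / 2; have h0 : 0 < h by rewrite divr_gt0.
pose v : 'rV[R]_d := h *: delta_mx 0 i.
have -> : torus_integral (partial i g) =
    torus_integral (fun x => partial i g x - h^-1 * (g (x + v) - g x)).
  rewrite tintB; [|exact: cper_integ|]; last first.
    by apply: integZ; apply: integB; [exact: cper_integ (cper_shift _ cg)|exact: cper_integ].
  rewrite tintZ; last by apply: integB; [exact: cper_integ (cper_shift _ cg)|exact: cper_integ].
  rewrite tintB; [|exact: cper_integ (cper_shift _ cg)|exact: cper_integ].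
  by rewrite tint_shift// subrr mulr0 subr0.
apply: tint_bound.
  apply: integB; first exact: cper_integ.
  by apply: integZ; apply: integB; [exact: cper_integ (cper_shift _ cg)|exact: cper_integ].
move=> x; have [t /andP[t0 t1] ->] := @mean_value_line g x v (fun y => test_diff y tg).
have -> : 'D_v g (x + t *: v) = h * partial i g (x + t *: v).
  rewrite deriveE; last exact: test_diff.
  by rewrite /v linearZ/= -partialE//; exact: test_diff.
rewrite mulrA mulVf ?gt_eqF// mul1r distrC ltW// hr// => j.
rewrite !mxE normrM (ger0_norm t0) normrM (gtr0_norm h0).
have dl : `|(((0 : 'I_1) == 0) && (j == i))%:R| <= 1 :> R.
  by case: (_ && _); rewrite ?normr1 ?normr0.
rewrite eqxx/= in dl *.
apply: (@le_lt_trans _ _ (1 * (h * 1))).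
  by rewrite ler_pM// ?mulr_ge0 ?ler_wpM2l// ltW.
by rewrite mul1r mulr1 /h; lra.
Qed.

Lemma tint_parts i f g : test_function f -> test_function g ->
  torus_integral (fun x => partial i f x * g x) = - torus_integral (fun x => f x * partial i g x).
Proof.
move=> tf tg; have := tint_partial i (testM tf tg).
rewrite partialM; [|by move=> x; exact: test_diff|by move=> x; exact: test_diff].
have i1 : integ (fun x => f x * partial i g x).
  by apply: cper_integ; apply: test_cper; apply: testM => //; exact: test_partial.
have i2 : integ (fun x => g x * partial i f x).
  by apply: cper_integ; apply: test_cper; apply: testM => //; exact: test_partial.
rewrite tintD// => /eqP; rewrite addr_eq0 => /eqP ->; rewrite opprK.
by under eq_fun do rewrite mulrC.
Qed.

Lemma fcos_partial i f k : test_function f ->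
  fcos (partial i f) k = 2 * pi * (k 0 i)%:~R * fsin f k.
Proof.
move=> tf; rewrite /fcos tint_parts//; last exact: test_cosp.
rewrite partial_cosp /fsin -tintZ; last by apply: integ_fsin; apply: cper_integ; exact: test_cper.
rewrite -mulN1r -tintZ; last first.
  under eq_fun do rewrite mulrCA; apply: integZ; apply: integ_fsin.
  by apply: cper_integ; exact: test_cper.
by congr torus_integral; apply/funext => x; move: (pi : R) => p; ring.
Qed.

Lemma fsin_partial i f k : test_function f ->
  fsin (partial i f) k = - (2 * pi * (k 0 i)%:~R) * fcos f k.
Proof.
move=> tf; rewrite /fsin tint_parts//; last exact: test_sinp.
rewrite partial_sinp /fcos -tintZ; last by apply: integ_fcos; apply: cper_integ; exact: test_cper.
rewrite -mulN1r -tintZ; last first.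
  under eq_fun do rewrite mulrCA; apply: integZ; apply: integ_fcos.
  by apply: cper_integ; exact: test_cper.
by congr torus_integral; apply/funext => x; move: (pi : R) => p; ring.
Qed.

Lemma partial_sum i (I : Type) (r : seq I) (F : I -> 'rV[R]_d -> R) :
  (forall j x, differentiable (F j) x) ->
  partial i (fun x => \sum_(j <- r) F j x) = fun x => \sum_(j <- r) partial i (F j) x.
Proof.
move=> dF; elim: r => [|j r IH].
  under eq_fun do rewrite big_nil; rewrite partial_cst.
  by apply/funext => x; rewrite big_nil.
have sF : forall x, differentiable (fun x => \sum_(j <- r) F j x) x.
  elim: r {IH} => [|j' r IH] x.
    by under eq_fun do rewrite big_nil; exact: differentiable_cst.
  by under eq_fun do rewrite big_cons; exact: differentiableD.
under eq_fun do rewrite big_cons.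
by rewrite partialD// IH; apply/funext => x; rewrite big_cons.
Qed.

Lemma partialZ i (c : R) f : (forall x, differentiable f x) ->
  partial i (fun x => c * f x) = fun x => c * partial i f x.
Proof.
move=> df; rewrite partialM//.
by apply/funext => x; rewrite partial_cst mulr0 addr0.
Qed.

Definition trig_partial i (P : trig) : trig :=
  map (fun t : 'rV[int]_d * (R * R) =>
    (t.1, (2 * pi * (t.1 0 i)%:~R * t.2.2, - (2 * pi * (t.1 0 i)%:~R * t.2.1)))) P.

Lemma partial_tev i P : partial i (tev P) = tev (trig_partial i P).
Proof.
have dc k x : differentiable (fun x : 'rV[R]_d => cos (phase k x)) x.
  by apply: test_diff; exact: test_cosp.
have ds k x : differentiable (fun x : 'rV[R]_d => sin (phase k x)) x.
  by apply: test_diff; exact: test_sinp.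
have dZ (c : R) f x : differentiable f x -> differentiable (fun x => c * f x) x.
  by move=> df; apply: differentiableM.
rewrite /tev partial_sum; last by move=> t x; apply: differentiableD; exact: dZ.
apply/funext => x; rewrite big_map; apply: eq_bigr => t _ /=.
rewrite partialD; [|by move=> y; exact: dZ|by move=> y; exact: dZ].
rewrite !partialZ// partial_cosp partial_sinp.
by move: (pi : R) => p; ring.
Qed.

Lemma partial_fmean i N f : test_function f ->
  partial i (fmean N f) = fmean N (partial i f).
Proof.
move=> tf; rewrite !fmeanE; [|exact: cper_integ (test_cper (test_partial i tf))|exact: cper_integ (test_cper tf)].
rewrite partial_tev; congr tev; rewrite /trig_partial /fmean_trig -map_comp.
apply: eq_map => p /=; rewrite fcos_partial// fsin_partial//.
by move: (pi : R) => q; congr (_, (_, _)); ring.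
Qed.

Lemma test_fmean N f : integ f -> test_function (fmean N f).
Proof. by move=> fi; rewrite fmeanE//; exact: test_tev. Qed.

(** Differentiation commutes with Fejer means, so their uniform convergence, applied to each
    derivative, is convergence in C^n. *)
Lemma fmean_dense_eventually n f (e : R) : test_function f -> 0 < e ->
  exists N0, forall N, (N0 <= N)%N -> bd supb n e 1 (fun x => f x - fmean N f x).
Proof.
elim: n f => [|n IH] f tf e0.
  have [N0 hN0] := fmean_cvg (test_cper tf) e0.
  by exists N0 => N hN; split => // x; exact: hN0.
have [N0 hN0] := fmean_cvg (test_cper tf) e0.
have /choice[M hM] : forall i : 'I_d, exists M, forall N, (M <= N)%N ->
    bd supb n e 1 (fun x => partial i f x - fmean N (partial i f) x).
  by move=> i; apply: IH => //; exact: test_partial.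
exists (maxn N0 (\max_i M i)) => N; rewrite geq_max => /andP[hN hMN]; split.
  by move=> x; exact: hN0.
move=> i; rewrite partialB.
- rewrite partial_fmean// mulr1; apply: hM.
  by apply: leq_trans hMN; exact: leq_bigmax.
- by move=> x; exact: test_diff.
- by move=> x; apply: test_diff; apply: test_fmean; exact: cper_integ (test_cper tf).
Qed.

Lemma trig_dense n f (e : R) : test_function f -> 0 < e ->
  exists P, bd supb n e 1 (fun x => f x - tev P x).
Proof.
move=> tf e0; have [N /(_ N (leqnn _))] := fmean_dense_eventually n tf e0.
by rewrite fmeanE; [exists (fmean_trig N f)|exact: cper_integ (test_cper tf)].
Qed.

End Periodic.

(** * Fourier multipliers on translation invariant norms *)

Section RieszFormula.
Context {R : realType}.

Lemma cos_natpi (r : nat) : cos (r%:R * pi : R) = (-1) ^+ r.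
Proof.
elim: r => [|r IH]; first by rewrite mul0r cos0 expr0.
by rewrite -natr1 mulrDl mul1r cosDpi IH exprS mulN1r.
Qed.

(* M. Riesz: the second difference in k of
   sum_r (-1)^r sin(k theta_r) / (4 sin^2 (theta_r / 2)) vanishes for 0 < k < N. *)
Lemma riesz_formula (N : nat) : (0 < N)%N ->
  exists w z : 'I_(N.*2) -> R, \sum_r `|w r| = N%:R /\
    forall k : int, `|k| <= N -> k%:~R = \sum_r w r * sin (k%:~R * z r).
Proof.
move=> N0; have NR0 : 0 < N%:R :> R by rewrite ltr0n.
pose h : R := pi / (2 * N%:R).
have hN : h * (2 * N%:R) = pi by rewrite /h divfK// mulf_neq0// gt_eqF.
have p0 : 0 < (pi : R) := pi_gt0 R.
have h0 : 0 < h by rewrite /h divr_gt0// mulr_gt0.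
pose th (r : nat) : R := (r%:R * 2 + 1) * h.
have sth r : (r < N.*2)%N -> 0 < sin (th r / 2).
  move=> rN; apply: sin_gt0_pi; rewrite -hN /th.
  have rR : r%:R + 1 <= 2 * N%:R :> R.
    by rewrite natr1 -natrM ler_nat mul2n.
  have r0 : 0 <= r%:R :> R by [].
  by apply/andP; split; nra.
pose c (r : nat) : R := (-1) ^+ r / (4 * sin (th r / 2) ^+ 2).
pose g (k : nat) : R := \sum_(r < N.*2) c r * sin (k%:R * th r).
have ortho k : (0 < k < N)%N -> \sum_(r < N.*2) (-1) ^+ r * sin (k%:R * th r) = 0.
  move=> /andP[k0 kN].
  have kR : k%:R + 1 <= N%:R :> R by rewrite natr1 ler_nat.
  have ck : 0 < cos (k%:R * h).
    apply: cos_gt0_pihalf; rewrite -hN.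
    have kR0 : 0 < k%:R :> R by rewrite ltr0n.
    by apply/andP; split; nra.
  (* Multiplication by 2 cos(k h) makes the alternating sum telescope; at M = 2 N the remaining sine
     is taken at a multiple of 2 pi, and cos(k h) > 0 can be divided out. *)
  have tele M : 2 * cos (k%:R * h) * \sum_(r < M) (-1) ^+ r * sin (k%:R * th r) =
      - (-1) ^+ M * sin (2 * k%:R * M%:R * h).
    elim: M => [|M IH]; first by rewrite big_ord0 !mulr0 mul0r sin0 mulr0.
    rewrite big_ord_recr/= mulrDr IH exprS.
    have -> : 2 * k%:R * M.+1%:R * h = k%:R * th M + k%:R * h.
      by rewrite /th -natr1; ring.
    have -> : 2 * k%:R * M%:R * h = k%:R * th M - k%:R * h by rewrite /th; ring.
    by rewrite sinB sinD; ring.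
  have := tele N.*2.
  rewrite -[(-1) ^+ _]signr_odd odd_double expr0.
  have -> : 2 * k%:R * N.*2%:R * h = 0 + 2 * pi * (k%:Z)%:~R.
    by rewrite -hN -mul2n natrM -pmulrn; ring.
  rewrite sinDint sin0 mulr0 => /eqP; rewrite mulf_eq0 mulf_eq0 (gt_eqF ck) orbF.
  by rewrite pnatr_eq0/= => /eqP.
have g0 : g 0%N = 0.
  by rewrite /g big1// => r _; rewrite mul0r sin0 mulr0.
have d2 k : (0 < k < N)%N -> g k.+1 + g k.-1 = 2 * g k.
  move=> /andP[k0 kN]; apply/eqP; rewrite -subr_eq0; apply/eqP.
  rewrite /g -big_split/= mulr_sumr -sumrB.
  transitivity (- \sum_(r < N.*2) (-1) ^+ r * sin (k%:R * th r)); last by rewrite ortho ?oppr0// k0.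
  rewrite -sumrN; apply: eq_bigr => r _.
  have sr := sth r (ltn_ord r).
  have -> : k.+1%:R * th r = k%:R * th r + th r by rewrite -natr1; ring.
  have -> : k.-1%:R * th r = k%:R * th r - th r.
    by rewrite -[in RHS](prednK k0) -natr1; ring.
  rewrite sinD sinB.
  have -> : cos (th r) = 1 - 2 * sin (th r / 2) ^+ 2.
    have -> : th r = th r / 2 + th r / 2 by field.
    have s2 := cos2Dsin2 (th r / 2).
    rewrite cosD -!expr2 -(_ : th r / 2 = (th r / 2 + th r / 2) / 2); last by field.
    by move: s2; move: (cos _ ^+ 2) (sin _ ^+ 2) => u v; lra.
  rewrite /c; set s := sin (th r / 2) in sr *.
  by field; rewrite gt_eqF.
have lin k : (k < N)%N -> g k = k%:R * g 1%N /\ g k.+1 = k.+1%:R * g 1%N.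
  elim: k => [|k IH] kN; first by rewrite g0 mul0r mul1r.
  have [gk gk1] := IH (ltnW kN); split=> //.
  have := d2 k.+1; rewrite /= kN => /(_ isT) E.
  have -> : g k.+2 = 2 * g k.+1 - g k by rewrite -E addrK.
  by rewrite gk gk1 -!natr1; ring.
pose A := \sum_(r < N.*2) (4 * sin (th r / 2) ^+ 2)^-1.
(* At k = N the sine equals (-1)^r and cancels the sign, so g N is the total mass A of the weights.
   Linearity gives A = N g(1), and the normalised weights N / A * c r have total mass exactly N. *)
have gN : g N = A.
  apply: eq_bigr => r _; rewrite /c.
  have -> : N%:R * th r = r%:R * pi + pi / 2 by rewrite /th -hN; field.
  rewrite sinDpihalf cos_natpi mulrAC -expr2 -exprM mulnC exprM sqrrN expr1n expr1n.
  by rewrite mul1r.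
have A0 : 0 < A.
  have N20 : (0 < N.*2)%N by rewrite double_gt0.
  rewrite /A (bigD1 (Ordinal N20))//= ltr_pwDl//.
    by rewrite invr_gt0 mulr_gt0// exprn_gt0// sth.
  by apply: sumr_ge0 => r _; rewrite invr_ge0 mulr_ge0// sqr_ge0.
have gA : A = N%:R * g 1%N.
  by rewrite -gN -(prednK N0); apply: (lin N.-1 _).2; rewrite prednK.
have g10 : g 1%N != 0.
  by apply: contraTneq A0 => g1; rewrite gA g1 mulr0 ltxx.
have g1A : (g 1%N)^-1 = N%:R / A by rewrite gA; field; rewrite g10 gt_eqF.
exists (fun r => N%:R / A * c r), (fun r => th r); split.
  transitivity (\sum_(r < N.*2) N%:R / A * (4 * sin (th r / 2) ^+ 2)^-1).
    apply: eq_bigr => r _; rewrite normrM ger0_norm; last by rewrite divr_ge0// ltW.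
    rewrite /c normrM normrX normrN1 expr1n mul1r ger0_norm//.
    by rewrite invr_ge0 mulr_ge0// sqr_ge0.
  by rewrite -mulr_sumr -/A divfK// gt_eqF.
have natk (k : nat) : (k <= N)%N -> k%:R = \sum_(r < N.*2) N%:R / A * c r * sin (k%:R * th r).
  move=> kN; under eq_bigr do rewrite -mulrA; rewrite -mulr_sumr -/(g k) -g1A.
  have -> : g k = k%:R * g 1%N.
    by case: k kN => [|k] kN; [rewrite g0 mul0r|apply: (lin k kN).2].
  by rewrite mulrCA mulVf// mulr1.
move=> [k|k] kN; first exact: natk.
rewrite NegzE mulrNz -pmulrn [in LHS](natk k.+1); last by move: kN; rewrite NegzE normrN.
rewrite -sumrN; apply: eq_bigr => r _.
by rewrite mulNr sinN mulrN.
Qed.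

(* E[cos(theta Z)] and E[Z sin(theta Z)] for a sum Z of n fair signs. *)
Fixpoint walk (n : nat) : seq R :=
  if n is n'.+1 then [seq z + 1 | z <- walk n'] ++ [seq z - 1 | z <- walk n'] else [:: 0].

Lemma walk_sum n (F : R -> R) :
  \sum_(z <- walk n.+1) F z = \sum_(z <- walk n) (F (z + 1) + F (z - 1)).
Proof. by rewrite /= big_cat !big_map big_split. Qed.

Lemma walk_cos n (t : R) : \sum_(z <- walk n) cos (z * t) = 2 ^+ n * cos t ^+ n.
Proof.
elim: n => [|n IH]; first by rewrite big_seq1 mul0r cos0 expr0 mulr1.
rewrite walk_sum (eq_bigr (fun z => 2 * cos t * cos (z * t))); last first.
  move=> z _; have -> : (z + 1) * t = z * t + t by ring.
  have -> : (z - 1) * t = z * t - t by ring.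
  by rewrite cosB cosD; ring.
by rewrite -mulr_sumr IH !exprS; ring.
Qed.

Lemma walk_zsin n (t : R) :
  \sum_(z <- walk n.+1) z * sin (z * t) = 2 ^+ n.+1 * (n.+1%:R * cos t ^+ n * sin t).
Proof.
have E k : \sum_(z <- walk k.+1) z * sin (z * t) =
   2 * cos t * \sum_(z <- walk k) z * sin (z * t) + 2 * sin t * \sum_(z <- walk k) cos (z * t).
  rewrite walk_sum !mulr_sumr -big_split/=; apply: eq_bigr => z _.
  have -> : (z + 1) * t = z * t + t by ring.
  have -> : (z - 1) * t = z * t - t by ring.
  by rewrite sinB sinD; ring.
elim: n => [|n IH]; rewrite E walk_cos.
  by rewrite big_seq1 !mul0r !expr0; ring.
by rewrite IH !exprS -!natr1; ring.
Qed.

Lemma walk_size n : size (walk n) = (2 ^ n)%N.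
Proof.
elim: n => // n IH; by rewrite /= size_cat !size_map IH expnS mul2n addnn.
Qed.

Lemma walk_sqr n : \sum_(z <- walk n) z ^+ 2 = 2 ^+ n * n%:R.
Proof.
elim: n => [|n IH]; first by rewrite big_seq1 expr0n/= mulr0.
rewrite walk_sum (eq_bigr (fun z => 2 * z ^+ 2 + 2)); last by move=> z _; ring.
rewrite big_split/= -mulr_sumr IH big_const_seq count_predT walk_size iter_addr addr0.
by rewrite -[2 *+ _]mulr_natr natrX exprS -natr1; ring.
Qed.

Lemma walk_norm n : \sum_(z <- walk n.+1) `|z| <= 2 ^+ n.+1 * Num.sqrt n.+1%:R.
Proof.
set S : R := Num.sqrt _; have S0 : 0 < S by rewrite sqrtr_gt0.
have SS : S ^+ 2 = n.+1%:R by rewrite sqr_sqrtr.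
move: (walk_sqr n.+1) (walk_size n.+1); move: (walk n.+1) => W hsq hsz.
apply: (@le_trans _ _ (\sum_(z <- W) (2^-1 * S^-1 * z ^+ 2 + 2^-1 * S))).
  apply: ler_sum => z _.
  rewrite -(ler_pM2l S0) mulrDr.
  have -> : S * (2^-1 * S^-1 * z ^+ 2) = 2^-1 * z ^+ 2 by field; rewrite gt_eqF.
  have -> : z ^+ 2 = `|z| ^+ 2 by rewrite real_normK// num_real.
  have := sqr_ge0 (S - `|z|); nra.
rewrite big_split/= -[X in X + _]mulr_sumr hsq big_const_seq count_predT hsz iter_addr addr0.
rewrite -[_ *+ (2 ^ _)]mulr_natr natrX -SS.
by rewrite le_eqVlt; apply/orP; left; apply/eqP; field; rewrite gt_eqF.
Qed.

Lemma sinc_cvg (u : nat -> R) (x : R) : u @ \oo --> 0 -> (forall n, u n != 0) ->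
  (u n)^-1 * sin (x * u n) @[n --> \oo] --> x.
Proof.
move=> u0 un0; have [->|x0] := eqVneq x 0.
  by under eq_fun do rewrite mul0r sin0 mulr0; exact: cvg_cst.
have h : h^-1 * sin h @[h --> (0 : R)^'] --> (1 : R).
  have [+ E] : is_derive (0 : R) 1 sin (cos 0) by exact: is_derive_sin.
  rewrite /derivable => /cvg_ex[l hl].
  have El : l = 1 by rewrite -cos0 -E /derive; apply/esym/cvg_lim.
  move: hl; rewrite El; apply: cvg_trans; apply: near_eq_cvg; near=> h.
  by rewrite /= sin0 subr0 addr0 -[h%:A]/(h * 1) mulr1.
have xu : x * u n @[n --> \oo] --> (0 : R)^'.
  have h0 : x * u n @[n --> \oo] --> (0 : R).
    by rewrite -(mulr0 x); apply: cvgM; [exact: cvg_cst|].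
  move=> A; rewrite /dnbhs/= => -[e e0 eA].
  move/cvgrPdist_lt : h0 => /(_ e e0); apply: filterS => n hn.
  by apply: eA => //; rewrite mulf_neq0.
have H : x * ((x * u n)^-1 * sin (x * u n)) @[n --> \oo] --> x * 1.
  by apply: cvgM; [exact: cvg_cst|exact: (cvg_comp _ _ xu h)].
have E : (fun n => x * ((x * u n)^-1 * sin (x * u n))) = (fun n => (u n)^-1 * sin (x * u n)).
  by apply/funext => n; rewrite invfM !mulrA divff// mul1r.
by rewrite E mulr1 in H.
Unshelve. all: by end_near. Qed.

(** The central limit theorem for random signs. With z = 1 - cos one has exp(- z / (1 - z)) <= 1 - z
    <= exp(- z), and n z tends to t x^2. The power is n while the step uses n + 1, which is harmless
    as n / (n + 1) tends to 1. *)
Lemma cos_pow_cvg (t x : R) : 0 < t ->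
  cos (x * Num.sqrt (2 * t / n.+1%:R)) ^+ n @[n --> \oo] --> expR (- (t * x ^+ 2)).
Proof.
move=> t0; pose a (n : nat) : R := Num.sqrt (2 * t / n.+1%:R).
have a2 n : a n ^+ 2 = 2 * t / n.+1%:R.
  by rewrite sqr_sqrtr// divr_ge0// mulr_ge0// ltW.
have a0 n : a n != 0.
  by rewrite gt_eqF// sqrtr_gt0 divr_gt0// mulr_gt0.
have inv0 : (n.+1%:R^-1 : R) @[n --> \oo] --> 0 by exact: cvg_harmonic.
have ca : a @ \oo --> 0.
  have h : 2 * t / n.+1%:R @[n --> \oo] --> (0 : R).
    by have h := cvgM (cvg_cst (2 * t)) inv0; rewrite mulr0 in h; exact: h.
  by rewrite -(sqrtr0 R); exact: (cvg_comp _ Num.sqrt h (@sqrt_continuous R 0)).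
pose z n : R := 1 - cos (x * a n).
have zE n : z n = 2 * a n ^+ 2 * ((a n)^-1 * sin (x / 2 * a n)) ^+ 2.
  rewrite /z; have -> : x * a n = x / 2 * a n + x / 2 * a n by field.
  have s2 := cos2Dsin2 (x / 2 * a n).
  rewrite cosD -!expr2; move: s2; set u := cos _; set v := sin _ => s2.
  have -> : 2 * a n ^+ 2 * ((a n)^-1 * v) ^+ 2 = 2 * v ^+ 2 by field.
  lra.
have cs := @sinc_cvg a (x / 2) ca a0.
have cs2 : ((a n)^-1 * sin (x / 2 * a n)) ^+ 2 @[n --> \oo] --> (x / 2) ^+ 2.
  have H : ((a n)^-1 * sin (x / 2 * a n)) * ((a n)^-1 * sin (x / 2 * a n)) @[n --> \oo] --> x / 2 * (x / 2).
    by apply: cvgM.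
  by under eq_fun do rewrite expr2; rewrite expr2.
have cnn : (n%:R / n.+1%:R : R) @[n --> \oo] --> (1 : R).
  have -> : (fun n : nat => n%:R / n.+1%:R : R) = (fun n => 1 - n.+1%:R^-1).
    by apply/funext => n; rewrite -[X in X / _](addrK 1) natr1 mulrBl divff// div1r.
  by rewrite -[X in _ --> X]subr0; apply: cvgB; [exact: cvg_cst|].
have cnz : n%:R * z n @[n --> \oo] --> t * x ^+ 2.
  have -> : (fun n => n%:R * z n) = (fun n => 4 * t * (n%:R / n.+1%:R) *
      ((a n)^-1 * sin (x / 2 * a n)) ^+ 2).
    by apply/funext => n; rewrite zE a2; ring.
  have -> : t * x ^+ 2 = 4 * t * 1 * (x / 2) ^+ 2 by field.
  by apply: cvgM => //; apply: cvgM => //; exact: cvg_cst.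
have cz : z @ \oo --> 0.
  have -> : z = (fun n => 2 * (a n * a n) * ((a n)^-1 * sin (x / 2 * a n)) ^+ 2).
    by apply/funext => n; rewrite zE expr2.
  have -> : 0 = 2 * (0 * 0) * (x / 2) ^+ 2 :> R by rewrite !mul0r mulr0 mul0r.
  by apply: cvgM => //; apply: cvgM; [exact: cvg_cst|exact: cvgM].
apply: (@squeeze_cvgr _ _ _ _ (fun n => expR (- (n%:R * z n / (1 - z n)))) (fun n => expR (- (n%:R * z n)))).
- near=> n.
  have z1 : z n < 1 by near: n; move/cvgr_lt : cz => /(_ 1 ltr01).
  have z0 : 0 <= z n by rewrite subr_ge0 cos_le1.
  have -> : cos (x * Num.sqrt (2 * t / n.+1%:R)) = 1 - z n by rewrite /z opprB addrCA subrr addr0.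
  have z1' : 0 < 1 - z n by rewrite subr_gt0.
  rewrite -mulrA -!mulrN !expRM_natl; apply/andP; split; apply: lerXn2r; rewrite ?nnegrE ?expR_ge0 ?(ltW z1')//.
    rewrite mulrN expRN -[leRHS]invrK lef_pV2 ?posrE ?expR_gt0 ?invr_gt0//.
    apply: le_trans (expR_ge1Dx _).
    have z1n : 1 - z n != 0 by rewrite gt_eqF.
    by have -> : 1 + z n / (1 - z n) = (1 - z n)^-1 by field.
  exact: expR_ge1Dx.
- apply: (cvg_comp _ (expR : R -> R)); last exact: continuous_expR.
  apply: cvgN; have -> : t * x ^+ 2 = t * x ^+ 2 / (1 - 0) by rewrite subr0 divr1.
  apply: cvgM => //; apply: cvgV; first by rewrite subr0 oner_eq0.
  by apply: cvgB => //; exact: cvg_cst.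
- apply: (cvg_comp (fun n => - (n%:R * z n)) (expR : R -> R)); last exact: continuous_expR.
  exact: cvgN.
Unshelve. all: by end_near. Qed.

End RieszFormula.

(** * Symbols that are bounded on translation invariant norms *)

Section Multipliers.
Context {R : realType} {d : nat}.
Implicit Types (f g : 'rV[R]_d -> R) (k : 'rV[int]_d) (P : @trig R d)
  (m : 'rV[int]_d -> R) (B : ('rV[R]_d -> R) -> R -> Prop).

(** [tn_sup] and [tn_inf] are what a passage to the limit needs: a uniformly small perturbation
    costs arbitrarily little. The instances are the uniform norm and the L^q norms. *)
Record tnorm B : Prop := TNorm {
  tn_nl : norm_like B;
  tn_shift : forall f c a, cper f -> B f c -> B (fun x => f (x + a)) c;
  tn_sup : forall f c, continuous f -> supb f c -> B f c;
  tn_inf : forall f c, (forall e, 0 < e -> B f (c + e)) -> B f c }.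

(* The multiplier with symbol [m] if [s = false], and [i m] if [s = true]. *)
Definition tmul (s : bool) m P : trig :=
  map (fun t : 'rV[int]_d * (R * R) => (t.1,
    if s then (m t.1 * t.2.2, - (m t.1 * t.2.1)) else (m t.1 * t.2.1, m t.1 * t.2.2))) P.

Definition tbase (s : bool) (t : 'rV[int]_d * (R * R)) (x : 'rV[R]_d) : R :=
  if s then t.2.2 * cos (phase t.1 x) - t.2.1 * sin (phase t.1 x)
  else t.2.1 * cos (phase t.1 x) + t.2.2 * sin (phase t.1 x).

Lemma tev_tmul s m P x : tev (tmul s m P) x = \sum_(t <- P) m t.1 * tbase s t x.
Proof.
rewrite /tev big_map; apply: eq_bigr => t _ /=; rewrite /tbase.
by case: s => /=; ring.
Qed.

Lemma tmulD s m m' P x : tev (tmul s (fun k => m k + m' k) P) x =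
  tev (tmul s m P) x + tev (tmul s m' P) x.
Proof.
by rewrite !tev_tmul -big_split/=; apply: eq_bigr => t _; rewrite mulrDl.
Qed.

Lemma tmulZ s (c : R) m P x : tev (tmul s (fun k => c * m k) P) x =
  c * tev (tmul s m P) x.
Proof.
by rewrite !tev_tmul mulr_sumr; apply: eq_bigr => t _; rewrite mulrA.
Qed.

Lemma tmul_comp s m m' P : tmul false m (tmul s m' P) = tmul s (fun k => m k * m' k) P.
Proof.
rewrite /tmul -map_comp; apply: eq_map => t /=.
by case: s => /=; congr (_, (_, _)); ring.
Qed.

Lemma tmul_compt m m' P :
  tmul true m (tmul true m' P) = tmul false (fun k => - (m k * m' k)) P.
Proof.
rewrite /tmul -map_comp; apply: eq_map => t /=.
by congr (_, (_, _)); ring.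
Qed.

Lemma tmul1 P : tmul false (fun=> 1) P = P.
Proof.
by rewrite /tmul -[RHS]map_id; apply: eq_map => -[k [a b]] /=; rewrite !mul1r.
Qed.

Lemma tmul_ext s m m' P : (forall t, t \in P -> m t.1 = m' t.1) -> tmul s m P = tmul s m' P.
Proof. by move=> H; apply/eq_in_map => t tP /=; rewrite H. Qed.

Lemma tmul_freq s m P : map fst (tmul s m P) = map fst P.
Proof. by rewrite /tmul -map_comp; apply: eq_map. Qed.

Section Bounds.
Variables (B : ('rV[R]_d -> R) -> R -> Prop) (tB : tnorm B).
Let nB := tn_nl tB.

Lemma ctev P : continuous (tev P : 'rV[R]_d -> R).
Proof. exact: test_continuous (test_tev P). Qed.

Lemma bZ f c (a : R) : continuous f -> B f c -> B (fun x => a * f x) (`|a| * c).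
Proof.
move=> cf Bf; apply: (nl_dom nB) Bf _ => //; first exact: contZ.
by move=> x; rewrite normrM.
Qed.

Lemma bsum (I : Type) (r : seq I) (F : I -> 'rV[R]_d -> R) (c : I -> R) :
  (forall i, continuous (F i)) -> (forall i, B (F i) (c i)) ->
  B (fun x => \sum_(i <- r) F i x) (\sum_(i <- r) c i).
Proof.
move=> cF BF; elim: r => [|i r IH].
  under eq_fun do rewrite big_nil; rewrite big_nil.
  by apply: (tn_sup tB) => [|x]; [exact: cont_cst|rewrite normr0].
under eq_fun do rewrite big_cons; rewrite big_cons.
by apply: (nl_add nB) => //; exact: cont_sum.
Qed.

Lemma bt_sum s P (I : Type) (r : seq I) (m : I -> 'rV[int]_d -> R) (w c : I -> R) :
  (forall i, B (tev (tmul s (m i) P)) (c i)) ->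
  B (tev (tmul s (fun k => \sum_(i <- r) w i * m i k) P)) (\sum_(i <- r) `|w i| * c i).
Proof.
move=> H.
rewrite (_ : tev _ = fun x => \sum_(i <- r) w i * tev (tmul s (m i) P) x).
  apply: bsum => i; first by apply: contZ; exact: ctev.
  by apply: bZ => //; exact: ctev.
apply/funext => x; rewrite tev_tmul; under eq_bigr do rewrite mulr_suml.
rewrite exchange_big/=; apply: eq_bigr => i _.
by rewrite tev_tmul mulr_sumr; apply: eq_bigr => t _; rewrite mulrA.
Qed.

Lemma tbase_le s t x : `|tbase s t x| <= `|t.2.1| + `|t.2.2|.
Proof.
have h (a b : R) : `|a * cos (phase t.1 x)| + `|b * sin (phase t.1 x)| <= `|a| + `|b|.
  by rewrite !normrM lerD// ler_piMr// ?cos_max// sin_max.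
rewrite /tbase; case: s.
  by apply: le_trans (ler_normB _ _) _; rewrite [leRHS]addrC; exact: h.
by apply: le_trans (ler_normD _ _) _; exact: h.
Qed.

(** A fixed [P] has finitely many frequencies, so pointwise convergence of the symbols is already
    uniform convergence of the polynomials. *)
Lemma bt_lim s P (m_ : nat -> 'rV[int]_d -> R) m (c : R) :
  (forall n, B (tev (tmul s (m_ n) P)) c) ->
  (forall k, m_ ^~ k @ \oo --> m k) -> B (tev (tmul s m P)) c.
Proof.
move=> H cvm; apply: (tn_inf tB) => e e0.
pose D n := \sum_(t <- P) `|m t.1 - m_ n t.1| * (`|t.2.1| + `|t.2.2|).
have cD : D n @[n --> \oo] --> 0.
  rewrite /D; elim: (P : seq _) => [|t P' IH].
    by under eq_fun do rewrite big_nil; exact: cvg_cst.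
  under eq_fun do rewrite big_cons.
  have h1 : `|m t.1 - m_ n t.1| @[n --> \oo] --> (0 : R).
    apply/cvgrPdist_lt => a a0; have /cvgrPdist_lt/(_ a a0) := cvm t.1.
    by apply: filterS => n; rewrite sub0r normrN normr_id.
  have h2 := cvgD (cvgM h1 (cvg_cst (`|t.2.1| + `|t.2.2|))) IH.
  by rewrite mul0r addr0 in h2; exact: h2.
have [n _ /(_ n (leqnn _)) /= hn] : \forall n \near \oo, D n < e.
  by move/cvgr_lt : cD => /(_ e e0).
have -> : tev (tmul s m P) = fun x => tev (tmul s (m_ n) P) x +
    (tev (tmul s m P) x - tev (tmul s (m_ n) P) x).
  by apply/funext => x; rewrite addrCA subrr addr0.
have cc : continuous (fun x => tev (tmul s m P) x - tev (tmul s (m_ n) P) x).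
  by apply: contB; exact: ctev.
apply: (nl_add nB) => //; first exact: ctev.
apply: (tn_sup tB) => // x; apply: le_trans (ltW hn).
rewrite !tev_tmul -sumrB; apply: le_trans (ler_norm_sum _ _ _) _.
apply: ler_sum => t _; rewrite -mulrBl normrM ler_wpM2l//.
exact: tbase_le.
Qed.

(* The symbol [m] acts on frequencies in [Z] with norm at most [C]. *)
Definition mb (Z : pred 'rV[int]_d) (s : bool) m (C : R) : Prop :=
  0 <= C /\ forall P c, {subset map fst P <= Z} -> B (tev P) c ->
    B (tev (tmul s m P)) (C * c).

Lemma mb_le Z s m C C' : mb Z s m C -> C <= C' -> mb Z s m C'.
Proof.
move=> [C0 H] CC; split=> [|P c ZP BP]; first exact: le_trans CC.
by apply: (nl_le nB) (H _ _ ZP BP) _; rewrite ler_wpM2r// (nl_ge0 nB BP).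
Qed.

Lemma mb_comp Z s m m' C C' : mb Z false m C -> mb Z s m' C' ->
  mb Z s (fun k => m k * m' k) (C * C').
Proof.
move=> [C0 H] [C'0 H']; split=> [|P c ZP BP]; first by rewrite mulr_ge0.
rewrite -tmul_comp -mulrA; apply: H; first by rewrite tmul_freq.
exact: H'.
Qed.

Lemma mb_compt Z m m' C C' : mb Z true m C -> mb Z true m' C' ->
  mb Z false (fun k => - (m k * m' k)) (C * C').
Proof.
move=> [C0 H] [C'0 H']; split=> [|P c ZP BP]; first by rewrite mulr_ge0.
rewrite -tmul_compt -mulrA; apply: H; first by rewrite tmul_freq.
exact: H'.
Qed.

Lemma mb_sum Z s (I : Type) (r : seq I) (m : I -> 'rV[int]_d -> R) (w C : I -> R) :
  (forall i, mb Z s (m i) (C i)) ->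
  mb Z s (fun k => \sum_(i <- r) w i * m i k) (\sum_(i <- r) `|w i| * C i).
Proof.
move=> H; split=> [|P c ZP BP].
  by apply: sumr_ge0 => i _; rewrite mulr_ge0//; case: (H i).
rewrite mulr_suml.
under eq_bigr do rewrite -mulrA.
by apply: bt_sum => i; apply: (H i).2.
Qed.

Lemma mb_Z Z s m C (a : R) : mb Z s m C -> mb Z s (fun k => a * m k) (`|a| * C).
Proof.
move=> H; have := @mb_sum Z s _ [:: tt] (fun=> m) (fun=> a) (fun=> C) (fun=> H).
by rewrite big_seq1; under eq_fun do rewrite big_seq1.
Qed.

Lemma mb_D Z s m m' C C' : mb Z s m C -> mb Z s m' C' ->
  mb Z s (fun k => m k + m' k) (C + C').
Proof.
move=> [C0 H] [C'0 H']; split=> [|P c ZP BP]; first by rewrite addr_ge0.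
rewrite (_ : tev _ = fun x => tev (tmul s m P) x + tev (tmul s m' P) x).
  by rewrite mulrDl; apply: (nl_add nB); [exact: ctev|exact: ctev|exact: H|exact: H'].
by apply/funext => x; rewrite tmulD.
Qed.

Lemma mb_ext (Z : pred 'rV[int]_d) s m m' C : (forall k, k \in Z -> m k = m' k) -> mb Z s m C -> mb Z s m' C.
Proof.
move=> mm' [C0 H]; split=> [//|P c ZP BP].
rewrite -(@tmul_ext s m)//; first exact: H.
by move=> t tP; apply: mm'; apply: ZP; exact: map_f.
Qed.

Lemma mb_lim Z s (m_ : nat -> 'rV[int]_d -> R) m (C : R) :
  (forall n, mb Z s (m_ n) C) -> (forall k, m_ ^~ k @ \oo --> m k) -> mb Z s m C.
Proof.
move=> H cvm; split; first by case: (H 0%N).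
by move=> P c ZP BP; apply: bt_lim cvm => n; apply: (H n).2.
Qed.

Lemma mb_1 Z : mb Z false (fun=> 1) 1.
Proof. by split=> // P c _; rewrite tmul1 mul1r. Qed.

Lemma mb_prod Z (I : Type) (r : seq I) (m : I -> 'rV[int]_d -> R) :
  (forall i, mb Z false (m i) 1) -> mb Z false (fun k => \prod_(i <- r) m i k) 1.
Proof.
move=> H; elim: r => [|i r IH].
  by under eq_fun do rewrite big_nil; exact: mb_1.
under eq_fun do rewrite big_cons.
by have := mb_comp (H i) IH; rewrite mul1r.
Qed.

Lemma mb_exp Z m n C : mb Z false m C -> mb Z false (fun k => m k ^+ n) (C ^+ n).
Proof.
move=> H; elim: n => [|n IH].
  by under eq_fun do rewrite expr0; rewrite expr0; exact: mb_1.
by under eq_fun do rewrite exprS; rewrite exprS; exact: mb_comp.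
Qed.

Lemma mb_sub (Z Z' : pred 'rV[int]_d) s m C : {subset Z' <= Z} -> mb Z s m C -> mb Z' s m C.
Proof. by move=> ZZ [C0 H]; split=> // P c ZP; apply: H => k /ZP /ZZ. Qed.

(** Half the sum, respectively half the difference, of the translates by a and - a. *)
Lemma mb_shift Z (s : bool) (a : 'rV[R]_d) :
  mb Z s (fun k => if s then sin (phase k a) else cos (phase k a)) 1.
Proof.
split=> [//|P c _ BP].
have cP := test_cper (test_tev P).
have B1 := tn_shift tB a cP BP.
have B2 := tn_shift tB (- a) cP BP.
have c1 := (cper_shift a cP).1; have c2 := (cper_shift (- a) cP).1.
have half : `|2^-1 : R| = 2^-1 by rewrite gtr0_norm.
have cc : 1 * c = 2^-1 * c + 2^-1 * c by field.
rewrite cc; case: s.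
  rewrite (_ : tev _ = fun x => 2^-1 * tev P (x + a) + (- 2^-1) * tev P (x + - a)).
    apply: (nl_add nB); [exact: contZ|exact: contZ| |].
      by have := bZ (2^-1) c1 B1; rewrite half.
    by have := bZ (- 2^-1) c2 B2; rewrite normrN half.
  apply/funext => x; rewrite tev_tmul /tev !mulr_sumr -big_split/=.
  apply: eq_bigr => t _; rewrite /tbase phaseB phaseD cosB cosD sinB sinD.
  by field.
rewrite (_ : tev _ = fun x => 2^-1 * tev P (x + a) + 2^-1 * tev P (x + - a)).
  apply: (nl_add nB); [exact: contZ|exact: contZ| |].
    by have := bZ (2^-1) c1 B1; rewrite half.
  by have := bZ (2^-1) c2 B2; rewrite half.
apply/funext => x; rewrite tev_tmul /tev !mulr_sumr -big_split/=.
apply: eq_bigr => t _; rewrite /tbase phaseB phaseD cosB cosD sinB sinD.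
by field.
Qed.

Lemma phase_axis k i (z : R) : phase k ((z / (2 * pi)) *: delta_mx 0 i : 'rV[R]_d) = (k 0 i)%:~R * z.
Proof.
have p0 : (pi : R) != 0 by rewrite gt_eqF ?pi_gt0.
by rewrite phaseZ phase_delta; move: (pi : R) p0 => p p0; field.
Qed.

Lemma mb_axis Z s i (z : R) :
  mb Z s (fun k => if s then sin ((k 0 i)%:~R * z) else cos ((k 0 i)%:~R * z)) 1.
Proof.
apply: mb_ext (mb_shift Z s ((z / (2 * pi)) *: delta_mx 0 i)) => k _.
by rewrite phase_axis.
Qed.

(** Bernstein's inequality with its sharp constant: for |k_i| <= N, Riesz's formula writes k_i as a
    combination of sines, that is of translations, with total mass N. *)
Lemma mb_partial i (N : nat) : (0 < N)%N ->
  mb [pred k : 'rV[int]_d | `|k 0 i| <= N] true (fun k => (k 0 i)%:~R) N%:R.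
Proof.
move=> N0; have [w [z [wN H]]] := @riesz_formula R N N0.
have := @mb_sum [pred k : 'rV[int]_d | `|k 0 i| <= N] true _ (index_enum _)
  (fun r k => sin ((k 0 i)%:~R * z r)) w (fun=> 1) (fun r => mb_axis _ true i (z r)).
under eq_bigr do rewrite mulr1.
by rewrite wN; apply: mb_ext => k; rewrite inE => /H hk; rewrite [RHS]hk.
Qed.

Definition kk k : R := \sum_i (k 0 i)%:~R ^+ 2.

Lemma kk_ge0 k : 0 <= kk k.
Proof. by apply: sumr_ge0 => i _; exact: sqr_ge0. Qed.

Lemma mb_heat1 Z i (t : R) : 0 < t ->
  mb Z false (fun k => expR (- (t * (k 0 i)%:~R ^+ 2))) 1.
Proof.
move=> t0.
apply: (@mb_lim Z false (fun n k => cos ((k 0 i)%:~R * Num.sqrt (2 * t / n.+1%:R)) ^+ n)).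
  move=> n; rewrite -[X in mb _ _ _ X](expr1n R n).
  by apply: mb_exp; exact: (mb_axis Z false i).
by move=> k; exact: cos_pow_cvg.
Qed.

(** The symbol is the limit of a^-1 sin(k a) cos(k a)^n with a = sqrt(2 t / (n + 1)), which is the
    mean of Z sin(k a Z) / ((n + 1) a) for a sum Z of n + 1 fair signs. Its norm is at most E|Z| /
    ((n + 1) a), and E|Z| <= sqrt(n + 1) yields 1 / sqrt(2 t). *)
Lemma mb_dheat1 Z i (t : R) : 0 < t ->
  mb Z true (fun k => (k 0 i)%:~R * expR (- (t * (k 0 i)%:~R ^+ 2))) (Num.sqrt (2 * t))^-1.
Proof.
move=> t0; pose a (n : nat) : R := Num.sqrt (2 * t / n.+1%:R).
have a0 n : 0 < a n by rewrite sqrtr_gt0 divr_gt0// mulr_gt0.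
have ca : a @ \oo --> 0.
  have h : 2 * t / n.+1%:R @[n --> \oo] --> (0 : R).
    by have h := cvgM (cvg_cst (2 * t)) (@cvg_harmonic R); rewrite mulr0 in h; exact: h.
  by rewrite -(sqrtr0 R); exact: (cvg_comp _ Num.sqrt h (@sqrt_continuous R 0)).
apply: (@mb_lim Z true (fun n k => ((a n)^-1 * sin ((k 0 i)%:~R * a n)) * cos ((k 0 i)%:~R * a n) ^+ n)).
  move=> n; have n0 : n.+1%:R != 0 :> R by rewrite pnatr_eq0.
  have s0 : 0 < Num.sqrt n.+1%:R :> R by rewrite sqrtr_gt0.
  have ss : Num.sqrt n.+1%:R ^+ 2 = n.+1%:R :> R by rewrite sqr_sqrtr.
  pose w z : R := (a n)^-1 * (2 ^+ n.+1 * n.+1%:R)^-1 * z.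
  have H0 := @mb_sum Z true _ (walk n.+1) (fun z k => sin ((k 0 i)%:~R * (z * a n))) w (fun=> 1)
    (fun z => mb_axis Z true i (z * a n)).
  have sw : \sum_(z <- walk n.+1) `|w z| * 1 = (a n)^-1 * (2 ^+ n.+1 * n.+1%:R)^-1 * \sum_(z <- walk n.+1) `|z|.
    rewrite mulr_sumr; apply: eq_bigr => z _; rewrite mulr1 normrM ger0_norm//.
    by rewrite mulr_ge0// invr_ge0// ?ltW// mulr_ge0// exprn_ge0.
  have c0 : 0 <= (a n)^-1 * (2 ^+ n.+1 * n.+1%:R)^-1 :> R.
    by rewrite mulr_ge0// invr_ge0// ?ltW// mulr_ge0// exprn_ge0.
  have tE : Num.sqrt (2 * t) = a n * Num.sqrt n.+1%:R.
    rewrite /a -sqrtrM ?divfK//; by rewrite divr_ge0// mulr_ge0// ltW.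
  have le1 : \sum_(z <- walk n.+1) `|w z| * 1 <= (Num.sqrt (2 * t))^-1.
    rewrite sw; apply: le_trans (ler_wpM2l c0 (walk_norm n)) _.
    rewrite tE le_eqVlt; apply/orP; left; apply/eqP.
    set S := Num.sqrt n.+1%:R in ss s0 *; rewrite -ss.
    by field; rewrite (gt_eqF (a0 n)) (gt_eqF s0)/= expf_neq0.
  have [C0 H] := mb_le H0 le1.
  split=> // P c ZP BP; have := H P c ZP BP.
  rewrite (@tmul_ext true (fun k => \sum_(z <- walk n.+1) w z * sin ((k 0 i)%:~R * (z * a n)))
    (fun k => (a n)^-1 * sin ((k 0 i)%:~R * a n) * cos ((k 0 i)%:~R * a n) ^+ n))//.
  move=> u _.
  transitivity ((a n)^-1 * (2 ^+ n.+1 * n.+1%:R)^-1 *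
      \sum_(z <- walk n.+1) z * sin (z * ((u.1 0 i)%:~R * a n))).
    rewrite mulr_sumr; apply: eq_bigr => z _.
    have -> : (u.1 0 i)%:~R * (z * a n) = z * ((u.1 0 i)%:~R * a n) by ring.
    by rewrite /w !mulrA.
  rewrite walk_zsin; set T := _%:~R * a n; set e := 2 ^+ _.
  have e0 : e != 0 by rewrite expf_neq0.
  have an0 : a n != 0 by rewrite gt_eqF.
  move: (a n) an0 (cos T ^+ n) (sin T) (n.+1%:R : R) n0 => a' a'0 cT sT q q0.
  by field; rewrite ?q0 ?e0 ?a'0.
move=> k; apply: cvgM; last exact: cos_pow_cvg.
by apply: sinc_cvg => // n; rewrite gt_eqF.
Qed.

Definition heat (t : R) k : R := expR (- (t * kk k)).

Lemma heatE i t k : heat t k = expR (- (t * (k 0 i)%:~R ^+ 2)) *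
  \prod_j (if j == i then 1 else expR (- (t * (k 0 j)%:~R ^+ 2))).
Proof.
rewrite /heat /kk mulr_sumr -sumrN expR_sum (bigD1 i)//= [X in _ * X = _](_ : _ =
  \prod_j (if j == i then 1 else expR (- (t * (k 0 j)%:~R ^+ 2))))//.
rewrite [RHS](bigD1 i)//= eqxx mul1r.
by apply: eq_bigr => j /negbTE ->.
Qed.

Lemma mb_heat Z (t : R) : 0 < t -> mb Z false (heat t) 1.
Proof.
move=> t0; have := @mb_prod Z _ (index_enum _) (fun i k => expR (- (t * (k 0 i)%:~R ^+ 2)))
  (fun i => mb_heat1 Z i t0).
apply: mb_ext => k _.
by rewrite /heat /kk mulr_sumr -sumrN expR_sum.
Qed.

Lemma mb_dheat Z i (t : R) : 0 < t ->
  mb Z true (fun k => (k 0 i)%:~R * heat t k) (Num.sqrt (2 * t))^-1.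
Proof.
move=> t0.
have := @mb_prod Z _ (index_enum _) (fun j k => if j == i then 1 else expR (- (t * (k 0 j)%:~R ^+ 2))).
move=> /(_ _)/mb_comp/(_ (mb_dheat1 Z i t0)); rewrite mul1r => H.
have {}H := H _; apply: mb_ext (H _) => [k _|j].
  by rewrite [in RHS](heatE i) mulrC -mulrA.
by case: eqP => _; [exact: mb_1|exact: mb_heat1].
Qed.

(** Two first derivatives, each after half of the time. *)
Lemma mb_d2heat Z i (t : R) : 0 < t ->
  mb Z false (fun k => (k 0 i)%:~R ^+ 2 * heat t k) t^-1.
Proof.
move=> t0; have t20 : 0 < t / 2 by rewrite divr_gt0.
have H := mb_dheat Z i t20.
have := mb_Z (-1) (mb_compt H H); rewrite normrN1 mul1r.
have -> : 2 * (t / 2) = t by field.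
rewrite -invfM -expr2 sqr_sqrtr ?ltW//.
apply: mb_ext => k _.
rewrite mulrN mulN1r opprK mulrACA -expr2; congr (_ * _).
by rewrite /heat -expRD; congr expR; field.
Qed.

Definition AA k : R := 1 + kk k.

Lemma AA_ge1 k : 1 <= AA k. Proof. by rewrite lerDl kk_ge0. Qed.

Lemma AA_gt0 k : 0 < AA k. Proof. exact: lt_le_trans (AA_ge1 k). Qed.

Definition heatA (t : R) k : R := expR (- (t * AA k)).

Lemma heatAE t k : heatA t k = expR (- t) * heat t k.
Proof. by rewrite /heatA /heat /AA mulrDr mulr1 opprD expRD. Qed.

Lemma mb_heatA Z (t : R) : 0 < t -> mb Z false (heatA t) (expR (- t)).
Proof.
move=> t0; have := mb_Z (expR (- t)) (mb_heat Z t0).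
rewrite ger0_norm ?expR_ge0// mulr1; apply: mb_ext => k _.
by rewrite heatAE.
Qed.

Lemma mb_A Z (t : R) : 0 < t -> mb Z false (fun k => AA k * heatA t k) ((1 + d%:R) / t).
Proof.
move=> t0.
have H := @mb_sum Z false _ (index_enum _) (fun i k => (k 0 i)%:~R ^+ 2 * heat t k) (fun=> 1) (fun=> t^-1)
  (fun i => mb_d2heat Z i t0).
have := mb_Z (expR (- t)) (mb_D (mb_heat Z t0) H).
rewrite (ger0_norm (expR_ge0 _)) => /mb_le.
move=> /(_ ((1 + d%:R) / t) _) K.
apply: mb_ext (K _) => [k _|].
  rewrite heatAE /AA /kk mulrCA mulrDl mul1r; congr (_ * (_ + _)).
  by rewrite mulr_suml; apply: eq_bigr => i _; rewrite mul1r.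
rewrite (eq_bigr (fun=> t^-1)); last by move=> i _; rewrite normr1 mul1r.
rewrite sumr_const card_ord -[_ *+ d]mulr_natr mulrDl mul1r mulrDr mulr1 lerD//.
  rewrite expRN lef_pV2 ?posrE ?expR_gt0//.
  by apply: le_trans (expR_ge1Dx t); rewrite lerDr.
rewrite mulrC (mulrC _ d%:R) ler_piMr ?mulr_ge0// ?invr_ge0 ?ltW//.
by rewrite expR_lt1 oppr_lt0.
Qed.

(** Time is split into n + 1 equal parts, one for each factor A. *)
Lemma mb_An Z (t : R) n : 0 < t ->
  mb Z false (fun k => AA k ^+ n.+1 * heatA t k) ((n.+1%:R * (1 + d%:R) / t) ^+ n.+1).
Proof.
move=> t0; have tn0 : 0 < t / n.+1%:R by rewrite divr_gt0.
have := mb_exp n.+1 (mb_A Z tn0).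
have -> : (1 + d%:R) / (t / n.+1%:R) = n.+1%:R * (1 + d%:R) / t.
  by rewrite invf_div mulrA (mulrC (1 + _)).
apply: mb_ext => k _; rewrite exprMn; congr (_ * _).
rewrite /heatA -expRM_natl; congr expR.
by rewrite mulrN mulrA (mulrC _ (t / _)) divfK ?pnatr_eq0.
Qed.

End Bounds.
End Multipliers.

(** * Monotonicity of real powers *)

Section PowR.
Context {R : realType}.
Implicit Types x y r t : R.

Lemma half_le x : x < 2^-1 -> 2^-1 <= 1 - x.
Proof. lra. Qed.

Lemma powRDp x r t : 0 < x -> x `^ (r + t) = x `^ r * x `^ t.
Proof. by move=> x0; rewrite powRD// (gt_eqF x0) implybT. Qed.

Lemma powR_mono x y r : 0 <= r -> 0 <= x -> x <= y -> x `^ r <= y `^ r.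
Proof.
by move=> r0 x0 xy; apply: ge0_ler_powR; rewrite ?nnegrE// (le_trans x0).
Qed.

Lemma powR_anti x y r : 0 <= r -> 0 < x -> x <= y -> y `^ (- r) <= x `^ (- r).
Proof.
move=> r0 x0 xy; rewrite !powRN lef_pV2 ?posrE ?powR_gt0//; last exact: lt_le_trans xy.
by apply: powR_mono => //; exact: ltW.
Qed.

End PowR.

(** * Discrete Mellin transforms *)

Section Theta.
Context {R : realType}.
Variables (b rho : R) (b0 : 0 < b) (rho1 : 1 < rho).

Let rho0 : 0 < rho. Proof. exact: lt_trans rho1. Qed.

(** The exponents - J, ..., J - 1. Summed over all integers j, rho^(j b) g(rho^j x) is a Riemann sum
    on a geometric grid for a multiple of the integral of t^(b - 1) g(t x) dt, and that integral is
    a constant times x^(- b). *)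
Definition thexp (J : nat) : seq R :=
  [seq i%:R | i <- iota 0 J] ++ [seq - i.+1%:R | i <- iota 0 J].

Definition thterm (g : R -> R) (e x : R) : R := (rho `^ e) `^ b * g (rho `^ e * x).

Definition thsum g J x : R := \sum_(e <- thexp J) thterm g e x.

Let u g x (i : nat) : R := thterm g i%:R x + thterm g (- i.+1%:R) x.

Let thsumE g J x : thsum g J x = series (u g x) J.
Proof.
rewrite /thsum /thexp big_cat !big_map /series/= /index_iota subn0.
by rewrite -big_split.
Qed.

Definition theta g x : R := limn (thsum g ^~ x).

Lemma thterm_scale g e x : thterm g e (rho * x) = rho `^ (- b) * thterm g (e + 1) x.
Proof.
rewrite /thterm (powRDp e 1 rho0).
rewrite powRr1 ?(ltW rho0)// powRM ?powR_ge0 ?(ltW rho0)//.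
rewrite [RHS]mulrA [rho `^ e * (rho * x)]mulrA; congr (_ * _).
by rewrite mulrCA -powRDp// addNr powRr0 mulr1.
Qed.

Section Profile.
Variable g : R -> R.
Hypothesis g_ge0 : forall x, 0 < x -> 0 <= g x.
Hypothesis g_mono : forall x y, 0 < x -> x <= y -> g y <= g x.
Hypothesis g_bnd : exists M, forall J, thsum g J 1 <= M.

Let thterm_ge0 e x : 1 <= x -> 0 <= thterm g e x.
Proof.
move=> x1; rewrite /thterm mulr_ge0 ?powR_ge0// g_ge0//.
by rewrite mulr_gt0 ?powR_gt0// (lt_le_trans _ x1).
Qed.

Let thterm_mono e x y : 1 <= x -> x <= y -> thterm g e y <= thterm g e x.
Proof.
move=> x1 xy; rewrite /thterm ler_wpM2l ?powR_ge0// g_mono//.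
  by rewrite mulr_gt0 ?powR_gt0// (lt_le_trans _ x1).
by rewrite ler_wpM2l ?powR_ge0.
Qed.

Let u_ge0 x i : 1 <= x -> 0 <= u g x i.
Proof. by move=> x1; rewrite addr_ge0// thterm_ge0. Qed.

Lemma thsum_mono J x y : 1 <= x -> x <= y -> thsum g J y <= thsum g J x.
Proof. by move=> x1 xy; apply: ler_sum => e _; exact: thterm_mono. Qed.

Let thsum_nd x : 1 <= x -> nondecreasing_seq (thsum g ^~ x).
Proof.
move=> x1; apply/nondecreasing_seqP => n; rewrite !thsumE /series/= big_nat_recr//=.
by rewrite lerDl u_ge0.
Qed.

Lemma thsum_cvg x : 1 <= x -> thsum g ^~ x @ \oo --> theta g x.
Proof.
move=> x1; apply: nondecreasing_is_cvgn; first exact: thsum_nd.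
have [M hM] := g_bnd; exists M => _ [J _ <-].
exact: le_trans (thsum_mono J (lexx 1) x1) (hM J).
Qed.

Lemma theta_ge x J : 1 <= x -> thsum g J x <= theta g x.
Proof. by move=> x1; apply: nondecreasing_cvgn_le; [exact: thsum_nd|apply/cvg_ex; eexists; exact: thsum_cvg]. Qed.

Lemma theta_le x M : 1 <= x -> (forall J, thsum g J x <= M) -> theta g x <= M.
Proof.
move=> x1 H; apply: limr_le; first by apply/cvg_ex; eexists; exact: thsum_cvg.
exact: nearW.
Qed.

Lemma theta_mono x y : 1 <= x -> x <= y -> theta g y <= theta g x.
Proof.
move=> x1 xy; apply: theta_le; first exact: le_trans xy.
by move=> J; apply: le_trans (theta_ge J x1); exact: thsum_mono.
Qed.

(** Multiplying x by rho shifts the summation index. The truncated sum changes by two boundary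
    terms, which are dominated by the terms of a convergent series and hence vanish in the limit. *)
Lemma theta_scale x : 1 <= x -> theta g (rho * x) = rho `^ (- b) * theta g x.
Proof.
move=> x1; have rx1 : 1 <= rho * x by rewrite -[1]mulr1 ler_pM// ltW.
have E J : thsum g J (rho * x) = rho `^ (- b) * (thsum g J x + thterm g J%:R x - thterm g (- J%:R) x).
  rewrite !thsumE /series/= !big_mkord; elim: J => [|J IH].
    by rewrite !big_ord0 oppr0 add0r subrr mulr0.
  rewrite !big_ord_recr/= IH /u !thterm_scale.
  have -> : - J.+1%:R + 1 = - J%:R :> R by rewrite -natr1; ring.
  by rewrite natr1; ring.
have cu : u g x @ \oo --> 0.
  apply: cvg_series_cvg_0; apply/cvg_ex; exists (theta g x).
  have -> : series (u g x) = thsum g ^~ x by apply/funext => J; rewrite thsumE.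
  exact: thsum_cvg.
have c1 : thterm g J%:R x @[J --> \oo] --> 0.
  apply: (@squeeze_cvgr _ _ _ _ (fun=> 0) (u g x)) => //; last exact: cvg_cst.
  by apply: nearW => J; rewrite thterm_ge0// lerDl thterm_ge0.
have c2 : thterm g (- J%:R) x @[J --> \oo] --> 0.
  rewrite -(cvg_shiftS (fun J => thterm g (- J%:R) x)).
  apply: (@squeeze_cvgr _ _ _ _ (fun=> 0) (u g x)) => //; last exact: cvg_cst.
  by apply: nearW => J; rewrite thterm_ge0// lerDr thterm_ge0.
have cE : rho `^ (- b) * (thsum g J x + thterm g J%:R x - thterm g (- J%:R) x) @[J --> \oo]
    --> rho `^ (- b) * (theta g x + 0 - 0).
  apply: cvgM; first exact: cvg_cst.
  by apply: cvgB => //; apply: cvgD => //; exact: thsum_cvg.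
rewrite addr0 subr0 in cE.
have := thsum_cvg rx1; under eq_fun do rewrite E.
by move=> H; apply: (cvg_unique _ H cE).
Qed.

Lemma theta_pow n : theta g (rho ^+ n) = rho `^ (- b * n%:R) * theta g 1.
Proof.
elim: n => [|n IH]; first by rewrite expr0 mulr0 powRr0 mul1r.
rewrite exprS theta_scale; last by rewrite exprn_ege1// ltW.
rewrite IH mulrA -powRDp//.
by congr (_ `^ _ * _); rewrite -natr1; ring.
Qed.

Lemma log_floor x : 1 <= x -> exists n, rho ^+ n <= x <= rho ^+ n.+1.
Proof.
move=> x1; have x0 : 0 < x by exact: lt_le_trans x1.
have l0 : 0 < ln rho by exact: ln_gt0.
pose n := Num.trunc (ln x / ln rho); exists n.
have q0 : 0 <= ln x / ln rho by rewrite divr_ge0 ?ln_ge0// ltW.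
have E m : rho ^+ m = expR (m%:R * ln rho) by rewrite expRM_natl lnK.
have Ex : x = expR (ln x) by rewrite lnK.
rewrite Ex !E !ler_expR -ler_pdivlMr// truncn_le q0/=.
rewrite -ler_pdivrMr// ltW//.
by have := truncnS_gt (ln x / ln rho).
Qed.

(** Homogeneity is exact along the powers of rho; monotonicity fills the gaps at the price of a
    factor rho^b, which tends to 1 as rho does. *)
Lemma theta_homogeneous x : 1 <= x ->
  rho `^ (- b) * x `^ (- b) * theta g 1 <= theta g x <= rho `^ b * x `^ (- b) * theta g 1.
Proof.
move=> x1; have x0 : 0 < x by exact: lt_le_trans x1.
have [n /andP[nx xn]] := log_floor x1.
have t0 : 0 <= theta g 1.
  by apply: le_trans (theta_ge 0 (lexx 1)); rewrite /thsum big_nil.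
have pn1 m : 1 <= rho ^+ m by rewrite exprn_ege1// ltW.
have pw m : (rho ^+ m) `^ (- b) = rho `^ (- b * m%:R).
  by rewrite -powR_mulrn ?ltW// -powRrM mulrC.
have mono (y z : R) := @powR_anti _ y z b (ltW b0).
have rn m : 0 < rho ^+ m by rewrite exprn_gt0.
apply/andP; split.
  apply: le_trans (theta_mono x1 xn); rewrite theta_pow ler_wpM2r//.
  rewrite -pw exprS powRM ?(ltW rho0) ?(ltW (rn _))// ler_wpM2l ?powR_ge0//.
  exact: mono.
apply: le_trans (theta_mono (pn1 n) nx) _; rewrite theta_pow ler_wpM2r//.
rewrite -pw; have -> : (rho ^+ n) `^ (- b) = rho `^ b * (rho ^+ n.+1) `^ (- b).
  by rewrite exprS powRM ?ltW// mulrA -powRDp// subrr powRr0 mul1r.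
by rewrite ler_wpM2l ?powR_ge0// mono.
Qed.

End Profile.

(** The two profiles of the subordination argument: [gexp] for the symbol of the heat semigroup,
    [gpow] for the decay of its norm. *)
Definition gexp (y : R) := expR (- y).
Definition gpow (a y : R) := (1 + y) `^ (- a).

Lemma gexp_mono x y : 0 < x -> x <= y -> gexp y <= gexp x.
Proof. by move=> _ xy; rewrite ler_expR lerN2. Qed.

Lemma gpow_mono (a x y : R) : 0 <= a -> 0 < x -> x <= y -> gpow a y <= gpow a x.
Proof.
by move=> a0 x0 xy; apply: powR_anti => //; [rewrite addr_gt0|rewrite lerD2l].
Qed.

(** From exp(y) = exp(y / a)^a >= (1 + y / a)^a and 1 + y <= max(1, a) (1 + y / a). *)
Lemma gexp_gpow (a y : R) : 0 < a -> 0 < y -> gexp y <= (Num.max 1 a) `^ a * gpow a y.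
Proof.
move=> a0 y0; have m0 : 0 < Num.max 1 a by rewrite lt_max ltr01.
have y1 : 0 < 1 + y by lra.
rewrite /gexp /gpow powRN expRN ler_pdivlMr ?powR_gt0// ler_pdivrMl ?expR_gt0//.
have -> : expR y = expR (y / a) `^ a by rewrite -expRM divfK ?gt_eqF.
rewrite -powRM ?expR_ge0 ?(ltW m0)//; apply: powR_mono; rewrite ?(ltW a0) ?(ltW y1)//.
apply: (@le_trans _ _ ((1 + y / a) * Num.max 1 a)); last first.
  by rewrite ler_wpM2r ?(ltW m0)// expR_ge1Dx.
rewrite mulrDl mul1r lerD ?le_max ?lexx//.
rewrite mulrAC ler_pdivlMr// ler_wpM2l ?(ltW y0)// le_max lexx orbT//.
Qed.

Let geom_bound (q : R) J : 0 < q -> q < 1 -> \sum_(0 <= i < J) q ^+ i <= (1 - q)^-1.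
Proof.
move=> q0 q1; have q1' : 0 < 1 - q by rewrite subr_gt0.
rewrite big_mkord -(ler_pM2l q1') divff ?gt_eqF//.
have -> : (1 - q) * \sum_(i < J) q ^+ i = 1 - q ^+ J.
  by rewrite -opprB mulNr -subrX1 opprB.
by rewrite gerBl exprn_ge0 ?ltW.
Qed.

(** Two geometric series. For exponents >= 0 the factor (1 + y)^(- a) is at most y^(- a), which
    leaves the ratio rho^(b - a); for negative exponents it is at most 1, which leaves the ratio
    rho^(- b). *)
Lemma thsum_gpow_le a J : b < a ->
  thsum (gpow a) J 1 <= (1 - rho `^ (b - a))^-1 + (1 - rho `^ (- b))^-1 * rho `^ (- b).
Proof.
move=> ba; have a0 : 0 < a by exact: lt_trans ba.
have lt1 (e : R) : e < 0 -> 0 < rho `^ e < 1.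
  move=> e0; rewrite powR_gt0//= /powR gt_eqF// expR_lt1 nmulr_rlt0// ln_gt0//.
have ba0 : b - a < 0 by rewrite subr_lt0.
have /andP[p0 p1] := lt1 _ ba0.
have nb0 : - b < 0 by rewrite oppr_lt0.
have /andP[r0 r1] := lt1 _ nb0.
rewrite /thsum /thexp big_cat !big_map/= lerD//.
  apply: le_trans (geom_bound J p0 p1); rewrite /index_iota subn0; apply: ler_sum => i _.
  rewrite /thterm /gpow mulr1 -powR_mulrn ?powR_ge0// -!powRrM mulrBl powRDp//.
  rewrite (mulrC b) ler_wpM2l ?powR_ge0// (mulrC a) powRN [_ `^ (- (_))]powRN powRrM.
  rewrite lef_pV2 ?posrE ?powR_gt0//; last by rewrite ltr_wpDl// powR_gt0.
  by apply: powR_mono; rewrite ?powR_ge0 ?ltW// ltrDr.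
apply: (@le_trans _ _ ((\sum_(0 <= i < J) (rho `^ (- b)) ^+ i) * rho `^ (- b))); last first.
  by rewrite ler_wpM2r ?powR_ge0// geom_bound.
rewrite mulr_suml /index_iota subn0; apply: ler_sum => i _.
rewrite /thterm /gpow mulr1 -exprSr -powR_mulrn ?powR_ge0// -!powRrM.
have -> : - i.+1%:R * b = - b * i.+1%:R by ring.
rewrite -[leRHS]mulr1 ler_wpM2l ?powR_ge0// powRN invf_le1 ?powR_gt0//; last first.
  by rewrite ltr_wpDl// powR_gt0.
apply: (@le_trans _ _ (1 `^ a)); first by rewrite powR1.
by apply: powR_mono; rewrite ?(ltW a0)// lerDl powR_ge0.
Qed.

Lemma gpow_bnd a : b < a -> exists M, forall J, thsum (gpow a) J 1 <= M.
Proof. by move=> ba; eexists => J; exact: thsum_gpow_le. Qed.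

Lemma gexp_bnd : exists M, forall J, thsum gexp J 1 <= M.
Proof.
have ba : b < b + 1 by rewrite ltrDl.
have [M hM] := gpow_bnd ba; exists ((Num.max 1 (b + 1)) `^ (b + 1) * M) => J.
apply: (@le_trans _ _ ((Num.max 1 (b + 1)) `^ (b + 1) * thsum (gpow (b + 1)) J 1)); last first.
  by rewrite ler_wpM2l ?powR_ge0.
rewrite /thsum mulr_sumr; apply: ler_sum => e _; rewrite /thterm mulrCA ler_wpM2l ?powR_ge0//.
by apply: gexp_gpow; rewrite ?mulr1 ?powR_gt0// (lt_trans b0).
Qed.

(** Only negative exponents are kept, where the exponential is at least exp(-1); a long enough
    geometric sum exceeds half of its limit. *)
Lemma theta_gexp_ge : expR (-1) * (rho `^ (- b) / (2 * (1 - rho `^ (- b)))) <= theta gexp 1.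
Proof.
set q := rho `^ (- b); have q0 : 0 < q by exact: powR_gt0.
have q1 : q < 1.
  by rewrite /q /powR gt_eqF// expR_lt1 nmulr_rlt0 ?ln_gt0// oppr_lt0.
have q1' : 0 < 1 - q by rewrite subr_gt0.
have [J _ /(_ J (leqnn _))/= hJ] : \forall J \near \oo, q ^+ J < 2^-1.
  have cq : q ^+ J @[J --> \oo] --> 0 by apply: cvg_expr; rewrite gtr0_norm.
  by move/cvgr_lt : cq; apply; rewrite invr_gt0.
have gm : forall x y, 0 < x -> x <= y -> gexp y <= gexp x by exact: gexp_mono.
have g0 : forall x, 0 < x -> 0 <= gexp x by move=> x _; exact: expR_ge0.
apply: le_trans (theta_ge g0 gm gexp_bnd J (lexx 1)).
rewrite /thsum /thexp big_cat !big_map/=; apply: ler_wpDl.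
  by apply: sumr_ge0 => i _; rewrite mulr_ge0 ?powR_ge0 ?expR_ge0.
apply: (@le_trans _ _ (\sum_(i <- iota 0 J) expR (-1) * (q * q ^+ i))); last first.
  apply: ler_sum => i _; rewrite /thterm mulr1 mulrC /gexp.
  have -> : q * q ^+ i = (rho `^ (- i.+1%:R)) `^ b.
    by rewrite -exprS -(powR_mulrn i.+1 (ltW q0)) /q -[LHS]powRrM -[RHS]powRrM mulNr mulrC -mulNr.
  rewrite ler_wpM2l ?powR_ge0// ler_expR lerN2 powRN invf_le1 ?powR_gt0//.
  by rewrite powR_mulrn ?(ltW rho0)// exprn_ege1// ltW.
rewrite -!mulr_sumr ler_wpM2l ?expR_ge0// ler_wpM2l ?(ltW q0)//.
have E : (1 - q) * \sum_(i <- iota 0 J) q ^+ i = 1 - q ^+ J.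
  have -> : \sum_(i <- iota 0 J) q ^+ i = \sum_(i < J) q ^+ i.
    by rewrite -(big_mkord xpredT (fun i => q ^+ i)) /index_iota subn0.
  by rewrite -opprB mulNr -subrX1 opprB.
rewrite -(ler_pM2l q1') E invfM mulrCA divff ?gt_eqF// mulr1.
exact: half_le.
Qed.

(** As rho tends to 1 both sums blow up and only their ratio stays bounded. With r = rho^(b - a) and
    q = rho^(- b), the choice of m gives r^(m + 1) <= q, so 1 - q <= (m + 1) (1 - r): the two
    geometric series are comparable uniformly in rho <= 2. *)
Lemma theta_ratio (a : R) (m : nat) : rho <= 2 -> b < a -> b <= m.+1%:R * (a - b) ->
  theta (gpow a) 1 <= (2 * expR 1 * m.+2%:R * 2 `^ b) * theta gexp 1.
Proof.
move=> rho2 ba hm; have a0 : 0 < a by exact: lt_trans ba.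
set q := rho `^ (- b); have q0 : 0 < q by exact: powR_gt0.
have q1 : q < 1.
  by rewrite /q /powR gt_eqF// expR_lt1 nmulr_rlt0 ?ln_gt0// oppr_lt0.
have q1' : 0 < 1 - q by rewrite subr_gt0.
set r := rho `^ (b - a); have r0 : 0 < r by exact: powR_gt0.
have r1 : r < 1.
  by rewrite /r /powR gt_eqF// expR_lt1 nmulr_rlt0 ?ln_gt0// subr_lt0.
have r1' : 0 < 1 - r by rewrite subr_gt0.
have rq : r ^+ m.+1 <= q.
  rewrite /r /q -powR_mulrn ?powR_ge0// -powRrM /powR gt_eqF//.
  rewrite ler_expR ler_wpM2r// ?ln_ge0 ?(ltW rho1)//.
  by move: hm; lra.
have bern : 1 - q <= m.+1%:R * (1 - r).
  apply: (@le_trans _ _ (1 - r ^+ m.+1)); first by rewrite lerD2l lerN2.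
  have -> : 1 - r ^+ m.+1 = (1 - r) * \sum_(i < m.+1) r ^+ i.
    by rewrite -opprB subrX1 -mulNr opprB.
  rewrite mulrC ler_wpM2r ?(ltW r1')//.
  rewrite -[X in _ <= X%:R](card_ord m.+1) -sumr_const; apply: ler_sum => i _.
  by rewrite exprn_ile1// ltW.
have inv : (1 - r)^-1 <= m.+1%:R / (1 - q).
  by rewrite ler_pdivlMr// ler_pdivrMl// mulrC.
have ga0 : forall x, 0 < x -> 0 <= gpow a x by move=> x _; exact: powR_ge0.
have gam : forall x y, 0 < x -> x <= y -> gpow a y <= gpow a x.
  by move=> x y; apply: gpow_mono; exact: ltW.
have T1 : theta (gpow a) 1 <= m.+2%:R / (1 - q).
  apply: (theta_le ga0 gam (gpow_bnd ba)) => // J.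
  apply: le_trans (thsum_gpow_le J ba) _; rewrite -/q -/r.
  rewrite -[m.+2%:R]natr1 mulrDl lerD// mulrC ler_wpM2r ?invr_ge0 ?(ltW q1') ?(ltW q1)//.
apply: (le_trans T1).
have T2 := theta_gexp_ge; rewrite -/q in T2.
have h2b : 0 < 2 `^ b :> R by exact: powR_gt0.
have qb : 1 <= 2 `^ b * q.
  by rewrite /q powRN ler_pdivlMr ?powR_gt0// mul1r; apply: powR_mono => //; exact: ltW.
have e1 : expR 1 * expR (-1) = 1 :> R by rewrite -expRD subrr expR0.
have e0 : 0 < expR 1 :> R := expR_gt0 _.
apply: (@le_trans _ _ (2 * expR 1 * m.+2%:R * 2 `^ b * (expR (-1) * (q / (2 * (1 - q)))))); last first.
  by rewrite ler_wpM2l// !mulr_ge0// ltW.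
have -> : 2 * expR 1 * m.+2%:R * 2 `^ b * (expR (-1) * (q / (2 * (1 - q)))) =
    (expR 1 * expR (-1)) * (2 `^ b * q) * (m.+2%:R / (1 - q)).
  by field; rewrite gt_eqF.
rewrite e1 mul1r ler_peMl// divr_ge0// ltW//.
Qed.

End Theta.

(** * Negative powers of A from the heat semigroup *)

Section Subordination.
Context {R : realType} {d : nat}.
Variables (B : ('rV[R]_d -> R) -> R -> Prop) (tB : tnorm B).

Definition rho_ (n : nat) : R := 2 `^ (n.+1%:R^-1).

Lemma rho_gt1 n : 1 < rho_ n.
Proof. by rewrite /rho_ /powR gt_eqF// expR_gt1 mulr_gt0 ?invr_gt0// ln_gt0// ltr1n. Qed.

Lemma rho_le2 n : rho_ n <= 2.
Proof.
rewrite -[leRHS]powRr1// /rho_; apply: ler_powR; first by rewrite ler1n.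
by rewrite invf_le1// ler1n.
Qed.

Lemma rho_cvg (e : R) : rho_ n `^ e @[n --> \oo] --> (1 : R).
Proof.
have -> : (fun n => rho_ n `^ e) = (fun n => expR (n.+1%:R^-1 * e * ln 2)).
  by apply/funext => n; rewrite /rho_ -powRrM /powR gt_eqF.
have h : n.+1%:R^-1 * e * ln 2 @[n --> \oo] --> (0 * e * ln 2 : R).
  apply: cvgM; last exact: cvg_cst.
  by apply: cvgM; [exact: cvg_harmonic|exact: cvg_cst].
rewrite !mul0r in h.
have := cvg_comp _ (expR : R -> R) h (@continuous_expR R 0).
by rewrite expR0.
Qed.

(* Subordination: [A `^ (- b)] is an average of [exp (- t A)] against [t `^ (b - 1) dt],
   here discretised along [t = rho ^ j] with [rho -> 1]. *)
Lemma subordination (a b : R) : 0 < b -> b < a -> exists2 C : R, 0 < C &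
  forall s (m : 'rV[int]_d -> R) P X y, 0 <= X -> 1 <= y ->
   (forall t, 0 < t -> B (tev (tmul s (fun k => heatA t k * m k) P)) (X * (1 + t * y) `^ (- a))) ->
   B (tev (tmul s (fun k => AA k `^ (- b) * m k) P)) (C * X * y `^ (- b)).
Proof.
move=> b0 ba; have a0 : 0 < a by exact: lt_trans ba.
have ab : 0 < a - b by rewrite subr_gt0.
have [m hm] : exists m : nat, b <= m.+1%:R * (a - b).
  exists (Num.trunc (b / (a - b))); rewrite -ler_pdivrMr// ltW//.
  exact: truncnS_gt.
pose C0 : R := 2 * expR 1 * m.+2%:R * 2 `^ b.
have C00 : 0 < C0 by rewrite !mulr_gt0 ?expR_gt0 ?powR_gt0.
exists (2 `^ b * C0); first by rewrite mulr_gt0 ?powR_gt0.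
move=> s mm P X y X0 y1 H.
have gm : forall x y : R, 0 < x -> x <= y -> gexp y <= gexp x by exact: gexp_mono.
have g0 : forall x : R, 0 < x -> 0 <= gexp x by move=> x _; exact: expR_ge0.
have ga0 : forall x, 0 < x -> 0 <= gpow a x by move=> x _; exact: powR_ge0.
have gam : forall x y, 0 < x -> x <= y -> gpow a y <= gpow a x.
  by move=> x z; apply: gpow_mono; exact: ltW.
pose Th n x := theta b (rho_ n) gexp x.
have Th0 n : 0 < Th n 1.
  have := theta_gexp_ge b0 (rho_gt1 n); apply: lt_le_trans.
  have q0 : 0 < rho_ n `^ (- b) by rewrite powR_gt0// (lt_trans _ (rho_gt1 n)).
  have q1 : rho_ n `^ (- b) < 1.
    rewrite /powR gt_eqF ?(lt_trans _ (rho_gt1 n))// expR_lt1 nmulr_rlt0 ?oppr_lt0//.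
    by rewrite ln_gt0 ?rho_gt1.
  by rewrite mulr_gt0 ?expR_gt0// divr_gt0// mulr_gt0// subr_gt0.
(* For fixed rho the symbol is divided by [Th n 1], the total weight up to a bounded factor;
   [theta_ratio] then keeps the constant bounded as rho tends to 1. *)
have step n : B (tev (tmul s (fun k => Th n (AA k) / Th n 1 * mm k) P)) (2 `^ b * C0 * X * y `^ (- b)).
  have bJ J : B (tev (tmul s (fun k => thsum b (rho_ n) gexp J (AA k) / Th n 1 * mm k) P))
      (2 `^ b * C0 * X * y `^ (- b)).
    have rp e : 0 < rho_ n `^ e by rewrite powR_gt0// (lt_trans _ (rho_gt1 n)).
    have K := @bt_sum _ _ _ tB s P _ (thexp J) (fun e k => heatA (rho_ n `^ e) k * mm k)
      (fun e => (rho_ n `^ e) `^ b / Th n 1) _ (fun e => H _ (rp e)).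
    have E : (fun k => thsum b (rho_ n) gexp J (AA k) / Th n 1 * mm k) =
       (fun k => \sum_(e <- thexp J) (rho_ n `^ e) `^ b / Th n 1 * (heatA (rho_ n `^ e) k * mm k)).
      apply/funext => k; rewrite /thsum !mulr_suml; apply: eq_bigr => e _.
      by rewrite /thterm /gexp /heatA; ring.
    rewrite E; apply: (nl_le (tn_nl tB)) K _.
    have -> : \sum_(e <- thexp J) `|(rho_ n `^ e) `^ b / Th n 1| * (X * (1 + rho_ n `^ e * y) `^ (- a)) =
        X * (thsum b (rho_ n) (gpow a) J y / Th n 1).
      rewrite /thsum mulr_suml mulr_sumr; apply: eq_bigr => e _.
      rewrite ger0_norm ?divr_ge0 ?powR_ge0 ?(ltW (Th0 n))//.
      by rewrite /thterm /gpow; ring.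
    have -> : 2 `^ b * C0 * X * y `^ (- b) = X * (2 `^ b * y `^ (- b) * C0) by ring.
    rewrite ler_wpM2l// ler_pdivrMr//.
    apply: le_trans (theta_ge (rho_gt1 n) ga0 gam (gpow_bnd b0 (rho_gt1 n) ba) J y1) _.
    have /andP[_ h] := theta_homogeneous b0 (rho_gt1 n) ga0 gam (gpow_bnd b0 (rho_gt1 n) ba) y1.
    apply: (le_trans h); rewrite -[2 `^ b * _ * C0 * _]mulrA.
    have rb : rho_ n `^ b <= 2 `^ b.
      by apply: powR_mono; rewrite ?rho_le2// ltW// (lt_trans _ (rho_gt1 n)).
    apply: ler_pM => //; rewrite ?powR_ge0// ?mulr_ge0 ?powR_ge0//.
      apply: le_trans (theta_ge (rho_gt1 n) ga0 gam (gpow_bnd b0 (rho_gt1 n) ba) 0 (lexx 1)).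
      by rewrite /thsum big_nil.
    - by rewrite ler_wpM2r ?powR_ge0.
    - exact: (theta_ratio b0 (rho_gt1 n) (rho_le2 n) ba hm).
  apply: (bt_lim tB bJ) => k; apply: cvgM; last exact: cvg_cst.
  apply: cvgM; last exact: cvg_cst.
  exact: (thsum_cvg (rho_gt1 n) g0 gm (gexp_bnd b0 (rho_gt1 n)) (AA_ge1 k)).
(* The second limit, rho -> 1, replaces the nearly homogeneous symbol by A^(- b) itself. *)
apply: (bt_lim tB step) => k; apply: cvgM; last exact: cvg_cst.
apply: (@squeeze_cvgr _ _ _ _ (fun n => rho_ n `^ (- b) * AA k `^ (- b)) (fun n => rho_ n `^ b * AA k `^ (- b))).
- apply: nearW => n; have := theta_homogeneous b0 (rho_gt1 n) g0 gm (gexp_bnd b0 (rho_gt1 n)) (AA_ge1 k).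
  by rewrite -/(Th n 1) -/(Th n (AA k)) ler_pdivlMr// ler_pdivrMr.
- by have h := cvgM (rho_cvg (- b)) (cvg_cst (AA k `^ (- b))); rewrite mul1r in h; exact: h.
- by have h := cvgM (rho_cvg b) (cvg_cst (AA k `^ (- b))); rewrite mul1r in h; exact: h.
Qed.

End Subordination.

(** * Bessel potentials of functions controlled at one scale *)

Section Potentials.
Context {R : realType} {d : nat}.
Variables (B : ('rV[R]_d -> R) -> R -> Prop) (tB : tnorm B).
Let nB := tn_nl tB.
Implicit Types (P : @trig R d) (m : 'rV[int]_d -> R).

(** A bound uniform in t and one decaying like (t y)^(- a) combine into the profile (1 + t y)^(- a)
    that [subordination] asks for, with a loss of 2^a. *)
Lemma subordination_min (a b : R) : 0 < b -> b < a -> exists2 C : R, 0 < C &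
  forall s m P c y M, 0 <= c -> 1 <= y -> 1 <= M ->
   (forall t, 0 < t -> B (tev (tmul s (fun k => heatA t k * m k) P)) c) ->
   (forall t, 0 < t -> B (tev (tmul s (fun k => heatA t k * m k) P)) (c * M * (t * y) `^ (- a))) ->
   B (tev (tmul s (fun k => AA k `^ (- b) * m k) P)) (C * M * c * y `^ (- b)).
Proof.
move=> b0 ba; have a0 : 0 < a by exact: lt_trans ba.
have [C C0 H] := subordination tB b0 ba.
exists (C * 2 `^ a); first by rewrite mulr_gt0 ?powR_gt0.
move=> s m P c y M c0 y1 M1 H1 H2.
have M0 : 0 < M by exact: lt_le_trans M1.
have y0 : 0 < y by exact: lt_le_trans y1.
have e2 : 0 < 2 `^ a :> R by exact: powR_gt0.
have -> : C * 2 `^ a * M * c * y `^ (- b) = C * (2 `^ a * M * c) * y `^ (- b) by ring.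
apply: H => // [|t t0]; first by rewrite !mulr_ge0// ltW.
have ty0 : 0 < t * y by rewrite mulr_gt0.
have ty1 : 0 < 1 + t * y by rewrite addr_gt0.
have [ty|ty] := leP (t * y) 1.
  apply: (nl_le nB) (H1 t t0) _.
  have h : 1 <= 2 `^ a * (1 + t * y) `^ (- a).
    rewrite powRN ler_pdivlMr ?powR_gt0// mul1r; apply: powR_mono; rewrite ?(ltW a0) ?(ltW ty1)//.
    by move: ty; lra.
  have -> : 2 `^ a * M * c * (1 + t * y) `^ (- a) = c * (M * (2 `^ a * (1 + t * y) `^ (- a))) by ring.
  by rewrite ler_peMr// -[leLHS]mulr1 ler_pM.
apply: (nl_le nB) (H2 t t0) _.
have -> : 2 `^ a * M * c * (1 + t * y) `^ (- a) = c * M * (2 `^ a * (1 + t * y) `^ (- a)) by ring.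
rewrite ler_wpM2l ?mulr_ge0 ?(ltW M0)// !powRN ler_pdivlMr ?powR_gt0// ler_pdivrMl ?powR_gt0//.
rewrite -powRM ?(ltW ty0)//; apply: powR_mono; rewrite ?(ltW a0) ?(ltW ty1)//.
by move: ty; lra.
Qed.

(* [A = 1 + |k| ^ 2], so that [A `^ (t / 2)] is the symbol of the Bessel potential. *)
Lemma bessel_neg (b : R) : 0 <= b -> exists2 C : R, 0 < C &
  forall s m P c, B (tev (tmul s m P)) c ->
   B (tev (tmul s (fun k => AA k `^ (- b) * m k) P)) (C * c).
Proof.
rewrite le_eqVlt => /predU1P[<-|b0].
  exists 1 => // s m P c; rewrite mul1r.
  by under [in X in _ -> X]eq_fun do rewrite oppr0 powRr0 mul1r.
have ba : b < b + 1 by rewrite ltrDl.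
have a0 : 0 < b + 1 by exact: lt_trans ba.
have [C C0 H] := subordination tB b0 ba.
exists (C * (Num.max 1 (b + 1)) `^ (b + 1)); first by rewrite mulr_gt0// powR_gt0// lt_max ltr01.
move=> s m P c Bc; have c0 := nl_ge0 nB Bc.
have -> : C * Num.max 1 (b + 1) `^ (b + 1) * c = C * (Num.max 1 (b + 1) `^ (b + 1) * c) * 1 `^ (- b).
  by rewrite powR1; ring.
apply: H => // [|t t0]; first by rewrite mulr_ge0 ?powR_ge0.
rewrite -tmul_comp.
have [e0 He] := mb_heatA tB predT t0.
apply: (nl_le nB) (He _ _ (fun _ _ => isT) Bc) _.
rewrite mulrC [leRHS](_ : _ = c * (Num.max 1 (b + 1) `^ (b + 1) * (1 + t * 1) `^ (- (b + 1)))); last by ring.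
by rewrite ler_wpM2l// mulr1; exact: gexp_gpow.
Qed.

(** A positive fractional power is a negative power of an integer one: A^(sg/2) = A^(- b) A^N with b
    = N - sg/2. The norm of exp(- t A) A^N is at most lam^(2N) w by hypothesis and a multiple of
    t^(- N) w by smoothing, so subordination at y = lam^2 gives lam^(2N - 2b) = lam^sg. *)
Lemma bessel_pos (n : nat) (sg : R) : 0 < sg -> sg < 2 * n.+1%:R -> exists2 C : R, 0 < C &
  forall s m P w lam, 1 <= lam -> B (tev (tmul s m P)) w ->
   B (tev (tmul s (fun k => AA k ^+ n.+1 * m k) P)) (lam ^+ (2 * n.+1) * w) ->
   B (tev (tmul s (fun k => AA k `^ (sg / 2) * m k) P)) (C * lam `^ sg * w).
Proof.
move=> s0 sn; set N := n.+1 in sn *.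
pose b : R := N%:R - sg / 2.
have b0 : 0 < b by rewrite /b; lra.
have ba : b < N%:R by rewrite /b; lra.
have [C C0 H] := subordination_min b0 ba.
pose M : R := (N%:R * (1 + d%:R)) ^+ N.
have Nd1 : 1 <= N%:R * (1 + d%:R) :> R.
  by rewrite -[leLHS]mulr1 ler_pM// ?ler1n// lerDl.
have M1 : 1 <= M by rewrite exprn_ege1.
exists (C * M); first by rewrite mulr_gt0// (lt_le_trans _ M1).
move=> s m P w lam lam1 Bw BN.
have lam0 : 0 < lam by exact: lt_le_trans lam1.
have w0 := nl_ge0 nB Bw.
have y1 : 1 <= lam ^+ 2 by rewrite exprn_ege1.
have l2 e : (lam ^+ 2) `^ e = lam `^ (2 * e) by rewrite -powR_mulrn ?(ltW lam0)// -powRrM.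
have lN : lam ^+ (2 * N) = lam `^ (2 * N%:R) by rewrite -natrM powR_mulrn// ltW.
have K : B (tev (tmul s (fun k => AA k `^ (- b) * (AA k ^+ N * m k)) P))
    (C * M * (lam ^+ (2 * N) * w) * (lam ^+ 2) `^ (- b)).
  apply: H => // [|t t0|t t0]; first by rewrite mulr_ge0// exprn_ge0// ltW.
  - rewrite -tmul_comp; have [_ He] := mb_heatA tB predT t0.
    apply: (nl_le nB) (He _ _ (fun _ _ => isT) BN) _.
    rewrite ler_piMl//; first by rewrite mulr_ge0// exprn_ge0// ltW.
    by rewrite expR_le1 oppr_le0 ltW.
  - have [_ He] := mb_An tB predT n t0.
    have := He _ _ (fun _ _ => isT) Bw; rewrite tmul_comp.
    rewrite (@tmul_ext _ _ _ _ (fun k => heatA t k * (AA k ^+ N * m k))); last first.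
      by move=> u _; rewrite mulrAC mulrA (mulrC (heatA _ _)) mulrAC -!mulrA.
    have -> //: (n.+1%:R * (1 + d%:R) / t) ^+ n.+1 * w =
      lam ^+ (2 * N) * w * M * (t * lam ^+ 2) `^ (- N%:R).
    rewrite powRM ?(ltW t0) ?exprn_ge0 ?(ltW lam0)// l2 lN -/N /M expr_div_n.
    rewrite (powRN t) (powR_mulrn N (ltW t0)).
    transitivity ((N%:R * (1 + d%:R)) ^+ N / t ^+ N * w * (lam `^ (2 * N%:R) * lam `^ (2 * - N%:R))); last by ring.
    by rewrite -powRDp// mulrN subrr powRr0 mulr1.
rewrite (@tmul_ext _ _ s _ (fun k => AA k `^ (- b) * (AA k ^+ N * m k))); last first.
  move=> u _; rewrite mulrA -(powR_mulrn N (ltW (AA_gt0 _))) -powRDp ?AA_gt0//.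
  by congr (_ `^ _ * _); rewrite /b; ring.
rewrite (_ : C * M * lam `^ sg * w = C * M * (lam ^+ (2 * N) * w) * (lam ^+ 2) `^ (- b))//.
rewrite l2 lN; transitivity (C * M * w * (lam `^ (2 * N%:R) * lam `^ (2 * - b))); last by ring.
rewrite -powRDp// (_ : 2 * N%:R + 2 * - b = sg); last by rewrite /b; field.
by ring.
Qed.

(** The same interpolation with one derivative in place of A^N. Smoothing is now of order t^(- 1/2),
    so b = (1 - sg)/2 has to stay below 1/2. *)
Lemma bessel_partial (i : 'I_d) (sg : R) : 0 < sg -> sg < 1 -> exists2 C : R, 0 < C &
  forall P w lam, 1 <= lam -> B (tev P) w ->
   B (tev (tmul true (fun k => (k 0 i)%:~R) P)) (lam * w) ->
   B (tev (tmul true (fun k => AA k `^ ((sg - 1) / 2) * (k 0 i)%:~R) P)) (C * lam `^ sg * w).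
Proof.
move=> s0 s1.
pose b : R := (1 - sg) / 2.
have b0 : 0 < b by rewrite /b; lra.
have ba : b < 2^-1 by rewrite /b; lra.
have [C C0 H] := subordination_min b0 ba.
exists C => // P w lam lam1 Bw B1.
have lam0 : 0 < lam by exact: lt_le_trans lam1.
have w0 := nl_ge0 nB Bw.
have y1 : 1 <= lam ^+ 2 by rewrite exprn_ege1.
have l2 e : (lam ^+ 2) `^ e = lam `^ (2 * e) by rewrite -powR_mulrn ?(ltW lam0)// -powRrM.
have K : B (tev (tmul true (fun k => AA k `^ (- b) * (k 0 i)%:~R) P))
    (C * 1 * (lam * w) * (lam ^+ 2) `^ (- b)).
  apply: H => // [|t t0|t t0]; first by rewrite mulr_ge0// ltW.
  - rewrite -tmul_comp; have [_ He] := mb_heatA tB predT t0.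
    apply: (nl_le nB) (He _ _ (fun _ _ => isT) B1) _.
    rewrite ler_piMl//; first by rewrite mulr_ge0// ltW.
    by rewrite expR_le1 oppr_le0 ltW.
  - have [_ He] := mb_dheat tB predT i t0.
    have [_ He'] := mb_heatA tB predT t0.
    have := He _ _ (fun _ _ => isT) Bw.
    (* [mb_dheat] concerns exp(- t |k|^2); the factor exp(- t) that distinguishes [heatA] is taken
       out here and put back by [bZ]. *)
    rewrite (@tmul_ext _ _ _ _ (fun k => expR t * (heatA t k * (k 0 i)%:~R))); last first.
      move=> u _; rewrite heatAE mulrA mulrA -expRD subrr expR0 mul1r mulrC//.
    move=> /(bZ tB (expR (- t)) (@ctev _ _ _)).
    rewrite [X in B X _](_ : _ = tev (tmul true (fun k => heatA t k * (k 0 i)%:~R) P)); last first.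
      apply/funext => x; rewrite tmulZ mulrA -expRD addrC subrr expR0 mul1r//.
    move=> /(nl_le nB); apply.
    rewrite ger0_norm ?expR_ge0// mulr1 powRM ?(ltW t0) ?exprn_ge0 ?(ltW lam0)// l2.
    rewrite mulrN divff// (powRN t) (powRN lam) powRr1 ?(ltW lam0)// powR12_sqrt ?(ltW t0)//.
    rewrite [leRHS](_ : _ = w / Num.sqrt t); last first.
      by field; rewrite (gt_eqF lam0) gt_eqF// sqrtr_gt0.
    rewrite mulrA (mulrC w) ler_wpM2r//.
    apply: (@le_trans _ _ (1 * (Num.sqrt (2 * t))^-1)).
      by rewrite ler_wpM2r ?invr_ge0 ?sqrtr_ge0// expR_le1 oppr_le0 ltW.
    rewrite mul1r lef_pV2 ?posrE ?sqrtr_gt0 ?mulr_gt0//.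
    by rewrite ler_wsqrtr// ler_peMl ?(ltW t0)// ler1n.
rewrite (@tmul_ext _ _ true _ (fun k => AA k `^ (- b) * (k 0 i)%:~R)); last first.
  by move=> u _; congr (_ `^ _ * _); rewrite /b; field.
rewrite (_ : C * lam `^ sg * w = C * 1 * (lam * w) * (lam ^+ 2) `^ (- b))//.
rewrite l2 -[X in _ * (X * _)](@powRr1 R lam) ?(ltW lam0)//.
transitivity (C * w * (lam `^ 1 * lam `^ (2 * - b))); last by ring.
rewrite -powRDp// (_ : 1 + 2 * - b = sg); last by rewrite /b; field.
by ring.
Qed.

Lemma trig_partialE i P : trig_partial i P = tmul true (fun k => 2 * pi * (k 0 i)%:~R) P.
Proof. by []. Qed.

Lemma tev_partial i P x :
  tev (tmul true (fun k => (k 0 i)%:~R) P) x = (2 * pi)^-1 * partial i (tev P) x.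
Proof.
rewrite partial_tev trig_partialE tmulZ mulrA mulVf ?mul1r//.
by rewrite mulf_neq0// gt_eqF// pi_gt0.
Qed.

(** The operator 1 - Laplacian / (2 pi)^2 with symbol [AA]: phases carry a factor 2 pi, [AA] does
    not. *)
Definition oneB_lap (f : 'rV[R]_d -> R) : 'rV[R]_d -> R :=
  fun x => f x - (2 * pi) ^- 2 * \sum_(i < d) partial i (partial i f) x.

Lemma tev_AA P : tev (tmul false AA P) = oneB_lap (tev P).
Proof.
apply/funext => x; rewrite /oneB_lap tev_tmul.
have -> : \sum_(i < d) partial i (partial i (tev P)) x =
  \sum_(t <- P) \sum_(i < d) - ((2 * pi * (t.1 0 i)%:~R) ^+ 2) * tbase false t x.
  rewrite exchange_big/=; apply: eq_bigr => i _.
  rewrite !partial_tev !trig_partialE tmul_compt tev_tmul; apply: eq_bigr => t _.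
  by rewrite expr2.
rewrite mulr_sumr -sumrB; apply: eq_bigr => t _.
rewrite -mulr_suml /AA /kk mulrDl mul1r; congr (_ + _); rewrite mulrA -mulNr; congr (_ * _).
rewrite sumrN mulrN opprK mulr_sumr; apply: eq_bigr => i _.
rewrite [(2 * pi * _) ^+ 2]exprMn mulrA mulVf ?mul1r//.
by rewrite expf_neq0// mulf_neq0// gt_eqF// pi_gt0.
Qed.

Lemma bdZ n c lam (a : R) f : sm n f -> 0 <= lam -> bd B n c lam f ->
  bd B n (`|a| * c) lam (fun x => a * f x).
Proof.
elim: n c f => [|n IH] c f sf lam0 [Bf bf]; split => //;
  try by apply: (bZ tB) => //; exact: sm_continuous sf.
move=> i; rewrite partialZ; last by move=> x; exact: sm_diff sf.
rewrite -mulrA; apply: IH => //; [exact: sf.2|exact: bf].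
Qed.

Lemma bd_sum n lam (I : Type) (r : seq I) (F : I -> 'rV[R]_d -> R) (c : I -> R) :
  (forall i, sm n (F i)) -> 0 <= lam -> (forall i, bd B n (c i) lam (F i)) ->
  bd B n (\sum_(i <- r) c i) lam (fun x => \sum_(i <- r) F i x).
Proof.
move=> sF lam0 bF; elim: r => [|i r IH].
  rewrite big_nil (_ : (fun x => _) = (fun=> 0)); last by apply/funext => x; rewrite big_nil.
  elim: n {sF bF} => [|n IH]; split => //;
   try by apply: (tn_sup tB) => [|x]; [exact: cont_cst|rewrite normr0].
  by move=> i; rewrite partial_cst mul0r.
rewrite big_cons (_ : (fun x => _) = (fun x => F i x + \sum_(j <- r) F j x)).
  by apply: bdD => //; exact: sm_sum.
by apply/funext => x; rewrite big_cons.
Qed.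

Lemma bd_oneB_lap n c lam f : sm n.+2 f -> 1 <= lam -> bd B n.+2 c lam f ->
  bd B n ((1 + d%:R) * lam ^+ 2 * c) lam (oneB_lap f).
Proof.
move=> sf lam1 bf; have lam0 : 0 <= lam by rewrite (le_trans _ lam1).
have c0 := nl_ge0 nB (bd0 bf).
have sp i : sm n (partial i (partial i f)) by apply: sm_partial; exact: sm_partial.
have bs : bd B n (d%:R * (c * lam * lam)) lam (fun x => \sum_(i < d) partial i (partial i f) x).
  have := @bd_sum n lam _ (index_enum 'I_d) (fun i => partial i (partial i f)) (fun=> c * lam * lam) sp lam0.
  rewrite sumr_const card_ord -[_ *+ d]mulr_natl; apply => i.
  by apply: bd_partial; exact: bd_partial.
have p1 : (2 * pi) ^- 2 <= 1 :> R.
  rewrite invf_le1 ?exprn_gt0 ?mulr_gt0 ?pi_gt0//; apply: exprn_ege1.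
  by have := pi_ge2 R; move: (pi : R) => p; lra.
have b2 := bdZ (- (2 * pi) ^- 2) (sm_sum _ sp) lam0 bs.
have := bdD nB (smS (smS sf)) (smZ _ (sm_sum _ sp)) (bdS (bdS bf)) b2.
rewrite [X in bd B n _ lam X](_ : _ = oneB_lap f); last first.
  by apply/funext => x; rewrite /oneB_lap mulNr.
move=> /(bd_le nB lam0); apply.
rewrite normrN ger0_norm ?invr_ge0 ?exprn_ge0// ?mulr_ge0 ?pi_ge0//.
have -> : (1 + d%:R) * lam ^+ 2 * c = lam ^+ 2 * c + d%:R * (lam ^+ 2 * c) by ring.
apply: lerD.
  by rewrite ler_peMl// exprn_ege1.
have -> : d%:R * (c * lam * lam) = d%:R * (lam ^+ 2 * c) by ring.
by rewrite ler_piMl// !mulr_ge0.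
Qed.

(** Each factor A uses up two orders of derivatives, hence [N.*2]. *)
Lemma bd_AA n N c lam P : 1 <= lam -> bd B (n + N.*2) c lam (tev P) ->
  bd B n (((1 + d%:R) * lam ^+ 2) ^+ N * c) lam (tev (tmul false (fun k => AA k ^+ N) P)).
Proof.
move=> lam1; elim: N n => [|N IH] n.
  rewrite addn0 expr0 mul1r.
  by under [in tmul _ _]eq_fun do rewrite expr0; rewrite tmul1.
rewrite doubleS !addnS -!addSn => /IH b.
rewrite exprS -mulrA [in X in bd _ _ _ _ X](_ : tmul _ _ _ = tmul false AA (tmul false (fun k => AA k ^+ N) P)).
  by rewrite tev_AA; apply: bd_oneB_lap => //; apply: test_sm; exact: test_tev.
by rewrite tmul_comp; apply: tmul_ext => t _; rewrite exprS.
Qed.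

End Potentials.

(** * The norms of L^q and H^{t,q} *)

Section LqNorm.
Context {R : realType} {d : nat}.
Variables (q : R) (q1 : 1 <= q).
Local Notation mu := (torus_measure d : probability _ R).
Local Notation row := (@row_of_tuple R d).
Implicit Types f g : 'rV[R]_d -> R.

Let q0 : 0 < q. Proof. exact: lt_le_trans q1. Qed.

Definition nq f (c : R) : Prop := (Lq_norm q f <= c%:E)%E.

Lemma Lq_powE f : (Lq_norm q f `^ q = \int[mu]_t (`|f (row t)| `^ q)%:E)%E.
Proof.
rewrite /Lq_norm poweR_Lnorm ?gt_eqF//.

Qed.

Lemma Lq_ge0 f : (0 <= Lq_norm q f)%E.
Proof. exact: Lnorm_ge0. Qed.

Lemma nqP f (c : R) : nq f c <->
  0 <= c /\ (\int[mu]_t (`|f (row t)| `^ q)%:E <= (c `^ q)%:E)%E.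
Proof.
rewrite -Lq_powE /nq; split=> [fc|[c0 fc]].
  have c0 : 0 <= c by rewrite -lee_fin (le_trans (Lq_ge0 f)).
  split=> //; rewrite -poweR_EFin; apply: gt0_ler_poweR => //; first exact: ltW.
  - by rewrite in_itv/= Lq_ge0 leey.
  - by rewrite in_itv/= lee_fin c0 leey.
have -> : Lq_norm q f = ((Lq_norm q f `^ q) `^ q^-1)%E.
  by rewrite -poweRrM divff ?poweRe1 ?Lq_ge0 ?gt_eqF.
have -> : c%:E = ((c `^ q)%:E `^ q^-1)%E.
  by rewrite poweR_EFin -powRrM divff ?powRr1// gt_eqF.
apply: gt0_ler_poweR => //; first by rewrite invr_ge0 ltW.
- by rewrite in_itv/= poweR_ge0 leey.
- by rewrite in_itv/= lee_fin powR_ge0 leey.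
Qed.

Lemma in_LqP f : in_Lq q f <-> mrow f /\ exists c, nq f c.
Proof.
split=> [/andP[mf fin]|[mf [c fc]]].
  split; first by move: mf; rewrite inE.
  move: fin; rewrite inE/= /finite_norm => fin; exists (fine (Lq_norm q f)).
  by rewrite /nq fineK// ge0_fin_numE ?Lq_ge0.
apply/andP; split; rewrite inE//=; rewrite /finite_norm.
by apply: le_lt_trans fc _; exact: ltry.
Qed.

Lemma mrow_pow f : mrow f ->
  measurable_fun setT (fun t : d.-tuple (measurableTypeR R) => (`|f (row t)| `^ q)%:E).
Proof.
move=> mf; apply/measurable_EFinP; apply: (measurableT_comp (measurable_powR q)).
exact: (measurableT_comp (@normr_measurable R setT)).
Qed.

Lemma nq_dom f g (c K : R) : mrow f -> mrow g -> 0 <= K -> nq f c ->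
  (forall x, `|g x| <= K * `|f x|) -> nq g (K * c).
Proof.
move=> mf mg K0 /nqP[c0 fc] gf; apply/nqP; split; first exact: mulr_ge0.
apply: (@le_trans _ _ (\int[mu]_t ((K `^ q)%:E * (`|f (row t)| `^ q)%:E)))%E.
  apply: ge0_le_integral => //.
  - exact: mrow_pow.
  - by apply: measurable_funeM; exact: mrow_pow.
  - by move=> t _; rewrite -EFinM lee_fin -powRM//; apply: powR_mono; rewrite ?(ltW q0).
rewrite ge0_integralZl//; last by rewrite lee_fin powR_ge0.
- by rewrite powRM// EFinM lee_wpmul2l// lee_fin powR_ge0.
- exact: mrow_pow.
Qed.

Lemma nq_add f g (c c' : R) : mrow f -> mrow g -> nq f c -> nq g c' ->
  nq (fun x => f x + g x) (c + c').
Proof.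
move=> mf mg fc gc; rewrite /nq EFinD; apply: le_trans (leeD fc gc).
exact: (minkowski_EFin mu mf mg q1).
Qed.

Lemma nq_le f (c c' : R) : nq f c -> c <= c' -> nq f c'.
Proof. by move=> fc cc; apply: le_trans fc _; rewrite lee_fin. Qed.

Lemma nq_sup f (c : R) : mrow f -> supb f c -> nq f c.
Proof.
move=> mf fc; have c0 : 0 <= c by exact: le_trans (fc 0).
apply/nqP; split=> //.
apply: (@le_trans _ _ (\int[mu]_t (cst (c `^ q)%:E t)))%E.
  apply: ge0_le_integral => //; first exact: mrow_pow.
  by move=> t _; rewrite lee_fin; apply: powR_mono; rewrite ?(ltW q0).
rewrite integral_cst//.
rewrite le_eqVlt; apply/orP; left; apply/eqP.
by transitivity ((c `^ q)%:E * 1)%E; [congr (_ * _)%E; exact: probability_setT|exact: mule1].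
Qed.

Lemma nq_inf f (c : R) : (forall e, 0 < e -> nq f (c + e)) -> nq f c.
Proof. by move=> H; apply/lee_addgt0Pr => e e0; rewrite -EFinD; exact: H. Qed.

Lemma continuous_normpow : continuous (fun x : R => `|x| `^ q).
Proof.
move=> x; have [->|x0] := eqVneq x 0.
  apply/cvgrPdist_lt => e e0 /=.
  have ei : 0 < e `^ q^-1 by rewrite powR_gt0.
  have /cvgrPdist_lt/(_ _ ei) := @norm_continuous _ R 0.
  apply: filterS => y /=; rewrite normr0 sub0r normrN normr_id => yl.
  rewrite powR0 ?gt_eqF// sub0r normrN ger0_norm ?powR_ge0//.
  have := @gt0_ltr_powR R q q0 `|y| (e `^ q^-1).
  by rewrite -[(e `^ _) `^ q]powRrM mulVf ?gt_eqF// powRr1 ?(ltW e0)//; apply; rewrite ?nnegrE ?powR_ge0.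
have x0' : 0 < `|x| by rewrite normr_gt0.
have E : \forall y \near x, expR (q * ln `|y|) = `|y| `^ q.
  have /cvgr_gt/(_ _ x0') := @norm_continuous _ R x.
  by apply: filterS => y y0; rewrite /powR gt_eqF.
rewrite /continuous_at; have -> : `|x| `^ q = expR (q * ln `|x|) by rewrite /powR gt_eqF.
apply: cvg_trans (near_eq_cvg E) _.
apply: (cvg_comp (fun y : R => q * ln `|y|) (expR : R -> R)); last exact: continuous_expR.
apply: cvgM; first exact: cvg_cst.
have := @continuous_comp _ _ _ (fun y : R => `|y|) (@ln R) x (@norm_continuous _ R x) (continuous_ln x0').
exact.
Qed.

Lemma cper_normpow f : cper f -> cper (fun x => `|f x| `^ q).
Proof.
exact: (cper_comp continuous_normpow).
Qed.

Lemma integral_tint f : integ f ->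
  (\int[mu]_t (f (row t))%:E)%E = (torus_integral f)%:E.
Proof.
move=> fi; rewrite /torus_integral /Rintegral fineK//.
exact: integrable_fin_num.
Qed.

Lemma nq_shift f (c : R) (a : 'rV[R]_d) : cper f -> nq f c -> nq (fun x => f (x + a)) c.
Proof.
move=> cf fc'; have [c0 fc] := (nqP f c).1 fc'; apply: (nqP _ c).2; split; first exact: c0.
have cp := cper_normpow cf.
have cs := cper_shift a cp.
have E1 := integral_tint (cper_integ cs).
have E2 := integral_tint (cper_integ cp).
have E3 := tint_shift a cp.
by move: fc; rewrite E2 -E3 -E1.
Qed.

Lemma nq_ge0 f (c : R) : nq f c -> 0 <= c.
Proof. by case/nqP. Qed.

Lemma tnorm_nq : tnorm nq.
Proof.
split; first split.
- exact: nq_ge0.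
- move=> f g c K cf cg K0 fc; apply: nq_dom => //; exact: measurable_continuous_row.
- move=> f g c c' cf cg; apply: nq_add; exact: measurable_continuous_row.
- exact: nq_le.
- exact: nq_shift.
- move=> f c cf; apply: nq_sup; exact: measurable_continuous_row.
- exact: nq_inf.
Qed.

End LqNorm.

(** * Comparison and duality of L^q norms on a space of mass 1 *)

Section LqOrder.
Context {R : realType} {d : nat}.
Local Notation mu := (torus_measure d : probability _ R).
Local Notation row := (@row_of_tuple R d).
Implicit Types f g : 'rV[R]_d -> R.

(** Hoelder's inequality against the constant 1, whose norm is 1. *)
Lemma nq_mono (r q : R) f (c : R) : 1 <= r -> r <= q -> mrow f -> nq q f c -> nq r f c.
Proof.
move=> r1; rewrite le_eqVlt => /predU1P[<-//|rq] mf.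
have r0 : 0 < r by exact: lt_le_trans r1.
have q0 : 0 < q by exact: lt_trans rq.
have q1 : 1 <= q by exact: le_trans (ltW rq).
move=> fc; have c0 := nq_ge0 q1 fc.
have mp : mrow (fun x => `|f x| `^ r).
  by apply: (measurableT_comp (measurable_powR r)); exact: (measurableT_comp (@normr_measurable R setT)).
pose P := q / r.
have P1 : 1 < P by rewrite /P ltr_pdivlMr// mul1r.
have P0 : 0 < P by exact: lt_trans P1.
pose Q := P / (P - 1).
have P1' : 0 < P - 1 by rewrite subr_gt0.
have Q0 : 0 < Q by rewrite divr_gt0.
have PQ : P^-1 + Q^-1 = 1 by rewrite /Q; field; rewrite !gt_eqF.
have := @hoelder _ _ _ mu (fun t => `|f (row t)| `^ r) (cst 1) P Q mp (measurable_cst _) P0 Q0 PQ.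
have -> : 'N[mu]_Q%:E[EFin \o cst 1%R]%E = 1%E.
  rewrite Lnorm_cst1.
  by transitivity (1 `^ Q^-1)%E; [congr (_ `^ _)%E; exact: probability_setT|exact: poweR1r].
rewrite mule1 Lnorm1 => H.
have fr : nq P (fun x => `|f x| `^ r) (c `^ r).
  apply/(nqP (ltW P1)); split; first exact: powR_ge0.
  have [_ fc'] := (nqP q1 f c).1 fc.
  have rP : r * P = q by rewrite /P mulrC divfK ?gt_eqF.
  rewrite -powRrM rP; apply: le_trans fc'; rewrite le_eqVlt; apply/orP; left; apply/eqP.
  apply: eq_integral => t _; congr EFin.
  by rewrite (ger0_norm (powR_ge0 _ _)) -powRrM rP.
apply/(nqP r1); split=> //.
apply: le_trans (le_trans H fr).
rewrite le_eqVlt; apply/orP; left; apply/eqP; apply: eq_integral => t _ /=.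
by rewrite mulr1 (ger0_norm (powR_ge0 _ _)).
Qed.

Lemma nq1_integ f (c : R) : mrow f -> nq 1 f c -> integ f /\ torus_integral (fun x => `|f x|) <= c.
Proof.
move=> mf /(nqP (lexx 1))[c0 fc].
have E : (\int[mu]_t (`|f (row t)| `^ 1)%:E = \int[mu]_t (`|f (row t)|)%:E)%E.
  by apply: eq_integral => t _; rewrite powRr1.
rewrite E powRr1// in fc.
have fi : integ f.
  apply/integrableP; split; first exact/measurable_EFinP.
  by apply: le_lt_trans fc _; exact: ltry.
split=> //; rewrite -lee_fin -integral_tint//; exact: integ_norm.
Qed.

Lemma nq_integ (q : R) f (c : R) : 1 <= q -> mrow f -> nq q f c -> integ f.
Proof. by move=> q1 mf /(nq_mono (lexx 1) q1 mf) /(nq1_integ mf)[]. Qed.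

Lemma nq_tint (q : R) f (c : R) : 1 <= q -> mrow f -> nq q f c -> `|torus_integral f| <= c.
Proof.
move=> q1 mf /(nq_mono (lexx 1) q1 mf) /(nq1_integ mf)[fi fc].
exact: le_trans (normr_tint fi) fc.
Qed.

(** Both factors are brought down to L^2, which is where 2 <= q enters; no conjugate exponent has to
    be introduced. *)
Lemma nq_hoelder (q : R) f g (a b : R) : 2 <= q -> mrow f -> mrow g ->
  nq q f a -> nq q g b -> nq 1 (fun x => f x * g x) (a * b).
Proof.
move=> q2 mf mg fa gb; have one2 : 1 <= 2 :> R by rewrite ler1n.
have {}fa := nq_mono one2 q2 mf fa; have {}gb := nq_mono one2 q2 mg gb.
have a0 := nq_ge0 one2 fa.
have E : (2^-1 + 2^-1 = 1 :> R) by field.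
have := @hoelder _ _ _ mu (f \o row) (g \o row) 2 2 mf mg (ltr0Sn _ 1) (ltr0Sn _ 1) E.
move=> H; apply: (le_trans H); rewrite EFinM.
apply: lee_pmul => //; exact: Lnorm_ge0.
Qed.

Lemma nqZ (q : R) f (a c : R) : 1 <= q -> mrow f -> nq q f c -> nq q (fun x => a * f x) (`|a| * c).
Proof.
move=> q1 mf fc; apply: (nq_dom q1 mf _ (normr_ge0 a) fc) => [|x]; last by rewrite normrM.
by apply: mrowM => //; exact: measurable_cst.
Qed.

End LqOrder.

Lemma mrow_sum {R : realType} {d : nat} (I : Type) (r : seq I) (F : I -> 'rV[R]_d -> R) :
  (forall i, mrow (F i)) -> mrow (fun x => \sum_(i <- r) F i x).
Proof.
move=> mF; have := @measurable_sum _ _ R setT _ r (fun i t => F i (row_of_tuple t)) mF.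
by [].
Qed.

(** * Series of L^q functions with summable norms *)

Section LqSeries.
Context {R : realType} {d : nat}.
Local Notation mu := (torus_measure d : probability _ R).
Local Notation row := (@row_of_tuple R d).
Variables (q : R) (q1 : 1 <= q).
Variables (g_ : nat -> 'rV[R]_d -> R) (c_ : nat -> R) (M : R).
Hypotheses (mg : forall l, mrow (g_ l)) (gc : forall l, nq q (g_ l) (c_ l)).
Hypothesis cM : forall n, \sum_(l < n) c_ l <= M.

Let S n x := \sum_(l < n) g_ l x.
Let Gs (t : d.-tuple (measurableTypeR R)) : \bar R := (\sum_(0 <= l <oo) (`|g_ l (row t)|)%:E)%E.

Let mS n : mrow (S n).
Proof. exact: mrow_sum. Qed.

Let mabs l : measurable_fun setT (fun t => (`|g_ l (row t)|)%:E).
Proof.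
by apply/measurable_EFinP; exact: (measurableT_comp (@normr_measurable R setT) (mg l)).
Qed.

Let mGs : measurable_fun setT Gs.
Proof. by apply: ge0_emeasurable_sum => // l _; exact: mabs. Qed.

Let Gs_ge0 t : (0 <= Gs t)%E.
Proof. by apply: nneseries_ge0 => l _ _; rewrite lee_fin. Qed.

Let iGs : mu.-integrable setT Gs.
Proof.
apply/integrableP; split=> //; apply: (@le_lt_trans _ _ M%:E); last exact: ltry.
under eq_integral do rewrite gee0_abs//.
rewrite /Gs integral_nneseries//.
apply: lime_le; first by apply: is_cvg_nneseries => l _ _; exact: integral_ge0.
apply: nearW => n; rewrite big_mkord; apply: le_trans (_ : (\sum_(l < n) (c_ l)%:E <= _)%E); last first.
  by rewrite sumEFin lee_fin.
apply: lee_sum => l _.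
have [h1 h2] := nq1_integ (mg l) (nq_mono (lexx 1) q1 (mg l) (gc l)).
by have := integral_tint (integ_norm h1) => ->; rewrite lee_fin.
Qed.

Let S_le n t : (`|(S n (row t))%:E| <= Gs t)%E.
Proof.
apply: le_trans (nneseries_lim_ge n _); last by move=> l _ _; rewrite lee_fin.
rewrite big_mkord sumEFin lee_fin; exact: ler_norm_sum.
Qed.

(** The upper limit is defined and measurable everywhere; almost everywhere it is the sum of the
    series, because the sum of the absolute values is integrable. *)
Let g x : R := fine (limn_esup (fun n => (S n x)%:E)).

Let S_cvg : \forall t \ae mu, S n (row t) @[n --> \oo] --> g (row t).
Proof.
apply: filterS (integrable_ae measurableT iGs) => t /(_ I) fin.
have cS : cvgn (series (fun l => g_ l (row t))).
  apply: normed_cvg; apply: nondecreasing_is_cvgn.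
    exact: (@nondecreasing_series R (fun l => `|g_ l (row t)|) xpredT 0 (fun _ _ _ => normr_ge0 _)).
  exists (fine (Gs t)) => _ [n _ <-]; rewrite -lee_fin fineK//=.
  have := @nneseries_lim_ge R (fun l => (`|g_ l (row t)|)%:E) xpredT 0 n.
  by rewrite -/(Gs t) sumEFin; apply=> l _ _; rewrite lee_fin.
have cS' : S n (row t) @[n --> \oo] --> limn (series (fun l => g_ l (row t))).
  have -> : (fun n => S n (row t)) = series (fun l => g_ l (row t)).
    by apply/funext => n; rewrite /series/= big_mkord.
  exact: cS.
have /cvg_limn_einf_sup[_ E] : (S n (row t))%:E @[n --> \oo] --> (limn (series (fun l => g_ l (row t))))%:E.
  by apply: cvg_EFin; [exact: nearW|exact: cS'].
by rewrite /g E.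
Qed.

Let mg_lim : mrow g.
Proof.
apply: (measurableT_comp (@fine_measurable R setT measurableT)).
by apply: measurable_fun_limn_esup => n; apply/measurable_EFinP; exact: mS.
Qed.

(** Fatou's lemma for the norm, dominated convergence for the pairings. The bound [c] of the limit
    is kept apart from the sum [M] of the norms, because in [riesz_fischer] the partial sums are
    better bounded than [M] tells. *)
Lemma Lq_series : exists g : 'rV[R]_d -> R, [/\ mrow g,
  forall c, (forall n, nq q (fun x => \sum_(l < n) g_ l x) c) -> nq q g c
  & forall phi C, mrow phi -> supb phi C ->
     torus_integral (fun x => (\sum_(l < n) g_ l x) * phi x) @[n --> \oo] -->
     torus_integral (fun x => g x * phi x)].
Proof.
exists g; split; first exact: mg_lim.
  move=> c H; apply: (nqP q1 _ c).2; split; first exact: nq_ge0 (H 0%N).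
  apply: (@le_trans _ _ (\int[mu]_t limn_einf (fun n => (`|S n (row t)| `^ q)%:E))%E).
    rewrite le_eqVlt; apply/orP; left; apply/eqP; apply: ge0_ae_eq_integral => //.
    - by apply: mrow_pow; exact: mg_lim.
    - rewrite (_ : (fun t => _) = (fun t => - limn_esup (fun n => - (`|S n (row t)| `^ q)%:E))%E); last first.
        by apply/funext => t; rewrite (limn_esupN (fun n => (`|S n (row t)| `^ q)%:E)) oppeK.
      apply: measurableT_comp => //; apply: measurable_fun_limn_esup => n.
      by apply: measurableT_comp => //; apply: mrow_pow; exact: mS.
    - move=> t _; rewrite limn_einf_lim; apply: lime_ge; first exact: is_cvg_einfs.
      apply: nearW => n; apply: le_ereal_inf_tmp => _ [k _ <-].
      by rewrite lee_fin powR_ge0.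
    - suff A : \forall t \ae mu, [set: d.-tuple (measurableTypeR R)] t ->
          (`|g (row t)| `^ q)%:E = limn_einf (fun n => (`|S n (row t)| `^ q)%:E) by exact: A.
      have FF : Filter (almost_everywhere mu) by exact: ae_filter_ringOfSetsType.
      apply: (@filterS _ _ FF _ _ _ S_cvg) => t St _; apply/esym.
      apply: (cvg_limn_einf_sup _).1; apply: cvg_EFin; first exact: nearW.
      exact: (cvg_comp _ (fun x => `|x| `^ q) St (@continuous_normpow R q q1 _)).
  apply: le_trans (fatou mu measurableT _ _) _ => //.
    by move=> n; apply: mrow_pow; exact: mS.
  rewrite limn_einf_lim; apply: lime_le; first exact: is_cvg_einfs.
  apply: nearW => n; apply: le_trans (_ : (\int[mu]_t (`|S n (row t)| `^ q)%:E <= _)%E).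
    by apply: ereal_inf_lbound; exists n => /=.
  exact: ((nqP q1 _ c).1 (H n)).2.
move=> phi C mphi phiC.
have C0 : 0 <= C by exact: le_trans (phiC 0).
have mSphi n : mrow (fun x => S n x * phi x) by exact: mrowM.
have FF : Filter (almost_everywhere mu) by exact: ae_filter_ringOfSetsType.
have A1 : \forall t \ae mu, [set: d.-tuple (measurableTypeR R)] t ->
    (S n (row t) * phi (row t))%:E @[n --> \oo] --> (g (row t) * phi (row t))%:E.
  apply: (@filterS _ _ FF _ _ _ S_cvg) => t St _; apply: cvg_EFin; first exact: nearW.
  by apply: cvgM => //; exact: cvg_cst.
have A2 : \forall t \ae mu, forall n, [set: d.-tuple (measurableTypeR R)] t ->
    (`|(S n (row t) * phi (row t))%:E| <= C%:E * Gs t)%E.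
  apply: aeW => t n _; rewrite EFinM abseM muleC.
  apply: lee_pmul; [exact: abse_ge0|exact: abse_ge0| |exact: S_le].
  by rewrite lee_fin; exact: phiC.
have m1 n : measurable_fun setT (fun t : d.-tuple (measurableTypeR R) => (S n (row t) * phi (row t))%:E).
  by apply/measurable_EFinP; exact: (mSphi n).
have m2 : measurable_fun setT (fun t : d.-tuple (measurableTypeR R) => (g (row t) * phi (row t))%:E).
  by apply/measurable_EFinP; exact: (mrowM mg_lim mphi).
have [iG _ L] := dominated_convergence measurableT m1 m2 A1 (integrableZl measurableT C iGs) A2.
have iG' : integ (fun x => g x * phi x) by exact: iG.
have EG := integral_tint iG'.
rewrite EG in L.
exact: (fine_cvg L).
Qed.

End LqSeries.

(** * Witnesses for bounds of the norm of H^{t,q} *)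

Section HNorm.
Context {R : realType} {d : nat}.
Implicit Types (T : functional R d) (f g : 'rV[R]_d -> R) (k : 'rV[int]_d) (P : @trig R d).

Lemma freq_norm_kk k : 1 + freq_norm k ^+ 2 = AA k :> R.
Proof. by rewrite /freq_norm sqr_sqrtr// kk_ge0. Qed.

(** A bound for [H_norm] that exhibits the Bessel potential and stays in the reals. As [H_norm] is
    an infimum, a strict inequality is used to get it back. *)
Definition hn (t q : R) T (c : R) : Prop :=
  exists g, [/\ mrow g, nq q g c & bessel_potential t T g].

Lemma H_norm_le t q T (c : R) : 1 <= q -> hn t q T c -> (H_norm t q T <= c%:E)%E.
Proof.
move=> q1 [g [mg gc bg]]; apply: ge_ereal_inf; exists (Lq_norm q g) => //.
by exists g => //; split=> //; apply/in_LqP; split=> //; exists c.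
Qed.

Lemma H_norm_lt t q T (c : R) : 1 <= q -> (H_norm t q T < c%:E)%E -> hn t q T c.
Proof.
move=> q1 /ereal_inf_lt[_ [g [/in_LqP[mg _] bg] <-] gc].
by exists g; split=> //; exact: ltW.
Qed.

Lemma hn_le t q T (c c' : R) : hn t q T c -> c <= c' -> hn t q T c'.
Proof. by move=> [g [mg gc bg]] cc; exists g; split=> //; exact: nq_le gc cc. Qed.

Lemma hn_ext t q T T' (c : R) :
  (forall k, T (cos \o phase k) = T' (cos \o phase k) /\ T (sin \o phase k) = T' (sin \o phase k)) ->
  hn t q T c -> hn t q T' c.
Proof.
move=> E [g [mg gc bg]]; exists g; split=> // k.
by have [<- <-] := E k.
Qed.

Lemma nq_sum (q : R) (I : Type) (r : seq I) (F : I -> 'rV[R]_d -> R) (c : I -> R) : 1 <= q ->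
  (forall i, mrow (F i)) -> (forall i, nq q (F i) (c i)) ->
  nq q (fun x => \sum_(i <- r) F i x) (\sum_(i <- r) c i).
Proof.
move=> q1 mF Fc; elim: r => [|i r IH].
  rewrite big_nil (_ : (fun x => _) = (fun=> 0)); last by apply/funext => x; rewrite big_nil.
  by apply: nq_sup => [//||x]; [exact: measurable_cst|rewrite normr0].
rewrite big_cons (_ : (fun x => _) = (fun x => F i x + \sum_(j <- r) F j x)).
  apply: nq_add => //.
  exact: mrow_sum.
by apply/funext => x; rewrite big_cons.
Qed.

(** Absolutely convergent series in H^{t,q}. The limit only has to have the right Fourier
    coefficients: these identify the sum of the potentials as the potential of the limit. *)
Lemma hn_series t q T (T_ : nat -> functional R d) (c_ : nat -> R) (M : R) : 1 <= q ->
  (forall l, hn t q (T_ l) (c_ l)) -> (forall n, \sum_(l < n) c_ l <= M) ->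
  (forall k, (\sum_(l < n) T_ l (cos \o phase k)) @[n --> \oo] --> T (cos \o phase k) /\
             (\sum_(l < n) T_ l (sin \o phase k)) @[n --> \oo] --> T (sin \o phase k)) ->
  hn t q T M.
Proof.
move=> q1 hT cM cvT; have [g_ Hg] := choice hT.
have mg l : mrow (g_ l) by case: (Hg l).
have gc l : nq q (g_ l) (c_ l) by case: (Hg l).
have bg l : bessel_potential t (T_ l) (g_ l) by case: (Hg l).
have [g [mg' ng cg]] := Lq_series q1 mg gc cM.
exists g; split=> //.
  apply: ng => n; apply: nq_le _ (cM n).
  exact: (nq_sum (index_enum 'I_n) q1 (fun l : 'I_n => mg l) (fun l : 'I_n => gc l)).
have ig l : integ (g_ l) by exact: nq_integ q1 (mg l) (gc l).
move=> k; split.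
  have H := cg _ 1 (integ_mrow (integ_cosp k)) (fun x => cos_max _).
  have E n : torus_integral (fun x => (\sum_(l < n) g_ l x) * cos (phase k x)) =
    (1 + freq_norm k ^+ 2) `^ (t / 2) * \sum_(l < n) T_ l (cos \o phase k).
    rewrite mulr_sumr; under [in LHS]eq_fun do rewrite mulr_suml.
    rewrite tint_sum => [|l]; last exact: integ_fcos.
    by apply: eq_bigr => l _; have [<- _] := bg l k.
  have K : (1 + freq_norm k ^+ 2) `^ (t / 2) * (\sum_(l < n) T_ l (cos \o phase k)) @[n --> \oo] -->
     (1 + freq_norm k ^+ 2) `^ (t / 2) * T (cos \o phase k).
    by apply: cvgM; [exact: cvg_cst|exact: (cvT k).1].
  by move: H; under eq_fun do rewrite E; move=> H; apply: (cvg_unique _ H K).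
have H := cg _ 1 (integ_mrow (integ_sinp k)) (fun x => sin_max _).
have E n : torus_integral (fun x => (\sum_(l < n) g_ l x) * sin (phase k x)) =
  (1 + freq_norm k ^+ 2) `^ (t / 2) * \sum_(l < n) T_ l (sin \o phase k).
  rewrite mulr_sumr; under [in LHS]eq_fun do rewrite mulr_suml.
  rewrite tint_sum => [|l]; last exact: integ_fsin.
  by apply: eq_bigr => l _; have [_ <-] := bg l k.
have K : (1 + freq_norm k ^+ 2) `^ (t / 2) * (\sum_(l < n) T_ l (sin \o phase k)) @[n --> \oo] -->
   (1 + freq_norm k ^+ 2) `^ (t / 2) * T (sin \o phase k).
  by apply: cvgM; [exact: cvg_cst|exact: (cvT k).2].
by move: H; under eq_fun do rewrite E; move=> H; apply: (cvg_unique _ H K).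
Qed.

End HNorm.

(** * Fourier coefficients of polynomials and of test functions *)

Section Fourier.
Context {R : realType} {d : nat}.
Implicit Types (f g : 'rV[R]_d -> R) (k l : 'rV[int]_d) (P : @trig R d) (m : 'rV[int]_d -> R).

Lemma tint_cc k l : torus_integral (fun x : 'rV[R]_d => cos (phase k x) * cos (phase l x)) =
  2^-1 * ((k == l)%:R + (k == - l)%:R).
Proof.
rewrite (_ : (fun x => _) = (fun x => 2^-1 * (cos (phase (k - l) x) + cos (phase (k + l) x)))); last first.
  by apply/funext => x; rewrite !phaseDk phaseNk cosB cosD; field.
rewrite tintZ; last by apply: integD; exact: integ_cosp.
rewrite tintD; [|exact: integ_cosp|exact: integ_cosp].
by rewrite !tint_cosp subr_eq0 addr_eq0.
Qed.

Lemma tint_ss k l : torus_integral (fun x : 'rV[R]_d => sin (phase k x) * sin (phase l x)) =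
  2^-1 * ((k == l)%:R - (k == - l)%:R).
Proof.
rewrite (_ : (fun x => _) = (fun x => 2^-1 * (cos (phase (k - l) x) - cos (phase (k + l) x)))); last first.
  by apply/funext => x; rewrite !phaseDk phaseNk cosB cosD; field.
rewrite tintZ; last by apply: integB; exact: integ_cosp.
rewrite tintB; [|exact: integ_cosp|exact: integ_cosp].
by rewrite !tint_cosp subr_eq0 addr_eq0.
Qed.

Lemma tint_sc k l : torus_integral (fun x : 'rV[R]_d => sin (phase k x) * cos (phase l x)) = 0.
Proof.
rewrite (_ : (fun x => _) = (fun x => 2^-1 * (sin (phase (k - l) x) + sin (phase (k + l) x)))); last first.
  by apply/funext => x; rewrite !phaseDk phaseNk sinB sinD; field.
rewrite tintZ; last by apply: integD; exact: integ_sinp.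
rewrite tintD; [|exact: integ_sinp|exact: integ_sinp].
by rewrite !tint_sinp addr0 mulr0.
Qed.

Lemma fcos_tev P k : fcos (tev P) k = \sum_(t <- P) t.2.1 * (2^-1 * ((t.1 == k)%:R + (t.1 == - k)%:R)).
Proof.
rewrite /fcos (_ : (fun y => _) = (fun y => \sum_(t <- P)
   (t.2.1 * (cos (phase t.1 y) * cos (phase k y)) + t.2.2 * (sin (phase t.1 y) * cos (phase k y))))); last first.
  by apply/funext => y; rewrite /tev mulr_suml; apply: eq_bigr => t _; ring.
have i1 l : integ (fun y : 'rV[R]_d => cos (phase l y) * cos (phase k y)) by apply: integ_fcos; exact: integ_cosp.
have i2 l : integ (fun y : 'rV[R]_d => sin (phase l y) * cos (phase k y)) by apply: integ_fcos; exact: integ_sinp.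
rewrite tint_sum => [|t]; last by apply: integD; exact: integZ.
apply: eq_bigr => t _; rewrite tintD; [|exact: integZ|exact: integZ].
by rewrite !tintZ// tint_cc tint_sc mulr0 addr0.
Qed.

Lemma fsin_tev P k : fsin (tev P) k = \sum_(t <- P) t.2.2 * (2^-1 * ((t.1 == k)%:R - (t.1 == - k)%:R)).
Proof.
rewrite /fsin (_ : (fun y => _) = (fun y => \sum_(t <- P)
   (t.2.1 * (sin (phase k y) * cos (phase t.1 y)) + t.2.2 * (sin (phase t.1 y) * sin (phase k y))))); last first.
  by apply/funext => y; rewrite /tev mulr_suml; apply: eq_bigr => t _; ring.
have i1 l : integ (fun y : 'rV[R]_d => sin (phase k y) * cos (phase l y)) by apply: integ_fcos; exact: integ_sinp.
have i2 l : integ (fun y : 'rV[R]_d => sin (phase l y) * sin (phase k y)) by apply: integ_fsin; exact: integ_sinp.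
rewrite tint_sum => [|t]; last by apply: integD; exact: integZ.
apply: eq_bigr => t _; rewrite tintD; [|exact: integZ|exact: integZ].
by rewrite !tintZ// tint_ss tint_sc mulr0 add0r.
Qed.

(** Terms of [P] at k and at - k both contribute to the coefficient at k, so the symbol has to be
    even. *)
Lemma fcos_tmul m P k : (forall k, m (- k) = m k) ->
  fcos (tev (tmul false m P)) k = m k * fcos (tev P) k.
Proof.
move=> mE; rewrite !fcos_tev big_map mulr_sumr; apply: eq_bigr => t _ /=.
have [->|tk] := eqVneq t.1 k; first by rewrite mulrA.
have [->|tk'] := eqVneq t.1 (- k); first by rewrite mE mulrA.
by rewrite add0r !mulr0.
Qed.

Lemma fsin_tmul m P k : (forall k, m (- k) = m k) ->
  fsin (tev (tmul false m P)) k = m k * fsin (tev P) k.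
Proof.
move=> mE; rewrite !fsin_tev big_map mulr_sumr; apply: eq_bigr => t _ /=.
have [->|tk] := eqVneq t.1 k; first by rewrite mulrA.
have [->|tk'] := eqVneq t.1 (- k); first by rewrite mE mulrA.
by rewrite subrr !mulr0.
Qed.

Lemma kkN k : kk (- k) = kk k :> R.
Proof. by apply: eq_bigr => i _; rewrite mxE mulrNz sqrrN. Qed.

Lemma AAN k : AA (- k) = AA k :> R.
Proof. by rewrite /AA kkN. Qed.

Lemma mrow_test f : test_function f -> mrow f.
Proof. by move=> tf; apply: measurable_continuous_row; exact: test_continuous. Qed.

Lemma integ_test f : test_function f -> integ f.
Proof. by move=> tf; exact: cper_integ (test_cper tf). Qed.

Lemma hn_trig (t q : R) P (c : R) :
  nq q (tev (tmul false (fun k => AA k `^ (t / 2)) P)) c -> hn t q (distr_of_fun (tev P)) c.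
Proof.
move=> H; exists (tev (tmul false (fun k => AA k `^ (t / 2)) P)); split=> //.
  by apply: mrow_test; exact: test_tev.
move=> k; rewrite freq_norm_kk; split.
  by apply: fcos_tmul => l; rewrite AAN.
by apply: fsin_tmul => l; rewrite AAN.
Qed.

Definition tsub P (Q : trig) : trig := P ++ tmul false (fun=> -1) Q.

Lemma tev_tsub P Q x : tev (tsub P Q) x = tev P x - tev Q x.
Proof.
rewrite /tsub {1}/tev big_cat/=; congr (_ + _).
rewrite -/(tev _ _) (_ : (fun=> -1) = (fun k => -1 * 1)) ?tmulZ ?tmul1 ?mulN1r//.
Qed.

Lemma bd_lam (B : ('rV[R]_d -> R) -> R -> Prop) n c (lam lam' : R) f : norm_like B -> 0 <= lam -> lam <= lam' ->
  bd B n c lam f -> bd B n c lam' f.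
Proof.
move=> nB l0 ll; elim: n c f => [|n IH] c f [Bf bf]; split=> // i.
apply: IH; apply: (bd_le nB l0) (bf i) _.
by rewrite ler_wpM2l// (nl_ge0 nB Bf).
Qed.

Lemma bd_tnorm (B : ('rV[R]_d -> R) -> R -> Prop) n c (lam : R) f : tnorm B -> sm n f ->
  bd supb n c lam f -> bd B n c lam f.
Proof.
move=> tB; elim: n c f => [|n IH] c f sf [Bf bf]; split=> //;
  try by apply: (tn_sup tB) => //; exact: sm_continuous sf.
by move=> i; apply: IH; [exact: sf.2|exact: bf].
Qed.

Section Transfer.
Variables (D : ('rV[R]_d -> R) -> 'rV[R]_d -> R) (n : nat) (K : R).
Hypothesis D_test : forall f, test_function f -> test_function (D f).
Hypothesis DB : forall f g, test_function f -> test_function g ->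
  D (fun x => f x - g x) = fun x => D f x - D g x.
Hypothesis D_sup : forall f e, test_function f -> bd supb n e 1 f -> supb (D f) (K * e).

(* Bounds for trigonometric polynomials pass to test functions by telescoping along a rapidly
   converging approximation. *)
Lemma hn_transfer (t q C lam : R) : 1 <= q -> 0 <= C -> 1 <= lam ->
  (forall P w, bd (nq q) n w lam (tev P) -> hn t q (distr_of_fun (D (tev P))) (C * w)) ->
  forall f w w', test_function f -> bd (nq q) n w lam f -> w < w' ->
    hn t q (distr_of_fun (D f)) (C * w').
Proof.
move=> q1 C0 lam1 H f w w' tf bf ww'.
have lam0 : 0 <= lam by exact: le_trans lam1.
have tB := @tnorm_nq R d q q1; have nB := tn_nl tB.
(* The errors e_m = e / 2^m cost e in the initial term and e_m + e_(m-1) in each correction, in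
   total e + e + 2 e = w' - w. *)
pose e := (w' - w) / 4; have e0 : 0 < e by rewrite divr_gt0// subr_gt0.
pose e_ (m : nat) : R := e * 2^-1 ^+ m.
have e_0 (m : nat) : 0 < e_ m by rewrite mulr_gt0// exprn_gt0.
have [P_ HP] := choice (fun m : nat => trig_dense n tf (e_0 m)).
have bfP (m : nat) : bd (nq q) n (e_ m) lam (fun x => f x - tev (P_ m) x).
  have tfP := testB tf (test_tev (P_ m)).
  by apply: (bd_tnorm tB (test_sm n tfP)); apply: (bd_lam supb_nl ler01 lam1 (HP m)).
pose Q_ (m : nat) : trig := if m is m'.+1 then tsub (P_ m) (P_ m') else P_ 0%N.
pose c_ (m : nat) : R := if m is m'.+1 then e_ m + e_ m' else w + e_ 0%N.
have bQ (m : nat) : bd (nq q) n (c_ m) lam (tev (Q_ m)).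
  case: m => [|m] /=.
    have := bdD nB (test_sm n tf) (smN (test_sm n (testB tf (test_tev (P_ 0%N)))))
      bf (bdN nB (test_sm n (testB tf (test_tev (P_ 0%N)))) (bfP 0%N)).
    rewrite (_ : (fun x => _) = tev (P_ 0%N))//.
    by apply/funext => x; rewrite opprB addrCA subrr addr0.
  have := bdD nB (smN (test_sm n (testB tf (test_tev (P_ m.+1))))) (test_sm n (testB tf (test_tev (P_ m))))
    (bdN nB (test_sm n (testB tf (test_tev (P_ m.+1)))) (bfP m.+1)) (bfP m).
  rewrite (_ : (fun x => _) = tev (tsub (P_ m.+1) (P_ m)))//.
  by apply/funext => x; rewrite tev_tsub; ring.
have sumD N x : \sum_(l < N.+1) D (tev (Q_ l)) x = D (tev (P_ N)) x.
  elim: N => [|N IH]; first by rewrite big_ord_recr big_ord0/= add0r.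
  rewrite big_ord_recr IH /= (_ : tev (tsub _ _) = fun x => tev (P_ N.+1) x - tev (P_ N) x); last first.
    by apply/funext => y; rewrite tev_tsub.
  by rewrite DB; [rewrite addrC subrK|exact: test_tev|exact: test_tev].
have e_cvg : e_ m @[m --> \oo] --> 0.
  have h : (2^-1 : R) ^+ m @[m --> \oo] --> 0 by apply: cvg_expr; rewrite gtr0_norm// invf_lt1// ltr1n.
  by have h2 := cvgM (cvg_cst e) h; rewrite mulr0 in h2; exact: h2.
have coef (phi : 'rV[R]_d -> R) : test_function phi -> supb phi 1 ->
   (\sum_(l < N) distr_of_fun (D (tev (Q_ l))) phi) @[N --> \oo] --> distr_of_fun (D f) phi.
  move=> tphi phi1; rewrite -cvg_shiftS/=.
  have E N : \sum_(l < N.+1) distr_of_fun (D (tev (Q_ l))) phi = distr_of_fun (D (tev (P_ N))) phi.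
    rewrite /distr_of_fun -tint_sum => [|l]; last by apply: integ_test; apply: testM => //; apply: D_test; exact: test_tev.
    by congr torus_integral; apply/funext => x; rewrite -mulr_suml sumD.
  under eq_fun do rewrite E.
  have K_cvg : K * e_ m @[m --> \oo] --> 0.
    by have h2 := cvgM (cvg_cst K) e_cvg; rewrite mulr0 in h2; exact: h2.
  apply/cvgrPdist_le => a a0.
  have /cvgrPdist_le/(_ a a0) := K_cvg.
  apply: filterS => N; rewrite sub0r normrN => h.
  apply: le_trans (le_trans (ler_norm _) h).
  have tP := test_tev (P_ N).
  rewrite /distr_of_fun -tintB; [|by apply: integ_test; apply: testM => //; exact: D_test|by apply: integ_test; apply: testM => //; exact: D_test].
  apply: tint_bound.
    by apply: integB; apply: integ_test; apply: testM => //; exact: D_test.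
  move=> x; rewrite -mulrBl normrM -[leRHS]mulr1.
  have := D_sup (testB tf tP) (HP N) x; rewrite DB// => h2.
  exact: ler_pM (normr_ge0 _) (normr_ge0 _) h2 (phi1 x).
apply: (@hn_series _ _ t q _ (fun l : nat => distr_of_fun (D (tev (Q_ l)))) (fun l : nat => C * c_ l)) => //.
- by move=> l; exact: H.
- move=> N; rewrite -mulr_sumr ler_wpM2l//.
  have bnd (M : nat) : \sum_(l < M.+1) c_ l <= w + 4 * e - 3 * e_ M.
    elim: M => [|M IH].
      by rewrite big_ord_recr big_ord0/= /e_ expr0 mulr1; move: e0; lra.
    rewrite big_ord_recr/=; apply: le_trans (lerD IH (lexx _)) _.
    by rewrite /e_ exprS; move: (e_0 M); rewrite /e_; set z := _ ^+ M; lra.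
  have we : w + 4 * e = w' by rewrite /e; field.
  case: N => [|N]; first by rewrite big_ord0; apply: le_trans (ltW ww'); exact: (nl_ge0 nB (bd0 bf)).
  by apply: le_trans (bnd N) _; rewrite we gerBl mulr_ge0// ltW.
- move=> k; split; apply: coef.
  + exact: test_cosp.
  + by move=> x; exact: cos_max.
  + exact: test_sinp.
  + by move=> x; exact: sin_max.
Qed.

End Transfer.

Definition lap f : 'rV[R]_d -> R := fun x => \sum_(i < d) partial i (partial i f) x.

Lemma test_lap f : test_function f -> test_function (lap f).
Proof. by move=> tf; apply: test_sum => i; do 2 apply: test_partial. Qed.

Lemma partial_testB i f g : test_function f -> test_function g ->
  partial i (fun x => f x - g x) = fun x => partial i f x - partial i g x.
Proof. by move=> tf tg; apply: partialB => x; exact: test_diff. Qed.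

Lemma lap_testB f g : test_function f -> test_function g ->
  lap (fun x => f x - g x) = fun x => lap f x - lap g x.
Proof.
move=> tf tg; apply/funext => x; rewrite /lap -sumrB; apply: eq_bigr => i _.
by rewrite !partial_testB//; exact: test_partial.
Qed.

Lemma partial_supb n i f (e : R) : bd supb n.+1 e 1 f -> supb (partial i f) (1 * e).
Proof. by move=> /(bd_partial i)/bd0; rewrite mulr1 mul1r. Qed.

Lemma lap_supb n f (e : R) : bd supb n.+2 e 1 f -> supb (lap f) (d%:R * e).
Proof.
move=> b x; rewrite /lap; apply: le_trans (ler_norm_sum _ _ _) _.
apply: le_trans (ler_sum _ (_ : forall i, _ -> _ <= e)) _.
  by move=> i _; have := bd0 (bd_partial i (bd_partial i b)) x; rewrite !mulr1.
by rewrite sumr_const card_ord mulr_natl.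
Qed.

Lemma fcos_lap f k : test_function f -> fcos (lap f) k = - (2 * pi) ^+ 2 * kk k * fcos f k.
Proof.
move=> tf; rewrite /fcos /lap.
under eq_fun do rewrite mulr_suml.
have tp i := test_partial i tf.
rewrite tint_sum => [|i]; last by apply: integ_fcos; apply: integ_test; apply: test_partial.
rewrite /kk mulr_sumr mulr_suml; apply: eq_bigr => i _.
by have := fcos_partial i k (tp i); rewrite (fsin_partial i k tf) /fcos => ->; ring.
Qed.

Lemma fsin_lap f k : test_function f -> fsin (lap f) k = - (2 * pi) ^+ 2 * kk k * fsin f k.
Proof.
move=> tf; rewrite /fsin /lap.
under eq_fun do rewrite mulr_suml.
have tp i := test_partial i tf.
rewrite tint_sum => [|i]; last by apply: integ_fsin; apply: integ_test; apply: test_partial.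
rewrite /kk mulr_sumr mulr_suml; apply: eq_bigr => i _.
by have := fsin_partial i k (tp i); rewrite (fcos_partial i k tf) /fsin => ->; ring.
Qed.

End Fourier.

(** * Sums over dyadic families *)

Section Families.
Context {R : realType} {d : nat}.
Implicit Types (f : 'rV[R]_d -> R) (k : 'rV[int]_d) (P : @trig R d).

Lemma tev_lap P : lap (tev P) = tev (tmul false (fun k => - (2 * pi) ^+ 2 * kk k) P).
Proof.
apply/funext => x; rewrite tev_tmul.
have -> : lap (tev P) x = \sum_(t <- P) \sum_(i < d) - ((2 * pi * (t.1 0 i)%:~R) ^+ 2) * tbase false t x.
  rewrite exchange_big/=; apply: eq_bigr => i _.
  rewrite !partial_tev !trig_partialE tmul_compt tev_tmul; apply: eq_bigr => t _.
  by rewrite expr2.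
apply: eq_bigr => t _; rewrite -mulr_suml; congr (_ * _).
rewrite /kk mulr_sumr; apply: eq_bigr => i _.
by rewrite exprMn mulNr.
Qed.

Section Trig.
Variables (q : R) (q1 : 1 <= q).
Let tB := @tnorm_nq R d q q1.
Let nB := tn_nl tB.

(** As |k|^2 = A - 1, the symbol |k|^2 A^((s-2)/2) splits into A^(s/2) - A^((s-2)/2). Since s may be
    nonpositive, a positive order sg >= s is reached first and then lowered by negative powers of
    A. *)
Lemma trig_lap (s sg : R) : 0 < sg -> s <= sg -> exists n, exists2 C : R, 0 < C &
  forall P w lam, 1 <= lam -> bd (nq q) n w lam (tev P) ->
    hn (s - 2) q (distr_of_fun (lap (tev P))) (C * lam `^ sg * w).
Proof.
move=> s0 ssg.
pose m := Num.trunc (sg / 2); pose N := m.+1.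
have sN : sg < 2 * N%:R by rewrite mulrC -ltr_pdivrMr// truncnS_gt.
have [C C0 H] := bessel_pos tB s0 sN.
have b0 : 0 <= (sg - s) / 2 by rewrite divr_ge0// subr_ge0.
have [C1 C10 H1] := bessel_neg tB b0.
have b10 : 0 <= (sg - s) / 2 + 1 by rewrite addr_ge0.
have [C2 C20 H2] := bessel_neg tB b10.
have d1 : 1 <= 1 + d%:R :> R by rewrite lerDl.
pose K : R := (2 * pi) ^+ 2.
have K0 : 0 < K by rewrite exprn_gt0// mulr_gt0// pi_gt0.
pose D := (1 + d%:R) ^+ N : R.
have D1 : 1 <= D by rewrite exprn_ege1.
have D0 : 0 < D by exact: lt_le_trans D1.
exists (0 + N.*2)%N, (K * (C1 + C2) * (C * D)); first exact: (mulr_gt0 (mulr_gt0 K0 (addr_gt0 C10 C20)) (mulr_gt0 C0 D0)).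
move=> P w lam lam1 b.
have lam0 : 0 < lam by exact: lt_le_trans lam1.
have w0 := nl_ge0 nB (bd0 b).
have B1 : nq q (tev (tmul false (fun=> 1) P)) (D * w).
  by rewrite tmul1; apply: (nl_le nB) (bd0 b) _; rewrite ler_peMl.
have B2 : nq q (tev (tmul false (fun k => AA k ^+ N * 1) P)) (lam ^+ (2 * N) * (D * w)).
  rewrite (@tmul_ext _ _ _ _ (fun k => AA k ^+ N)); last by move=> t _; rewrite mulr1.
  have := bd0 (bd_AA tB lam1 b); rewrite exprMn -exprM.
  by rewrite (_ : lam ^+ (2 * N) * (D * w) = (1 + d%:R) ^+ N * lam ^+ (2 * N) * w)// /D; ring.
have B3 := H false (fun=> 1) P (D * w) lam lam1 B1 B2.
have B4 := H1 _ _ _ _ B3; have B5 := H2 _ _ _ _ B3.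
rewrite tev_lap; apply: hn_trig; rewrite tmul_comp.
set c := C * lam `^ sg * (D * w) in B4 B5.
have c0 : 0 <= c by rewrite /c !mulr_ge0// ?powR_ge0// ltW.
have -> : K * (C1 + C2) * (C * D) * lam `^ sg * w = K * (C1 * c) + K * (C2 * c) by rewrite /c; ring.
have A0 k : 0 < AA k :> R := AA_gt0 k.
rewrite (@tmul_ext _ _ _ _ (fun k => - K * (AA k `^ (- ((sg - s) / 2)) * (AA k `^ (sg / 2) * 1)) +
   K * (AA k `^ (- ((sg - s) / 2 + 1)) * (AA k `^ (sg / 2) * 1)))); last first.
  move=> t _; set A := AA t.1.
  have -> : kk t.1 = A - 1 by rewrite /A /AA addrAC subrr add0r.
  rewrite !mulr1 -!powRDp ?A0//.
  have -> : - ((sg - s) / 2) + sg / 2 = (s - 2) / 2 + 1 by field.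
  have -> : - ((sg - s) / 2 + 1) + sg / 2 = (s - 2) / 2 by field.
  rewrite powRDp ?A0// powRr1 ?(ltW (A0 _))// -/K; set z := A `^ _.
  have hr (x y c' : R) : x * (- c' * (y - 1)) = - c' * (x * y) + c' * x by ring.
  exact: hr.
rewrite (_ : tev _ = fun x => - K * tev (tmul false (fun k => AA k `^ (- ((sg - s) / 2)) * (AA k `^ (sg / 2) * 1)) P) x +
   K * tev (tmul false (fun k => AA k `^ (- ((sg - s) / 2 + 1)) * (AA k `^ (sg / 2) * 1)) P) x); last first.
  by apply/funext => x; rewrite tmulD !tmulZ.
apply: (nl_add nB); [by apply: contZ; exact: ctev|by apply: contZ; exact: ctev| |].
  by have := bZ tB (- K) (@ctev _ _ _) B4; rewrite normrN gtr0_norm.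
by have := bZ tB K (@ctev _ _ _) B5; rewrite gtr0_norm.
Qed.

(** For sg >= 1 a full derivative costs lam <= lam^sg; for sg < 1 the gain of negative order has to
    be used, through [bessel_partial]. *)
Lemma trig_partial_hn (i : 'I_d) (r sg : R) : 0 < sg -> r <= 0 -> r <= sg - 1 -> exists2 C : R, 0 < C &
  forall P w lam, 1 <= lam -> bd (nq q) 1 w lam (tev P) ->
    hn r q (distr_of_fun (partial i (tev P))) (C * lam `^ sg * w).
Proof.
move=> s0 r0 rsg; have [sg1|sg1] := leP 1 sg.
  have b0 : 0 <= - r / 2 by rewrite divr_ge0// oppr_ge0.
  have [C C0 H] := bessel_neg tB b0.
  exists C => // P w lam lam1 b; have w0 := nl_ge0 nB (bd0 b).
  rewrite partial_tev; apply: hn_trig.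
  have b1 : nq q (tev (tmul false (fun=> 1) (trig_partial i P))) (w * lam).
    by rewrite tmul1 -partial_tev; exact: (bd0 (bd_partial i b)).
  have := H _ _ _ _ b1.
  rewrite (@tmul_ext _ _ _ _ (fun k => AA k `^ (r / 2))); last first.
    by move=> t _; rewrite mulr1 mulNr opprK.
  move=> /(nl_le nB); apply.
  rewrite -mulrA ler_wpM2l ?(ltW C0)// mulrC ler_wpM2r//.
  rewrite -[leLHS]powRr1 ?(le_trans _ lam1)//.
  by apply: ler_powR.
have [C C0 H] := bessel_partial tB i s0 sg1.
have b0 : 0 <= (sg - 1 - r) / 2 by rewrite divr_ge0// subr_ge0.
have [C1 C10 H1] := bessel_neg tB b0.
have p0 : 0 < 2 * pi :> R by rewrite mulr_gt0// pi_gt0.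
exists (2 * pi * C1 * C); first by rewrite !mulr_gt0// pi_gt0.
move=> P w lam lam1 b; have w0 := nl_ge0 nB (bd0 b).
have lam0 : 0 <= lam by exact: le_trans lam1.
have B1 : nq q (tev (tmul true (fun k => (k 0 i)%:~R) P)) (lam * w).
  rewrite (_ : tev _ = fun x => (2 * pi)^-1 * partial i (tev P) x); last first.
    by apply/funext => x; rewrite tev_partial.
  apply: (nl_le nB) (bZ tB _ _ (bd0 (bd_partial i b))) _.
    by rewrite partial_tev; exact: ctev.
  rewrite ger0_norm ?invr_ge0 ?(ltW p0)// (mulrC w) ler_piMl ?mulr_ge0// invf_le1//.
  by have := pi_ge2 R; move: (pi : R) => z; lra.
have B2 := H1 _ _ _ _ (H P w lam lam1 (bd0 b) B1).
rewrite partial_tev trig_partialE; apply: hn_trig; rewrite tmul_comp.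
rewrite (@tmul_ext _ _ _ _ (fun k => (2 * pi) * (AA k `^ (- ((sg - 1 - r) / 2)) * (AA k `^ ((sg - 1) / 2) * (k 0 i)%:~R)))); last first.
  move=> t _; rewrite [X in _ = _ * X]mulrA -powRDp ?AA_gt0//.
  have -> : - ((sg - 1 - r) / 2) + (sg - 1) / 2 = r / 2 by field.
  by rewrite mulrCA.
rewrite (_ : tev _ = fun x => (2 * pi) * tev (tmul true (fun k => AA k `^ (- ((sg - 1 - r) / 2)) * (AA k `^ ((sg - 1) / 2) * (k 0 i)%:~R)) P) x); last first.
  by apply/funext => x; rewrite tmulZ.
have := bZ tB (2 * pi) (@ctev _ _ _) B2.
rewrite (gtr0_norm p0) => /(nl_le nB); apply.
rewrite le_eqVlt; apply/orP; left; apply/eqP.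
by move: (2 * pi) => z; ring.
Qed.

End Trig.

(** What survives of a Besov decomposition under nonlinear operations: pieces with derivative bounds
    at scale 2^j and l^p-summable weighted sizes, with no condition on their spectrum. *)
Definition dyadic_family (q p theta : R) n (F_ : nat -> 'rV[R]_d -> R) (W : nat -> R) (K : R) : Prop :=
  [/\ forall j, test_function (F_ j), forall j, bd (nq q) n (W j) (2 ^+ j) (F_ j)
    & forall N, \sum_(j < N) (2 `^ (j%:R * theta) * W j) `^ p <= K `^ p].

Definition coefs (F_ : nat -> 'rV[R]_d -> R) (A B : 'rV[int]_d -> R) : Prop :=
  forall k, (\sum_(j < N) fcos (F_ j) k) @[N --> \oo] --> A k /\
            (\sum_(j < N) fsin (F_ j) k) @[N --> \oo] --> B k.

(** Only values on cosines and sines are prescribed, because [hn] tests nothing else. *)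
Definition lap_of (A B : 'rV[int]_d -> R) (S : functional R d) : Prop :=
  forall k, S (cos \o phase k) = - (2 * pi) ^+ 2 * kk k * A k /\
            S (sin \o phase k) = - (2 * pi) ^+ 2 * kk k * B k.

Definition partial_of i (A B : 'rV[int]_d -> R) (S : functional R d) : Prop :=
  forall k, S (cos \o phase k) = 2 * pi * (k 0 i)%:~R * B k /\
            S (sin \o phase k) = - (2 * pi * (k 0 i)%:~R) * A k.

(** The common interface of the two regimes: [lossy_lap] provides it for s < theta, [plancherel_lap]
    for theta = s and p = q = 2. *)
Definition lap_bound (t q p theta : R) : Prop := exists n, exists2 C : R, 0 < C &
  forall F_ W K A B S, 0 < K -> dyadic_family q p theta n F_ W K -> coefs F_ A B -> lap_of A B S ->
    hn t q S (C * K).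

Definition partial_bound (t q p theta : R) : Prop := exists n, exists2 C : R, 0 < C &
  forall i F_ W K A B S, 0 < K -> dyadic_family q p theta n F_ W K -> coefs F_ A B -> partial_of i A B S ->
    hn t q S (C * K).

Lemma family_le (q p theta : R) n F_ W K : 1 <= q -> 0 < p -> 0 < K -> dyadic_family q p theta n F_ W K ->
  forall j, W j <= K * 2 `^ (- (j%:R * theta)).
Proof.
move=> q1 p0 K0 [tf bf sf] j.
have W0 i : 0 <= W i by exact: (nl_ge0 (tn_nl (tnorm_nq q1)) (bd0 (bf i))).
have e0 : 0 < 2 `^ (j%:R * theta) :> R by exact: powR_gt0.
rewrite powRN ler_pdivlMr// mulrC.
have h : (2 `^ (j%:R * theta) * W j) `^ p <= K `^ p.
  apply: le_trans (sf j.+1); rewrite big_ord_recr/= lerDr.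
  by apply: sumr_ge0 => i _; exact: powR_ge0.
rewrite leNgt; apply/negP => lt.
have a1 : K \is Num.nneg by rewrite nnegrE ltW.
have a2 : 2 `^ (j%:R * theta) * W j \is Num.nneg by rewrite nnegrE mulr_ge0// ltW.
by have := gt0_ltr_powR p0 a1 a2 lt; rewrite ltNge h.
Qed.

Lemma geom_le (x : R) N : 0 <= x -> x < 1 -> \sum_(j < N) x ^+ j <= (1 - x)^-1.
Proof.
move=> x0 x1; have x1' : 0 < 1 - x by rewrite subr_gt0.
rewrite -(ler_pM2l x1') divff ?gt_eqF//.
have -> : (1 - x) * \sum_(j < N) x ^+ j = 1 - x ^+ N by rewrite -opprB mulNr -subrX1 opprB.
by rewrite gerBl exprn_ge0.
Qed.

(** * Summation block by block when theta > s *)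

Section Lossy.
Variables (q p theta sg : R).
Hypotheses (q1 : 1 <= q) (p0 : 0 < p) (sg0 : 0 < sg) (sgth : sg < theta).

(** Block j costs 2^(j sg) W_j <= K 2^(j (sg - theta)), a convergent geometric series because sg <
    theta. *)
Lemma lossy_bound (t C : R) (D : ('rV[R]_d -> R) -> 'rV[R]_d -> R) n : 0 < C ->
  (forall f w w' lam, test_function f -> bd (nq q) n w lam f -> 1 <= lam -> w < w' ->
    hn t q (distr_of_fun (D f)) (C * lam `^ sg * w')) ->
  exists2 C' : R, 0 < C' & forall F_ W K S, 0 < K -> dyadic_family q p theta n F_ W K ->
    (forall k, (\sum_(j < N) distr_of_fun (D (F_ j)) (cos \o phase k)) @[N --> \oo] --> S (cos \o phase k) /\
       (\sum_(j < N) distr_of_fun (D (F_ j)) (sin \o phase k)) @[N --> \oo] --> S (sin \o phase k)) ->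
    hn t q S (C' * K).
Proof.
move=> C0 H; pose x : R := 2 `^ (sg - theta).
have x0 : 0 < x by exact: powR_gt0.
have x1 : x < 1.
  rewrite /x /powR gt_eqF// expR_lt1 nmulr_rlt0 ?subr_lt0//.
  by rewrite ln_gt0// ltr1n.
have x1' : 0 < 1 - x by rewrite subr_gt0.
exists (2 * C / (1 - x)); first by rewrite divr_gt0// mulr_gt0.
move=> F_ W K S K0 fam cS.
have Wle := family_le q1 p0 K0 fam.
have [tf bf _] := fam.
apply: (@hn_series _ _ t q S (fun j => distr_of_fun (D (F_ j))) (fun j => 2 * C * K * x ^+ j)) => //.
- move=> j.
  have lam1 : 1 <= 2 ^+ j :> R by rewrite exprn_ege1// ler1n.
  (* [H] asks for a bound strictly above [W j]; adding K 2^(- j theta) only doubles the constant. *)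
  have lt : W j < W j + K * 2 `^ (- (j%:R * theta)) by rewrite ltrDl mulr_gt0// powR_gt0.
  apply: hn_le (H _ _ _ _ (tf j) (bf j) lam1 lt) _.
  have -> : 2 * C * K * x ^+ j = C * (2 ^+ j) `^ sg * (K * 2 `^ (- (j%:R * theta)) + K * 2 `^ (- (j%:R * theta))).
    have -> : x ^+ j = (2 ^+ j) `^ sg * 2 `^ (- (j%:R * theta)).
      rewrite /x -(powR_mulrn j (powR_ge0 _ _)) -(powR_mulrn j (ler0n R 2)).
      rewrite -!powRrM -powRDp//; congr (_ `^ _); ring.
    by ring.
  by rewrite ler_wpM2l ?mulr_ge0 ?powR_ge0 ?(ltW C0)// lerD2r.
- move=> N; rewrite -mulr_sumr mulrAC -!mulrA.
  have -> : 2 * (C * ((1 - x)^-1 * K)) = 2 * (C * (K * (1 - x)^-1)) by rewrite (mulrC K).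
  by rewrite !ler_wpM2l ?(ltW C0)// mulrC ler_wpM2l ?(ltW K0)// geom_le ?(ltW x0).
Qed.

Lemma lossy_lap (s : R) : s <= sg -> lap_bound (s - 2) q p theta.
Proof.
move=> ssg; have [n [C C0 H]] := trig_lap q1 sg0 ssg.
(* Two orders more than [trig_lap] provides: the transfer to test functions controls the Laplacian
   of the approximation error uniformly. *)
have [C' C'0 H'] : exists2 C' : R, 0 < C' & forall F_ W K S, 0 < K -> dyadic_family q p theta n.+2 F_ W K ->
    (forall k, (\sum_(j < N) distr_of_fun (lap (F_ j)) (cos \o phase k)) @[N --> \oo] --> S (cos \o phase k) /\
       (\sum_(j < N) distr_of_fun (lap (F_ j)) (sin \o phase k)) @[N --> \oo] --> S (sin \o phase k)) ->
    hn (s - 2) q S (C' * K).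
  apply: (lossy_bound C0) => f w w' lam tf bf lam1 ww'.
  have Ds (g : 'rV[R]_d -> R) (e : R) : test_function g -> bd supb n.+2 e 1 g -> supb (lap g) (d%:R * e).
    by move=> tg bg; exact: lap_supb bg.
  have Cl : 0 <= C * lam `^ sg by rewrite mulr_ge0 ?powR_ge0// ltW.
  have HP P v : bd (nq q) n.+2 v lam (tev P) -> hn (s - 2) q (distr_of_fun (lap (tev P))) (C * lam `^ sg * v).
    by move=> b; apply: H => //; exact: bdS (bdS b).
  exact: (hn_transfer (@test_lap R d) (@lap_testB R d) Ds q1 Cl lam1 HP tf bf ww').
exists n.+2, C' => // F_ W K A B S K0 fam cAB SL.
apply: (H' _ _ _ _ K0 fam) => k; have [tf _ _] := fam.
have [-> ->] := SL k; have [cA cB] := cAB k.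
split.
  have -> : (fun N => \sum_(j < N) distr_of_fun (lap (F_ j)) (cos \o phase k)) =
     (fun N => - (2 * pi) ^+ 2 * kk k * \sum_(j < N) fcos (F_ j) k).
    by apply/funext => N; rewrite mulr_sumr; apply: eq_bigr => j _; rewrite -fcos_lap.
  by apply: cvgM => //; exact: cvg_cst.
have -> : (fun N => \sum_(j < N) distr_of_fun (lap (F_ j)) (sin \o phase k)) =
   (fun N => - (2 * pi) ^+ 2 * kk k * \sum_(j < N) fsin (F_ j) k).
  by apply/funext => N; rewrite mulr_sumr; apply: eq_bigr => j _; rewrite -fsin_lap.
by apply: cvgM => //; exact: cvg_cst.
Qed.

Lemma lossy_partial (r : R) : r <= 0 -> r <= sg - 1 -> partial_bound r q p theta.
Proof.
move=> r0 rsg.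
have H0 i : exists2 C' : R, 0 < C' & forall F_ W K S, 0 < K -> dyadic_family q p theta 1 F_ W K ->
    (forall k, (\sum_(j < N) distr_of_fun (partial i (F_ j)) (cos \o phase k)) @[N --> \oo] --> S (cos \o phase k) /\
       (\sum_(j < N) distr_of_fun (partial i (F_ j)) (sin \o phase k)) @[N --> \oo] --> S (sin \o phase k)) ->
    hn r q S (C' * K).
  have [C C0 H] := trig_partial_hn q1 i sg0 r0 rsg.
  apply: (lossy_bound C0) => f w w' lam tf bf lam1 ww'.
  apply: (@hn_transfer _ _ (partial i) 1 1 _ _ _ r q (C * lam `^ sg) lam) bf ww' => //.
  - exact: test_partial.
  - exact: partial_testB.
  - by move=> g e _; exact: partial_supb.
  - by rewrite mulr_ge0 ?powR_ge0// ltW.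
  - by move=> P v b; apply: H.
have [C_ HC] := choice (fun i => let: ex_intro2 C' C'0 H := H0 i in ex_intro _ C' (conj C'0 H)).
exists 1%N, (1 + \sum_i C_ i).
  by rewrite ltr_pwDl// sumr_ge0// => i _; exact: ltW (HC i).1.
move=> i F_ W K A B S K0 fam cAB SL.
apply: (@hn_le _ _ r q S (C_ i * K)); last first.
  rewrite ler_wpM2r ?(ltW K0)// (bigD1 i)//= addrCA lerDl addr_ge0// sumr_ge0// => j _.
  exact: ltW (HC j).1.
apply: ((HC i).2 _ _ _ _ K0 fam) => k; have [tf _ _] := fam.
have [-> ->] := SL k; have [cA cB] := cAB k.
split.
  have -> : (fun N => \sum_(j < N) distr_of_fun (partial i (F_ j)) (cos \o phase k)) =
     (fun N => 2 * pi * (k 0 i)%:~R * \sum_(j < N) fsin (F_ j) k).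
    by apply/funext => N; rewrite mulr_sumr; apply: eq_bigr => j _; rewrite -fcos_partial.
  by apply: cvgM => //; exact: cvg_cst.
have -> : (fun N => \sum_(j < N) distr_of_fun (partial i (F_ j)) (sin \o phase k)) =
   (fun N => - (2 * pi * (k 0 i)%:~R) * \sum_(j < N) fcos (F_ j) k).
  by apply/funext => N; rewrite mulr_sumr; apply: eq_bigr => j _; rewrite -fsin_partial.
by apply: cvgM => //; exact: cvg_cst.
Qed.

End Lossy.

End Families.

(** * The case p = q = 2 *)

Section Box.
Context {R : realType} {d : nat}.
Implicit Types (f g : 'rV[R]_d -> R) (k : 'rV[int]_d) (P : @trig R d).

(** The cubes |k_i| <= N exhaust Z^d and are stable under k |-> - k; sums over all frequencies are
    handled as limits over N. *)
Definition box (N : nat) : seq 'rV[int]_d :=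
  [seq (\row_i ((j i : nat)%:Z - N%:Z)) | j : {ffun 'I_d -> 'I_(N.*2.+1)}].

Lemma box_uniq N : uniq (box N).
Proof.
rewrite map_inj_uniq ?enum_uniq// => j j' /rowP h; apply/ffunP => i; apply/val_inj.
by have := h i; rewrite !mxE => /addIr [].
Qed.

Lemma mem_box N k : (k \in box N) = [forall i, `|k 0 i| <= N].
Proof.
apply/mapP/forallP => [[j _ -> i]|H].
  by rewrite mxE ler_norml; have := ltn_ord (j i); move: (nat_of_ord (j i)) => z; rewrite -addnn => h; apply/andP; split; lia.
have h i : (absz (k 0 i + N%:Z)%R < N.*2.+1)%N by have := H i; rewrite ler_norml -addnn => /andP[]; lia.
exists [ffun i => Ordinal (h i)]; first by rewrite mem_enum.
apply/rowP => i; rewrite mxE ffunE /=.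
by have := H i; rewrite ler_norml => /andP[]; lia.
Qed.

Lemma box_opp N k : (- k \in box N) = (k \in box N).
Proof. by rewrite !mem_box; apply: eq_forallb => i; rewrite mxE normrN. Qed.

Lemma box_sub N N' k : (N <= N')%N -> k \in box N -> k \in box N'.
Proof.
rewrite !mem_box => NN /forallP H; apply/forallP => i; apply: le_trans (H i) _.
by rewrite lez_nat.
Qed.

Lemma box_ex k : exists N, forall N', (N <= N')%N -> k \in box N'.
Proof.
exists (\max_i absz (k 0%R i))%N => N' NN; apply: (box_sub NN).
by rewrite mem_box; apply/forallP => i; rewrite -abszE lez_nat; exact: leq_bigmax.
Qed.

Section Coefficients.
Variables (a b : 'rV[int]_d -> R).
Hypotheses (aN : forall k, a (- k) = a k) (bN : forall k, b (- k) = - b k).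

Definition ptrig N : @trig R d := [seq (k, (a k, b k)) | k <- box N].
Definition energy N : R := \sum_(k <- box N) (a k ^+ 2 + b k ^+ 2).

Let sum_mem (F : 'rV[int]_d -> R) N k :
  \sum_(l <- box N) F l * (l == k)%:R = if k \in box N then F k else 0.
Proof.
case: ifPn => [kN|kN].
  rewrite (bigD1_seq k)//= ?box_uniq// eqxx mulr1 big1 ?addr0//.
  by move=> l /negbTE ->; rewrite mulr0.
rewrite big_seq big1// => l lN; case: eqP => [lk|_]; last by rewrite mulr0.
by rewrite -lk lN in kN.
Qed.

(** A cosine at k contributes one half at k and one half at - k. Both frequencies lie in the box and
    [a] is even, so the halves add up. *)
Lemma fcos_ptrig N k : fcos (tev (ptrig N)) k = if k \in box N then a k else 0.
Proof.
rewrite fcos_tev big_map/=.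
under eq_bigr => l _ do rewrite mulrCA mulrDr.
rewrite -mulr_sumr big_split/= !sum_mem box_opp aN; case: ifP => _; last by rewrite addr0 mulr0.
by field.
Qed.

Lemma fsin_ptrig N k : fsin (tev (ptrig N)) k = if k \in box N then b k else 0.
Proof.
rewrite fsin_tev big_map/=.
under eq_bigr => l _ do rewrite mulrCA mulrBr.
rewrite -mulr_sumr big_split/= sumrN !sum_mem box_opp bN; case: ifP => _; last by rewrite subr0 mulr0.
by field.
Qed.

Lemma tint_ptrig f N : integ f ->
  torus_integral (fun x => f x * tev (ptrig N) x) = \sum_(k <- box N) (fcos f k * a k + fsin f k * b k).
Proof.
move=> fi.
rewrite (_ : (fun x => _) = (fun x => \sum_(k <- box N) (a k * (f x * cos (phase k x)) + b k * (f x * sin (phase k x))))); last first.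
  by apply/funext => x; rewrite /tev big_map mulr_sumr; apply: eq_bigr => k _ /=; ring.
rewrite tint_sum => [|k]; last by apply: integD; apply: integZ; [exact: integ_fcos|exact: integ_fsin].
apply: eq_bigr => k _; rewrite tintD; [|by apply: integZ; exact: integ_fcos|by apply: integZ; exact: integ_fsin].
rewrite tintZ; last exact: integ_fcos.
rewrite tintZ; last exact: integ_fsin.
by rewrite (mulrC (a k)) (mulrC (b k)).
Qed.

Lemma tint_ptrig2 N N' : (N <= N')%N ->
  torus_integral (fun x => tev (ptrig N) x * tev (ptrig N') x) = energy N.
Proof.
move=> NN; under eq_fun do rewrite mulrC.
rewrite tint_ptrig; last by apply: integ_test; exact: test_tev.
rewrite /energy big_seq [RHS]big_seq; apply: eq_bigr => k kN.
by rewrite fcos_ptrig fsin_ptrig (box_sub NN kN) -!expr2.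
Qed.

Lemma tint_ptrig_dist N N' : (N <= N')%N ->
  torus_integral (fun x => (tev (ptrig N') x - tev (ptrig N) x) ^+ 2) = energy N' - energy N.
Proof.
move=> NN; have it M M' : integ (fun x => tev (ptrig M) x * tev (ptrig M') x).
  by apply: integ_test; apply: testM; exact: test_tev.
rewrite (_ : (fun x => _) = (fun x => tev (ptrig N') x * tev (ptrig N') x
   - (2 * (tev (ptrig N) x * tev (ptrig N') x) - tev (ptrig N) x * tev (ptrig N) x))); last first.
  by apply/funext => x; ring.
rewrite tintB//; last by apply: integB => //; exact: integZ.
rewrite tintB//; last exact: integZ.
by rewrite tintZ// !tint_ptrig2//; ring.
Qed.

Lemma energy_mono N N' : (N <= N')%N -> energy N <= energy N'.
Proof.
move=> NN; have := @tint_ge0 R d (fun x => (tev (ptrig N') x - tev (ptrig N) x) ^+ 2) (fun x => sqr_ge0 _).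
by rewrite (tint_ptrig_dist NN) subr_ge0.
Qed.

End Coefficients.

Lemma fcosN f k : fcos f (- k) = fcos f k.
Proof. by rewrite /fcos; under eq_fun do rewrite phaseNk cosN. Qed.

Lemma fsinN f k : integ f -> fsin f (- k) = - fsin f k.
Proof.
move=> fi; rewrite /fsin; under eq_fun do rewrite phaseNk sinN mulrN -mulN1r.
by rewrite tintZ ?mulN1r//; exact: integ_fsin.
Qed.

Lemma bessel_inequality f N : test_function f ->
  energy (fcos f) (fsin f) N <= torus_integral (fun x => f x ^+ 2).
Proof.
move=> tf; have fi := integ_test tf.
have aN := fcosN f; have bN k : fsin f (- k) = - fsin f k by exact: fsinN.
set P := ptrig (fcos f) (fsin f) N; have tP := test_tev P.
have := @tint_ge0 R d (fun x => (f x - tev P x) ^+ 2) (fun x => sqr_ge0 _).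
rewrite (_ : (fun x => (_ - _) ^+ 2) = (fun x => f x ^+ 2 - (2 * (f x * tev P x) - tev P x * tev P x))); last first.
  by apply/funext => x; ring.
have i1 : integ (fun x => f x ^+ 2) by under eq_fun do rewrite expr2; apply: integ_test; exact: testM.
have i2 : integ (fun x => f x * tev P x) by apply: integ_test; exact: testM.
have i3 : integ (fun x => tev P x * tev P x) by apply: integ_test; exact: testM.
rewrite tintB//; last by apply: integB => //; exact: integZ.
rewrite tintB//; last exact: integZ.
rewrite tintZ// (tint_ptrig2 aN bN (leqnn N)) (tint_ptrig _ _ N fi).
rewrite (_ : \sum_(k <- box N) _ = energy (fcos f) (fsin f) N); last first.
  by apply: eq_bigr => k _; rewrite !expr2.
by set e := energy _ _ _; set z := torus_integral _; lra.
Qed.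

Lemma nq2P f (c : R) : test_function f ->
  nq 2 f c <-> 0 <= c /\ torus_integral (fun x => f x ^+ 2) <= c ^+ 2.
Proof.
move=> tf; have two : 1 <= 2 :> R by rewrite ler1n.
have i1 : integ (fun x => f x ^+ 2) by under eq_fun do rewrite expr2; apply: integ_test; exact: testM.
have E : (\int[torus_measure d]_t (`|f (row_of_tuple t)| `^ 2)%:E = (torus_integral (fun x => f x ^+ 2))%:E)%E.
  rewrite -(integral_tint i1); apply: eq_integral => t _.
  by rewrite (powR_mulrn 2)// real_normK// num_real.
have K (c0 : 0 <= c) : (c `^ 2 = c ^+ 2 :> R) by rewrite (powR_mulrn 2 c0).
split=> [/(nqP two)[c0]|[c0 h]].
  by rewrite E K// lee_fin.
by apply/(nqP two); rewrite E K// lee_fin.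
Qed.

Section RieszFischer.
Variables (a b : 'rV[int]_d -> R) (M : R).
Hypotheses (aN : forall k, a (- k) = a k) (bN : forall k, b (- k) = - b k).
Hypotheses (M0 : 0 <= M) (EM : forall N, energy a b N <= M ^+ 2).

(** Along a subsequence whose energy defect is at most 4^(- j), consecutive partial sums differ by
    at most 2^(- j) in L^2, and [Lq_series] applies. The partial sums themselves never exceed
    [M]. *)
Lemma riesz_fischer : exists g, [/\ mrow g, nq 2 g M &
  forall k, fcos g k = a k /\ fsin g k = b k].
Proof.
have two : 1 <= 2 :> R by rewrite ler1n.
have /cvg_ex[L EL] : cvgn (energy a b).
  apply: nondecreasing_is_cvgn; first by move=> m n; exact: energy_mono.
  by exists (M ^+ 2) => _ [n _ <-].
have LE N : energy a b N <= L.
  have cE : cvgn (energy a b) by apply/cvg_ex; exists L.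
  rewrite -(cvg_lim _ EL)//; apply: nondecreasing_cvgn_le => //.
  by move=> m n; exact: energy_mono.
have Hn (j : nat) : exists N, (j <= N)%N /\ L - energy a b N <= 4^-1 ^+ j.
  have e0 : 0 < 4^-1 ^+ j :> R by rewrite exprn_gt0.
  move/cvgrPdist_le : EL => /(_ _ e0)[N _ HN]; exists (maxn N j); split; first exact: leq_maxr.
  by apply: le_trans (ler_norm _) (HN _ _); exact: leq_maxl.
have [n_ Hn_] := choice Hn.
pose Q (j : nat) := tev (ptrig a b (n_ j)).
have tQ j : test_function (Q j) by exact: test_tev.
have dist (j : nat) : torus_integral (fun x => (Q j.+1 x - Q j x) ^+ 2) <= (2^-1 ^+ j) ^+ 2.
  have e4 : (2^-1 ^+ j) ^+ 2 = 4^-1 ^+ j :> R.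
    by rewrite -exprM mulnC exprM; congr (_ ^+ _); field.
  have [_ h1] := Hn_ j; have [_ h2] := Hn_ j.+1.
  have le4 : 4^-1 ^+ j.+1 <= 4^-1 ^+ j :> R.
    by rewrite exprS ler_piMl ?exprn_ge0// invf_le1// ler1n.
  have l1 := LE (n_ j); have l2 := LE (n_ j.+1).
  rewrite e4; have [nn|nn] := leqP (n_ j) (n_ j.+1).
    rewrite (tint_ptrig_dist aN bN nn).
    by apply: le_trans h1; rewrite lerD2r.
  rewrite (_ : (fun x => _) = (fun x => (Q j x - Q j.+1 x) ^+ 2)).
    rewrite (tint_ptrig_dist aN bN (ltnW nn)).
    by apply: le_trans (le_trans h2 le4); rewrite lerD2r.
  by apply/funext => x; ring.
pose g_ (j : nat) : 'rV[R]_d -> R := if j is j'.+1 then fun x => Q j'.+1 x - Q j' x else Q 0%N.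
pose c_ (j : nat) : R := if j is j'.+1 then 2^-1 ^+ j' else M.
have tg j : test_function (g_ j) by case: j => [|j] //=; exact: testB.
have mg j : mrow (g_ j) by exact: mrow_test.
have nQ j : nq 2 (Q j) M.
  apply/nq2P => //; split=> //; apply: le_trans (EM (n_ j)).
  by under eq_fun do rewrite expr2; rewrite (tint_ptrig2 aN bN (leqnn _)).
have gc j : nq 2 (g_ j) (c_ j).
  case: j => [|j]; first exact: nQ.
  by apply/nq2P => //; split; [rewrite exprn_ge0|exact: dist].
have sumg N x : \sum_(j < N.+1) g_ j x = Q N x.
  elim: N => [|N IH]; first by rewrite big_ord_recr big_ord0/= add0r.
  by rewrite big_ord_recr IH/= addrC subrK.
have cM N : \sum_(j < N) c_ j <= M + 2.
  case: N => [|N]; first by rewrite big_ord0 addr_ge0.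
  rewrite big_ord_recl/= lerD2l.
  apply: le_trans (geom_le N _ _) _ => //; first by rewrite invf_lt1// ltr1n.
  by rewrite le_eqVlt; apply/orP; left; apply/eqP; field.
have [g [mg' ng cg]] := Lq_series two mg gc cM.
exists g; split=> //.
  apply: ng => -[|N]; last by rewrite (_ : (fun x => _) = Q N)//; apply/funext => x; rewrite sumg.
  rewrite (_ : (fun x => _) = (fun=> 0)); last by apply/funext => x; rewrite big_ord0.
  by apply: nq_sup => //[|x]; [exact: measurable_cst|rewrite normr0].
have near_box k : \forall j \near \oo, k \in box (n_ j).
  have [N HN] := box_ex k; exists N => // j /= Nj.
  by apply: HN; apply: leq_trans (Hn_ j).1.
move=> k; split.
  have := cg _ 1 (integ_mrow (integ_cosp k)) (fun x => cos_max _).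
  rewrite -cvg_shiftS/= => H.
  suff C : torus_integral (fun x => (\sum_(l < j.+1) g_ l x) * cos (phase k x)) @[j --> \oo] --> a k.
    exact: (cvg_unique _ H C).
  apply: cvg_near_cst; apply: filterS (near_box k) => j kj.
  rewrite (_ : (fun x => _) = (fun x => Q j x * cos (phase k x))); last by apply/funext => x; rewrite sumg.
  by have := @fcos_ptrig a b aN (n_ j) k; rewrite kj /fcos.
have := cg _ 1 (integ_mrow (integ_sinp k)) (fun x => sin_max _).
rewrite -cvg_shiftS/= => H.
suff C : torus_integral (fun x => (\sum_(l < j.+1) g_ l x) * sin (phase k x)) @[j --> \oo] --> b k.
  exact: (cvg_unique _ H C).
apply: cvg_near_cst; apply: filterS (near_box k) => j kj.
rewrite (_ : (fun x => _) = (fun x => Q j x * sin (phase k x))); last by apply/funext => x; rewrite sumg.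
by have := @fsin_ptrig a b bN (n_ j) k; rewrite kj /fsin.
Qed.

End RieszFischer.

End Box.

(** * Cauchy-Schwarz and a uniformly bounded sum of weights *)

Section SumLemmas.
Context {R : realType}.

Lemma four_sq : 4 = 2 ^+ 2 :> R. Proof. by rewrite -natrX. Qed.

Lemma cauchy_schwarz_sum (u v : nat -> R) n :
  (\sum_(l < n) u l * v l) ^+ 2 <= (\sum_(l < n) u l ^+ 2) * (\sum_(l < n) v l ^+ 2).
Proof.
elim: n => [|n IH]; first by rewrite !big_ord0 expr0n/= mul0r.
rewrite !big_ord_recr/=; move: (\sum_(l < n) _) IH (u n) (v n) => S.
have U0 : 0 <= \sum_(l < n) u l ^+ 2 by apply: sumr_ge0 => l _; exact: sqr_ge0.
have V0 : 0 <= \sum_(l < n) v l ^+ 2 by apply: sumr_ge0 => l _; exact: sqr_ge0.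
move: (\sum_(l < n) u l ^+ 2) (\sum_(l < n) v l ^+ 2) U0 V0 => U V U0 V0 IH a b.
have -> : U = Num.sqrt U ^+ 2 by rewrite sqr_sqrtr.
have -> : V = Num.sqrt V ^+ 2 by rewrite sqr_sqrtr.
have hS : `|S| <= Num.sqrt U * Num.sqrt V.
  rewrite -(@ler_pXn2r _ 2) ?nnegrE ?mulr_ge0 ?sqrtr_ge0//.
  by rewrite exprMn !sqr_sqrtr// real_normK// num_real.
move: (Num.sqrt U) (Num.sqrt V) (sqrtr_ge0 U) (sqrtr_ge0 V) hS => x y x0 y0 hS.
have h1 : 2 * S * (a * b) <= 2 * (x * y) * `|a * b|.
  apply: le_trans (ler_norm _) _; rewrite normrM ler_wpM2r//.
  by rewrite normrM ger0_norm// ler_wpM2l.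
have h2 : 2 * (x * y) * `|a * b| <= (x * b) ^+ 2 + (y * a) ^+ 2.
  rewrite normrM -(real_normK (num_real (x * b))) -(real_normK (num_real (y * a))) !normrM.
  rewrite (ger0_norm x0) (ger0_norm y0).
  by have := sqr_ge0 (x * `|b| - y * `|a|); lra.
have h3 : S ^+ 2 <= (x * y) ^+ 2.
  by rewrite -(real_normK (num_real S)) ler_pXn2r// nnegrE mulr_ge0.
lra.
Qed.

Lemma cvg_sum_seq (I : Type) (r : seq I) (F : nat -> I -> R) (L : I -> R) :
  (forall i, F n i @[n --> \oo] --> L i) ->
  (\sum_(i <- r) F n i) @[n --> \oo] --> \sum_(i <- r) L i.
Proof.
move=> H; elim: r => [|i r IH].
  by under eq_fun do rewrite big_nil; rewrite big_nil; exact: cvg_cst.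
by under eq_fun do rewrite big_cons; rewrite big_cons; exact: cvgD.
Qed.

(** The terms are A^s times those of the discrete Mellin sum with base 4, exponent s and profile (1
    + y)^(- 2m), whose homogeneity of degree - s cancels A^s. The two ends converge because 0 < s <
    2m. *)
Lemma weight_sum (s : R) (m : nat) : 0 < s -> s < 2 * m%:R -> exists2 G : R, 0 < G &
  forall A n, 1 <= A -> \sum_(l < n) ((A / 4 ^+ l) `^ (s / 2) / (1 + A / 4 ^+ l) ^+ m) ^+ 2 <= G.
Proof.
move=> s0 sm; have four : 1 < 4 :> R by rewrite ltr1n.
have m0 : 0 <= 2 * m%:R :> R by rewrite mulr_ge0.
have ga0 : forall x : R, 0 < x -> 0 <= gpow (2 * m%:R) x by move=> x _; exact: powR_ge0.
have gam : forall x y : R, 0 < x -> x <= y -> gpow (2 * m%:R) y <= gpow (2 * m%:R) x.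
  by move=> x z; exact: gpow_mono.
have bnd := gpow_bnd s0 four sm.
set th := theta s 4 (gpow (2 * m%:R)) 1.
have th0 : 0 <= th.
  by apply: le_trans (theta_ge four ga0 gam bnd 0 (lexx 1)); rewrite /thsum big_nil.
exists (1 + 4 `^ s * th); first by rewrite ltr_pwDl// mulr_ge0// powR_ge0.
move=> A n A1; have A0 : 0 < A by exact: lt_le_trans A1.
apply: (@le_trans _ _ (A `^ s * thsum s 4 (gpow (2 * m%:R)) n.+1 A)).
  have E l : ((A / 4 ^+ l) `^ (s / 2) / (1 + A / 4 ^+ l) ^+ m) ^+ 2 =
      A `^ s * thterm s 4 (gpow (2 * m%:R)) (- l%:R) A.
    have q0 : 0 < 4 ^+ l :> R by rewrite exprn_gt0.
    have x0 : 0 < A / 4 ^+ l by rewrite divr_gt0.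
    have e1 : 4 `^ (- l%:R) = (4 ^+ l)^-1 :> R by rewrite powRN powR_mulrn.
    rewrite /thterm /gpow e1 (mulrC _ A) mulrA -powRM ?invr_ge0 ?(ltW A0) ?(ltW q0)//.
    rewrite expr_div_n -(powR_mulrn 2 (powR_ge0 _ _)) -powRrM divfK// powRN.
    congr (_ * _^-1); rewrite -exprM -powR_mulrn; last by rewrite addr_ge0// ltW.
    by rewrite [(m * 2)%N]mulnC natrM.
  rewrite (eq_bigr _ (fun (l : 'I_n) _ => E l)) -mulr_sumr ler_wpM2l ?powR_ge0//.
  have t0 e : 0 <= thterm s 4 (gpow (2 * m%:R)) e A.
    by rewrite /thterm mulr_ge0 ?powR_ge0.
  rewrite /thsum /thexp big_cat !big_map/=.
  case: n => [|n]; first by rewrite big_ord0 addr_ge0// sumr_ge0.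
  rewrite big_ord_recl/= lerD//.
    by rewrite big_cons oppr0 lerDl sumr_ge0.
  rewrite -(big_mkord xpredT (fun i => thterm s 4 (gpow (2 * m%:R)) (- (bump 0 i)%:R) A)) /index_iota subn0.
  rewrite [X in _ <= X](_ : _ = \sum_(i <- iota 0 n.+2) thterm s 4 (gpow (2 * m%:R)) (- i.+1%:R) A)//.
  have -> : iota 0 n.+2 = iota 0 n ++ iota n 2 by rewrite -[n.+2]addn2 iotaD.
  by rewrite big_cat/= lerDl sumr_ge0.
have h := theta_ge four ga0 gam bnd n.+1 A1.
have /andP[_ h2] := theta_homogeneous s0 four ga0 gam bnd A1.
apply: (@le_trans _ _ (A `^ s * (4 `^ s * A `^ (- s) * th))).
  by rewrite ler_wpM2l ?powR_ge0//; exact: le_trans h h2.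
rewrite (_ : A `^ s * _ = (A `^ s * A `^ (- s)) * (4 `^ s * th)); last by ring.
by rewrite -powRDp// subrr powRr0 mul1r lerDr.
Qed.

Lemma pow1D_le (x : R) m : 0 <= x -> ((1 + x) ^+ m) ^+ 2 <= 4 ^+ m * (1 + (x ^+ m) ^+ 2).
Proof.
move=> x0; have e4 : 4 ^+ m = (2 ^+ m) ^+ 2 :> R by rewrite four_sq -!exprM mulnC.
rewrite e4; have [x1|x1] := leP x 1.
  apply: (@le_trans _ _ ((2 ^+ m) ^+ 2)).
    rewrite lerXn2r ?nnegrE ?exprn_ge0 ?addr_ge0//.
    by rewrite lerXn2r ?nnegrE ?addr_ge0//; lra.
  by rewrite ler_peMr ?sqr_ge0// lerDl sqr_ge0.
apply: (@le_trans _ _ ((2 ^+ m) ^+ 2 * (x ^+ m) ^+ 2)).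
  rewrite -!exprMn lerXn2r ?nnegrE ?exprn_ge0 ?mulr_ge0 ?addr_ge0//.
  by rewrite lerXn2r ?nnegrE ?mulr_ge0 ?addr_ge0//; lra.
by rewrite ler_wpM2l ?sqr_ge0// lerDr.
Qed.

End SumLemmas.

(** * Almost orthogonality of the blocks in L^2 *)

Section Plancherel.
Context {R : realType} {d : nat}.
Implicit Types (f g : 'rV[R]_d -> R) (k : 'rV[int]_d).

Lemma test_oneB_lap f : test_function f -> test_function (oneB_lap f).
Proof. by move=> tf; exact: (testB tf (testZ _ (test_lap tf))). Qed.

Lemma fcos_oneB_lap f k : test_function f -> fcos (oneB_lap f) k = AA k * fcos f k.
Proof.
move=> tf; have il := integ_test (test_lap tf).
transitivity (fcos f k - (2 * pi) ^- 2 * fcos (lap f) k).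
  rewrite /fcos -tintZ; last exact: integ_fcos.
  rewrite -tintB; [|by apply: integ_fcos; exact: integ_test|by apply: integZ; exact: integ_fcos].
  by congr torus_integral; apply/funext => x; rewrite mulrBl mulrA.
rewrite fcos_lap// /AA !mulrA mulrN mulVf ?expf_neq0 ?mulf_neq0 ?gt_eqF ?pi_gt0//.
by rewrite mulN1r mulNr opprK mulrDl mul1r.
Qed.

Lemma fsin_oneB_lap f k : test_function f -> fsin (oneB_lap f) k = AA k * fsin f k.
Proof.
move=> tf; have il := integ_test (test_lap tf).
transitivity (fsin f k - (2 * pi) ^- 2 * fsin (lap f) k).
  rewrite /fsin -tintZ; last exact: integ_fsin.
  rewrite -tintB; [|by apply: integ_fsin; exact: integ_test|by apply: integZ; exact: integ_fsin].
  by congr torus_integral; apply/funext => x; rewrite mulrBl mulrA.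
rewrite fsin_lap// /AA !mulrA mulrN mulVf ?expf_neq0 ?mulf_neq0 ?gt_eqF ?pi_gt0//.
by rewrite mulN1r mulNr opprK mulrDl mul1r.
Qed.

Lemma iter_oneB_lap f m : test_function f -> [/\ test_function (iter m oneB_lap f),
  forall k, fcos (iter m oneB_lap f) k = AA k ^+ m * fcos f k
  & forall k, fsin (iter m oneB_lap f) k = AA k ^+ m * fsin f k].
Proof.
move=> tf; elim: m => [|m [IH1 IH2 IH3]]; first by split=> // k; rewrite expr0 mul1r.
split=> [|k|k]; rewrite iterS.
- exact: test_oneB_lap.
- by rewrite fcos_oneB_lap// IH2 exprS mulrA.
- by rewrite fsin_oneB_lap// IH3 exprS mulrA.
Qed.

Lemma bd_iter_oneB_lap B n m (c lam : R) f : tnorm B -> test_function f -> 1 <= lam ->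
  bd B (n + m.*2) c lam f -> bd B n (((1 + d%:R) * lam ^+ 2) ^+ m * c) lam (iter m oneB_lap f).
Proof.
move=> tB tf lam1; elim: m n => [|m IH] n; first by rewrite addn0 expr0 mul1r.
rewrite doubleS !addnS -!addSn => /IH b.
rewrite exprS -mulrA iterS; apply: bd_oneB_lap => //.
by apply: test_sm; case: (iter_oneB_lap m tf).
Qed.

(** A substitute for spectral localisation: comparing the energies of f and of (A / 4^l)^m f shows
    that frequencies far beyond 2^l carry little energy. *)
Lemma block_energy f m (W : R) l N : test_function f -> bd (nq 2) m.*2 W (2 ^+ l) f ->
  \sum_(k <- box N) ((1 + AA k / 4 ^+ l) ^+ m) ^+ 2 * (fcos f k ^+ 2 + fsin f k ^+ 2) <=
  4 ^+ m * (1 + ((1 + d%:R) ^+ m) ^+ 2) * W ^+ 2.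
Proof.
move=> tf b; have two : 1 <= 2 :> R by rewrite ler1n.
have lam1 : 1 <= 2 ^+ l :> R by rewrite exprn_ege1// ler1n.
have q0 : 0 < 4 ^+ l :> R by rewrite exprn_gt0.
have [tI cI sI] := iter_oneB_lap m tf.
have b0 := (nq2P W tf).1 (bd0 b).
have bI := (nq2P _ tI).1 (bd0 (@bd_iter_oneB_lap _ 0 m W _ f (tnorm_nq two) tf lam1 b)).
have E0 := le_trans (bessel_inequality N tf) b0.2.
have E1 := le_trans (bessel_inequality N tI) bI.2.
have l4 : (2 ^+ l) ^+ 2 = 4 ^+ l :> R by rewrite four_sq -!exprM mulnC.
have E2 : \sum_(k <- box N) ((AA k / 4 ^+ l) ^+ m) ^+ 2 * (fcos f k ^+ 2 + fsin f k ^+ 2) <=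
    ((1 + d%:R) ^+ m) ^+ 2 * W ^+ 2.
  have -> : \sum_(k <- box N) ((AA k / 4 ^+ l) ^+ m) ^+ 2 * (fcos f k ^+ 2 + fsin f k ^+ 2) =
     ((4 ^+ l) ^+ m) ^- 2 * energy (fcos (iter m oneB_lap f)) (fsin (iter m oneB_lap f)) N.
    rewrite /energy mulr_sumr; apply: eq_bigr => k _; rewrite cI sI.
    by rewrite !expr_div_n !exprMn; field; rewrite !expf_neq0// gt_eqF.
  rewrite ler_pdivrMl ?exprn_gt0//; apply: le_trans E1 _.
  by rewrite l4 !exprMn le_eqVlt; apply/orP; left; apply/eqP; ring.
have -> : 4 ^+ m * (1 + ((1 + d%:R) ^+ m) ^+ 2) * W ^+ 2 =
  4 ^+ m * (W ^+ 2 + ((1 + d%:R) ^+ m) ^+ 2 * W ^+ 2) by ring.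
apply: le_trans (_ : 4 ^+ m * (energy (fcos f) (fsin f) N +
  \sum_(k <- box N) ((AA k / 4 ^+ l) ^+ m) ^+ 2 * (fcos f k ^+ 2 + fsin f k ^+ 2)) <= _); last first.
  by rewrite ler_wpM2l ?exprn_ge0// lerD.
rewrite /energy -big_split/= mulr_sumr; apply: ler_sum => k _.
rewrite [leRHS](_ : _ = 4 ^+ m * (1 + ((AA k / 4 ^+ l) ^+ m) ^+ 2) * (fcos f k ^+ 2 + fsin f k ^+ 2)); last by ring.
rewrite ler_wpM2r ?addr_ge0 ?sqr_ge0//.
by apply: pow1D_le; rewrite divr_ge0 ?(ltW q0)// ltW// AA_gt0.
Qed.

(** Cauchy-Schwarz in l at each frequency, with x_l = A / 4^l. The weights x_l^(s/2) / (1 + x_l)^m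
    are square summable uniformly in A; the other factor, 2^(l s) (1 + x_l)^m times the coefficient,
    has its energy bounded by [block_energy]. No power of 2^l is lost, so theta = s is allowed. *)
Lemma sum_energy (s : R) (m : nat) : 0 < s -> s < 2 * m%:R -> exists2 C : R, 0 < C &
  forall F_ W K A B, 0 < K -> @dyadic_family R d 2 2 s m.*2 F_ W K -> coefs F_ A B ->
    forall N, \sum_(k <- box N) AA k `^ s * (A k ^+ 2 + B k ^+ 2) <= (C * K) ^+ 2.
Proof.
move=> s0 sm; have [G G0 HG] := weight_sum s0 sm.
pose D : R := 4 ^+ m * (1 + ((1 + d%:R) ^+ m) ^+ 2).
have D0 : 0 < D by rewrite mulr_gt0 ?exprn_gt0// ltr_pwDl// sqr_ge0.
exists (1 + G * D); first by rewrite ltr_pwDl// mulr_ge0// ltW.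
move=> F_ W K A B K0 [tf bf sf] cAB N.
have two : 1 <= 2 :> R by rewrite ler1n.
have W0 l : 0 <= W l by exact: (nl_ge0 (tn_nl (tnorm_nq two)) (bd0 (bf l))).
have W2 n : \sum_(l < n) ((2 ^+ l) `^ s) ^+ 2 * W l ^+ 2 <= K ^+ 2.
  have := sf n; rewrite (powR_mulrn 2 (ltW K0)); apply: le_trans.
  apply: ler_sum => l _; rewrite (powR_mulrn 2) ?mulr_ge0 ?powR_ge0// exprMn.
  by rewrite -(powR_mulrn l)// -powRrM.
pose x l k : R := AA k / 4 ^+ l.
have x0 l k : 0 < x l k by rewrite divr_gt0 ?AA_gt0// exprn_gt0.
have part n (c : nat -> 'rV[int]_d -> R) k : AA k `^ s * (\sum_(l < n) c l k) ^+ 2 <=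
    G * \sum_(l < n) ((2 ^+ l) `^ s) ^+ 2 * ((1 + x l k) ^+ m) ^+ 2 * c l k ^+ 2.
  pose u l := (x l k) `^ (s / 2) / (1 + x l k) ^+ m.
  pose v l := (2 ^+ l) `^ s * (1 + x l k) ^+ m * c l k.
  have uv l : u l * v l = AA k `^ (s / 2) * c l k.
    have y0 : 0 < 1 + x l k by rewrite addr_gt0.
    have -> : AA k `^ (s / 2) = x l k `^ (s / 2) * (2 ^+ l) `^ s.
      have -> : (2 ^+ l) `^ s = (4 ^+ l) `^ (s / 2) :> R.
        have -> : 4 ^+ l = (2 ^+ l) `^ 2 :> R by rewrite powR_mulrn ?exprn_ge0// four_sq -!exprM mulnC.
        by rewrite -powRrM mulrC divfK.
      by rewrite -powRM ?(ltW (x0 _ _)) ?exprn_ge0// divfK// gt_eqF// exprn_gt0.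
    by rewrite /u /v; field; rewrite expf_neq0// gt_eqF.
  have := cauchy_schwarz_sum u v n.
  rewrite (eq_bigr _ (fun (l : 'I_n) _ => uv l)) -mulr_sumr exprMn.
  rewrite -(powR_mulrn 2 (powR_ge0 _ _)) -powRrM divfK//.
  move=> /le_trans; apply; apply: ler_pM => //.
  - by apply: sumr_ge0 => l _; exact: sqr_ge0.
  - by apply: sumr_ge0 => l _; exact: sqr_ge0.
  - by apply: HG; exact: AA_ge1.
  - by apply: ler_sum => l _; rewrite /v !exprMn.
have fin n : \sum_(k <- box N) AA k `^ s * ((\sum_(l < n) fcos (F_ l) k) ^+ 2 + (\sum_(l < n) fsin (F_ l) k) ^+ 2)
    <= (1 + G * D) ^+ 2 * K ^+ 2.
  apply: le_trans (_ : \sum_(k <- box N) G * \sum_(l < n) ((2 ^+ l) `^ s) ^+ 2 * (((1 + x l k) ^+ m) ^+ 2 *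
    (fcos (F_ l) k ^+ 2 + fsin (F_ l) k ^+ 2)) <= _).
    apply: ler_sum => k _; rewrite mulrDr.
    apply: le_trans (lerD (part n (fun l => fcos (F_ l)) k) (part n (fun l => fsin (F_ l)) k)) _.
    rewrite -mulrDr -big_split/= ler_wpM2l ?(ltW G0)//; apply: ler_sum => l _.
    by rewrite le_eqVlt; apply/orP; left; apply/eqP; ring.
  rewrite -mulr_sumr exchange_big/=.
  apply: le_trans (_ : G * (D * K ^+ 2) <= _).
    rewrite ler_wpM2l ?(ltW G0)//.
    apply: le_trans (_ : \sum_(l < n) ((2 ^+ l) `^ s) ^+ 2 * (D * W l ^+ 2) <= _).
      apply: ler_sum => l _; rewrite -mulr_sumr ler_wpM2l ?sqr_ge0//.
      exact: block_energy (tf l) (bf l).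
    under eq_bigr do rewrite mulrCA; rewrite -mulr_sumr.
    by rewrite ler_wpM2l// ltW.
  rewrite mulrA ler_wpM2r ?sqr_ge0//.
  have gd : 0 < G * D by rewrite mulr_gt0.
  by move: (G * D) gd => z z0; nra.
rewrite exprMn.
have cE : (\sum_(k <- box N) AA k `^ s * ((\sum_(l < n) fcos (F_ l) k) ^+ 2 + (\sum_(l < n) fsin (F_ l) k) ^+ 2)) @[n --> \oo]
   --> \sum_(k <- box N) AA k `^ s * (A k ^+ 2 + B k ^+ 2).
  apply: cvg_sum_seq => k; have [cA cB] := cAB k.
  apply: cvgM; first exact: cvg_cst.
  by apply: cvgD; under eq_fun do rewrite expr2; rewrite expr2; apply: cvgM.
rewrite -(cvg_lim _ cE)//; apply: limr_le; first by apply/cvg_ex; eexists; exact: cE.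
by apply: nearW => n; exact: fin.
Qed.

Lemma hn_energy (t : R) S (M : R) : 0 <= M -> (forall k, S (sin \o phase (- k)) = - S (sin \o phase k)) ->
  (forall N, \sum_(k <- box N) AA k `^ t * (S (cos \o phase k) ^+ 2 + S (sin \o phase k) ^+ 2) <= M ^+ 2) ->
  @hn R d t 2 S M.
Proof.
move=> M0 SN H.
pose a k := AA k `^ (t / 2) * S (cos \o phase k).
pose b k := AA k `^ (t / 2) * S (sin \o phase k).
have aN k : a (- k) = a k.
  rewrite /a AAN; congr (_ * S _); apply/funext => x /=; by rewrite phaseNk cosN.
have bN k : b (- k) = - b k by rewrite /b AAN SN mulrN.
have EM N : energy a b N <= M ^+ 2.
  apply: le_trans (H N); apply: ler_sum => k _.
  rewrite /a /b !exprMn -mulrDr -(powR_mulrn 2 (powR_ge0 _ _)) -powRrM divfK//.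
have [g [mg gM cg]] := riesz_fischer aN bN M0 EM.
exists g; split=> // k; rewrite freq_norm_kk; exact: (cg k).
Qed.

Lemma coefs_odd F_ A B k : (forall l, test_function (F_ l)) -> @coefs R d F_ A B ->
  A (- k) = A k /\ B (- k) = - B k.
Proof.
move=> tf cAB; have [c1 s1] := cAB k; have [c2 s2] := cAB (- k).
split.
  suff E : (fun N => \sum_(j < N) fcos (F_ j) (- k)) = (fun N => \sum_(j < N) fcos (F_ j) k).
    by rewrite E in c2; exact: (cvg_unique _ c2 c1).
  by apply/funext => N; apply: eq_bigr => j _; exact: fcosN.
have E : (fun N => \sum_(j < N) fsin (F_ j) (- k)) = (fun N => - \sum_(j < N) fsin (F_ j) k).
  by apply/funext => N; rewrite -sumrN; apply: eq_bigr => j _; apply: fsinN; exact: integ_test.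
by rewrite E in s2; exact: (cvg_unique _ s2 (cvgN s1)).
Qed.

Lemma plancherel_lap (s : R) : 0 < s -> @lap_bound R d (s - 2) 2 2 s.
Proof.
move=> s0; pose m := (Num.trunc (s / 2)).+1.
have sm : s < 2 * m%:R by rewrite mulrC -ltr_pdivrMr// truncnS_gt.
have [C C0 H] := sum_energy s0 sm.
pose z : R := (2 * pi) ^+ 2; have z0 : 0 < z by rewrite exprn_gt0// mulr_gt0// pi_gt0.
exists m.*2, (z * C); first exact: mulr_gt0.
move=> F_ W K A B S K0 fam cAB SL; have [tf _ _] := fam.
apply: hn_energy => [|k|N]; first exact: mulr_ge0 (mulr_ge0 (ltW z0) (ltW C0)) (ltW K0).
  have [_ ->] := SL (- k); have [_ ->] := SL k.
  by rewrite kkN (coefs_odd k tf cAB).2 mulrN.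
rewrite -mulrA exprMn; apply: le_trans (ler_wpM2l (sqr_ge0 z) (H _ _ _ _ _ K0 fam cAB N)).
rewrite mulr_sumr; apply: ler_sum => k _; have [-> ->] := SL k.
have A0 := AA_gt0 k : 0 < AA k :> R.
have -> : AA k `^ s = AA k `^ (s - 2) * AA k ^+ 2 :> R.
  by rewrite -(powR_mulrn 2 (ltW A0)) -powRDp// subrK.
rewrite -/z; have := powR_ge0 (AA k) (s - 2); move: (_ `^ _) => y y0.
have kA : kk k ^+ 2 <= AA k ^+ 2 :> R.
  by rewrite lerXn2r ?nnegrE ?kk_ge0 ?(ltW A0)// /AA lerDr.
have := sqr_ge0 z; have := addr_ge0 (sqr_ge0 (A k)) (sqr_ge0 (B k)).
have -> : y * ((- z * kk k * A k) ^+ 2 + (- z * kk k * B k) ^+ 2) = y * z ^+ 2 * (A k ^+ 2 + B k ^+ 2) * kk k ^+ 2 by ring.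
have -> : z ^+ 2 * (y * AA k ^+ 2 * (A k ^+ 2 + B k ^+ 2)) = y * z ^+ 2 * (A k ^+ 2 + B k ^+ 2) * AA k ^+ 2 by ring.
by move=> h1 h2; exact: (ler_wpM2l (mulr_ge0 (mulr_ge0 y0 h2) h1) kA).
Qed.

Lemma plancherel_partial (r s : R) : 0 < s -> r <= s - 1 -> @partial_bound R d r 2 2 s.
Proof.
move=> s0 rs; pose m := (Num.trunc (s / 2)).+1.
have sm : s < 2 * m%:R by rewrite mulrC -ltr_pdivrMr// truncnS_gt.
have [C C0 H] := sum_energy s0 sm.
pose z : R := 2 * pi; have z0 : 0 < z by rewrite mulr_gt0// pi_gt0.
exists m.*2, (z * C); first exact: mulr_gt0.
move=> i F_ W K A B S K0 fam cAB SL; have [tf _ _] := fam.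
apply: hn_energy => [|k|N]; first exact: mulr_ge0 (mulr_ge0 (ltW z0) (ltW C0)) (ltW K0).
  have [_ ->] := SL (- k); have [_ ->] := SL k.
  by rewrite (coefs_odd k tf cAB).1 mxE mulrNz mulrN mulNr.
rewrite -mulrA exprMn; apply: le_trans (ler_wpM2l (sqr_ge0 z) (H _ _ _ _ _ K0 fam cAB N)).
rewrite mulr_sumr; apply: ler_sum => k _; have [-> ->] := SL k.
have A0 := AA_gt0 k : 0 < AA k :> R.
have A1 : AA k `^ r * AA k <= AA k `^ s :> R.
  rewrite -[X in _ * X]powRr1 ?(ltW A0)// -powRDp//; apply: ler_powR; first exact: AA_ge1.
  by rewrite -lerBrDr.
rewrite -/z; have := powR_ge0 (AA k) r; move: (_ `^ r) A1 => y A1 y0.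
have kA : (k 0 i)%:~R ^+ 2 <= AA k :> R.
  rewrite /AA /kk (bigD1 i)//= addrCA lerDl addr_ge0// sumr_ge0// => j _; exact: sqr_ge0.
have h1 := sqr_ge0 z; have h2 := addr_ge0 (sqr_ge0 (A k)) (sqr_ge0 (B k)).
have -> : y * ((z * (k 0 i)%:~R * B k) ^+ 2 + (- (z * (k 0 i)%:~R) * A k) ^+ 2) = z ^+ 2 * ((y * (k 0 i)%:~R ^+ 2) * (A k ^+ 2 + B k ^+ 2)) by ring.
rewrite ler_wpM2l// ler_wpM2r//; apply: le_trans A1.
by rewrite ler_wpM2l.
Qed.

End Plancherel.

(** * Dyadic blocks and Besov norms *)

Section Nikolskii.
Context {R : realType} {d : nat}.
Implicit Types (f g : 'rV[R]_d -> R) (k : 'rV[int]_d) (P Q : @trig R d).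

Definition freqs P := [seq t.1 | t <- P].

Definition tprod2 (t t' : 'rV[int]_d * (R * R)) : trig :=
  [:: (t.1 - t'.1, ((t.2.1 * t'.2.1 + t.2.2 * t'.2.2) / 2, (t.2.2 * t'.2.1 - t.2.1 * t'.2.2) / 2));
      (t.1 + t'.1, ((t.2.1 * t'.2.1 - t.2.2 * t'.2.2) / 2, (t.2.2 * t'.2.1 + t.2.1 * t'.2.2) / 2))].

Definition tprod P Q : trig := flatten [seq tprod2 t t' | t <- P, t' <- Q].

Lemma tev_tprod P Q x : tev (tprod P Q) x = tev P x * tev Q x.
Proof.
rewrite /tev big_flatten/= big_allpairs_dep/= mulr_suml; apply: eq_bigr => t _.
rewrite mulr_sumr; apply: eq_bigr => t' _; rewrite !big_cons big_nil addr0 /=.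
rewrite !phaseDk !phaseNk cosB cosD sinB sinD.
by field.
Qed.

Lemma box_addsub N N' k k' : k \in box N -> k' \in box N' ->
  k + k' \in box (N + N') /\ k - k' \in box (N + N').
Proof.
rewrite !mem_box => /forallP H /forallP H'; split; apply/forallP => i; rewrite !mxE PoszD.
  by apply: le_trans (ler_normD _ _) _; exact: lerD.
by apply: le_trans (ler_normB _ _) _; exact: lerD.
Qed.

Lemma tprod_box P Q N N' : {subset freqs P <= box N} -> {subset freqs Q <= box N'} ->
  {subset freqs (tprod P Q) <= box (N + N')}.
Proof.
move=> hP hQ k /mapP[t /flattenP[s /allpairsPdep[t1 [t2 [h1 h2 ->]]]] + ->].
have m1 : t1.1 \in box N by apply: hP; exact: map_f.
have m2 : t2.1 \in box N' by apply: hQ; exact: map_f.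
have [a b] := box_addsub m1 m2.
by rewrite !inE => /orP[]/eqP ->.
Qed.

Lemma tev_exp P N m : {subset freqs P <= box N} -> exists2 Q,
  {subset freqs Q <= box (m * N)} & forall x, tev Q x = tev P x ^+ m.
Proof.
move=> hP; elim: m => [|m [Q hQ EQ]].
  exists [:: (0, (1, 0))].
    by move=> k; rewrite !inE => /eqP ->; rewrite mem_box; apply/forallP => i; rewrite mxE normr0.
  by move=> x; rewrite expr0 /tev big_seq1/= phase0 cos0 sin0 mulr1 mulr0 addr0.
exists (tprod P Q); first by rewrite mulSn; exact: tprod_box.
by move=> x; rewrite tev_tprod EQ exprS.
Qed.

Lemma tev_fourier P N x : {subset freqs P <= box N} ->
  tev P x = \sum_(k <- box N) (fcos (tev P) k * cos (phase k x) + fsin (tev P) k * sin (phase k x)).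
Proof.
move=> hP.
under eq_bigr => k _ do rewrite fcos_tev fsin_tev !mulr_suml -big_split/=.
rewrite exchange_big/= /tev big_seq [RHS]big_seq; apply: eq_bigr => t tP.
have tb : t.1 \in box N by apply: hP; exact: map_f.
have tb' : - t.1 \in box N by rewrite box_opp.
have pick (F : 'rV[int]_d -> R) k : k \in box N -> \sum_(l <- box N) (k == l)%:R * F l = F k.
  move=> kN; rewrite (bigD1_seq k)//= ?box_uniq// eqxx mul1r big1 ?addr0//.
  by move=> l; rewrite eq_sym => /negbTE ->; rewrite mul0r.
transitivity (2^-1 * t.2.1 * (\sum_(l <- box N) (t.1 == l)%:R * cos (phase l x) + \sum_(l <- box N) (- t.1 == l)%:R * cos (phase l x))
  + 2^-1 * t.2.2 * (\sum_(l <- box N) (t.1 == l)%:R * sin (phase l x) - \sum_(l <- box N) (- t.1 == l)%:R * sin (phase l x))).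
  by rewrite !pick// phaseNk cosN sinN; field.
rewrite -sumrN -!big_split/= !mulr_sumr -big_split/=; apply: eq_bigr => l _.
by rewrite (eqr_oppLR t.1 l); ring.
Qed.

Lemma sqr_sum_le (I : Type) (r : seq I) (v : I -> R) :
  (\sum_(i <- r) v i) ^+ 2 <= (size r)%:R * \sum_(i <- r) v i ^+ 2.
Proof.
elim: r => [|i r IH]; first by rewrite !big_nil expr0n mul0r.
rewrite !big_cons/= -natr1.
have V0 : 0 <= \sum_(j <- r) v j ^+ 2 by apply: sumr_ge0 => j _; exact: sqr_ge0.
have : 2 * v i * \sum_(j <- r) v j <= (size r)%:R * v i ^+ 2 + \sum_(j <- r) v j ^+ 2.
  elim: (r) => [|j s IHs]; first by rewrite !big_nil mulr0 mul0r addr0.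
  by rewrite !big_cons/= -natr1; have := sqr_ge0 (v i - v j); move: IHs; lra.
by move: IH; lra.
Qed.

Lemma size_box N : (size (@box d N) = N.*2.+1 ^ d)%N.
Proof. by rewrite size_map -cardE card_ffun !card_ord. Qed.

(** Cauchy-Schwarz over the (2N + 1)^d frequencies of the box, then Bessel's inequality. *)
Lemma sup_l2 P N x : {subset freqs P <= box N} ->
  tev P x ^+ 2 <= (N.*2.+1)%:R ^+ d * torus_integral (fun x => tev P x ^+ 2).
Proof.
move=> hP; rewrite (tev_fourier x hP).
apply: le_trans (sqr_sum_le _ _) _.
rewrite size_box natrX ler_wpM2l ?exprn_ge0//.
apply: le_trans (bessel_inequality N (test_tev P)); apply: ler_sum => k _.
have := cos2Dsin2 (phase k x); move: (cos _) (sin _) (fcos _ _) (fsin _ _) => c s a b E.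
have -> : a ^+ 2 + b ^+ 2 = (a ^+ 2 + b ^+ 2) * (c ^+ 2 + s ^+ 2) by rewrite E mulr1.
have := sqr_ge0 (a * s - b * c); lra.
Qed.

(** The L^2 estimate is applied to P^m with 2m > q, whose frequencies lie in the box of size m N. If
    b is the supremum of |P|, then |P|^(2m) <= b^(2m - q) |P|^q turns it into b^(2m) <= Z b^(2m - q)
    c^q, and b^(2m - q) cancels. *)
Lemma nikolskii (q : R) : 1 <= q -> exists2 C : R, 0 < C &
  forall P N c, (0 < N)%N -> {subset freqs P <= box N} -> nq q (tev P) c ->
    supb (tev P) (C * N%:R `^ (d%:R / q) * c).
Proof.
move=> q1; have q0 : 0 < q by exact: lt_le_trans q1.
pose m := (Num.trunc (q / 2)).+1.
have qm : q < 2 * m%:R by rewrite mulrC -ltr_pdivrMr// truncnS_gt.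
exists ((3 * m%:R) `^ (d%:R / q)); first by rewrite powR_gt0// mulr_gt0.
move=> P N c N0 hP Pc.
have c0 := nq_ge0 q1 Pc.
pose A : set R := [set `|tev P x| | x in setT].
have [bb bb0 hbb] := cper_bounded (test_cper (test_tev P)).
have uA : has_ubound A by exists bb => _ [x _ <-].
pose b := sup A.
have bP x : `|tev P x| <= b by apply: (ub_le_sup uA); exists x.
have b0 : 0 <= b by exact: le_trans (bP 0).
have [Q hQ EQ] := tev_exp m hP.
pose Z : R := ((m * N).*2.+1)%:R ^+ d.
have Z0 : 0 < Z by rewrite exprn_gt0.
have [_ Ic] := (nqP q1 _ c).1 Pc.
have cp := cper_normpow q1 (test_cper (test_tev P)).
rewrite (integral_tint (cper_integ cp)) lee_fin in Ic.
have Im : torus_integral (fun x => tev Q x ^+ 2) <= b `^ (2 * m%:R - q) * c `^ q.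
  apply: (@le_trans _ _ (torus_integral (fun x => b `^ (2 * m%:R - q) * `|tev P x| `^ q))); last first.
    rewrite tintZ; last exact: cper_integ cp.
    by rewrite ler_wpM2l ?powR_ge0.
  apply: le_tint.
  - by under eq_fun do rewrite expr2; apply: integ_test; apply: testM; exact: test_tev.
  - by apply: integZ; exact: cper_integ cp.
  move=> x; rewrite EQ -exprM -[leLHS]ger0_norm; last by rewrite exprM sqr_ge0.
  rewrite normrX; have [->|z0] := eqVneq `|tev P x| 0.
    by rewrite expr0n muln2 double_eq0/= mulr_ge0 ?powR_ge0.
  have z0' : 0 < `|tev P x| by rewrite lt0r z0 normr_ge0.
  have -> : `|tev P x| ^+ (m * 2) = `|tev P x| `^ (2 * m%:R - q) * `|tev P x| `^ q.
    by rewrite -powRDp// subrK -powR_mulrn// natrM mulrC.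
  by rewrite ler_wpM2r ?powR_ge0//; apply: powR_mono => //; rewrite subr_ge0 ltW.
have bnd x : `|tev P x| `^ (2 * m%:R) <= Z * (b `^ (2 * m%:R - q) * c `^ q).
  have := sup_l2 x hQ; rewrite EQ => h.
  apply: le_trans (le_trans _ h) _; last by rewrite ler_wpM2l// ltW.
  rewrite -exprM -[leRHS]ger0_norm; last by rewrite exprM sqr_ge0.
  by rewrite normrX -natrM powR_mulrn// mulnC.
have [b00|bpos] := eqVneq b 0.
  move=> x; apply: le_trans (bP x) _; rewrite b00.
  by rewrite !mulr_ge0 ?powR_ge0.
have {}bpos : 0 < b by rewrite lt0r bpos.
have m20 : 0 < 2 * m%:R :> R by rewrite mulr_gt0.
have bb2 : b `^ (2 * m%:R) <= Z * (b `^ (2 * m%:R - q) * c `^ q).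
  set w := Z * _; have w0 : 0 <= w by rewrite mulr_ge0 ?(ltW Z0)// mulr_ge0 ?powR_ge0.
  have : b <= w `^ (2 * m%:R)^-1.
    apply: ge_sup; first by exists `|tev P 0|, 0.
    move=> _ [x _ <-]; have h := powR_mono (_ : 0 <= (2 * m%:R)^-1) (powR_ge0 _ _) (bnd x).
    have := h _; rewrite invr_ge0 (ltW m20) -powRrM divff ?gt_eqF// powRr1//; exact.
  move=> /(powR_mono (ltW m20) b0); rewrite -[(w `^ _) `^ _]powRrM mulVf ?gt_eqF// powRr1//.
have bq : b `^ q <= Z * c `^ q.
  have bp : 0 < b `^ (2 * m%:R - q) by exact: powR_gt0.
  rewrite -(ler_pM2l bp) -powRDp// subrK.
  by apply: le_trans bb2 _; rewrite mulrCA.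
have Zle : Z <= (3 * m%:R * N%:R) ^+ d.
  rewrite lerXn2r ?nnegrE ?mulr_ge0// -natrM -natrM ler_nat.
  have : (0 < m * N)%N by rewrite muln_gt0.
  rewrite -mulnA; move: (m * N)%N => z z0.
  by rewrite mulSn mul2n -[X in (X < _)%N]add0n ltn_add2r.
move=> x; apply: le_trans (bP x) _.
have := powR_mono (_ : 0 <= q^-1) (powR_ge0 _ _) bq.
rewrite invr_ge0 (ltW q0) => /(_ isT).
rewrite -powRrM divff ?gt_eqF// powRr1// powRM ?powR_ge0 ?(ltW Z0)//.
rewrite -powRrM divff ?gt_eqF// powRr1// => h; apply: (le_trans h).
rewrite ler_wpM2r// -powRM ?mulr_ge0//.
have -> : (3 * m%:R * N%:R) `^ (d%:R / q) = ((3 * m%:R * N%:R) ^+ d) `^ q^-1.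
  by rewrite -powR_mulrn ?mulr_ge0// -powRrM.
by apply: powR_mono; rewrite ?invr_ge0 ?(ltW q0) ?(ltW Z0).
Qed.

Lemma bd_trig B P N n (c : R) : tnorm B -> (0 < N)%N -> {subset freqs P <= box N} ->
  B (tev P) c -> bd B n c (2 * pi * N%:R) (tev P).
Proof.
move=> tB N0; elim: n P c => [|n IH] P c hP BP; split=> // i.
have hP' : {subset freqs (trig_partial i P) <= box N}.
  by rewrite trig_partialE /freqs tmul_freq.
rewrite partial_tev; apply: IH => //.
have sub : {subset box N <= [pred k : 'rV[int]_d | `|k 0 i| <= N]}.
  by move=> k; rewrite mem_box => /forallP /(_ i).
have [_ H] := mb_sub sub (mb_partial tB i N0).
have H2 := H P c hP BP.
have p0 : 0 <= 2 * pi :> R by rewrite mulr_ge0// pi_ge0.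
rewrite (_ : tev _ = fun x => 2 * pi * tev (tmul true (fun k => (k 0 i)%:~R) P) x); last first.
  by apply/funext => x; rewrite trig_partialE tmulZ.
have := bZ tB (2 * pi) (@ctev _ _ _) H2; rewrite ger0_norm//.
by rewrite (_ : 2 * pi * (N%:R * c) = c * (2 * pi * N%:R))//; move: (2 * pi) => z; ring.
Qed.

(** Scales are normalised to powers of 2: a constant factor in the scale becomes a constant factor
    in the bound. *)
Lemma bd_scale B n (c K lam : R) f : norm_like B -> 1 <= K -> bd B n c (K * lam) f ->
  bd B n (K ^+ n * c) lam f.
Proof.
move=> nB K1; elim: n c f => [|n IH] c f [Bf bf]; first by split=> //; rewrite expr0 mul1r.
have c0 := nl_ge0 nB Bf.
split; first by apply: (nl_le nB) Bf _; rewrite ler_peMl// exprn_ege1.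
move=> i; have := IH _ _ (bf i).
by rewrite (_ : K ^+ n * (c * (K * lam)) = K ^+ n.+1 * c * lam)// exprS; ring.
Qed.

End Nikolskii.

(** * Distributions and their Fourier coefficients *)

Section Distr.
Context {R : realType} {d : nat}.
Implicit Types (f g : 'rV[R]_d -> R) (k : 'rV[int]_d) (T S u v : functional R d).

Lemma distr0 T : distribution_on_torus T -> T (fun=> 0) = 0.
Proof.
move=> [lin _]; have := lin 1 (fun=> 0) (fun=> 0) (test_cst 0) (test_cst 0).
rewrite (_ : (fun x : 'rV[R]_d => 1 * 0 + 0) = (fun=> 0)); last by apply/funext => x; rewrite mulr0 addr0.
by rewrite mul1r => /eqP; rewrite -subr_eq0 opprD addrA subrr sub0r oppr_eq0 => /eqP.
Qed.

Lemma distrZ T (a : R) f : distribution_on_torus T -> test_function f ->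
  T (fun x => a * f x) = a * T f.
Proof.
move=> dT tf; have [lin _] := dT.
have := lin a f (fun=> 0) tf (test_cst 0); rewrite (distr0 dT) addr0 => <-.
by congr T; apply/funext => x; rewrite addr0.
Qed.

Lemma distrD T f g : distribution_on_torus T -> test_function f -> test_function g ->
  T (fun x => f x + g x) = T f + T g.
Proof.
move=> [lin _] tf tg; have := lin 1 f g tf tg; rewrite mul1r => <-.
by congr T; apply/funext => x; rewrite mul1r.
Qed.

Lemma distrB T f g : distribution_on_torus T -> test_function f -> test_function g ->
  T (fun x => f x - g x) = T f - T g.
Proof.
move=> dT tf tg; rewrite -mulN1r -distrZ// -distrD//; last exact: testZ.
by congr T; apply/funext => x; rewrite mulN1r.
Qed.

Lemma distr_sum T (I : Type) (r : seq I) (F : I -> 'rV[R]_d -> R) : distribution_on_torus T ->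
  (forall i, test_function (F i)) -> T (fun x => \sum_(i <- r) F i x) = \sum_(i <- r) T (F i).
Proof.
move=> dT tF; elim: r => [|i r IH].
  by rewrite big_nil -[RHS](distr0 dT); congr T; apply/funext => x; rewrite big_nil.
rewrite big_cons -IH -distrD//; last exact: test_sum.
by congr T; apply/funext => x; rewrite big_cons.
Qed.

Lemma bd_iter_partial n (e : R) f l x : bd supb n e 1 f -> (size l <= n)%N ->
  `|iter_partial l f x| <= e.
Proof.
elim/last_ind: l n e f => [|l i IH] n e f; first by move=> /bd0 b _; exact: b.
rewrite size_rcons; case: n => // n b sl.
rewrite /iter_partial foldr_rcons.
by have := IH n (e * 1) _ (bd_partial i b) sl; rewrite mulr1.
Qed.

Lemma distr_small T f (e : R) : distribution_on_torus T -> test_function f -> 0 < e ->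
  exists P, `|T f - T (tev P)| <= e.
Proof.
move=> dT tf e0; have [_ [N [C HC]]] := dT.
pose C' := 1 + `|C|; have C'0 : 0 < C' by rewrite ltr_pwDl.
have e1 : 0 < e / C' by rewrite divr_gt0.
have [P bP] := trig_dense N tf e1; exists P.
rewrite -distrB//; last exact: test_tev.
apply: le_trans (HC _ (e / C') (testB tf (test_tev P)) (fun l x sl => bd_iter_partial x bP sl)) _.
apply: (@le_trans _ _ (C' * (e / C'))); last by rewrite mulrC divfK// gt_eqF.
by rewrite ler_wpM2r ?(ltW e1)//; apply: le_trans (ler_norm _) _; rewrite lerDr.
Qed.

Lemma distr_tev T P : distribution_on_torus T ->
  T (tev P) = \sum_(t <- P) (t.2.1 * T (cos \o phase t.1) + t.2.2 * T (sin \o phase t.1)).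
Proof.
move=> dT; rewrite distr_sum// => [|t]; last first.
  by apply: testD; apply: testZ; [exact: test_cosp|exact: test_sinp].
apply: eq_bigr => t _.
have tc := test_cosp t.1 : test_function (cos \o phase t.1 : 'rV[R]_d -> R).
have ts := test_sinp t.1 : test_function (sin \o phase t.1 : 'rV[R]_d -> R).
by rewrite distrD ?distrZ//; exact: testZ.
Qed.

(** A distribution has finite order N, and trigonometric polynomials are dense in C^N. *)
Lemma distr_eq_trig T S : distribution_on_torus T -> distribution_on_torus S ->
  (forall k, T (cos \o phase k) = S (cos \o phase k) /\ T (sin \o phase k) = S (sin \o phase k)) ->
  eq_distr T S.
Proof.
move=> dT dS E f tf; apply/eqP; rewrite -subr_eq0 -normr_le0; apply/ler_addgt0Pr => e e0.
rewrite add0r.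
have dB : distribution_on_torus (T \- S).
  have [lT [N1 [C1 H1]]] := dT; have [lS [N2 [C2 H2]]] := dS; split.
    by move=> a phi psi tp ts /=; rewrite lT// lS//; ring.
  exists (maxn N1 N2), (C1 + C2) => phi M tp HM /=.
  apply: le_trans (ler_normB _ _) _; rewrite mulrDl; apply: lerD.
    by apply: H1 => // l x sl; apply: HM; apply: leq_trans sl (leq_maxl _ _).
  by apply: H2 => // l x sl; apply: HM; apply: leq_trans sl (leq_maxr _ _).
have [P HP] := distr_small dB tf e0.
apply: le_trans HP; rewrite /= !distr_tev//.
rewrite (eq_bigr (fun t => t.2.1 * S (cos \o phase t.1) + t.2.2 * S (sin \o phase t.1))); last first.
  by move=> t _; have [-> ->] := E t.1.
by rewrite subrr subr0.
Qed.

Lemma distr_of_fun_distr f : integ f -> distribution_on_torus (distr_of_fun f).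
Proof.
move=> fi.
have im phi : test_function phi -> integ (fun x => f x * phi x).
  move=> tp; have [C _ hC] := cper_bounded (test_cper tp).
  exact: (integM fi (mrow_test tp) hC).
split.
  move=> a phi psi tp ts; rewrite /distr_of_fun -tintZ ?im// -tintD ?im//; last by apply: integZ; exact: im.
  by congr torus_integral; apply/funext => x; ring.
exists 0%N, (torus_integral (fun x => `|f x|)) => phi M tp HM.
apply: le_trans (normr_tint (im _ tp)) _.
rewrite mulrC -tintZ; last exact: integ_norm.
apply: le_tint.
- by apply: integ_norm; exact: im.
- by apply: integZ; exact: integ_norm.
move=> x; rewrite normrM mulrC ler_wpM2r//.
exact: (HM [::]).
Qed.

Lemma distr_partial_distr i T : distribution_on_torus T -> distribution_on_torus (distr_partial i T).
Proof.
move=> dT; have [lin [N [C H]]] := dT; split.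
  move=> a phi psi tp ts; rewrite /distr_partial.
  have -> : partial i (fun x => a * phi x + psi x) = fun x => a * partial i phi x + partial i psi x.
    rewrite partialD; [|by move=> x; apply: test_diff; exact: testZ|by move=> x; exact: test_diff].
    by rewrite partialZ// => x; exact: test_diff.
  by rewrite lin; [ring|exact: test_partial|exact: test_partial].
exists N.+1, C => phi M tp HM; rewrite /distr_partial normrN.
apply: H; first exact: test_partial.
by move=> l x sl; have := HM (rcons l i) x; rewrite /iter_partial foldr_rcons size_rcons; apply.
Qed.

End Distr.

(** * Littlewood-Paley blocks of a distribution *)

Section Blocks.
Context {R : realType} {d : nat}.
Implicit Types (f g : 'rV[R]_d -> R) (k : 'rV[int]_d) (T S u v : functional R d).
Variables (chi : R -> R) (hchi : dyadic_profile chi).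

Lemma freq_norm_ge k i : `|(k 0 i)%:~R| <= freq_norm k :> R.
Proof.
rewrite -sqrtr_sqr /freq_norm; apply: ler_wsqrtr.
by rewrite (bigD1 i)//= lerDl sumr_ge0// => j _; exact: sqr_ge0.
Qed.

Lemma chi0 (r : R) : 2 <= r -> chi r = 0. Proof. by case: hchi => _ _; exact. Qed.
Lemma chi1 (r : R) : r <= 1 -> chi r = 1. Proof. by case: hchi => _ + _; exact. Qed.

Lemma dyadic_symbol0 l k : k \notin box (2 ^ l.+1) -> dyadic_symbol chi l k = 0.
Proof.
rewrite mem_box negb_forall => /existsP[i]; rewrite -ltNge => ki.
have fk : (2 ^ l.+1)%:R < freq_norm k :> R.
  apply: lt_le_trans (freq_norm_ge k i).
  by rewrite -intr_norm [X in X < _]pmulrn ltr_int.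
have e (j : nat) : (j <= l)%N -> 2 <= freq_norm k / 2 ^+ j :> R.
  move=> jl; rewrite ler_pdivlMr ?exprn_gt0// -exprS -natrX.
  by apply: le_trans (ltW fk); rewrite ler_nat leq_exp2l.
case: l fk e {ki} => [|l] fk e /=.
  by rewrite chi0//; have := e 0%N (leqnn _); rewrite expr0 divr1.
by rewrite !chi0 ?subrr// e.
Qed.

Lemma dyadic_symbolN l k : dyadic_symbol chi l (- k) = dyadic_symbol chi l k.
Proof.
have E : freq_norm (- k) = freq_norm k :> R.
  by rewrite /freq_norm; congr Num.sqrt; apply: eq_bigr => i _; rewrite mxE mulrNz sqrrN.
by case: l => [|l] /=; rewrite E.
Qed.

Definition btrig l u : trig :=
  ptrig (fun k => dyadic_symbol chi l k * u (cos \o phase k))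
        (fun k => dyadic_symbol chi l k * u (sin \o phase k)) (2 ^ l.+1).

(** The sum over Z^d is finite, because the symbol vanishes outside the box of size 2^(l+1). *)
Lemma dyadic_blockE l u : distribution_on_torus u -> dyadic_block chi l u = tev (btrig l u).
Proof.
move=> du; apply/funext => x; rewrite /dyadic_block.
rewrite -(@fsbig_widen _ _ _ _ [set` box (2 ^ l.+1)]); last first.
- by move=> k /= [_ /negP kN]; rewrite /= dyadic_symbol0 ?mul0r.
- by [].
rewrite -fsbig_seq ?box_uniq//.
rewrite /btrig /ptrig /tev [RHS]big_map.
apply: eq_bigr => k _ /=.
have tc := test_cosp k : test_function (cos \o phase k : 'rV[R]_d -> R).
have ts := test_sinp k : test_function (sin \o phase k : 'rV[R]_d -> R).
rewrite (_ : (fun y => cos (phase k (x - y))) =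
    (fun y => cos (phase k x) * (cos \o phase k) y + sin (phase k x) * (sin \o phase k) y)).
  by rewrite distrD ?distrZ//; [ring|exact: testZ|exact: testZ].
by apply/funext => y /=; rewrite phaseB cosB.
Qed.

Lemma btrig_box l u : {subset freqs (btrig l u) <= box (2 ^ l.+1)}.
Proof. by rewrite /freqs /btrig /ptrig -map_comp map_id_in. Qed.

Lemma cosphN k : cos \o phase (- k) = cos \o phase k :> ('rV[R]_d -> R).
Proof. by apply/funext => x /=; rewrite phaseNk cosN. Qed.

Lemma sinphN u k : distribution_on_torus u -> u (sin \o phase (- k)) = - u (sin \o phase k).
Proof.
move=> du; have ts := test_sinp k : test_function (sin \o phase k : 'rV[R]_d -> R).
rewrite -mulN1r -distrZ//; congr u; apply/funext => x /=.
by rewrite phaseNk sinN mulN1r.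
Qed.

Lemma fcos_block l u k : distribution_on_torus u ->
  fcos (dyadic_block chi l u) k = dyadic_symbol chi l k * u (cos \o phase k).
Proof.
move=> du; rewrite dyadic_blockE// fcos_ptrig.
  by case: ifPn => // kN; rewrite dyadic_symbol0// mul0r.
by move=> k'; rewrite dyadic_symbolN cosphN.
Qed.

Lemma fsin_block l u k : distribution_on_torus u ->
  fsin (dyadic_block chi l u) k = dyadic_symbol chi l k * u (sin \o phase k).
Proof.
move=> du; rewrite dyadic_blockE// fsin_ptrig.
  by case: ifPn => // kN; rewrite dyadic_symbol0// mul0r.
by move=> k'; rewrite dyadic_symbolN sinphN// mulrN.
Qed.

Lemma test_block l u : distribution_on_torus u -> test_function (dyadic_block chi l u).
Proof. by move=> du; rewrite dyadic_blockE//; exact: test_tev. Qed.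

Lemma sum_symbol n k : \sum_(l < n.+1) dyadic_symbol chi l k = chi (freq_norm k / 2 ^+ n).
Proof.
elim: n => [|n IH]; first by rewrite big_ord_recl big_ord0 addr0/= expr0 divr1.
by rewrite big_ord_recr IH/= addrC subrK.
Qed.

Lemma sum_symbol1 k : \forall n \near \oo, \sum_(l < n) dyadic_symbol chi l k = 1.
Proof.
exists (Num.trunc (freq_norm k : R)).+2 => // -[//|n] /= hn.
rewrite sum_symbol chi1// ler_pdivrMr ?exprn_gt0// mul1r.
apply: le_trans (ltW (truncnS_gt _)) _; rewrite -natrX ler_nat.
by apply: leq_trans (ltnW (ltn_expl n (ltnSn 1))).
Qed.

Lemma coefs_block u : distribution_on_torus u ->
  coefs (fun l => dyadic_block chi l u) (fun k => u (cos \o phase k)) (fun k => u (sin \o phase k)).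
Proof.
move=> du k; split; apply: cvg_near_cst; apply: filterS (sum_symbol1 k) => n En.
  by under eq_bigr do rewrite fcos_block//; rewrite -mulr_suml En mul1r.
by under eq_bigr do rewrite fsin_block//; rewrite -mulr_suml En mul1r.
Qed.

Lemma blockB l u v x : distribution_on_torus u -> distribution_on_torus v ->
  distribution_on_torus (u \- v) ->
  dyadic_block chi l (u \- v) x = dyadic_block chi l u x - dyadic_block chi l v x.
Proof.
move=> du dv duv; rewrite !dyadic_blockE// /btrig /ptrig /tev !big_map -sumrB.
by apply: eq_bigr => k _ /=; ring.
Qed.

Lemma distrBB u v : distribution_on_torus u -> distribution_on_torus v ->
  distribution_on_torus (u \- v).
Proof.
move=> [lT [N1 [C1 H1]]] [lS [N2 [C2 H2]]]; split.
  by move=> a phi psi tp ts /=; rewrite lT// lS//; ring.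
exists (maxn N1 N2), (C1 + C2) => phi M tp HM /=.
apply: le_trans (ler_normB _ _) _; rewrite mulrDl; apply: lerD.
  by apply: H1 => // l x sl; apply: HM; apply: leq_trans sl (leq_maxl _ _).
by apply: H2 => // l x sl; apply: HM; apply: leq_trans sl (leq_maxr _ _).
Qed.

(* The block norms of a distribution whose Besov norm is at most [K]. *)
Definition besov_data (q p theta : R) u (beta : nat -> R) (K : R) : Prop :=
  [/\ distribution_on_torus u, forall l, nq q (dyadic_block chi l u) (beta l)
    & forall N, \sum_(l < N) (2 `^ (l%:R * theta) * beta l) `^ p <= K `^ p].

(** Passage from extended reals to reals: the block norms are finite because blocks are
    trigonometric polynomials, and partial sums of the series are below its total. *)
Lemma besov_dataP (q p theta : R) u (K : R) : 1 <= q -> 0 < p -> distribution_on_torus u ->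
  (besov_norm chi theta q p u <= K%:E)%E -> exists beta, besov_data q p theta u beta K.
Proof.
move=> q1 p0 du uK.
have fin l : exists b, Lq_norm q (dyadic_block chi l u) = b%:E.
  have [C C0 hC] := cper_bounded (test_cper (test_block l du)).
  have := nq_sup q1 (mrow_test (test_block l du)) hC.
  rewrite /nq => h; exists (fine (Lq_norm q (dyadic_block chi l u))).
  by rewrite fineK// ge0_fin_numE ?Lq_ge0//; apply: le_lt_trans h _; exact: ltry.
have [beta Hb] := choice fin; exists beta; split=> // [l|N].
  by rewrite /nq Hb.
have b0 l : 0 <= beta l by rewrite -lee_fin -Hb Lq_ge0.
have K0 : 0 <= K by rewrite -lee_fin (le_trans _ uK)// poweR_ge0.
pose V l := (((2 `^ (l%:R * theta))%:E * Lq_norm q (dyadic_block chi l u)) `^ p)%E.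
have VE l : V l = ((2 `^ (l%:R * theta) * beta l) `^ p)%:E by rewrite /V Hb -EFinM poweR_EFin.
have V0 l : (0 <= V l)%E by exact: poweR_ge0.
have S0 : (0 <= \sum_(0 <= l <oo) V l)%E by apply: nneseries_ge0 => l _ _.
rewrite -lee_fin -sumEFin; under eq_bigr do rewrite -VE.
apply: (@le_trans _ _ (\sum_(0 <= l <oo) V l)%E).
  by have := @nneseries_lim_ge R V xpredT 0 N; rewrite big_mkord; apply=> l _ _.
have -> : (\sum_(0 <= l <oo) V l = (besov_norm chi theta q p u) `^ p)%E.
  by rewrite /besov_norm -poweRrM mulVf ?gt_eqF// poweRe1.
rewrite -poweR_EFin; apply: gt0_ler_poweR => //; first exact: ltW.
- by rewrite in_itv/= poweR_ge0 leey.
- by rewrite in_itv/= lee_fin K0 leey.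
Qed.

End Blocks.

(** * Telescoping of Psi(u) - Psi(v) *)

Section Nonlinear.
Context {R : realType} {d : nat}.
Implicit Types (f g : 'rV[R]_d -> R) (k : 'rV[int]_d) (u v : functional R d).
Variables (chi : R -> R) (hchi : dyadic_profile chi).
Variables (q p theta : R).
Hypotheses (q1 : 1 <= q) (p1 : 1 <= p) (hth : d%:R / q < theta).

Let p0 : 0 < p. Proof. exact: lt_le_trans p1. Qed.
Let q0 : 0 < q. Proof. exact: lt_le_trans q1. Qed.
Let nB := tn_nl (@tnorm_nq R d q q1).

Local Notation data := (besov_data chi q p theta).

Lemma tnorm_supb : tnorm (supb : ('rV[R]_d -> R) -> R -> Prop).
Proof.
split=> //; first exact: supb_nl.
  by move=> f c a _ H x; exact: H.
by move=> f c H x; apply/ler_addgt0Pr => e e0; exact: H.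
Qed.

Lemma data_ge0 u beta K l : data u beta K -> 0 <= beta l.
Proof. by move=> [_ b _]; exact: (nq_ge0 q1 (b l)). Qed.

Lemma data_le u beta K l : 0 <= K -> data u beta K -> beta l <= K * 2 `^ (- (l%:R * theta)).
Proof.
move=> K0 [_ b s]; have b0 i : 0 <= beta i by exact: (nq_ge0 q1 (b i)).
have e0 : 0 < 2 `^ (l%:R * theta) :> R by exact: powR_gt0.
rewrite powRN ler_pdivlMr// mulrC.
have h : (2 `^ (l%:R * theta) * beta l) `^ p <= K `^ p.
  apply: le_trans (s l.+1); rewrite big_ord_recr/= lerDr.
  by apply: sumr_ge0 => i _; exact: powR_ge0.
rewrite leNgt; apply/negP => lt.
have a1 : K \is Num.nneg by rewrite nnegrE.
have a2 : 2 `^ (l%:R * theta) * beta l \is Num.nneg by rewrite nnegrE mulr_ge0// ltW.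
by have := gt0_ltr_powR p0 a1 a2 lt; rewrite ltNge h.
Qed.

(** By Nikolskii's inequality the uniform norm of block l is of order 2^(l d / q) 2^(- l theta);
    condition (b) makes this ratio less than 1. *)
Definition decay : R := 2 `^ (d%:R / q - theta).

Lemma decay_gt0 : 0 < decay. Proof. exact: powR_gt0. Qed.

Lemma decay_lt1 : decay < 1.
Proof.
rewrite /decay /powR gt_eqF// expR_lt1 nmulr_rlt0 ?subr_lt0//.
by rewrite ln_gt0// ltr1n.
Qed.

Let four_pi : 1 <= 4 * pi :> R.
Proof. by have := pi_ge2 R; move: (pi : R) => z; lra. Qed.

Let lamE l : 2 * pi * (2 ^ l.+1)%:R = 4 * pi * 2 ^+ l :> R.
Proof. by rewrite natrX exprS; move: (pi : R) (2 ^+ l) => z y; ring. Qed.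

(** Bernstein's inequality gives the scale 2 pi 2^(l+1) = 4 pi 2^l; the factor 4 pi is moved into
    the constant. *)
Lemma block_bd B r u beta K l (c : R) : tnorm B -> data u beta K -> B (dyadic_block chi l u) c ->
  bd B r ((4 * pi) ^+ r * c) (2 ^+ l) (dyadic_block chi l u).
Proof.
move=> tB [du _ _] Bc; have N0 : (0 < 2 ^ l.+1)%N by rewrite expn_gt0.
apply: (bd_scale (tn_nl tB) four_pi).
rewrite -lamE (dyadic_blockE hchi)//; apply: (bd_trig r tB N0 (@btrig_box _ _ _ _ _)).
by rewrite -(dyadic_blockE hchi).
Qed.

Lemma block_sup r : exists2 C : R, 0 < C & forall u beta K l, 0 <= K -> data u beta K ->
  bd supb r (C * K * decay ^+ l) (2 ^+ l) (dyadic_block chi l u).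
Proof.
have [C C0 H] := @nikolskii R d q q1.
exists ((4 * pi) ^+ r * (C * 2 `^ (d%:R / q))).
  by rewrite !mulr_gt0 ?powR_gt0// exprn_gt0// (lt_le_trans _ four_pi).
move=> u beta K l K0 D; have [du b _] := D.
have N0 : (0 < 2 ^ l.+1)%N by rewrite expn_gt0.
have bl := b l; rewrite (dyadic_blockE hchi)// in bl.
have sb := H _ _ _ N0 (@btrig_box _ _ _ _ _) bl.
rewrite -(dyadic_blockE hchi)// in sb.
have := block_bd r tnorm_supb D sb; move/(bd_le supb_nl); apply.
  by rewrite exprn_ge0.
have c4 : 0 <= (4 * pi) ^+ r :> R by rewrite exprn_ge0// (le_trans _ four_pi).
rewrite -!mulrA ler_wpM2l// ler_wpM2l ?(ltW C0)//.
have -> : (2 ^ l.+1)%:R `^ (d%:R / q) = 2 `^ (d%:R / q) * (2 ^+ l) `^ (d%:R / q) :> R.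
  by rewrite natrX exprS powRM ?exprn_ge0.
rewrite -mulrA ler_wpM2l ?powR_ge0//.
have -> : K * decay ^+ l = (2 ^+ l) `^ (d%:R / q) * (K * 2 `^ (- (l%:R * theta))).
  rewrite mulrCA; congr (_ * _).
  rewrite /decay -(powR_mulrn l (powR_ge0 _ _)) -(powR_mulrn l (ler0n R 2)).
  by rewrite -!powRrM -powRDp//; congr (_ `^ _); ring.
by rewrite ler_wpM2l ?powR_ge0//; exact: data_le D.
Qed.

Definition psum n u x := \sum_(l < n) dyadic_block chi l u x.

Lemma test_psum n u : distribution_on_torus u -> test_function (psum n u).
Proof. by move=> du; apply: test_sum => l; exact: test_block. Qed.

Lemma psumB n u v x : distribution_on_torus u -> distribution_on_torus v ->
  psum n (u \- v) x = psum n u x - psum n v x.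
Proof.
move=> du dv; rewrite /psum -sumrB; apply: eq_bigr => l _.
by apply: blockB => //; exact: distrBB.
Qed.

Lemma psum_sup r : exists2 C : R, 0 < C & forall u beta K n, 0 <= K -> data u beta K ->
  bd supb r (C * K) (2 ^+ n) (psum n u).
Proof.
have [C C0 H] := block_sup r.
exists (C / (1 - decay)); first by rewrite divr_gt0// subr_gt0 decay_lt1.
move=> u beta K n K0 D; have [du _ _] := D.
have l0 : 0 <= 2 ^+ n :> R by rewrite exprn_ge0.
have := @bd_sum _ _ _ tnorm_supb r (2 ^+ n) _ (index_enum 'I_n) (fun l : 'I_n => dyadic_block chi l u)
  (fun l : 'I_n => C * K * decay ^+ l).
move=> /(_ (fun l => test_sm r (test_block hchi l du)) l0) h.
apply: (bd_le supb_nl l0) (h _) _.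
  move=> l; apply: bd_lam (H u beta K l K0 D); [exact: supb_nl|by rewrite exprn_ge0|].
  by rewrite ler_weXn2l ?ler1n// ltnW.
rewrite -mulr_sumr [leRHS](_ : _ = C * K * (1 - decay)^-1); last by ring.
rewrite ler_wpM2l ?mulr_ge0// ?(ltW C0)//.
by apply: geom_le; [exact: ltW decay_gt0|exact: decay_lt1].
Qed.

(** The limit of the dyadic partial sums as a total function, the preferred representative of u;
    [rep_dist] shows that the convergence is uniform. *)
Definition rep u x : R := limn (fun n => psum n u x).

Lemma rep_dist : exists2 C : R, 0 < C & forall u beta K n x, 0 <= K -> data u beta K ->
  psum n u x @[n --> \oo] --> rep u x /\ `|rep u x - psum n u x| <= C * K * decay ^+ n.
Proof.
have [C C0 H] := block_sup 0; have r1 := decay_lt1; have r0 := decay_gt0.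
exists (C / (1 - decay)); first by rewrite divr_gt0// subr_gt0.
move=> u beta K n x K0 D.
have bl l : `|dyadic_block chi l u x| <= C * K * decay ^+ l by exact: (bd0 (H u beta K l K0 D)).
have CK : 0 <= C * K by rewrite mulr_ge0// ltW.
have cv : cvgn (fun n => psum n u x).
  have -> : (fun n => psum n u x) = series (fun l => dyadic_block chi l u x).
    by apply/funext => m; rewrite /psum /series/= big_mkord.
  apply: normed_cvg; apply: nondecreasing_is_cvgn.
    exact: (@nondecreasing_series R (fun l => `|dyadic_block chi l u x|) xpredT 0 (fun _ _ _ => normr_ge0 _)).
  exists (C * K * (1 - decay)^-1) => _ [m _ <-] /=.
  apply: le_trans (ler_sum _ (fun l _ => bl l)) _.
  by rewrite big_mkord -mulr_sumr ler_wpM2l// geom_le// ltW.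
split; first exact: cv.
have part m : `|psum (n + m) u x - psum n u x| <= C / (1 - decay) * K * decay ^+ n.
  have -> : psum (n + m) u x - psum n u x = \sum_(l < m) dyadic_block chi (n + l) u x.
    by rewrite /psum big_split_ord/= addrAC subrr add0r.
  apply: le_trans (ler_norm_sum _ _ _) _.
  apply: le_trans (ler_sum _ (fun (l : 'I_m) _ => bl (n + l)%N)) _.
  under eq_bigr do rewrite exprD mulrA; rewrite -mulr_sumr mulrC (mulrAC C) -!mulrA mulrCA.
  rewrite [leRHS](_ : _ = (1 - decay)^-1 * (C * (K * decay ^+ n))); last by ring.
  rewrite [leLHS](_ : _ = (\sum_(l < m) decay ^+ l) * (C * (K * decay ^+ n))); last by ring.
  rewrite ler_wpM2r ?mulr_ge0 ?exprn_ge0 ?(ltW C0) ?(ltW r0)//.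
  by apply: geom_le => //; exact: ltW.
have cm : `|psum (n + m) u x - psum n u x| @[m --> \oo] --> `|rep u x - psum n u x|.
  apply: cvg_norm; apply: cvgB; last exact: cvg_cst.
  have := cv; rewrite -(cvg_shiftn n) /=.
  by under eq_fun do rewrite addnC.
rewrite -(cvg_lim _ cm)//; apply: limr_le; first by apply/cvg_ex; eexists; exact: cm.
by apply: nearW => m; exact: part.
Qed.

Lemma mrow_rep u beta K : 0 <= K -> data u beta K -> mrow (rep u).
Proof.
move=> K0 D; have [C _ H] := rep_dist; have [du _ _] := D.
apply: (measurable_fun_cvg (h := fun n t => psum n u (row_of_tuple t))) => [n|t _].
  exact: mrow_test (test_psum n du).
by have [h _] := H u beta K 0%N (row_of_tuple t) K0 D.
Qed.

Lemma rep_sup : exists2 C : R, 0 < C & forall u beta K, 0 <= K -> data u beta K -> supb (rep u) (C * K).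
Proof.
have [C C0 H] := rep_dist; exists C => // u beta K K0 D x.
have [_] := H u beta K 0%N x K0 D.
by rewrite /psum big_ord0 subr0 expr0 mulr1.
Qed.

Lemma integ_rep u beta K : 0 <= K -> data u beta K -> integ (rep u).
Proof.
move=> K0 D; have [C _ H] := rep_sup.
by apply: (integ_bounded (mrow_rep K0 D)) (H u beta K K0 D).
Qed.

Lemma tint_unif_cvg (G : nat -> 'rV[R]_d -> R) g phi (e : nat -> R) (C : R) :
  (forall n, integ (G n)) -> integ g -> mrow phi -> supb phi C ->
  (forall n x, `|g x - G n x| <= e n) -> e @ \oo --> 0 ->
  torus_integral (fun x => G n x * phi x) @[n --> \oo] --> torus_integral (fun x => g x * phi x).
Proof.
move=> iG ig mphi phiC He e0.
have h : e n * C @[n --> \oo] --> 0.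
  by have h2 := cvgM e0 (cvg_cst C); rewrite mul0r in h2; exact: h2.
apply/cvgrPdist_le => a a0.
have /cvgrPdist_le/(_ a a0) := h; apply: filterS => n.
rewrite sub0r normrN => hn; apply: le_trans (le_trans (ler_norm _) hn).
have i1 := integM ig mphi phiC; have i2 := integM (iG n) mphi phiC.
rewrite -tintB//; apply: tint_bound; first exact: integB.
by move=> x; rewrite -mulrBl normrM ler_pM.
Qed.

Lemma decay_cvg (C : R) : C * decay ^+ n @[n --> \oo] --> 0.
Proof.
have h : decay ^+ n @[n --> \oo] --> 0.
  by apply: cvg_expr; rewrite ger0_norm ?decay_lt1// ltW// decay_gt0.
by have h2 := cvgM (cvg_cst C) h; rewrite mulr0 in h2; exact: h2.
Qed.

Lemma rep_distr u beta K : 0 <= K -> data u beta K -> eq_distr u (distr_of_fun (rep u)).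
Proof.
move=> K0 D; have [du _ _] := D; have ir := integ_rep K0 D.
apply: distr_eq_trig => //; first exact: distr_of_fun_distr.
have [C _ H] := rep_dist.
have dist n x : `|rep u x - psum n u x| <= C * K * decay ^+ n by case: (H u beta K n x K0 D).
have ip n := integ_test (test_psum n du).
have E phi : mrow phi -> supb phi 1 -> (forall n, integ (fun x => dyadic_block chi n u x * phi x)) ->
    (\sum_(l < n) torus_integral (fun x => dyadic_block chi l u x * phi x)) @[n --> \oo] -->
     torus_integral (fun x => rep u x * phi x).
  move=> mp p1' ib; have := tint_unif_cvg ip ir mp p1' dist (decay_cvg _).
  under eq_fun => n.
    rewrite (_ : (fun x => _) = (fun x => \sum_(l < n) dyadic_block chi l u x * phi x)); last first.
      by apply/funext => x; rewrite /psum mulr_suml.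
    rewrite tint_sum; last by move=> l; exact: ib.
    over.
  by [].
move=> k; have [c1 s1] := coefs_block hchi du k.
split.
  suff EE : (\sum_(l < n) torus_integral (fun x => dyadic_block chi l u x * (cos \o phase k) x)) @[n --> \oo] -->
     torus_integral (fun x => rep u x * (cos \o phase k) x) by exact: (cvg_unique _ c1 EE).
  apply: E => [||n].
  - exact: mrow_test (test_cosp k).
  - by move=> x; exact: cos_max.
  - by apply: integ_fcos; apply: integ_test; exact: test_block.
suff EE : (\sum_(l < n) torus_integral (fun x => dyadic_block chi l u x * (sin \o phase k) x)) @[n --> \oo] -->
   torus_integral (fun x => rep u x * (sin \o phase k) x) by exact: (cvg_unique _ s1 EE).
apply: E => [||n].
- exact: mrow_test (test_sinp k).
- by move=> x; exact: sin_max.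
- by apply: integ_fsin; apply: integ_test; exact: test_block.
Qed.

Section Composition.
Variables (Psi : R -> R) (sPsi : smooth_on setT Psi) (M : R) (M0 : 0 <= M).

Definition nlblock u v (l : nat) : 'rV[R]_d -> R := fun x =>
  Psi (psum l.+1 u x) - Psi (psum l u x) - Psi (psum l.+1 v x) + Psi (psum l v x).

Lemma test_nlblock u v l : distribution_on_torus u -> distribution_on_torus v ->
  test_function (nlblock u v l).
Proof.
move=> du dv.
have tP n w : distribution_on_torus w -> test_function (fun x => Psi (psum n w x)).
  by move=> dw; apply: test_comp => //; exact: test_psum.
by apply: testD (tP _ _ dv); apply: testB (tP _ _ dv); apply: testB; exact: tP.
Qed.

Lemma nlblock_sum u v n x : \sum_(l < n) nlblock u v l x = Psi (psum n u x) - Psi (psum n v x).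
Proof.
elim: n => [|n IH]; first by rewrite big_ord0 /psum !big_ord0 subrr.
by rewrite big_ord_recr/= IH /nlblock; ring.
Qed.

Lemma nlblock_bd r : exists2 C : R, 0 < C & forall u v b1 b2 b3 (dl : R) l, 0 <= dl ->
  data u b1 M -> data v b2 M -> data (u \- v) b3 dl ->
  bd (nq q) r (C * (b3 l + dl * (b1 l + b2 l))) (2 ^+ l) (nlblock u v l).
Proof.
have [C1 C10 H1] := psum_sup r.
have CM : 0 <= C1 * M by rewrite mulr_ge0// ltW.
have [C3 C30 H3] := @bd_comp2 R d r Psi (C1 * M) sPsi CM.
pose C2 : R := (4 * pi) ^+ r.
have C20 : 0 < C2 by rewrite exprn_gt0// (lt_le_trans _ four_pi).
exists (2 ^+ r * (1 + C3) * (C2 * (1 + C1))).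
  by rewrite mulr_gt0//; apply: mulr_gt0 => //; rewrite ?exprn_gt0// ltr_pwDl// ltW.
move=> u v b1 b2 b3 dl l dl0 D1 D2 D3.
have [du n1 _] := D1; have [dv n2 _] := D2; have [duv n3 _] := D3.
have b10 := data_ge0 l D1; have b20 := data_ge0 l D2; have b30 := data_ge0 l D3.
have lam0 : 0 <= 2 ^+ l :> R by rewrite exprn_ge0.
have lam0' : 0 <= 2 ^+ l.+1 :> R by rewrite exprn_ge0.
have lamS : 2 ^+ l <= 2 ^+ l.+1 :> R by rewrite ler_weXn2l ?ler1n.
have sS n w : distribution_on_torus w -> sm r (psum n w) by move=> dw; exact: test_sm (test_psum n dw).
have up B c f : norm_like B -> bd B r c (2 ^+ l) f -> bd B r c (2 ^+ l.+1) f by move=> nB'; exact: bd_lam.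
have diff w : (fun x => psum l.+1 w x - psum l w x) = dyadic_block chi l w.
  by apply/funext => x; rewrite /psum big_ord_recr/= addrAC subrr add0r.
have sub n : (fun x => psum n u x - psum n v x) = psum n (u \- v).
  by apply/funext => x; rewrite psumB.
(* [w] bounds the increments of u and v in L^q and [e] bounds u - v uniformly; the summand w * e in
   [W] ensures the hypothesis w * e <= W of [bd_comp2]. *)
pose w := C2 * (b1 l + b2 l); pose e := C1 * dl; pose W := C2 * b3 l + w * e.
have bw1 : bd (nq q) r w (2 ^+ l.+1) (fun x => psum l.+1 u x - psum l u x).
  rewrite diff; apply: up => //; apply: (bd_le nB lam0) (block_bd r (tnorm_nq q1) D1 (n1 l)) _.
  by rewrite ler_wpM2l ?(ltW C20)// lerDl.
have bw2 : bd (nq q) r w (2 ^+ l.+1) (fun x => psum l.+1 v x - psum l v x).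
  rewrite diff; apply: up => //; apply: (bd_le nB lam0) (block_bd r (tnorm_nq q1) D2 (n2 l)) _.
  by rewrite ler_wpM2l ?(ltW C20)// lerDr.
have w0 : 0 <= w * e by rewrite /w /e !mulr_ge0 ?addr_ge0// ltW.
have bW : bd (nq q) r W (2 ^+ l.+1) (fun x => psum l.+1 u x - psum l u x - psum l.+1 v x + psum l v x).
  rewrite (_ : (fun x => _) = dyadic_block chi l (u \- v)); last first.
    apply/funext => x; rewrite -diff !psumB//; ring.
  apply: up => //; apply: (bd_le nB lam0) (block_bd r (tnorm_nq q1) D3 (n3 l)) _.
  by rewrite lerDl.
have := H3 _ nB (2 ^+ l.+1) _ _ _ _ w e W lam0' (sS l.+1 u du) (sS l u du) (sS l.+1 v dv) (sS l v dv)
  (H1 u b1 M l.+1 M0 D1) (up _ _ _ supb_nl (H1 u b1 M l M0 D1))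
  (H1 v b2 M l.+1 M0 D2) (up _ _ _ supb_nl (H1 v b2 M l M0 D2)).
rewrite !sub => /(_ (H1 _ b3 dl l.+1 dl0 D3) (up _ _ _ supb_nl (H1 _ b3 dl l dl0 D3)) bw1 bw2 bW).
have wW : w * e <= W by rewrite /W lerDr mulr_ge0// ltW.
(* Partial sums with l + 1 blocks are controlled at scale 2^(l+1); returning to 2^l costs a factor
   2^r. *)
move=> /(_ wW); rewrite exprS => /(bd_scale nB (ler1n R 2)).
move=> h; apply: (bd_le nB lam0 h).
rewrite -!mulrA ler_wpM2l ?exprn_ge0//.
have W0 : 0 <= W by apply: le_trans wW.
apply: (@le_trans _ _ ((1 + C3) * W)); first by rewrite ler_wpM2r// lerDr.
rewrite ler_wpM2l ?addr_ge0//.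
rewrite /W /w /e -!mulrA -mulrDr ler_wpM2l ?(ltW C20)//.
have s0 : 0 <= dl * (b1 l + b2 l) by rewrite mulr_ge0// addr_ge0.
have -> : b3 l + (b1 l + b2 l) * (C1 * dl) = b3 l + C1 * (dl * (b1 l + b2 l)) by ring.
by have := mulr_ge0 (ltW C10) b30; move: s0; set z := dl * _; lra.
Qed.

Lemma pow3_le (a b c : R) : 0 <= a -> 0 <= b -> 0 <= c ->
  (a + b + c) `^ p <= 3 `^ p * (a `^ p + b `^ p + c `^ p).
Proof.
move=> a0 b0 c0; have pw z : 0 <= z `^ p by exact: powR_ge0.
have H m : 0 <= m -> a <= m -> b <= m -> c <= m -> (a + b + c) `^ p <= 3 `^ p * m `^ p.
  move=> m0 am bm cm; rewrite -powRM//; apply: powR_mono; [exact: ltW|by rewrite !addr_ge0|].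
  by move: am bm cm; lra.
have [ab|ba] := leP a b; have [bc|cb] := leP b c.
- apply: le_trans (H c c0 (le_trans ab bc) bc (lexx _)) _.
  by rewrite ler_wpM2l// lerDr addr_ge0.
- apply: le_trans (H b b0 ab (lexx _) (ltW cb)) _.
  by rewrite ler_wpM2l// addrAC lerDr addr_ge0.
- have [ac|ca] := leP a c.
    apply: le_trans (H c c0 ac bc (lexx _)) _.
    by rewrite ler_wpM2l// lerDr addr_ge0.
  apply: le_trans (H a a0 (lexx _) (ltW ba) (ltW ca)) _.
  by rewrite ler_wpM2l// -addrA lerDl addr_ge0.
- apply: le_trans (H a a0 (lexx _) (ltW ba) (ltW (lt_trans cb ba))) _.
  by rewrite ler_wpM2l// -addrA lerDl addr_ge0.
Qed.

(** The sizes b3 + dl (b1 + b2) consist of the blocks of u - v, of l^p norm dl, and of those of u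
    and v, of l^p norm M, multiplied by dl. Everything is thus proportional to dl, which is the
    source of the Lipschitz estimate. *)
Lemma nlfamily r : exists2 C : R, 0 < C & forall u v b1 b2 b3 (dl : R), 0 <= dl ->
  data u b1 M -> data v b2 M -> data (u \- v) b3 dl ->
  exists W, dyadic_family q p theta r (nlblock u v) W (C * dl).
Proof.
have [C C0 H] := nlblock_bd r.
(* Since Z >= 1 and p >= 1, a sum of p-th powers bounded by Z dl^p is at most (Z dl)^p, so no p-th
   root of Z is taken. *)
pose Z : R := 1 + 2 * M `^ p.
have Z1 : 1 <= Z by rewrite lerDl mulr_ge0 ?powR_ge0.
have Z0 : 0 < Z by exact: lt_le_trans Z1.
exists (3 * C * Z); first by rewrite !mulr_gt0.
move=> u v b1 b2 b3 dl dl0 D1 D2 D3.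
have [du _ s1] := D1; have [dv _ s2] := D2; have [duv _ s3] := D3.
exists (fun l => C * (b3 l + dl * (b1 l + b2 l))); split.
- by move=> l; exact: test_nlblock.
- by move=> l; exact: H.
move=> N; pose y l : R := 2 `^ (l%:R * theta).
have y0 l : 0 <= y l by exact: powR_ge0.
have E (l : nat) : (y l * (C * (b3 l + dl * (b1 l + b2 l)))) `^ p <=
   (3 * C) `^ p * ((y l * b3 l) `^ p + dl `^ p * (y l * b1 l) `^ p + dl `^ p * (y l * b2 l) `^ p).
  have b10 := data_ge0 l D1; have b20 := data_ge0 l D2; have b30 := data_ge0 l D3.
  have -> : y l * (C * (b3 l + dl * (b1 l + b2 l))) = C * (y l * b3 l + dl * (y l * b1 l) + dl * (y l * b2 l)) by ring.
  rewrite (powRM p (ltW C0)) ?addr_ge0 ?mulr_ge0// (powRM p (ler0n R 3) (ltW C0)) (mulrC (3 `^ p)) -mulrA.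
  rewrite ler_wpM2l ?powR_ge0//.
  apply: le_trans (pow3_le _ _ _) _; rewrite ?mulr_ge0//.
  by rewrite !(powRM p dl0) ?mulr_ge0.
apply: le_trans (ler_sum _ (fun (l : 'I_N) _ => E l)) _.
rewrite -mulr_sumr !big_split/= -!mulr_sumr.
apply: (@le_trans _ _ ((3 * C) `^ p * (dl `^ p * Z))).
  rewrite ler_wpM2l ?powR_ge0// /Z.
  have -> : dl `^ p * (1 + 2 * M `^ p) = dl `^ p + dl `^ p * M `^ p + dl `^ p * M `^ p by ring.
  by apply: lerD; [apply: lerD; [exact: s3|rewrite ler_wpM2l ?powR_ge0//; exact: s1]|rewrite ler_wpM2l ?powR_ge0//; exact: s2].
have C3 : 0 <= 3 * C by rewrite mulr_ge0// ltW.
rewrite (powRM p (mulr_ge0 C3 (ltW Z0)) dl0) (powRM p C3 (ltW Z0)) -mulrA.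
rewrite ler_wpM2l ?powR_ge0// mulrC ler_wpM2r ?powR_ge0//.
by rewrite -[leLHS]powRr1 ?(ltW Z0)//; apply: ler_powR.
Qed.

(** The blocks telescope, and uniform convergence of S_l u passes to Psi(S_l u) and hence to every
    Fourier coefficient. *)
Lemma nl_coefs u v b1 b2 : data u b1 M -> data v b2 M ->
  coefs (nlblock u v) (fun k => fcos (fun x => Psi (rep u x) - Psi (rep v x)) k)
    (fun k => fsin (fun x => Psi (rep u x) - Psi (rep v x)) k).
Proof.
move=> D1 D2; have [du _ _] := D1; have [dv _ _] := D2.
have [C1 C10 H1] := psum_sup 0; have [C2 C20 H2] := rep_sup; have [C3 C30 H3] := rep_dist.
pose c := Num.max C1 C2 * M.
have [L L0 HL] := lipschitz_on c sPsi.
have bp w b n x : data w b M -> `|psum n w x| <= c.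
  move=> D; apply: le_trans (bd0 (H1 w b M n M0 D) x) _.
  by rewrite ler_wpM2r// le_max lexx.
have br w b x : data w b M -> `|rep w x| <= c.
  move=> D; apply: le_trans (H2 w b M M0 D x) _.
  by rewrite ler_wpM2r// le_max lexx orbT.
have bd w b n x : data w b M -> `|Psi (rep w x) - Psi (psum n w x)| <= L * (C3 * M * decay ^+ n).
  move=> D; apply: le_trans (HL _ _ (br w b x D) (bp w b n x D)) _.
  by rewrite ler_wpM2l//; case: (H3 w b M n x M0 D).
have cPsi := smooth_on_continuous sPsi.
have ir w b : data w b M -> integ (fun x => Psi (rep w x)).
  move=> D; have [CP CP0 HP] := continuous_bounded c cPsi.
  apply: (@integ_bounded _ _ _ CP) => [|x]; last by apply: HP; exact: br D.
  apply: (@measurableT_comp _ _ _ _ _ _ Psi); last exact: mrow_rep M0 D.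
  exact: continuous_measurable_fun.
have ig : integ (fun x => Psi (rep u x) - Psi (rep v x)).
  by apply: integB; [exact: ir D1|exact: ir D2].
have iG n : integ (fun x => Psi (psum n u x) - Psi (psum n v x)).
  by apply: integ_test; apply: testB; apply: test_comp => //; exact: test_psum.
have dist n x : `|(Psi (rep u x) - Psi (rep v x)) - (Psi (psum n u x) - Psi (psum n v x))| <=
    L * (C3 * M) * 2 * decay ^+ n.
  have -> : (Psi (rep u x) - Psi (rep v x)) - (Psi (psum n u x) - Psi (psum n v x)) =
    (Psi (rep u x) - Psi (psum n u x)) - (Psi (rep v x) - Psi (psum n v x)) by ring.
  apply: le_trans (ler_normB _ _) _.
  have h1 := bd u b1 n x D1; have h2 := bd v b2 n x D2.
  rewrite (_ : L * (C3 * M) * 2 * decay ^+ n = L * (C3 * M * decay ^+ n) + L * (C3 * M * decay ^+ n)); last by ring.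
  exact: lerD.
have E phi : mrow phi -> supb phi 1 -> (forall n, integ (fun x => nlblock u v n x * phi x)) ->
    (\sum_(l < n) torus_integral (fun x => nlblock u v l x * phi x)) @[n --> \oo] -->
     torus_integral (fun x => (Psi (rep u x) - Psi (rep v x)) * phi x).
  move=> mp p1' ib; have := tint_unif_cvg iG ig mp p1' dist (decay_cvg _).
  under eq_fun => n.
    rewrite (_ : (fun x => _) = (fun x => \sum_(l < n) nlblock u v l x * phi x)); last first.
      by apply/funext => x; rewrite -mulr_suml nlblock_sum.
    rewrite tint_sum; last by move=> l; exact: ib.
    over.
  by [].
move=> k; split; apply: E.
- exact: mrow_test (test_cosp k).
- by move=> x; exact: cos_max.
- by move=> n; apply: integ_fcos; apply: integ_test; exact: test_nlblock.
- exact: mrow_test (test_sinp k).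
- by move=> x; exact: sin_max.
- by move=> n; apply: integ_fsin; apply: integ_test; exact: test_nlblock.
Qed.

End Composition.

End Nonlinear.

(** * Almost everywhere uniqueness *)

Section Coordinates.
Context {R : realType}.
Local Notation T d := (d.-tuple (measurableTypeR R)).

Lemma uniform_prob_itvoo : uniform_prob (@ltr01 R) (~` `]0, 1[%classic) = 0%E.
Proof.
have E : uniform_prob (@ltr01 R) (~` `]0, 1[%classic) =
    uniform_prob (@ltr01 R) (~` `]0, 1[%classic `&` `[0, 1]%classic).
  exact: (integral_uniform_pdf 0 1).
have m1 : measurable [set (0 : measurableTypeR R)] by exact: measurable_set1.
have m2 : measurable [set (1 : measurableTypeR R)] by exact: measurable_set1.
rewrite E.
suff h : lebesgue_measure (~` `]0, 1[%classic `&` `[0, 1]%classic : set (measurableTypeR R)) = 0%E.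
  apply: (null_content_dominatesP _ _).1 (@dominates_uniform_prob R 0 1 ltr01) _ _ h.
  by apply: measurableI; [apply: measurableC; exact: measurable_itv|exact: measurable_itv].
have m01 : measurable (~` `]0, 1[%classic `&` `[0, 1]%classic : set (measurableTypeR R)).
  by apply: measurableI; [apply: measurableC; exact: measurable_itv|exact: measurable_itv].
have mU : measurable ([set 0] `|` [set 1] : set (measurableTypeR R)) by exact: measurableU.
apply/eqP; rewrite eq_le measure_ge0 andbT.
apply: (@le_trans _ _ (lebesgue_measure ([set 0] `|` [set 1] : set (measurableTypeR R)))).
  apply: le_measure; rewrite ?inE// => x /= []; rewrite !in_itv/= => h /andP[x0 x1].
  have [x00|x00] := eqVneq x 0; [by left|right].
  apply/eqP; rewrite eq_le x1 leNgt; apply/negP => h1; apply: h.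
  by rewrite h1 lt_neqAle eq_sym x00 x0.
apply: (le_trans (measureU2 _ m1 m2)).
have z (c : R) : lebesgue_measure ([set c] : set (measurableTypeR R)) = 0%E by exact: lebesgue_measure_set1.
by move: (z 0) (z 1) => + + /=; rewrite /= => -> ->; rewrite adde0.
Qed.

Lemma torus_coord0 d (i : 'I_d) (A : set (measurableTypeR R)) : measurable A ->
  uniform_prob (@ltr01 R) A = 0%E -> torus_measure d [set t | A (tnth t i)] = 0%E.
Proof.
move=> mA A0; elim: d i => [[]//|d IH] i.
have mS n (j : 'I_n) : measurable [set t : T n | A (tnth t j)].
  by have := measurable_tnth j measurableT mA; rewrite setTI.
rewrite /= /distribution /pushforward/=.
case: (unliftP ord0 i) => [j ->|->].
  rewrite (_ : _ @^-1` _ = setT `*` [set t : T d | A (tnth t j)]); last first.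
    by apply/seteqP; split => -[x t] /=; rewrite tnthS => //; case.
  rewrite product_measure1E//.
  have := IH j; set x := torus_measure d _; set y := (X in (_ * X)%E).
  by rewrite (_ : y = x)// => ->; rewrite mule0.
  exact: mS.
rewrite (_ : _ @^-1` _ = A `*` setT); last first.
  by apply/seteqP; split => -[x t] /=; rewrite tnth0 => //; case.
rewrite product_measure1E//.
by move: A0; set x := uniform_prob _ _; set y := (X in (X * _)%E); rewrite (_ : y = x)// => ->; rewrite mul0e.
Qed.

(** Periodic functions cannot separate opposite faces of the cube; the faces form a null set. *)
Lemma torus_interior d : {ae torus_measure d, forall t : T d, forall i, 0 < (tnth t i : R) < 1}.
Proof.
have FF : Filter (almost_everywhere (torus_measure d : {measure set (T d) -> \bar R})).
  exact: ae_filter_ringOfSetsType.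
apply: (@filter_forall _ _ _ _ FF) => i.
have m : measurable (~` `]0, 1[%classic : set (measurableTypeR R)).
  by apply: measurableC; exact: measurable_itv.
exists [set t | (~` `]0, 1[%classic) (tnth t i)]; split => /=.
- by have := measurable_tnth i measurableT m; rewrite setTI.
- exact: (@torus_coord0 d i _ m uniform_prob_itvoo).
- by move=> t /= h; rewrite in_itv.
Qed.

(** Lower orthants. The bound +oo drops a coordinate, so these sets form a pi-system that contains
    the half-spaces generating the product sigma-algebra. *)
Definition lower d (b : 'I_d -> \bar R) : set (T d) := [set t | forall i, ((tnth t i)%:E < b i)%E].

Lemma measurable_lower d (b : 'I_d -> \bar R) : measurable (lower b).
Proof.
rewrite (_ : lower b = ~` \bigcup_(i : 'I_d) [set t : T d | ~ ((tnth t i)%:E < b i)%E]).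
  apply: measurableC; apply: fin_bigcup_measurable => // i _.
  have m : measurable [set x : measurableTypeR R | ~ (x%:E < b i)%E].
    rewrite (_ : [set x | _] = ~` [set x | (x%:E < b i)%E])//; apply: measurableC.
    case: (b i) => [r| |].
    - rewrite (_ : [set x | _] = `]-oo, r[%classic); first exact: measurable_itv.
      by apply/seteqP; split => x /=; rewrite in_itv/= lte_fin.
    - by rewrite (_ : [set x | _] = setT)//; apply/seteqP; split => x //= _; exact: ltry.
    - by rewrite (_ : [set x | _] = set0)//; apply/seteqP; split => x //=.
  by have := measurable_tnth i measurableT m; rewrite setTI.
apply/seteqP; split => t /=.
  by move=> h [i _ /=]; apply; exact: h.
by move=> h i; apply/negP => /negP hi; apply: h; exists i => //; exact/negP.
Qed.

Lemma lower_gen d : @measurable _ (T d) = <<s [set lower b | b in [set: 'I_d -> \bar R]] >>.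
Proof.
set G := [set lower b | b in _].
apply/seteqP; split; last first.
  apply: smallest_sub; first exact: sigma_algebra_measurable.
  by move=> _ [b _ <-]; exact: measurable_lower.
apply: smallest_sub; first exact: smallest_sigma_algebra.
elim/big_ind : _ => [//|X Y hX hY|i _]; first by move=> S [/hX|/hY].
have sG : sigma_algebra [set: T d] <<s G >> by exact: smallest_sigma_algebra.
have sI := sigma_algebra_image (fun t : T d => tnth t i) sG.
move=> _ [Y mY <-].
have : image_set_system [set: T d] (fun t : T d => tnth t i) <<s G >> Y.
  have {}mY : <<s @RGenInftyO.G R >> Y by exact: (eq_ind _ (fun X : Prop => X) mY _ (f_equal (@^~ Y) (RGenInftyO.measurableE R))).
  apply: mY; split => // _ [x ->]; rewrite /image_set_system/= setTI.
  apply: sub_sigma_algebra.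
  exists (fun j => if j == i then x%:E else +oo%E) => //.
  apply/seteqP; split => t /=.
    by move=> /(_ i); rewrite eqxx lte_fin in_itv.
  rewrite in_itv/= => h j; case: eqP => [->|_]; first by rewrite lte_fin.
  exact: ltry.
by rewrite /image_set_system/=.
Qed.

End Coordinates.

(** * Test functions separate integrable functions *)

Section Uniqueness.
Context {R : realType} {d : nat}.
Local Notation T := (d.-tuple (measurableTypeR R)).
Local Notation mu := (torus_measure d : probability T R).
Variables (eta : R -> R) (heta : eta_cutoff eta).
Implicit Types (r : 'rV[R]_d -> R).

Let eta_ge0 x : 0 <= eta x.
Proof.
case: heta => _ mono _ e0; have [x1|x1] := leP x 1; first by rewrite e0.
by rewrite -(e0 1 (lexx 1)); apply: mono; exact: ltW.
Qed.

Let eta_le1 x : eta x <= 1.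
Proof.
case: heta => _ mono e2 _; have [x1|x1] := leP 2 x; first by rewrite e2.
by rewrite -(e2 2 (lexx 2)); apply: mono; exact: ltW.
Qed.

(* On the circle, [{0 < x < be}] is where [cos (pi (2 x - be)) > cos (pi be)]. *)
Definition bump (n : nat) (b : \bar R) (x : R) : R :=
  match b with
  | r%:E => if 1 <= r then 1 else if r <= 0 then 0
            else eta (n%:R * (cos (pi * (2 * x - r)) - cos (pi * r)))
  | +oo%E => 1
  | -oo%E => 0
  end.

Lemma bump_norm n b x : `|bump n b x| <= 1.
Proof.
case: b => [r| |] /=; rewrite ?normr1 ?normr0//.
case: (leP 1 r) => _; first by rewrite normr1.
by case: (leP r 0) => _; rewrite ?normr0// ger0_norm.
Qed.

Lemma bump_test n b (i : 'I_d) : test_function (fun x : 'rV[R]_d => bump n b (x 0 i)).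
Proof.
case: b => [r| |] /=; try exact: test_cst.
case: leP => _; first exact: test_cst.
case: leP => _; first exact: test_cst.
apply: test_comp; first by case: heta.
apply: testZ; apply: testB; last exact: test_cst.
rewrite (_ : (fun x => _) = fun x : 'rV[R]_d =>
   cos (pi * r) * cos (phase (unitv i) x) + sin (pi * r) * sin (phase (unitv i) x)).
  by apply: testD; apply: testZ; [exact: test_cosp|exact: test_sinp].
apply/funext => x; rewrite phase_unitv.
have -> : pi * (2 * x 0 i - r) = 2 * pi * x 0 i - pi * r by move: (pi : R) => z; ring.
by rewrite cosB mulrC (mulrC (sin _)).
Qed.

Let pi0 : 0 < pi :> R. Proof. exact: pi_gt0. Qed.

Let ler_cos : {in `[0, pi] &, {mono cos : x y /~ y <= x :> R}}.
Proof. by move=> x y hx hy; rewrite leNgt ltr_cos// -leNgt. Qed.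

Lemma bump_out n b x : 0 < x < 1 -> (b <= x%:E)%E -> bump n b x = 0.
Proof.
case: b => [r| |]//= /andP[x0 x1]; rewrite lee_fin => rx.
case: leP => [r1|r1]; first by have := lt_le_trans x1 (le_trans r1 rx); rewrite ltxx.
case: leP => // r0; case: heta => _ _ _; apply.
apply: (@le_trans _ _ 0) => //; rewrite mulr_ge0_le0// subr_le0.
have pr : pi * r \in `[0, pi] by rewrite in_itv/= mulr_ge0 ?(ltW r0) ?(ltW pi0)// ger_pMr// ltW.
have [h|h] := leP (2 * x - r) 1.
  rewrite ler_cos//; first by rewrite ler_pM2l//; move: rx; lra.
  by rewrite in_itv/= mulr_ge0 ?(ltW pi0)//= ?ger_pMr//; move: rx r0; lra.
(* An angle beyond pi is replaced by 2 pi minus itself, so that both angles lie where the cosine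
   decreases. *)
rewrite -cosN -[cos (- _)](cosDint _ 1) mulr1.
have -> : - (pi * (2 * x - r)) + 2 * pi = pi * (2 - (2 * x - r)) by move: (pi : R) => z; ring.
rewrite ler_cos//; first by rewrite ler_pM2l//; move: x1; lra.
by rewrite in_itv/= mulr_ge0 ?(ltW pi0)//= ?ger_pMr//; move: h x1 r0; lra.
Qed.

Lemma bump_in b x : 0 < x < 1 -> (x%:E < b)%E -> \forall n \near \oo, bump n b x = 1.
Proof.
case: b => [r| |]//= /andP[x0 x1]; last by move=> _; exact: nearW.
rewrite lte_fin => xr.
have [r1|r1] := leP 1 r; first exact: nearW.
have r0 : 0 < r by exact: lt_trans xr.
rewrite leNgt r0/=.
have h : 0 < cos (pi * (2 * x - r)) - cos (pi * r).
  have pr : pi * r \in `[0, pi] by rewrite in_itv/= mulr_ge0 ?(ltW r0) ?(ltW pi0)// ger_pMr// ltW.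
  rewrite subr_gt0; have [h|h] := leP 0 (2 * x - r).
    rewrite ltr_cos//; first by rewrite ltr_pM2l//; move: xr; lra.
    by rewrite in_itv/= mulr_ge0 ?(ltW pi0)//= ?ger_pMr//; move: xr r1; lra.
  rewrite -[cos (pi * (2 * x - r))]cosN -mulrN ltr_cos//; first by rewrite ltr_pM2l//; move: x0; lra.
  by rewrite in_itv/= mulr_ge0 ?(ltW pi0)//= ?ger_pMr//; move: h x0 r1; lra.
move: h; set h := _ - _ => h0.
have := nbhs_infty_ger (2 / h); apply: filterS => n.
by rewrite ler_pdivrMr// => hn; case: heta => _ _ + _; apply.
Qed.

Definition bumps n (b : 'I_d -> \bar R) (x : 'rV[R]_d) : R := \prod_(i < d) bump n (b i) (x 0 i).

Lemma test_bumps n b : test_function (bumps n b).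
Proof.
rewrite /bumps; elim: (index_enum _) => [|i s IH].
  by rewrite (_ : (fun x => _) = fun=> 1) ?big_nil//; [exact: test_cst|apply/funext => x; rewrite big_nil].
rewrite (_ : (fun x => _) = fun x : 'rV[R]_d =>
   bump n (b i) (x 0 i) * \prod_(j <- s) bump n (b j) (x 0 j)).
  by apply: testM => //; exact: bump_test.
by apply/funext => x; rewrite big_cons.
Qed.

Lemma bumps_norm n b x : `|bumps n b x| <= 1.
Proof.
by rewrite /bumps normr_prod prodr_ile1// => i _; rewrite normr_ge0 bump_norm.
Qed.

(** On the open cube the products of bumps converge to the indicator of the orthant, and they stay
    bounded by 1: dominated convergence. *)
Lemma integral_lower0 r b : integ r ->
  (forall phi, test_function phi -> torus_integral (fun x => r x * phi x) = 0) ->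
  (\int[mu]_(t in lower b) (r (row_of_tuple t))%:E = 0)%E.
Proof.
move=> ir r0.
have ml : measurable (lower b : set T) by exact: measurable_lower.
have iB n : integ (fun x => r x * bumps n b x).
  by apply: (integM ir (mrow_test (test_bumps n b)) (bumps_norm n b)).
have mr : measurable_fun setT (EFin \o (r \o @row_of_tuple R d)) by case/integrableP : ir.
pose F n (t : T) : \bar R := (r (row_of_tuple t) * bumps n b (row_of_tuple t))%:E.
pose G : T -> \bar R := (EFin \o (r \o @row_of_tuple R d)) \_ (lower b).
have mF n : measurable_fun setT (F n) by case/integrableP : (iB n).
have mG : measurable_fun setT G.
  apply: (measurable_restrictT _ ml).1; apply: (measurable_funS measurableT _ mr).
  exact: subsetT.
have FF : Filter (almost_everywhere mu) by exact: ae_filter_ringOfSetsType.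
have FG : {ae mu, forall t, [set: T] t -> F ^~ t @ \oo --> G t}.
  apply: (@filterS _ _ FF _ _ _ (torus_interior d)) => t ht _.
  have row i : row_of_tuple t 0 i = tnth t i by rewrite mxE.
  rewrite /G /patch; case: ifPn => [/set_mem tb|/negP tb].
    apply: (@cvg_near_cst _ _ _ _ _).
    have : \forall n \near \oo, forall i : 'I_d, bump n (b i) (tnth t i) = 1.
      by apply: filter_forall => i; apply: bump_in; [exact: ht|exact: tb].
    apply: filterS => n hn; rewrite /F /bumps big1 ?mulr1// => i _.
    by rewrite row hn.
  have [i hi] : exists i, (b i <= (tnth t i)%:E)%E.
    apply: contrapT => nh; apply: tb; apply/mem_set => i; rewrite ltNge; apply/negP => h.
    by apply: nh; exists i.
  have -> : F ^~ t = fun=> 0%E.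
    apply/funext => n; rewrite /F /bumps (bigD1 i)//= row bump_out ?mul0r ?mulr0//; exact: ht.
  exact: cvg_cst.
have dom : {ae mu, forall t, forall n, [set: T] t -> (`|F n t| <= (`|r (row_of_tuple t)|)%:E)%E}.
  apply: aeW => t n _; rewrite lee_fin normrM ler_piMr// bumps_norm.
  done.
have [_ _ L] := dominated_convergence measurableT mF mG FG (integ_norm ir) dom.
have Z : (fun n => (\int[mu]_t F n t)%E) = fun=> 0%E.
  apply/funext => n /=; have := r0 _ (test_bumps n b).
  rewrite /torus_integral /Rintegral => h.
  rewrite -[LHS]fineK; last exact: integrable_fin_num (iB n).
  by congr EFin.
have L' : (fun n => (\int[mu]_t F n t)%E) @ \oo --> (\int[mu]_t G t)%E by exact: L.
rewrite Z in L'.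
have E0 : (\int[mu]_t G t = 0)%E by exact: (cvg_unique _ L' (cvg_cst _)).
by rewrite integral_mkcond.
Qed.

(** The measurable sets over which r has integral 0 form a Dynkin system that contains the orthants,
    hence are all measurable sets. *)
Lemma ae_zero r : integ r ->
  (forall phi, test_function phi -> torus_integral (fun x => r x * phi x) = 0) ->
  {ae mu, forall t, r (row_of_tuple t) = 0}.
Proof.
move=> ir r0.
have mr : measurable_fun setT (EFin \o (r \o @row_of_tuple R d)) by case/integrableP : ir.
suff H : ae_eq mu setT (EFin \o (r \o @row_of_tuple R d)) (cst 0%E).
  have FF : Filter (almost_everywhere mu) by exact: ae_filter_ringOfSetsType.
  by apply: (@filterS _ _ FF _ _ _ H) => t /(_ I) [].
apply: integral_ae_eq => //= E _ mE; rewrite integral0.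
have gen := @lower_gen R d.
have sT : (\int[mu]_(t in setT) (r (row_of_tuple t))%:E = 0)%E.
  have := @integral_lower0 r (fun=> +oo%E) ir r0.
  by rewrite (_ : lower _ = setT)//; apply/seteqP; split => // t _ i; exact: ltry.
apply: (@dynkin_induction _ T _ (fun E => (\int[mu]_(t in E) (r (row_of_tuple t))%:E = 0)%E) gen).
- move=> _ _ [b _ <-] [c _ <-]; exists (fun i => Order.min (b i) (c i)) => //.
  apply/seteqP; split => t /=.
    by move=> h; split=> i; have := h i; rewrite lt_min => /andP[].
  by move=> [h1 h2] i; rewrite lt_min h1 h2.
- exact: sT.
- by move=> _ [b _ <-]; exact: integral_lower0.
- move=> S mS S0; have := sT; rewrite -(setUv S) integral_setU//.
  + by rewrite S0 add0e.
  + exact: measurableC.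
  + by rewrite setUv.
  + by apply/disj_setPS; rewrite setICr.
- move=> F mF tF F0; rewrite integral_bigcup//.
    by apply: eseries0 => n _ _; exact: F0.
  by apply: (integrableS measurableT) ir => //; exact: bigcupT_measurable.
- by rewrite -gen.
Qed.

End Uniqueness.

(** * The product Phi_j(u) grad u *)

Section Duality.
Context {R : realType} {d : nat}.
Implicit Types (f g G rho : 'rV[R]_d -> R) (k : 'rV[int]_d) (P : @trig R d).
Variables (q : R) (q2 : 2 <= q).
Let q1 : 1 <= q. Proof. by apply: le_trans q2; rewrite ler1n. Qed.
Let tB := @tnorm_nq R d q q1.
Let nB := tn_nl tB.

Definition lift (sg : R) P := tmul false (fun k => AA k `^ (sg / 2)) P.

(** A substitute for G in H^{sg,q}: the polynomials approach G uniformly, which controls pairings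
    with integrable functions, while their potentials of order sg stay bounded in L^q. The form is
    stable under sums and uniform limits. *)
Definition appr (sg : R) G (C : R) : Prop := forall e, 0 < e ->
  exists P, supb (fun x => G x - tev P x) e /\ nq q (tev (lift sg P)) C.

Lemma trig_lift (sg : R) : 0 < sg -> exists n, exists2 C : R, 0 < C &
  forall P w lam, 1 <= lam -> bd (nq q) n w lam (tev P) -> nq q (tev (lift sg P)) (C * lam `^ sg * w).
Proof.
move=> s0; pose m := Num.trunc (sg / 2); pose N := m.+1.
have sN : sg < 2 * N%:R by rewrite mulrC -ltr_pdivrMr// truncnS_gt.
have [C C0 H] := bessel_pos tB s0 sN.
have d1 : 1 <= 1 + d%:R :> R by rewrite lerDl.
pose D := (1 + d%:R) ^+ N : R.
have D1 : 1 <= D by rewrite exprn_ege1.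
have D0 : 0 < D by exact: lt_le_trans D1.
exists (0 + N.*2)%N, (C * D); first exact: mulr_gt0.
move=> P w lam lam1 b; have w0 := nl_ge0 nB (bd0 b).
have B1 : nq q (tev (tmul false (fun=> 1) P)) (D * w).
  by rewrite tmul1; apply: (nl_le nB) (bd0 b) _; rewrite ler_peMl.
have B2 : nq q (tev (tmul false (fun k => AA k ^+ N * 1) P)) (lam ^+ (2 * N) * (D * w)).
  rewrite (@tmul_ext _ _ _ _ (fun k => AA k ^+ N)); last by move=> t _; rewrite mulr1.
  have := bd0 (bd_AA tB lam1 b); rewrite exprMn -exprM.
  by rewrite (_ : lam ^+ (2 * N) * (D * w) = (1 + d%:R) ^+ N * lam ^+ (2 * N) * w)// /D; ring.
have := H false (fun=> 1) P (D * w) lam lam1 B1 B2.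
rewrite (@tmul_ext _ _ _ _ (fun k => AA k `^ (sg / 2))); last by move=> t _; rewrite mulr1.
by rewrite (_ : C * D * lam `^ sg * w = C * lam `^ sg * (D * w))//; ring.
Qed.

Lemma appr_test (sg : R) : 0 < sg -> exists n, exists2 C : R, 0 < C &
  forall f w lam w', test_function f -> 1 <= lam -> bd (nq q) n w lam f -> w < w' ->
    appr sg f (C * lam `^ sg * w').
Proof.
move=> s0; have [n [C C0 H]] := trig_lift s0; exists n, C => // f w lam w' tf lam1 b ww e e0.
have lam0 : 0 <= lam by exact: le_trans lam1.
have e'0 : 0 < Num.min e (w' - w) by rewrite lt_min e0 subr_gt0.
have [P HP] := trig_dense n tf e'0; exists P; split.
  by move=> x; apply: le_trans (bd0 HP x) _; rewrite ge_min lexx.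
have tP := test_tev P : test_function (tev P : 'rV[R]_d -> R).
have sB : sm n (fun x => f x - tev P x) by apply: test_sm; exact: testB.
have bP : bd (nq q) n w' lam (tev P).
  rewrite (_ : tev P = fun x => f x + - (f x - tev P x)); last by apply/funext => x; ring.
  have b2 := bd_tnorm tB sB (bd_lam supb_nl (ler01) lam1 HP).
  apply: (bd_le nB lam0) (bdD nB (test_sm n tf) (smN sB) b (bdN nB sB b2)) _.
  by rewrite -lerBrDl ge_min lexx orbT.
exact: H.
Qed.

Lemma appr_le sg G (C C' : R) : appr sg G C -> C <= C' -> appr sg G C'.
Proof. by move=> H CC e e0; have [P [h1 h2]] := H e e0; exists P; split=> //; exact: (nl_le nB) h2 CC. Qed.

Lemma appr_add sg G G' (C C' : R) : appr sg G C -> appr sg G' C' ->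
  appr sg (fun x => G x + G' x) (C + C').
Proof.
move=> H H' e e0; have e2 : 0 < e / 2 by rewrite divr_gt0.
have [P [h1 h2]] := H _ e2; have [Q [h3 h4]] := H' _ e2; exists (P ++ Q); split.
  move=> x; rewrite /tev big_cat/= -!/(tev _ _).
  have -> : G x + G' x - (tev P x + tev Q x) = (G x - tev P x) + (G' x - tev Q x) by ring.
  by apply: le_trans (ler_normD _ _) _; rewrite [e]splitr; apply: lerD; [exact: h1|exact: h3].
rewrite (_ : tev _ = fun x => tev (lift sg P) x + tev (lift sg Q) x).
  by apply: (nl_add nB) => //; exact: ctev.
by apply/funext => x; rewrite /lift /tmul map_cat /tev big_cat.
Qed.

Lemma appr_sum sg N (F : 'I_N -> 'rV[R]_d -> R) (C : 'I_N -> R) : (forall l, appr sg (F l) (C l)) ->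
  appr sg (fun x => \sum_(l < N) F l x) (\sum_(l < N) C l).
Proof.
move=> H; elim: (index_enum _) => [|l s IH].
  rewrite big_nil => e e0; exists [::]; split.
    by move=> x; rewrite /tev !big_nil subrr normr0 ltW.
  apply: nq_sup => //; first by apply: mrow_test; exact: test_tev.
  by move=> x; rewrite /tev big_nil normr0.
rewrite big_cons (_ : (fun x => _) = fun x => F l x + \sum_(j <- s) F j x); first exact: appr_add.
by apply/funext => x; rewrite big_cons.
Qed.

Lemma appr_lim sg G (C : R) : (forall e, 0 < e -> exists2 G', supb (fun x => G x - G' x) e & appr sg G' C) ->
  appr sg G C.
Proof.
move=> H e e0; have e2 : 0 < e / 2 by rewrite divr_gt0.
have [G' h /(_ _ e2) [P [h1 h2]]] := H _ e2; exists P; split=> // x.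
have -> : G x - tev P x = (G x - G' x) + (G' x - tev P x) by ring.
by apply: le_trans (ler_normD _ _) _; rewrite [e]splitr; apply: lerD; [exact: h|exact: h1].
Qed.

(** Parseval rewrites the pairing of rho with P as that of the potential g of rho, of order - sg,
    with [lift sg P]; Hoelder's inequality applies to the latter. Replacing G by P costs at most the
    L^1 norm of rho times the uniform error. *)
Lemma appr_dual sg G (C a c : R) rho : mrow G -> supb G a -> appr sg G C -> integ rho ->
  hn (- sg) q (distr_of_fun rho) c -> `|torus_integral (fun x => rho x * G x)| <= C * c.
Proof.
move=> mG Ga aG ir [g [mg gc bg]].
have ig := nq_integ q1 mg gc.
have dr := distr_of_fun_distr ir; have dg := distr_of_fun_distr ig.
set I := torus_integral (fun x => `|rho x|).
have I0 : 0 <= I by apply: tint_ge0.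
apply/ler_addgt0Pr => e e0.
have e1 : 0 < e / (I + 1) by rewrite divr_gt0// ltr_wpDl.
have [P [h1 h2]] := aG _ e1.
have mP : mrow (tev P) by apply: mrow_test; exact: test_tev.
have E : torus_integral (fun x => rho x * tev P x) = torus_integral (fun x => tev (lift sg P) x * g x).
  transitivity (distr_of_fun g (tev (lift sg P))); last first.
    by rewrite /distr_of_fun; congr torus_integral; apply/funext => x; rewrite mulrC.
  rewrite -[LHS]/(distr_of_fun rho (tev P)) !distr_tev// /lift /tmul big_map; apply: eq_bigr => t _ /=.
  have [] := bg t.1; rewrite freq_norm_kk -/(AA t.1) -[torus_integral _]/(distr_of_fun g (cos \o phase t.1)).
  rewrite -[X in _ -> X = _ -> _]/(distr_of_fun g (sin \o phase t.1)) => -> ->.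
  have A0 : AA t.1 `^ (sg / 2) * AA t.1 `^ (- sg / 2) = 1 :> R.
    by rewrite -powRDp ?AA_gt0// mulNr subrr powRr0.
  have hr (x y z v w z' : R) : x * v * (y * w) + x * z * (y * z') = x * y * (v * w + z * z') by ring.
  by rewrite hr A0 mul1r.
have b1 : `|torus_integral (fun x => rho x * tev P x)| <= C * c.
  rewrite E; have mL : mrow (tev (lift sg P)) by apply: mrow_test; exact: test_tev.
  by apply: nq_tint (nq_hoelder q2 mL mg h2 gc) => //; exact: mrowM.
have [cP _ HP] := cper_bounded (test_cper (test_tev P)).
have i1 : integ (fun x => rho x * G x) := integM ir mG Ga.
have i2 : integ (fun x => rho x * tev P x) := integM ir mP HP.
have b2 : `|torus_integral (fun x => rho x * G x) - torus_integral (fun x => rho x * tev P x)| <= e.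
  rewrite -tintB//; apply: le_trans (normr_tint (integB i1 i2)) _.
  apply: (@le_trans _ _ (e / (I + 1) * I)).
    rewrite -tintZ; last exact: integ_norm.
    apply: le_tint; [exact: integ_norm (integB i1 i2)|by apply: integZ; exact: integ_norm|].
    by move=> x; rewrite -mulrBr normrM mulrC ler_wpM2r//; exact: h1.
  by rewrite mulrAC ler_pdivrMr ?ltr_wpDl// ler_wpM2l ?(ltW e0)// lerDl.
rewrite -[X in `|X|](subrK (torus_integral (fun x => rho x * tev P x))) addrC.
by apply: le_trans (ler_normD _ _) _; exact: lerD.
Qed.

End Duality.

(** * Independence of the representative *)

Section Coefficients.
Context {R : realType} {d : nat}.
Variables (eta : R -> R) (heta : eta_cutoff eta).
Implicit Types (f g G rho : 'rV[R]_d -> R).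

(** [represents] fixes a function only up to its distribution; by [ae_zero] two choices agree almost
    everywhere and may be exchanged under an integral. *)
Lemma tint_eq_distr f g (F F' : 'rV[R]_d -> R) : integ f -> integ g ->
  eq_distr (distr_of_fun f) (distr_of_fun g) -> mrow F -> mrow F' ->
  (forall x, f x = g x -> F x = F' x) -> torus_integral F = torus_integral F'.
Proof.
move=> jf jg E mF mF' FF'.
have H := @ae_zero R d eta heta (fun x => f x - g x) (integB jf jg).
have {}H : {ae (torus_measure d), forall t, f (row_of_tuple t) - g (row_of_tuple t) = 0}.
  apply: H => phi tp; have [c _ Hc] := cper_bounded (test_cper tp).
  under eq_fun do rewrite mulrBl.
  rewrite tintB; [|exact: integM (mrow_test tp) Hc|exact: integM (mrow_test tp) Hc].
  by have := E phi tp; rewrite /distr_of_fun => ->; rewrite subrr.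
rewrite /torus_integral /Rintegral; congr fine; apply: ae_eq_integral => //.
- exact/measurable_EFinP.
- exact/measurable_EFinP.
- have FF : Filter (almost_everywhere (torus_measure d : {measure set (d.-tuple (measurableTypeR R)) -> \bar R})).
    exact: ae_filter_ringOfSetsType.
  apply: (@filterS _ _ FF _ _ _ H) => t /eqP; rewrite subr_eq0 => /eqP h _ /=.
  by rewrite (FF' _ h).
Qed.

(** The pairing for s >= 1: the potential of order 0 is rho itself almost everywhere, so a bounded
    measurable G can be paired with it. *)
Lemma hn0_tint (q : R) rho G (a c : R) : 1 <= q -> integ rho -> hn 0 q (distr_of_fun rho) c ->
  mrow G -> supb G a -> `|torus_integral (fun x => rho x * G x)| <= a * c.
Proof.
move=> q1 ir [g [mg gc bg]] mG Ga; have ig := nq_integ q1 mg gc.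
have a0 : 0 <= a := le_trans (normr_ge0 _) (Ga 0).
have dE : eq_distr (distr_of_fun rho) (distr_of_fun g).
  apply: distr_eq_trig; try exact: distr_of_fun_distr.
  move=> k; have [] := bg k; rewrite mul0r powRr0 !mul1r => h1 h2.
  by split; rewrite [RHS]/distr_of_fun ?h1 ?h2.
have -> : torus_integral (fun x => rho x * G x) = torus_integral (fun x => g x * G x).
  apply: (tint_eq_distr ir ig dE) => [||x -> //]; apply: mrowM => //; exact: integ_mrow.
have h : nq q (fun x => g x * G x) (a * c).
  apply: (nq_dom q1 mg _ a0 gc) => [|x]; first exact: mrowM.
  by rewrite normrM mulrC ler_wpM2r//; exact: Ga.
by apply: nq_tint h => //; exact: mrowM.
Qed.

End Coefficients.

(** * Weak derivatives, sums in H^{t,q} and tails of series *)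

Section Derivatives.
Context {R : realType} {d : nat}.
Implicit Types (f g : 'rV[R]_d -> R) (k : 'rV[int]_d) (u v : functional R d).

Lemma partial_of_distr i u : distribution_on_torus u ->
  partial_of i (fun k => u (cos \o phase k)) (fun k => u (sin \o phase k)) (distr_partial i u).
Proof.
move=> du k; rewrite /distr_partial (partial_cosp i k) (partial_sinp i k); split.
  by rewrite distrZ//; [ring|exact: test_sinp].
by rewrite distrZ//; [ring|exact: test_cosp].
Qed.

Lemma lap_cosp k : lap (fun x : 'rV[R]_d => cos (phase k x)) =
  fun x => - (2 * pi) ^+ 2 * kk k * cos (phase k x).
Proof.
apply/funext => x; rewrite /lap /kk mulr_sumr mulr_suml; apply: eq_bigr => i _.
rewrite partial_cosp partialZ; last by move=> y; apply: test_diff; exact: test_sinp.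
by rewrite partial_sinp mulrA; congr (_ * _); move: (pi : R) => z; ring.
Qed.

Lemma lap_sinp k : lap (fun x : 'rV[R]_d => sin (phase k x)) =
  fun x => - (2 * pi) ^+ 2 * kk k * sin (phase k x).
Proof.
apply/funext => x; rewrite /lap /kk mulr_sumr mulr_suml; apply: eq_bigr => i _.
rewrite partial_sinp partialZ; last by move=> y; apply: test_diff; exact: test_cosp.
by rewrite partial_cosp mulrA; congr (_ * _); move: (pi : R) => z; ring.
Qed.

Lemma lap_of_tint g (S : functional R d) : integ g ->
  (forall phi, test_function phi -> S phi = torus_integral (fun x => g x * lap phi x)) ->
  lap_of (fcos g) (fsin g) S.
Proof.
move=> ig H k; split.
  rewrite H; last exact: test_cosp.
  rewrite (_ : cos \o phase k = fun x => cos (phase k x))// lap_cosp /fcos.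
  under eq_fun do rewrite mulrCA.
  by rewrite tintZ//; exact: integ_fcos.
rewrite H; last exact: test_sinp.
rewrite (_ : sin \o phase k = fun x => sin (phase k x))// lap_sinp /fsin.
under eq_fun do rewrite mulrCA.
by rewrite tintZ//; exact: integ_fsin.
Qed.

Lemma hn_add t q u v (a b : R) : 1 <= q -> hn t q u a -> hn t q v b -> hn t q (u \+ v) (a + b).
Proof.
move=> q1 [g [mg ga bg]] [h [mh hb bh]]; exists (fun x => g x + h x); split.
- exact: measurable_funD.
- exact: nq_add.
move=> k; have [g1 g2] := bg k; have [h1 h2] := bh k.
have ig := nq_integ q1 mg ga; have ih := nq_integ q1 mh hb.
split; under eq_fun do rewrite mulrDl.
  by rewrite tintD ?g1 ?h1/= ?mulrDr//; exact: integ_fcos.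
by rewrite tintD ?g2 ?h2/= ?mulrDr//; exact: integ_fsin.
Qed.

Lemma sum_truncated (a : nat -> R) m N : (m <= N)%N ->
  \sum_(l < N) (m <= l)%:R * a l = \sum_(l < N) a l - \sum_(l < m) a l.
Proof.
move=> mN; rewrite -(subnKC mN) !big_split_ord/= addrAC subrr add0r big1 ?add0r.
  by apply: eq_bigr => l _; rewrite leq_addr mul1r.
by move=> l _; rewrite leqNgt ltn_ord mul0r.
Qed.

Lemma sum_tail (x : nat -> R) (K e : R) : (forall l, 0 <= x l) -> (forall N, \sum_(l < N) x l <= K) -> 0 < e ->
  \forall m \near \oo, forall N, \sum_(l < N) (m <= l)%:R * x l <= e.
Proof.
move=> x0 xK e0; have cv : cvgn (fun N => \sum_(l < N) x l).
  apply: nondecreasing_is_cvgn.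
    apply/nondecreasing_seqP => n; rewrite big_ord_recr/= lerDl; exact: x0.
  by exists K => _ [n _ <-]; exact: xK.
have nd N : \sum_(l < N) x l <= limn (fun N => \sum_(l < N) x l).
  apply: nondecreasing_cvgn_le => //.
  by apply/nondecreasing_seqP => n; rewrite big_ord_recr/= lerDl; exact: x0.
have /cvgrPdist_le/(_ _ e0) := cv; apply: filterS => m hm N.
have [mN|Nm] := leqP m N.
  rewrite sum_truncated//; apply: le_trans hm; apply: le_trans (ler_norm _).
  by rewrite lerD2r.
rewrite big1 ?(ltW e0)// => l _; rewrite leqNgt (ltn_trans (ltn_ord l) Nm) mul0r//.
Qed.

End Derivatives.

(** * The limit of the products of phi(u) with the gradients of partial sums *)

Section Limits.
Context {R : realType} {d : nat}.
Implicit Types (f g : 'rV[R]_d -> R) (k : 'rV[int]_d) (u v : functional R d).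
Variables (chi : R -> R) (hchi : dyadic_profile chi).
Variables (q p theta : R).
Hypotheses (q2 : 2 <= q) (p1 : 1 <= p) (hth : d%:R / q < theta).
Let q1 : 1 <= q. Proof. by apply: le_trans q2; rewrite ler1n. Qed.
Let p0 : 0 < p. Proof. exact: lt_le_trans p1. Qed.
Let tB := @tnorm_nq R d q q1.
Let nB := tn_nl tB.
Local Notation data := (besov_data chi q p theta).
Local Notation Psum := (@psum R d chi).
Local Notation Rep := (@rep R d chi).
Local Notation Block := (@dyadic_block R d chi).

(** The blocks of index at least m form a dyadic family for u - S_m u, whose size is the tail [kap]
    of the l^p sum. *)
Lemma partial_tail (r : R) : @partial_bound R d r q p theta -> exists2 C : R, 0 < C &
  forall u beta K, data u beta K -> forall i m (kap : R), 0 < kap ->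
    (forall N, \sum_(l < N) (m <= l)%:R * (2 `^ (l%:R * theta) * beta l) `^ p <= kap `^ p) ->
    hn r q (distr_partial i u \- distr_of_fun (partial i (Psum m u))) (C * kap).
Proof.
move=> [n [C C0 H]]; pose D : R := (4 * pi) ^+ n.
have D0 : 0 < D by rewrite exprn_gt0// mulr_gt0// pi_gt0.
exists (C * D); first exact: mulr_gt0.
move=> u beta K Du i m kap kap0 sk; have [du bu _] := Du.
have beta0 l : 0 <= beta l by exact: (nq_ge0 q1 (bu l)).
have tb l : test_function (Block l u) by exact: (test_block hchi).
pose F l : 'rV[R]_d -> R := fun x => (m <= l)%:R * Block l u x.
pose W l : R := (m <= l)%:R * (D * beta l).
rewrite -mulrA; apply: (H i F W (D * kap) (fun k => u (cos \o phase k) - fcos (Psum m u) k)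
  (fun k => u (sin \o phase k) - fsin (Psum m u) k)).
- exact: mulr_gt0.
- split=> [l|l|N].
  + exact: testZ.
  + rewrite /W -[X in X * (D * _)]ger0_norm//; apply: (bdZ tB) => //; first exact: test_sm.
    exact: (block_bd hchi n tB Du (bu l)).
  + rewrite powRM ?(ltW D0) ?(ltW kap0)//.
    apply: (@le_trans _ _ (\sum_(l < N) D `^ p * ((m <= l)%:R * (2 `^ (l%:R * theta) * beta l) `^ p))).
      apply: ler_sum => l _; rewrite /W; case: (m <= l)%N; last first.
        by rewrite mul0r mulr0 powR0 ?gt_eqF// mul0r mulr0.
      by rewrite !mul1r mulrCA (powRM p (ltW D0) (mulr_ge0 (powR_ge0 _ _) (beta0 l))).
    by rewrite -mulr_sumr ler_wpM2l ?powR_ge0.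
- move=> k; have [c s] := coefs_block hchi du k.
  have ib l : integ (Block l u) by apply: integ_test.
  have fc : fcos (Psum m u) k = \sum_(l < m) fcos (Block l u) k.
    rewrite /fcos -tint_sum; last by move=> l; exact: integ_fcos.
    by congr torus_integral; apply/funext => x; rewrite mulr_suml.
  have fs : fsin (Psum m u) k = \sum_(l < m) fsin (Block l u) k.
    rewrite /fsin -tint_sum; last by move=> l; exact: integ_fsin.
    by congr torus_integral; apply/funext => x; rewrite mulr_suml.
  have fcF l : fcos (F l) k = (m <= l)%:R * fcos (Block l u) k.
    rewrite /fcos -tintZ; last exact: integ_fcos.
    by congr torus_integral; apply/funext => x; rewrite /F mulrA.
  have fsF l : fsin (F l) k = (m <= l)%:R * fsin (Block l u) k.
    rewrite /fsin -tintZ; last exact: integ_fsin.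
    by congr torus_integral; apply/funext => x; rewrite /F mulrA.
  split.
    rewrite fc; apply: (@cvg_trans _ ((\sum_(l < N) fcos (Block l u) k - \sum_(l < m) fcos (Block l u) k) @[N --> \oo])).
      apply: near_eq_cvg; near=> N.
      rewrite -(@sum_truncated R (fun l => fcos (Block l u) k)); last by near: N; exact: nbhs_infty_ge.
      by apply: eq_bigr => l _; rewrite fcF.
    by apply: cvgB; [exact: c|exact: cvg_cst].
  rewrite fs; apply: (@cvg_trans _ ((\sum_(l < N) fsin (Block l u) k - \sum_(l < m) fsin (Block l u) k) @[N --> \oo])).
    apply: near_eq_cvg; near=> N.
    rewrite -(@sum_truncated R (fun l => fsin (Block l u) k)); last by near: N; exact: nbhs_infty_ge.
    by apply: eq_bigr => l _; rewrite fsF.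
  by apply: cvgB; [exact: s|exact: cvg_cst].
- move=> k; have [c s] := partial_of_distr i du k.
  have tp : test_function (Psum m u) by exact: (test_psum hchi).
  split; rewrite /= ?c ?s mulrBr; congr (_ - _).
    exact: fcos_partial.
  exact: fsin_partial.
Unshelve. all: by end_near. Qed.

Lemma partial_hn (r : R) : @partial_bound R d r q p theta -> exists2 C : R, 0 < C &
  forall u beta K, 0 < K -> data u beta K -> forall i, hn r q (distr_partial i u) (C * K).
Proof.
move=> pb; have [C C0 H] := partial_tail pb; exists C => // u beta K K0 D i.
have [_ _ s] := D.
apply: hn_ext (H u beta K D i 0%N K K0 _) => [k|N]; last first.
  by under eq_bigr do rewrite leq0n mul1r; exact: s.
have z : partial i (Psum 0%N u) = fun=> 0.
  rewrite (_ : Psum 0%N u = fun=> 0); first exact: partial_cst.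
  by apply/funext => x; rewrite /psum big_ord0.
rewrite /= z /distr_of_fun; split; under eq_fun do rewrite mul0r; by rewrite tint_cst subr0.
Qed.

(** The tails of a convergent series tend to 0; this is where a finite p matters. *)
Lemma partial_psum_cvg (r : R) u beta K i (e : R) : @partial_bound R d r q p theta -> data u beta K -> 0 < e ->
  \forall m \near \oo, hn r q (distr_partial i u \- distr_of_fun (partial i (Psum m u))) e.
Proof.
move=> pb D e0; have [C C0 H] := partial_tail pb; have [_ _ s] := D.
have eC : 0 < e / C by rewrite divr_gt0.
have h0 : 0 < (e / C) `^ p by exact: powR_gt0.
have := @sum_tail R (fun l => (2 `^ (l%:R * theta) * beta l) `^ p) (K `^ p) _ (fun l => powR_ge0 _ _) s h0; apply: filterS => m hm.
by have := H u beta K D i m (e / C) eC hm; rewrite mulrC divfK ?gt_eqF.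
Qed.

Hypothesis th2 : 2^-1 < theta.

(** theta is lowered to an exponent strictly between 1/2 and 1. Then 2 x > 1, so that geometric sums
    of (2 x)^l are governed by their last term, and 2 x^2 < 1, which is the decay used in
    [partial_limit]. *)
Let th' : R := Num.min theta (3 / 4).
Let x : R := 2 `^ (- th').

Let th'2 : 2^-1 < th'. Proof. by rewrite lt_min th2/=; lra. Qed.
Let th'1 : th' < 1. Proof. by rewrite gt_min; apply/orP; right; lra. Qed.
Let x0 : 0 < x. Proof. exact: powR_gt0. Qed.

Let powR2_lt1 (a : R) : a < 0 -> 2 `^ a < 1.
Proof. by move=> a0; rewrite /powR gt_eqF// expR_lt1 nmulr_rlt0// ln_gt0// ltr1n. Qed.

Let x1 : x < 1. Proof. by apply: powR2_lt1; move: th'2; lra. Qed.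

Let xx1 : 2 * x * x < 1.
Proof.
rewrite -[X in X * _ * _](powRr1 (ler0n R 2)) -!powRDp//; apply: powR2_lt1.
by move: th'2; lra.
Qed.

Let x2 : 1 < 2 * x.
Proof.
rewrite -[X in X * _](powRr1 (ler0n R 2)) -powRDp//.
rewrite /powR gt_eqF// expR_gt1 mulr_gt0// ?ln_gt0 ?ltr1n//.
by rewrite subr_gt0.
Qed.

Let beta_le u beta K l : 0 <= K -> data u beta K -> beta l <= K * x ^+ l.
Proof.
move=> K0 D; apply: le_trans (data_le q1 p1 l K0 D) _; rewrite ler_wpM2l//.
rewrite -(powR_mulrn l (powR_ge0 _ _)) -powRrM; apply: ler_powR; first by rewrite ler1n.
by rewrite mulNr lerN2 mulrC ler_wpM2l// ge_min lexx.
Qed.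

Lemma psum_dist_nq u beta K m N : 0 <= K -> data u beta K -> (m <= N)%N ->
  nq q (fun y => Psum N u y - Psum m u y) (K * (1 - x)^-1 * x ^+ m).
Proof.
move=> K0 D mN; have [du bu _] := D.
rewrite -(subnKC mN) (_ : (fun y => _) = fun y => \sum_(l < N - m) Block (m + l) u y); last first.
  by apply/funext => y; rewrite /psum big_split_ord/= addrAC subrr add0r.
have h := @nq_sum R d q _ (index_enum 'I_(N - m)) (fun l : 'I_(N - m) => Block (m + l) u)
  (fun l : 'I_(N - m) => beta (m + l)%N) q1 (fun l => mrow_test (test_block hchi _ du)) (fun l => bu _).
apply: (nq_le h); apply: (@le_trans _ _ (\sum_(l < N - m) K * x ^+ m * x ^+ l)).
  by apply: ler_sum => l _; rewrite -mulrA -exprD; exact: beta_le D.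
rewrite -mulr_sumr [leRHS](_ : _ = K * x ^+ m * (1 - x)^-1); last by ring.
rewrite ler_wpM2l ?mulr_ge0 ?exprn_ge0 ?(ltW x0)//.
by apply: geom_le => //; exact: ltW.
Qed.

Lemma partial_psum_nq u beta K i m : 0 <= K -> data u beta K ->
  nq q (partial i (Psum m u)) (4 * pi * K / (2 * x - 1) * (2 * x) ^+ m).
Proof.
move=> K0 D; have [du bu _] := D.
have pi40 : 0 <= 4 * pi :> R by rewrite mulr_ge0// pi_ge0.
have tb l : test_function (Block l u) by exact: (test_block hchi).
rewrite (_ : partial i _ = fun y => \sum_(l < m) partial i (Block l u) y); last first.
  by rewrite -partial_sum// => l y; exact: test_diff.
have b1 (l : 'I_m) : nq q (partial i (Block l u)) (4 * pi * beta l * 2 ^+ l).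
  have h := bd_partial i (block_bd hchi 1 tB D (bu l)).
  by have := bd0 h; rewrite expr1.
have h := @nq_sum R d q _ (index_enum 'I_m) (fun l : 'I_m => partial i (Block l u)) _ q1
  (fun l => mrow_test (test_partial i (tb l))) b1.
apply: (nq_le h); apply: (@le_trans _ _ (\sum_(l < m) 4 * pi * K * (2 * x) ^+ l)).
  apply: ler_sum => l _; rewrite exprMn.
  have -> : 4 * pi * K * (2 ^+ l * x ^+ l) = 4 * pi * (K * x ^+ l) * 2 ^+ l.
    by move: (pi : R) (2 ^+ l) (x ^+ l) => z a b; ring.
  by rewrite ler_wpM2r ?exprn_ge0// ler_wpM2l//; exact: beta_le D.
rewrite -mulr_sumr -!mulrA ler_wpM2l// ler_wpM2l ?pi_ge0// ler_wpM2l//.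
have y1 : 0 < 2 * x - 1 by rewrite subr_gt0.
by rewrite [leRHS]mulrC ler_pdivlMr// mulrC -subrX1 gerBl.
Qed.

Section Composition.
Variables (phi Psi : R -> R) (sphi : smooth_on setT phi) (sPsi : smooth_on setT Psi).
Hypothesis dPsi : derive1 Psi = phi.

Lemma integ_comp_rep (Th : R -> R) u beta K : smooth_on setT Th -> 0 <= K -> data u beta K ->
  exists2 C : R, 0 <= C & mrow (fun y => Th (Rep u y)) /\ supb (fun y => Th (Rep u y)) C.
Proof.
move=> sT K0 D; have [C2 C20 H2] := rep_sup hchi q1 p1 hth.
have [CP CP0 HP] := continuous_bounded (C2 * K) (smooth_on_continuous sT).
exists CP => //; split; last by move=> y; apply: HP; exact: H2 D y.
apply: (@measurableT_comp _ _ _ _ _ _ Th); last exact: (mrow_rep hchi q1 p1 hth K0 D).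
by apply: continuous_measurable_fun; exact: smooth_on_continuous.
Qed.

Lemma rep_comp_dist (Th : R -> R) u beta K : smooth_on setT Th -> 0 <= K -> data u beta K ->
  exists2 C : R, 0 <= C &
    (forall n y, `|Th (Rep u y) - Th (Psum n u y)| <= C * (@decay R d q theta) ^+ n) /\
    forall n m y, `|Th (Psum n u y) - Th (Psum m u y)| <= C * `|Psum n u y - Psum m u y|.
Proof.
move=> sT K0 D.
have [C1 C10 H1] := psum_sup hchi q1 p1 hth 0; have [C2 C20 H2] := rep_sup hchi q1 p1 hth.
have [C3 C30 H3] := rep_dist hchi q1 p1 hth.
pose c := Num.max C1 C2 * K.
have [L L0 HL] := lipschitz_on c sT.
have bp n y : `|Psum n u y| <= c.
  by apply: le_trans (bd0 (H1 u beta K n K0 D) y) _; rewrite ler_wpM2r// le_max lexx.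
have br y : `|Rep u y| <= c.
  by apply: le_trans (H2 u beta K K0 D y) _; rewrite ler_wpM2r// le_max lexx orbT.
exists (L * (1 + C3 * K)); first by rewrite mulr_ge0// addr_ge0// mulr_ge0// ltW.
have CK : 0 <= C3 * K by rewrite mulr_ge0// ltW.
split=> [n y|n m y].
  apply: le_trans (HL _ _ (br y) (bp n y)) _; rewrite -mulrA ler_wpM2l//.
  case: (H3 u beta K n y K0 D) => _ h; apply: le_trans h _.
  by rewrite ler_wpM2r ?exprn_ge0 ?(ltW (decay_gt0 _ _))// lerDr.
apply: le_trans (HL _ _ (bp n y) (bp m y)) _; rewrite -mulrA ler_wpM2l//.
by rewrite ler_peMl// lerDl.
Qed.

(** With S_m u in both factors the integration by parts is exact, as phi = Psi'. Replacing phi(S_m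
    u) by phi(u) costs a multiple of x^m in L^q, against a gradient of size (2 x)^m, and (2 x^2)^m
    tends to 0. *)
Lemma partial_limit i u beta K psi : 0 <= K -> data u beta K -> test_function psi ->
  torus_integral (fun y => partial i (Psum m u) y * (phi (Rep u y) * psi y)) @[m --> \oo] -->
  - torus_integral (fun y => Psi (Rep u y) * partial i psi y).
Proof.
move=> K0 D tpsi; have [du _ _] := D.
have tS m : test_function (Psum m u) by exact: (test_psum hchi).
have [c c0 Hc] := cper_bounded (test_cper tpsi).
have [c' _ Hc'] := cper_bounded (test_cper (test_partial i tpsi)).
have [CP _ [mP bP]] := integ_comp_rep sPsi K0 D; have [Cp _ [mp bp]] := integ_comp_rep sphi K0 D.
have [LP LP0 [dP _]] := rep_comp_dist sPsi K0 D; have [L L0 [dp lp]] := rep_comp_dist sphi K0 D.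
have iP := integ_bounded mP bP; have ip := integ_bounded mp bp.
have iT (Th : R -> R) n : smooth_on setT Th -> integ (fun y => Th (Psum n u y)).
  by move=> sT; apply: integ_test; exact: test_comp.
pose v m := torus_integral (fun y => partial i (Psum m u) y * (phi (Rep u y) * psi y)).
pose a m := torus_integral (fun y => Psi (Psum m u y) * partial i psi y).
have ca : a m @[m --> \oo] --> torus_integral (fun y => Psi (Rep u y) * partial i psi y).
  apply: (tint_unif_cvg (fun n => iT Psi n sPsi) iP (mrow_test (test_partial i tpsi)) Hc' dP).
  exact: decay_cvg.
pose Q : R := L * (K * (1 - x)^-1) * (c * (4 * pi * K / (2 * x - 1))).
have bound m : `|v m + a m| <= Q * (2 * x * x) ^+ m.
  have tB' : test_function (fun y => partial i (Psum m u) y * psi y).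
    by apply: testM => //; exact: test_partial.
  have [cm _ Hcm] := cper_bounded (test_cper tB').
  (* phi(u) is itself approached by phi(S_N u), so that only smooth functions are compared and N
     tends to infinity at the end. *)
  pose b N := torus_integral (fun y => phi (Psum N u y) * (partial i (Psum m u) y * psi y)).
  have cb : b N @[N --> \oo] --> v m.
    rewrite /v (_ : (fun y => _) = fun y => phi (Rep u y) * (partial i (Psum m u) y * psi y)); last first.
      by apply/funext => y; ring.
    apply: (tint_unif_cvg (fun n => iT phi n sphi) ip (mrow_test tB') Hcm dp).
    exact: decay_cvg.
  have bm : b m = - a m.
    rewrite /a -tint_parts//; last exact: test_comp.
    rewrite /b; congr torus_integral; apply/funext => y.
    by rewrite partial_comp// ?dPsi ?mulrA// => z; exact: test_diff.
  have bN N : (m <= N)%N -> `|b N - b m| <= Q * (2 * x * x) ^+ m.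
    move=> mN; have tf n : test_function (fun y => phi (Psum n u y)) by exact: test_comp.
    have mf n : mrow (fun y => phi (Psum n u y)) by exact: mrow_test.
    have iM n : integ (fun y => phi (Psum n u y) * (partial i (Psum m u) y * psi y)).
      by apply: integ_test; exact: testM.
    rewrite -tintB//; under eq_fun do rewrite -mulrBl.
    have h1 := psum_dist_nq K0 D mN; have h2 := partial_psum_nq i m K0 D.
    have mBB : mrow (fun y => phi (Psum N u y) - phi (Psum m u y)).
      by apply: mrow_test; exact: testB.
    have {}h1 := nq_dom q1 (mrow_test (testB (tS N) (tS m))) mBB L0 h1 (lp N m).
    have {}h2 : nq q (fun y => partial i (Psum m u) y * psi y) (c * (4 * pi * K / (2 * x - 1) * (2 * x) ^+ m)).
      apply: (nq_dom q1 (mrow_test (test_partial i (tS m))) (mrow_test tB') c0 h2) => y.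
      by rewrite normrM mulrC ler_wpM2r.
    have h := nq_hoelder q2 mBB (mrow_test tB') h1 h2.
    apply: le_trans (nq_tint (lexx 1) (mrowM mBB (mrow_test tB')) h) _.
    rewrite !exprMn /Q; move: (4 * pi * K / (2 * x - 1)) (K * (1 - x)^-1) (2 ^+ m) (x ^+ m) => A B y z.
    by rewrite le_eqVlt; apply/orP; left; apply/eqP; ring.
  rewrite -[a m]opprK -bm.
  have cn : `|b N - b m| @[N --> \oo] --> `|v m - b m|.
    by apply: cvg_norm; apply: cvgB; [exact: cb|exact: cvg_cst].
  rewrite -(cvg_lim _ cn)//; apply: limr_le; first by apply/cvg_ex; eexists; exact: cn.
  by have := nbhs_infty_ge m; apply: filterS => N; exact: bN.
have cQ : Q * (2 * x * x) ^+ m @[m --> \oo] --> 0.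
  have h : (2 * x * x) ^+ m @[m --> \oo] --> 0.
    by apply: cvg_expr; rewrite ger0_norm// !mulr_ge0 ?(ltW x0).
  by have h2 := cvgM (cvg_cst Q) h; rewrite mulr0 in h2; exact: h2.
have cs : v m + a m @[m --> \oo] --> 0.
  apply/cvgrPdist_le => e e0; have /cvgrPdist_le/(_ e e0) := cQ; apply: filterS => m.
  rewrite !sub0r !normrN => h; apply: le_trans (bound m) (le_trans (ler_norm _) h).
have E : (fun m => v m + a m - a m) = v by apply/funext => m; rewrite addrK.
have h : v m + a m - a m @[m --> \oo] --> - torus_integral (fun y => Psi (Rep u y) * partial i psi y).
  by rewrite -sub0r; exact: cvgB cs ca.
by rewrite E in h; exact: h.
Qed.

End Composition.

End Limits.

(** * Identification of the product phi(u) grad u *)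

Section Products.
Context {R : realType} {d : nat}.
Implicit Types (f g : 'rV[R]_d -> R) (k : 'rV[int]_d) (u v : functional R d).

Lemma test_bd n psi : test_function psi -> exists2 c : R, 0 <= c & @bd R d supb n c 1 psi.
Proof.
elim: n psi => [|n IH] psi tpsi; have [c0 c00 H0] := cper_bounded (test_cper tpsi); first by exists c0.
have /choice[c Hc] : forall i, exists c : R, 0 <= c /\ bd supb n c 1 (partial i psi).
  by move=> i; have [c c1 h] := IH _ (test_partial i tpsi); exists c.
have s0 : 0 <= \sum_i c i by apply: sumr_ge0 => i _; case: (Hc i).
exists (c0 + \sum_i c i); first exact: addr_ge0.
split=> [y|i]; first by apply: le_trans (H0 y) _; rewrite lerDl.
have [_ h] := Hc i; rewrite mulr1; apply: (bd_le supb_nl ler01) h _.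
by rewrite (bigD1 i)//= addrCA lerDl addr_ge0// sumr_ge0// => j _; case: (Hc j).
Qed.

Lemma distr_of_funB (f g h : 'rV[R]_d -> R) : integ (fun y => f y * h y) -> integ (fun y => g y * h y) ->
  distr_of_fun (fun y => f y - g y) h = distr_of_fun f h - distr_of_fun g h.
Proof. by move=> i1 i2; rewrite /distr_of_fun; under eq_fun do rewrite mulrBl; rewrite tintB. Qed.

Lemma hn_sub_test t q u (f g : 'rV[R]_d -> R) (a b : R) : 1 <= q -> integ f -> integ g ->
  hn t q (distr_of_fun f \- u) a -> hn t q (u \- distr_of_fun g) b ->
  hn t q (distr_of_fun (fun y => f y - g y)) (a + b).
Proof.
move=> q1 jf jg h1 h2; apply: hn_ext (hn_add q1 h1 h2) => k.
split; rewrite distr_of_funB /= ?addrA ?subrK//; try exact: integ_fcos; exact: integ_fsin.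
Qed.

Variables (chi : R -> R) (hchi : dyadic_profile chi).
Variables (q p theta : R).
Hypotheses (q2 : 2 <= q) (p1 : 1 <= p) (hth : d%:R / q < theta).
Let q1 : 1 <= q. Proof. by apply: le_trans q2; rewrite ler1n. Qed.
Let p0 : 0 < p. Proof. exact: lt_le_trans p1. Qed.
Let tB := @tnorm_nq R d q q1.
Let nB := tn_nl tB.
Local Notation data := (besov_data chi q p theta).
Local Notation Psum := (@psum R d chi).
Local Notation Rep := (@rep R d chi).

Local Notation zf := (fun _ : 'rV[R]_d -> R => 0 : R).

Lemma block0 l y : dyadic_block chi l zf y = 0 :> R.
Proof. by rewrite /dyadic_block fsbig1// => k _; rewrite mulr0. Qed.

Lemma psum0 n y : Psum n zf y = 0.
Proof. by rewrite /psum big1// => l _; rewrite block0. Qed.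

Lemma rep0 y : Rep zf y = 0.
Proof. by rewrite /rep; under eq_fun do rewrite psum0; exact: lim_cst. Qed.

Lemma distr_zero : distribution_on_torus zf.
Proof.
split=> [a phi psi _ _|]; first by rewrite mulr0 addr0.
by exists 0%N, 0 => phi M _ _; rewrite normr0 mul0r.
Qed.

(** The zero distribution plays the part of v whenever an estimate for u alone is read off from one
    for differences. *)
Lemma data0 (K : R) : data zf (fun=> 0) K.
Proof.
split=> [|l|N]; first exact: distr_zero.
  apply: nq_sup => // [|y]; last by rewrite block0 normr0.
  by rewrite (_ : dyadic_block _ _ _ = fun=> 0); [exact: measurable_cst|apply/funext => y; exact: block0].
by rewrite big1 ?powR_ge0// => l _; rewrite mulr0 powR0// gt_eqF.
Qed.

Lemma data_sub0 u beta (K : R) : data u beta K -> data (u \- zf) beta K.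
Proof. by rewrite (_ : u \- _ = u)//; apply/funext => phi /=; rewrite subr0. Qed.

(** phi(S_N u) is phi(0) plus the telescoping blocks of phi(u) - phi(0), all multiplied by psi.
    Order sg costs 2^(l sg) against sizes of order 2^(- l theta), which is summable since sg <
    theta. *)
Lemma appr_comp (sg : R) phi u beta K psi : 0 < sg -> sg < theta -> smooth_on setT phi ->
  0 < K -> data u beta K -> test_function psi ->
  exists C, appr q sg (fun y => phi (Rep u y) * psi y) C.
Proof.
move=> sg0 sgth sphi K0 D tpsi; have [du _ _] := D.
have [n [C C0 H]] := appr_test (d := d) q2 sg0.
have [C1 C10 H1] := nlblock_bd hchi q1 p1 hth sphi (ltW K0) n.
have [c c0 Hc] := test_bd n tpsi.
pose W : R := 2 ^+ n * (C1 * (1 + K)) * c * K + 1.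
pose z : R := 2 `^ (sg - theta).
have z0 : 0 < z by exact: powR_gt0.
have z1 : z < 1.
  by rewrite /z /powR gt_eqF// expR_lt1 nmulr_rlt0 ?subr_lt0// ln_gt0// ltr1n.
have W0 : 0 <= 2 ^+ n * (C1 * (1 + K)) * c * K.
  by rewrite !mulr_ge0 ?exprn_ge0 ?addr_ge0// ltW.
have piece (l : nat) : appr q sg (fun y => nlblock chi phi u zf l y * psi y) (C * W * z ^+ l).
  have lam0 : 0 <= 2 ^+ l :> R by exact: exprn_ge0.
  have lam1 : 1 <= 2 ^+ l :> R by rewrite exprn_ege1// ler1n.
  have tn : test_function (nlblock chi phi u zf l) by apply: test_nlblock => //; exact: distr_zero.
  have b1 := H1 _ _ _ _ _ K l (ltW K0) D (data0 K) (data_sub0 D).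
  have b2 := bd_lam supb_nl ler01 lam1 Hc.
  have b := bdM nB lam0 (test_sm n tn) (test_sm n tpsi) c0 b1 b2.
  have bl := data_le q1 p1 l (ltW K0) D.
  have e0 : 0 < 2 `^ (- (l%:R * theta)) :> R by exact: powR_gt0.
  set w := _ * _ * c in b; have wW : w < W * 2 `^ (- (l%:R * theta)).
    rewrite /W mulrDl mul1r; apply: (@le_lt_trans _ _ (2 ^+ n * (C1 * (1 + K)) * c * (K * 2 `^ (- (l%:R * theta))))).
      have -> : w = 2 ^+ n * (C1 * (1 + K)) * c * beta l by rewrite /w addr0; ring.
      by rewrite ler_wpM2l// !mulr_ge0 ?exprn_ge0 ?addr_ge0// ltW.
    by rewrite [ltLHS]mulrA ltrDl.
  have h := H _ _ _ _ (testM tn tpsi) lam1 b wW; apply: (appr_le q2 h).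
  rewrite -!mulrA ler_wpM2l ?(ltW C0)// le_eqVlt; apply/orP; left; apply/eqP.
  rewrite mulrCA; congr (_ * _).
  rewrite /z -(powR_mulrn l (powR_ge0 _ _)) -(powR_mulrn l (ler0n R 2)).
  by rewrite -!powRrM -powRDp//; congr (_ `^ _); ring.
have [C2 H2] : exists C2, appr q sg (fun y => phi 0 * psi y) C2.
  have tz : test_function (fun y => phi 0 * psi y) by exact: testZ.
  have [c' c'0 Hc'] := test_bd n tz.
  exists (C * 1 `^ sg * (c' + 1)); apply: (H _ c') => //; last by rewrite ltrDl.
  by apply: (bd_tnorm tB) => //; exact: test_sm.
have [L L0 [dp _]] := rep_comp_dist hchi q2 p1 hth sphi (ltW K0) D.
exists (C * W * (1 - z)^-1 + C2); apply: appr_lim => e e0.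
have cd : L * c * @decay R d q theta ^+ N @[N --> \oo] --> 0 by exact: decay_cvg.
have /cvgrPdist_le/(_ e e0)[N _ /(_ N (leqnn N))] := cd.
rewrite sub0r normrN => hN.
exists (fun y => phi (Psum N u y) * psi y).
  move=> y; rewrite -mulrBl normrM; apply: le_trans hN; apply: le_trans (ler_norm _).
  by rewrite (mulrAC L); exact: ler_pM (normr_ge0 _) (normr_ge0 _) (dp N y) (bd0 Hc y).
rewrite (_ : (fun y => _) = fun y => \sum_(l < N) (nlblock chi phi u zf l y * psi y) + phi 0 * psi y); last first.
  by apply/funext => y; rewrite -mulr_suml nlblock_sum psum0 -mulrDl subrK.
apply: appr_add => //.
have h := appr_sum q2 (fun l : 'I_N => piece l); apply: (appr_le q2 h).
rewrite -mulr_sumr ler_wpM2l//; last by apply: geom_le => //; exact: ltW.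
by rewrite mulr_ge0 ?(ltW C0)// addr_ge0.
Qed.

Section Derivative.
Variables (phi Psi : R -> R) (sphi : smooth_on setT phi) (sPsi : smooth_on setT Psi).
Hypotheses (dPsi : derive1 Psi = phi) (th2 : 2^-1 < theta).

(** The multiplier product quantifies over all approximating sequences. Any of them differs from the
    derivatives of S_m u by a sequence tending to 0 in H^{-sg,q}, whose pairing with phi(u) psi
    vanishes in the limit by [appr_dual]. *)
Lemma multiplier_limit (sg : R) u beta K i psi (f_ : nat -> 'rV[R]_d -> R) : 0 < sg -> sg < theta ->
  @partial_bound R d (- sg) q p theta -> 0 < K -> data u beta K -> test_function psi ->
  (forall m, test_function (f_ m)) ->
  (fun m => H_norm (- sg) q (distr_of_fun (f_ m) \- distr_partial i u)) @ \oo --> 0%E ->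
  torus_integral (fun y => f_ m y * (phi (Rep u y) * psi y)) @[m --> \oo] -->
  - torus_integral (fun y => Psi (Rep u y) * partial i psi y).
Proof.
move=> sg0 sgth pb K0 D tpsi tf cf; have [du _ _] := D.
have [C aC] := appr_comp sg0 sgth sphi K0 D tpsi.
have [Cp Cp0 [mp bp]] := integ_comp_rep hchi q2 p1 hth sphi (ltW K0) D.
have [c c0 Hc] := cper_bounded (test_cper tpsi).
have mG : mrow (fun y => phi (Rep u y) * psi y) by apply: mrowM => //; exact: mrow_test.
have bG : supb (fun y => phi (Rep u y) * psi y) (Cp * c).
  by move=> y; rewrite normrM ler_pM//; exact: bp.
have tS m : test_function (partial i (Psum m u)) by apply: test_partial; exact: (test_psum hchi).
have L := partial_limit hchi q2 p1 hth th2 sphi sPsi dPsi (i := i) (ltW K0) D tpsi.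
have Z : torus_integral (fun y => (f_ m y - partial i (Psum m u) y) * (phi (Rep u y) * psi y)) @[m --> \oo] --> 0.
  apply/cvgrPdist_le => e e0; pose e1 := e / (2 * (`|C| + 1)).
  have C1 : 0 < `|C| + 1 by rewrite ltr_wpDl.
  have e10 : 0 < e1 by rewrite divr_gt0// mulr_gt0.
  have h2 := partial_psum_cvg hchi q2 p1 i pb D e10.
  have h1 : \forall m \near \oo, (H_norm (- sg) q (distr_of_fun (f_ m) \- distr_partial i u)%R < e1%:E)%E.
    have := cf; move/fine_cvgP => [].
    move=> fin /cvgrPdist_lt/(_ _ e10) hm; near=> m.
    have fm : H_norm (- sg) q (distr_of_fun (f_ m) \- distr_partial i u) \is a fin_num by near: m.
    rewrite -(fineK fm) lte_fin.
    have : `|0 - fine (H_norm (- sg) q (distr_of_fun (f_ m) \- distr_partial i u))| < e1 by near: m.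
    by rewrite sub0r normrN; apply: le_lt_trans; exact: ler_norm.
  near=> m; rewrite sub0r normrN.
  have a1 : hn (- sg) q (distr_of_fun (f_ m) \- distr_partial i u) e1.
    by apply: H_norm_lt => //; near: m.
  have a2 : hn (- sg) q (distr_partial i u \- distr_of_fun (partial i (Psum m u))) e1 by near: m.
  have a := hn_sub_test q1 (integ_test (tf m)) (integ_test (tS m)) a1 a2.
  have i1 : integ (fun y => f_ m y - partial i (Psum m u) y) by apply: integB; exact: integ_test.
  apply: le_trans (appr_dual q2 mG bG aC i1 a) _.
  apply: (@le_trans _ _ ((`|C| + 1) * (e1 + e1))).
    rewrite ler_wpM2r ?addr_ge0 ?(ltW e10)//.
    by apply: le_trans (ler_norm _) _; rewrite lerDl.
  by rewrite /e1 le_eqVlt; apply/orP; left; apply/eqP; field; rewrite gt_eqF.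
have := cvgD Z L; rewrite add0r => h.
rewrite (_ : (fun m => _) = fun m => torus_integral (fun y => (f_ m y - partial i (Psum m u) y) * (phi (Rep u y) * psi y)) +
  torus_integral (fun y => partial i (Psum m u) y * (phi (Rep u y) * psi y))); first exact: h.
apply/funext => m; rewrite -tintD; first by congr torus_integral; apply/funext => y; ring.
  by apply: (integM _ mG bG); apply: integB; exact: integ_test.
by apply: (integM _ mG bG); exact: integ_test.
Unshelve. all: by end_near. Qed.

Variables (eta : R -> R) (heta : eta_cutoff eta).

(** The case s >= 1: the derivatives of S_m u converge in L^q, and phi(u) psi is bounded. *)
Lemma pointwise_limit u beta K i psi g0 : @partial_bound R d 0 q p theta -> 0 < K -> data u beta K ->
  test_function psi -> integ g0 -> eq_distr (distr_partial i u) (distr_of_fun g0) ->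
  torus_integral (fun y => g0 y * (phi (Rep u y) * psi y)) =
  - torus_integral (fun y => Psi (Rep u y) * partial i psi y).
Proof.
move=> pb K0 D tpsi ig E; have [du _ _] := D.
have [Cp Cp0 [mp bp]] := integ_comp_rep hchi q2 p1 hth sphi (ltW K0) D.
have [c c0 Hc] := cper_bounded (test_cper tpsi).
have mG : mrow (fun y => phi (Rep u y) * psi y) by apply: mrowM => //; exact: mrow_test.
have bG : supb (fun y => phi (Rep u y) * psi y) (Cp * c).
  by move=> y; rewrite normrM ler_pM//; exact: bp.
have tS m : test_function (partial i (Psum m u)) by apply: test_partial; exact: (test_psum hchi).
have L := partial_limit hchi q2 p1 hth th2 sphi sPsi dPsi (i := i) (ltW K0) D tpsi.
have Z : torus_integral (fun y => partial i (Psum m u) y * (phi (Rep u y) * psi y)) @[m --> \oo] -->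
    torus_integral (fun y => g0 y * (phi (Rep u y) * psi y)).
  apply/cvgrPdist_le => e e0; pose e1 := e / (Cp * c + 1).
  have C1 : 0 < Cp * c + 1 by rewrite ltr_wpDl// mulr_ge0.
  have e10 : 0 < e1 by rewrite divr_gt0.
  have h2 := partial_psum_cvg hchi q2 p1 i pb D e10.
  apply: filterS h2 => m a.
  have i1 : integ (fun y => g0 y - partial i (Psum m u) y) by apply: integB => //; exact: integ_test.
  have a' : hn 0 q (distr_of_fun (fun y => g0 y - partial i (Psum m u) y)) e1.
    apply: hn_ext a => k; rewrite /= (E _ (test_cosp k)) (E _ (test_sinp k)).
    have it := integ_test (tS m).
    by split; rewrite -distr_of_funB//; try exact: integ_fcos; exact: integ_fsin.
  have h := hn0_tint heta q1 i1 a' mG bG.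
  rewrite -tintB; [|exact: (integM ig mG bG)|by apply: (integM _ mG bG); exact: integ_test].
  under eq_fun do rewrite -mulrBl.
  apply: le_trans h _; rewrite /e1 mulrCA -[leRHS]mulr1 ler_wpM2l ?(ltW e0)//.
  by rewrite ler_pdivrMr// mul1r lerDl.
exact: (cvg_unique _ Z L).
Qed.

End Derivative.

End Products.

(** * The antiderivative of Phi_j *)

Section RealFunctions.
Context {R : realType}.
Implicit Types (f g : R -> R) (A : set R).

Lemma smooth_on_sub A A' f : A' `<=` A -> smooth_on A f -> smooth_on A' f.
Proof. by move=> sA H n x /sA; exact: H. Qed.

Lemma smooth_onS A f : (forall x, A x -> derivable f x 1) -> smooth_on A (derive1 f) -> smooth_on A f.
Proof. by move=> d0 d1 [|n] x Ax; [exact: d0|rewrite derive1Sn; exact: d1]. Qed.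

(** Differentiability of finite order, which allows induction and is local on open sets; smoothness
    can then be checked separately on two open sets that cover the line. *)
Fixpoint diffn A n f : Prop :=
  (forall x, A x -> derivable f x 1) /\ if n is n'.+1 then diffn A n' (derive1 f) else True.

Lemma diffnP A f : smooth_on A f <-> forall n, diffn A n f.
Proof.
split=> [sf n|].
  elim: n f sf => [|n IH] f sf; split=> //; try by move=> x Ax; exact: (sf 0%N).
  by apply: IH => m x Ax; rewrite -derive1Sn; exact: sf.
move=> H n; elim: n f H => [|n IH] f H x Ax; first by case: (H 0%N) => h _; exact: h.
by rewrite derive1Sn; apply: IH => // m; case: (H m.+1).
Qed.

Lemma diffnS A n f : diffn A n.+1 f -> diffn A n f.
Proof. by elim: n f => [|n IH] f [df sf]; split=> //; exact: IH. Qed.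

Variables (A : set R) (oA : open A).

Lemma near_open (x : R) (P : R -> Prop) : A x -> (forall y, A y -> P y) -> \forall y \near x, P y.
Proof. by move=> Ax H; have := open_nbhs_nbhs (conj oA Ax); apply: filterS. Qed.

Lemma diffn_eq n f g : (forall x, A x -> f x = g x) -> diffn A n f -> diffn A n g.
Proof.
have der f' g' x : (forall y, A y -> f' y = g' y) -> A x -> derivable f' x 1 -> derivable g' x 1.
  by move=> fg' Ax; apply: near_eq_derivable; exact: near_open.
elim: n f g => [|n IH] f g fg [df sf].
  by split; [move=> x Ax; exact: der fg Ax (df x Ax)|exact: I].
split; first by move=> x Ax; exact: der fg Ax (df x Ax).
apply: (IH (derive1 f)) => // x Ax; rewrite !derive1E; apply: near_eq_derive.
exact: near_open.
Qed.

Lemma diffnD n f g : diffn A n f -> diffn A n g -> diffn A n (fun x => f x + g x).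
Proof.
elim: n f g => [|n IH] f g [df sf] [dg sg].
  by split; [move=> x Ax; exact: (@derivableD R R R f g x 1 (df x Ax) (dg x Ax))|exact: I].
split; first by move=> x Ax; exact: (@derivableD R R R f g x 1 (df x Ax) (dg x Ax)).
apply: (@diffn_eq n (fun x => derive1 f x + derive1 g x)); last exact: IH sf sg.
move=> x Ax; have := @deriveD R R R f g x 1 (df x Ax) (dg x Ax).
by rewrite -!derive1E => <-.
Qed.

Lemma diffnM n f g : diffn A n f -> diffn A n g -> diffn A n (fun x => f x * g x).
Proof.
elim: n f g => [|n IH] f g.
  move=> [df _] [dg _].
  by split; [move=> x Ax; exact: (@derivableM R R f g x 1 (df x Ax) (dg x Ax))|exact: I].
move=> sf sg; have [df sf'] := sf; have [dg sg'] := sg.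
split; first by move=> x Ax; exact: (@derivableM R R f g x 1 (df x Ax) (dg x Ax)).
apply: (@diffn_eq n (fun x => f x * derive1 g x + g x * derive1 f x)).
  move=> x Ax; have := @deriveM R R f g x 1 (df x Ax) (dg x Ax).
  by rewrite -!derive1E => <-.
by apply: diffnD; apply: IH => //; exact: diffnS.
Qed.

End RealFunctions.

(** * The regularised coefficient *)

Section Cutoff.
Context {R : realType}.
Implicit Types (f g phi : R -> R).

Lemma smooth_cst (c : R) : smooth_on setT (fun _ : R => c).
Proof.
move=> n x _; elim: n c x => [|n IH] c x; first exact: derivable_cst.
rewrite derive1Sn (_ : derive1 _ = fun=> 0); first exact: IH.
by apply/funext => y; rewrite derive1_cst.
Qed.

Lemma smooth_scale (c : R) f : smooth_on setT f -> smooth_on setT (fun x => f (c * x)).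
Proof.
move=> /diffnP H; apply/diffnP => n; elim: n f H => [|n IH] f H.
  split=> // x _; have [df _] := H 0%N.
  apply/derivable1_diffP; apply: (@differentiable_comp _ _ _ _ (fun y => c * y) f).
    by apply/derivable1_diffP; case: (is_deriveZ c (is_derive_id x 1)).
  by apply/derivable1_diffP; exact: df.
have [df _] := H 0%N.
have dl (x : R) : is_derive x 1 (fun y : R => c * y) c.
  by have := is_deriveZ c (is_derive_id x (1 : R)); rewrite /GRing.scale/= mulr1.
split.
  move=> x _; apply/derivable1_diffP; apply: (@differentiable_comp _ _ _ _ (fun y => c * y) f).
    by apply/derivable1_diffP; case: (dl x).
  by apply/derivable1_diffP; exact: df.
apply: (diffn_eq openT (f := fun x => c * derive1 f (c * x))).
  move=> x _; have [dx ex] := dl x; have fx := df (c * x) I.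
  have -> : derive1 (fun y => f (c * y)) x = derive1 f (c * x) * derive1 (fun y => c * y) x.
    exact: (@derive1_comp R (fun y => c * y) f x dx fx).
  by rewrite [derive1 (fun y => c * y) x]derive1E ex mulrC.
apply: (diffnM openT); first exact: (diffnP _ _).1 (@smooth_cst c) n.
by apply: IH => m; case: (H m.+1).
Qed.

(** For r > 0 the coefficient is a product of smooth functions, and on the open set j r < 1 it is 0.
    The two sets cover the line. *)
Lemma Phi_reg_smooth (eta Phi : R -> R) j : eta_cutoff eta -> smooth_on [set r | 0 < r] Phi ->
  smooth_on setT (Phi_reg eta Phi j) /\ forall r, r <= 0 -> Phi_reg eta Phi j r = 0.
Proof.
move=> [se _ _ e0] sPhi; split; last first.
  by move=> r r0; rewrite /Phi_reg e0 ?mul0r// (le_trans _ ler01)// mulr_ge0_le0.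
move=> n x _; have [x0|x0] := ltP 0 x.
  have o : open [set r : R | 0 < r] by exact: open_gt.
  apply: ((diffnP [set r | 0 < r] (Phi_reg eta Phi j)).2 _ n x x0) => {}n.
  apply: (diffnM o); last exact: (diffnP _ _).1 sPhi n.
  by apply: (diffnP _ _).1; apply: smooth_on_sub (smooth_scale se).
have o : open [set r : R | j%:R * r < 1].
  rewrite (_ : [set r | _] = (fun r => j%:R * r) @^-1` [set r | r < 1])//.
  apply: open_comp; last exact: open_lt.
  by move=> y _; apply: (@contZ _ _ j%:R id) => z; exact: cvg_id.
have jx : j%:R * x < 1 by rewrite (le_lt_trans _ ltr01)// mulr_ge0_le0.
apply: ((diffnP [set r | j%:R * r < 1] (Phi_reg eta Phi j)).2 _ n x jx) => {}n.
apply: (diffn_eq o (f := fun=> 0)) => [y /= /ltW h|]; first by rewrite /Phi_reg e0 ?mul0r.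
by apply: (diffnP _ _).1; apply: smooth_on_sub (@smooth_cst 0).
Qed.

Lemma antiderivative phi : smooth_on setT phi -> (forall x, x <= 0 -> phi x = 0) ->
  exists Psi, [/\ smooth_on setT Psi, derive1 Psi = phi & Psi 0 = 0].
Proof.
(* Starting the integral at - 1 instead of 0 leaves it unchanged, as phi vanishes up to 0, and puts
   0 in the interior for the fundamental theorem. *)
move=> sphi phi0; pose Psi (x : R) := (\int[lebesgue_measure]_(t in `[-1, x]) phi t)%R.
have z x : x <= 0 -> Psi x = 0.
  move=> x0; rewrite /Psi /Rintegral integral0_eq//= => t; rewrite in_itv/= => /andP[_ tx].
  by rewrite phi0// (le_trans tx).
have cphi := smooth_on_continuous sphi.
have H x : derivable Psi x 1 /\ derive1 Psi x = phi x.
  have [x0|x0] := ltP x 0.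
    have E : \forall y \near x, cst 0 y = Psi y.
      by have := lt_nbhsl x0; apply: filterS => y y0; rewrite z// ltW.
    split; first by apply: near_eq_derivable E _; exact: derivable_cst.
    by rewrite derive1E -(near_eq_derive _ E) derive_cst phi0// ltW.
  apply: (@continuous_FTC1_closed R phi (-1) x (x + 1)).
  - by rewrite ltrDl.
  - apply: continuous_compact_integrable; first exact: segment_compact.
    exact: continuous_subspaceT.
  - by apply: lt_le_trans x0; rewrite oppr_lt0.
  - exact: cphi.
have dE : derive1 Psi = phi by apply/funext => x; case: (H x).
exists Psi; split; [|exact: dE|exact: z].
by apply: smooth_onS => [x _|]; [case: (H x)|rewrite dE].
Qed.

End Cutoff.

(** * The operator F^(j) *)

Section Divergence.
Context {R : realType} {d : nat}.
Implicit Types (f g : 'rV[R]_d -> R) (k : 'rV[int]_d) (u v w : functional R d).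
Local Notation zf := (fun _ : 'rV[R]_d -> R => 0 : R).

Lemma hn_swap t q u v (c : R) : 1 <= q -> hn t q (u \- v) c -> hn t q (v \- u) c.
Proof.
move=> q1 [g [mg gc bg]]; have ig := nq_integ q1 mg gc; exists (fun x => -1 * g x); split.
- by apply: measurable_funM => //; exact: measurable_cst.
- by rewrite -[c]mul1r -[X in X * c](normrN1 R); exact: nqZ.
move=> k; have [g1 g2] := bg k.
split; under eq_fun do rewrite -mulrA.
  by rewrite tintZ ?g1/=; [rewrite mulN1r -mulrN opprB|exact: integ_fcos].
by rewrite tintZ ?g2/=; [rewrite mulN1r -mulrN opprB|exact: integ_fsin].
Qed.

Lemma H_norm_ge0 t q u : (0 <= H_norm t q u)%E.
Proof. by apply: le_ereal_inf_tmp => _ [g _ <-]; exact: Lq_ge0. Qed.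

Lemma H_norm_cvg0 t q (u_ : nat -> functional R d) : 1 <= q ->
  (forall e, 0 < e -> \forall m \near \oo, hn t q (u_ m) e) ->
  (fun m => H_norm t q (u_ m)) @ \oo --> 0%E.
Proof.
move=> q1 H; apply/fine_cvgP; split.
  apply: filterS (H 1 ltr01) => m h; rewrite ge0_fin_numE ?H_norm_ge0//.
  by apply: le_lt_trans (H_norm_le q1 h) _; exact: ltry.
apply/cvgrPdist_le => e e0; apply: filterS (H e e0) => m h /=.
rewrite sub0r normrN ger0_norm ?fine_ge0 ?H_norm_ge0//.
have := H_norm_le q1 h; rewrite -[X in (X <= _)%E]fineK ?lee_fin//.
rewrite ge0_fin_numE ?H_norm_ge0//.
by apply: le_lt_trans (H_norm_le q1 h) _; exact: ltry.
Qed.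

Lemma distr_sum_distr (I : Type) (r : seq I) (T : I -> functional R d) :
  (forall i, distribution_on_torus (T i)) -> distribution_on_torus (fun phi => \sum_(i <- r) T i phi).
Proof.
move=> dT; elim: r => [|i r IH].
  by rewrite (_ : (fun _ => _) = zf); [exact: distr_zero|apply/funext => f; rewrite big_nil].
rewrite (_ : (fun _ => _) = T i \- (zf \- (fun phi => \sum_(j <- r) T j phi))).
  by apply: distrBB => //; apply: distrBB => //; exact: distr_zero.
by apply/funext => f; rewrite big_cons /= sub0r opprK.
Qed.

Variables (chi : R -> R) (hchi : dyadic_profile chi) (eta : R -> R) (heta : eta_cutoff eta).
Variables (q p theta s : R).
Hypotheses (q2 : 2 <= q) (p1 : 1 <= p) (hth : d%:R / q < theta) (th2 : 2^-1 < theta).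
Hypothesis sth : 1 - s < theta.
(** The order in which grad u is approximated: multipliers act on H^{s-1,q} if s < 1, and L^q is
    enough for pointwise products. *)
Let r : R := if s < 1 then s - 1 else 0.
Hypotheses (pb : @partial_bound R d r q p theta) (lb : @lap_bound R d (s - 2) q p theta).
Let q1 : 1 <= q. Proof. by apply: le_trans q2; rewrite ler1n. Qed.
Let p0 : 0 < p. Proof. exact: lt_le_trans p1. Qed.
Local Notation data := (besov_data chi q p theta).
Local Notation Psum := (@psum R d chi).
Local Notation Rep := (@rep R d chi).

Variables (Phi : R -> R) (j : nat) (Psi : R -> R).
Let phi := Phi_reg eta Phi j.
Hypotheses (sphi : smooth_on setT phi) (sPsi : smooth_on setT Psi).
Hypotheses (dPsi : derive1 Psi = phi) (Psi0 : Psi 0 = 0).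

Let mcomp f : mrow f -> mrow (fun x => phi (f x)).
Proof.
move=> mf; apply: (@measurableT_comp _ _ _ _ _ _ phi) mf.
by apply: continuous_measurable_fun; exact: smooth_on_continuous.
Qed.

Lemma represents_rep u beta (K : R) : 0 < K -> data u beta K -> represents (Rep u) u.
Proof.
move=> K0 D; split; last exact: (rep_distr hchi q1 p1 hth (ltW K0) D).
by apply/in_Lq1P; exact: (integ_rep hchi q1 p1 hth (ltW K0) D).
Qed.

(** For s < 1 the defining limit is evaluated along the derivatives of S_m u, for s >= 1 the
    pointwise product is evaluated directly. Either way h is determined, whatever representative f
    was chosen. *)
Lemma product_partial u h f i beta (K : R) psi : 0 < K -> data u beta K -> represents f u ->
  (if s < 1 then multiplier_product (s - 1) q (phi \o f) (distr_partial i u) h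
   else pointwise_product q (phi \o f) (distr_partial i u) h) ->
  test_function psi -> h psi = - torus_integral (fun y => Psi (Rep u y) * partial i psi y).
Proof.
move=> K0 D [/in_Lq1P jf fu] hp tpsi; have [du _ _] := D.
have ir := integ_rep hchi q1 p1 hth (ltW K0) D.
have E : eq_distr (distr_of_fun f) (distr_of_fun (Rep u)).
  move=> g tg; rewrite -(fu g tg); exact: (rep_distr hchi q1 p1 hth (ltW K0) D).
have mf := mcomp (integ_mrow jf); have mr := mcomp (integ_mrow ir).
have mpsi := mrow_test tpsi.
have swap g : mrow g -> torus_integral (fun x => phi (f x) * g x * psi x) =
    torus_integral (fun x => g x * (phi (Rep u x) * psi x)).
  move=> mg; apply: (tint_eq_distr heta jf ir E).
  - by apply: mrowM => //; exact: mrowM.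
  - by apply: mrowM => //; exact: mrowM.
  - by move=> x ->; ring.
have tS m : test_function (partial i (Psum m u)) by apply: test_partial; exact: (test_psum hchi).
move: hp pb; rewrite /r; case: ifP => s1.
  move=> [_ _ lim] pb'.
  have c0 : (fun m => H_norm (s - 1) q (distr_of_fun (partial i (Psum m u)) \- distr_partial i u)) @ \oo --> 0%E.
    apply: H_norm_cvg0 => // e e0.
    apply: filterS (partial_psum_cvg hchi q2 p1 i pb' D e0) => m; exact: hn_swap.
  have L1 := lim _ tS c0 _ tpsi.
  have L2 := partial_limit hchi q2 p1 hth th2 sphi sPsi dPsi (i := i) (ltW K0) D tpsi.
  have e : (fun m => distr_of_fun (fun x => (phi \o f) x * partial i (Psum m u) x) psi) =
     fun m => torus_integral (fun y => partial i (Psum m u) y * (phi (Rep u y) * psi y)).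
    by apply/funext => m; exact: swap (mrow_test (tS m)).
  by rewrite e in L1; exact: (cvg_unique _ L1 L2).
move=> [g0 [_ [/in_Lq1P jg Eg]] [_ Eh]] pb'.
rewrite (Eh _ tpsi) -(pointwise_limit hchi q2 p1 hth sphi sPsi dPsi th2 heta pb' K0 D tpsi jg Eg).
exact: swap (integ_mrow jg).
Qed.

(** The weak form of w = Laplacian of Psi(u). It is all that the estimates need, and as a
    consequence of [is_F] it shows that w is determined on test functions. *)
Definition solves u w : Prop := forall g, test_function g ->
  w g = torus_integral (fun y => Psi (Rep u y) * lap g y).

Lemma integ_Psi u beta (K : R) : 0 < K -> data u beta K -> integ (fun y => Psi (Rep u y)).
Proof.
move=> K0 D; have [C _ [m b]] := integ_comp_rep hchi q2 p1 hth sPsi (ltW K0) D.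
exact: integ_bounded m b.
Qed.

Lemma integ_Psi_test u beta (K : R) g : 0 < K -> data u beta K -> test_function g ->
  integ (fun y => Psi (Rep u y) * g y).
Proof.
move=> K0 D tg; have [c _ Hc] := cper_bounded (test_cper tg).
exact: integM (integ_Psi K0 D) (mrow_test tg) Hc.
Qed.

Lemma is_F_solves u w beta (K : R) : 0 < K -> data u beta K -> is_F s q eta Phi j u w -> solves u w.
Proof.
move=> K0 D [_ [f fu [h Hh E]]] g tg; rewrite (E g tg) /distr_div /distr_partial.
have tp i : test_function (partial i (partial i g)) by do 2 apply: test_partial.
transitivity (\sum_(i < d) torus_integral (fun y => Psi (Rep u y) * partial i (partial i g) y)).
  apply: eq_bigr => i _; have [_ hi] := Hh i.
  by rewrite (product_partial K0 D fu hi (test_partial i tg)) opprK.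
rewrite -tint_sum; last by move=> i; exact: integ_Psi_test K0 D (tp i).
by congr torus_integral; apply/funext => y; rewrite /lap mulr_sumr.
Qed.

Lemma solves0 : solves zf zf.
Proof.
move=> g tg; rewrite -[LHS](tint_cst (d := d)); congr torus_integral.
by apply/funext => y; rewrite rep0 Psi0 mul0r.
Qed.

(** [M] fixes the constant through the size of u and v; [dl] is positive because [lap_bound] is
    stated for positive K. *)
Lemma solves_bound (M : R) : 0 < M -> exists2 C : R, 0 < C &
  forall u v wu wv b1 b2 b3 (dl : R), 0 < dl -> data u b1 M -> data v b2 M -> data (u \- v) b3 dl ->
    solves u wu -> solves v wv -> hn (s - 2) q (wu \- wv) (C * dl).
Proof.
move=> M0; have [n [C C0 H]] := lb.
have [C' C'0 H'] := nlfamily hchi q1 p1 hth sPsi (ltW M0) n.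
exists (C * C'); first exact: mulr_gt0.
move=> u v wu wv b1 b2 b3 dl dl0 D1 D2 D3 S1 S2.
have [W fam] := H' u v b1 b2 b3 dl (ltW dl0) D1 D2 D3.
rewrite -mulrA; apply: (H _ _ _ _ _ _ _ fam (nl_coefs hchi q1 p1 hth sPsi (ltW M0) D1 D2)).
  exact: mulr_gt0.
apply: lap_of_tint => [|g tg].
  by apply: integB; [exact: integ_Psi M0 D1|exact: integ_Psi M0 D2].
under eq_fun do rewrite mulrBl.
rewrite tintB /= ?S1 ?S2//; [exact: integ_Psi_test M0 D1 (test_lap tg)|exact: integ_Psi_test M0 D2 (test_lap tg)].
Qed.

(** The candidate for h is the distributional gradient of Psi(u). Its membership in H^{s-1,q} comes
    from the dyadic family of Psi(u) - Psi(0), the multiplier property from duality. *)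
Lemma is_F_exists u beta (K : R) : 0 < K -> data u beta K -> exists w, is_F s q eta Phi j u w.
Proof.
move=> K0 D; have [du _ _] := D.
pose T := distr_of_fun (fun y => Psi (Rep u y)).
have dT : distribution_on_torus T by apply: distr_of_fun_distr; exact: integ_Psi K0 D.
pose h i := distr_partial i T.
have dh i : distribution_on_torus (h i) by exact: distr_partial_distr.
exists (distr_div h); split; first by apply: distr_sum_distr => i; exact: distr_partial_distr.
exists (Rep u); first exact: represents_rep K0 D.
exists h => // i; split=> //.
have ir := integ_rep hchi q1 p1 hth (ltW K0) D.
have [Cp Cp0 [mp bp]] := integ_comp_rep hchi q2 p1 hth sphi (ltW K0) D.
move: pb; rewrite /r; case: ifP => s1 pb'.
  split.
  - split; first exact: distr_partial_distr.
    have [C C0 H] := partial_hn hchi q2 p1 pb'.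
    by apply: le_lt_trans (H_norm_le q1 (H u beta K K0 D i)) _; exact: ltry.
  - split=> //; have [n [C C0 H]] := pb'.
    have [C' C'0 H'] := nlfamily hchi q1 p1 hth sPsi (ltW K0) n.
    have dz : data zf (fun=> 0) K by exact: data0.
    have [W fam] := H' u zf _ _ _ K (ltW K0) D dz (data_sub0 D).
    have co := nl_coefs hchi q1 p1 hth sPsi (ltW K0) D dz.
    have e : (fun x => Psi (Rep u x) - Psi (Rep zf x)) = fun x => Psi (Rep u x).
      by apply/funext => x; rewrite rep0 Psi0 subr0.
    rewrite e in co.
    have hh := H i _ _ _ _ _ (h i) (mulr_gt0 C'0 K0) fam co (partial_of_distr i dT).
    by apply: le_lt_trans (H_norm_le q1 hh) _; exact: ltry.
  - move=> f_ tf cf psi tpsi.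
    have sg0 : 0 < 1 - s by rewrite subr_gt0.
    have E1 : s - 1 = - (1 - s) by rewrite opprB.
    rewrite E1 in pb' cf.
    have L := multiplier_limit hchi q2 p1 hth sphi sPsi dPsi th2 sg0 sth pb' K0 D tpsi tf cf.
    rewrite (_ : (fun m => _) = fun m => torus_integral (fun y => f_ m y * (phi (Rep u y) * psi y))).
      exact: L.
    by apply/funext => m; congr torus_integral; apply/funext => y; rewrite /phi /=; ring.
have [C C0 H] := partial_hn hchi q2 p1 pb'.
have [g0 [mg gc bg]] := H u beta K K0 D i.
have jg := nq_integ q1 mg gc.
have Eg : eq_distr (distr_partial i u) (distr_of_fun g0).
  apply: distr_eq_trig; [exact: distr_partial_distr|exact: distr_of_fun_distr|].
  move=> k; have [] := bg k; rewrite mul0r powRr0 !mul1r => h1 h2.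
  by split; rewrite [RHS]/distr_of_fun ?h1 ?h2.
exists g0; first by split; [apply/in_LqP; split=> //; exists (C * K)|split=> //; exact/in_Lq1P].
split.
  apply/in_Lq1P; rewrite (_ : (fun x => _) = fun x => g0 x * phi (Rep u x)).
    exact: integM jg mp bp.
  by apply/funext => x /=; rewrite mulrC.
move=> psi tpsi.
rewrite [LHS](_ : _ = - torus_integral (fun y => Psi (Rep u y) * partial i psi y))//.
rewrite -(pointwise_limit hchi q2 p1 hth sphi sPsi dPsi th2 heta pb' K0 D tpsi jg Eg).
by congr torus_integral; apply/funext => y; rewrite /phi /=; ring.
Qed.

End Divergence.

(** * Consequences of admissibility *)

Section Admissible.
Context {R : realType} {d : nat}.
Variables (s p q kappa : R) (adm : @admissible R d s p q kappa).
Let theta : R := trace_exponent s p kappa.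

(** kappa < p / 2 - 1 means (1 + kappa) / p < 1/2, hence theta > s; for p = 2 and kappa = 0 the
    exponent is s itself. *)
Lemma admissible_cases : s < theta \/ [/\ q = 2, p = 2 & theta = s].
Proof.
case: adm => _ p2 _ k0 [[p2' kp]|[-> p2' k0']] _ _; [left|right].
  have p0 : 0 < p by exact: lt_trans p2'.
  have h : (1 + kappa) / p < 2^-1 by rewrite ltr_pdivrMr//; move: kp; lra.
  by rewrite /theta /trace_exponent; move: h; set z := _ / p; lra.
by split=> //; rewrite /theta /trace_exponent p2' k0' addr0; field.
Qed.

(** Add 1 - s < theta and s <= theta. *)
Lemma admissible_half : 2^-1 < theta.
Proof. by have := adm_c adm; rewrite -/theta; case: admissible_cases => [h|[_ _ h]]; move: h; lra. Qed.

Lemma admissible_lap : @lap_bound R d (s - 2) q p theta.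
Proof.
have t0 := admissible_half; have q1 : 1 <= q by apply: le_trans (adm_q adm); rewrite ler1n.
have p0 : 0 < p by apply: lt_le_trans (adm_p adm).
case: admissible_cases => [st|[-> -> ts]].
  have m1 : s <= Num.max s 0 by rewrite le_max lexx.
  have m2 : 0 <= Num.max s 0 by rewrite le_max lexx orbT.
  have m3 : Num.max s 0 < theta by rewrite gt_max st/=; move: t0; lra.
  (* An order strictly between max(s, 0) and theta: it has to be positive even when s is not. *)
  apply: (@lossy_lap _ _ q p theta ((Num.max s 0 + theta) / 2)) => //.
  - by move: m2 t0; lra.
  - by move: m3; lra.
  - by move: m1 m3; lra.
by rewrite ts; apply: plancherel_lap; rewrite -ts; move: t0; lra.
Qed.

Lemma admissible_partial : @partial_bound R d (if s < 1 then s - 1 else 0) q p theta.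
Proof.
have t0 := admissible_half; have q1 : 1 <= q by apply: le_trans (adm_q adm); rewrite ler1n.
have p0 : 0 < p by apply: lt_le_trans (adm_p adm).
case: admissible_cases => [st|[-> -> ts]].
  have m1 : s <= Num.max s 0 by rewrite le_max lexx.
  have m2 : 0 <= Num.max s 0 by rewrite le_max lexx orbT.
  have m3 : Num.max s 0 < theta by rewrite gt_max st/=; move: t0; lra.
  apply: (@lossy_partial _ _ q p theta ((Num.max s 0 + theta) / 2)) => //.
  - by move: m2 t0; lra.
  - by move: m3; lra.
  - by case: ltP => //; lra.
  - by case: ltP => //; move: m1 m3; lra.
rewrite ts; apply: plancherel_partial; first by rewrite -ts; move: t0; lra.
by case: ltP => //; lra.
Qed.

End Admissible.

Lemma besov_norm_ge0 (R : realType) (d : nat) (chi : R -> R) (t q p : R) (u : functional R d) :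
  (0 <= besov_norm chi t q p u)%E.
Proof. exact: poweR_ge0. Qed.

Theorem lemma2p2 (R : realType) (d : nat) (hd : (1 <= d)%N)
    (chi : R -> R) (hchi : dyadic_profile chi)
    (eta : R -> R) (heta : eta_cutoff eta)
    (Phi : R -> R) (hPhi : smooth_on [set r | 0 < r] Phi)
    (s p q kappa : R) (hadm : admissible d s p q kappa) :
  (* F^(j) is well defined on X^Tr *)
  (forall (j : nat) (u : functional R d),
     in_XTr chi s p q kappa u -> exists w, is_F s q eta Phi j u w) /\
  (forall j n : nat, exists C L : R, [/\ 0 < C, 0 < L,
     forall u w : functional R d,
       in_XTr chi s p q kappa u ->
       (XTr_norm chi s p q kappa u <= n%:R%:E)%E ->
       is_F s q eta Phi j u w ->
       (X0_norm s q w <= C%:E * XTr_norm chi s p q kappa u)%E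
   & forall u v wu wv : functional R d,
       in_XTr chi s p q kappa u -> in_XTr chi s p q kappa v ->
       (XTr_norm chi s p q kappa u <= n%:R%:E)%E ->
       (XTr_norm chi s p q kappa v <= n%:R%:E)%E ->
       is_F s q eta Phi j u wu -> is_F s q eta Phi j v wv ->
       (X0_norm s q (wu \- wv)%R <=
          L%:E * XTr_norm chi s p q kappa (u \- v)%R)%E]).
Proof.
have q2 := adm_q hadm; have p1 : 1 <= p by apply: le_trans (adm_p hadm); rewrite ler1n.
have p0 : 0 < p by exact: lt_le_trans p1.
have q1 : 1 <= q by apply: le_trans q2; rewrite ler1n.
pose theta := trace_exponent s p kappa.
have hth : d%:R / q < theta by have := adm_b hadm; rewrite subr_gt0.
have th2 : 2^-1 < theta := admissible_half hadm.
have sth : 1 - s < theta := adm_c hadm.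
have lb := admissible_lap hadm; have pb := admissible_partial hadm.
have dataP (u : functional R d) (K : R) : in_XTr chi s p q kappa u -> (XTr_norm chi s p q kappa u <= K%:E)%E ->
    exists beta, besov_data chi q p theta u beta K.
  by move=> [du _]; exact: besov_dataP.
split=> [j u hu|j n].
  have [sphi phi0] := Phi_reg_smooth j heta hPhi.
  have [Psi [sPsi dPsi Psi0]] := antiderivative sphi phi0.
  have [K K0 uK] : exists2 K : R, 0 < K & (XTr_norm chi s p q kappa u <= K%:E)%E.
    have [_ uf] := hu; have u0 : (0 <= XTr_norm chi s p q kappa u)%E := besov_norm_ge0 _ _ _ _ _.
    (* A positive bound is required and the norm of u may be 0. *)
    exists (fine (XTr_norm chi s p q kappa u) + 1); first by rewrite ltr_wpDl// fine_ge0.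
    by rewrite EFinD fineK ?ge0_fin_numE// leeDl.
  have [beta D] := dataP u K hu uK.
  exact: (is_F_exists hchi heta q2 p1 hth th2 sth pb sphi sPsi dPsi Psi0 K0 D).
have [sphi phi0] := Phi_reg_smooth j heta hPhi.
have [Psi [sPsi dPsi Psi0]] := antiderivative sphi phi0.
(* n may be 0, whereas the estimates require a positive M. *)
have M0 : 0 < n%:R + 1 :> R by rewrite ltr_wpDl.
have [C C0 H] := solves_bound hchi q2 p1 hth lb sPsi M0.
have dM (u : functional R d) : in_XTr chi s p q kappa u -> (XTr_norm chi s p q kappa u <= n%:R%:E)%E ->
    exists beta, besov_data chi q p theta u beta (n%:R + 1).
  by move=> hu un; apply: dataP => //; apply: le_trans un _; rewrite lee_fin lerDl.
have sol (u w : functional R d) : in_XTr chi s p q kappa u -> (XTr_norm chi s p q kappa u <= n%:R%:E)%E ->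
    is_F s q eta Phi j u w -> solves chi Psi u w.
  move=> hu un Fw; have [beta D] := dM u hu un.
  exact: (is_F_solves hchi heta q2 p1 hth th2 pb sphi sPsi dPsi M0 D Fw).
have main (u v wu wv : functional R d) b1 b2 : besov_data chi q p theta u b1 (n%:R + 1) ->
    besov_data chi q p theta v b2 (n%:R + 1) -> solves chi Psi u wu -> solves chi Psi v wv ->
    (X0_norm s q (wu \- wv)%R <= C%:E * XTr_norm chi s p q kappa (u \- v)%R)%E.
  move=> D1 D2 S1 S2; have [du _ _] := D1; have [dv _ _] := D2.
  have duv := distrBB du dv.
  have := besov_norm_ge0 chi theta q p (u \- v)%R; rewrite -/(XTr_norm chi s p q kappa (u \- v)%R).
  (* An infinite norm of u - v makes the right-hand side infinite. *)
  case E : (XTr_norm chi s p q kappa (u \- v)%R) => [x| |] // x0; last first.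
    by rewrite gt0_muley ?lte_fin// leey.
  rewrite lee_fin in x0; rewrite -EFinM; apply/lee_addgt0Pr => e e0.
  (* The norm x of u - v may be 0, so it is enlarged by e / C with e > 0 arbitrary; the estimate
     then exceeds C x by e. *)
  have d0 : 0 < x + e / C by rewrite ltr_wpDl// divr_gt0.
  have [b3 D3] : exists b3, besov_data chi q p theta (u \- v)%R b3 (x + e / C).
    apply: besov_dataP => //.
    rewrite -/(XTr_norm chi s p q kappa (u \- v)%R) E lee_fin lerDl ltW// divr_gt0//.
  have h := H u v wu wv b1 b2 b3 _ d0 D1 D2 D3 S1 S2.
  apply: le_trans (H_norm_le q1 h) _.
  by rewrite -EFinD lee_fin mulrDr (mulrCA C) divff ?gt_eqF// mulr1.
(* One constant serves both estimates: the growth bound is the Lipschitz bound against v = 0, for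
   which [solves0] holds. *)
exists C, C; split=> // [u w hu un Fw|u v wu wv hu hv un vn Fu Fv].
  have [b1 D1] := dM u hu un.
  have D0 : besov_data chi q p theta (fun _ : 'rV[R]_d -> R => 0) (fun=> 0) (n%:R + 1) by exact: data0.
  have := main _ _ _ _ _ _ D1 D0 (sol u w hu un Fw) (solves0 chi Psi0).
  have sub0 (T : functional R d) : (T \- (fun=> 0))%R = T by apply/funext => f /=; rewrite subr0.
  by rewrite !sub0.
have [b1 D1] := dM u hu un; have [b2 D2] := dM v hv vn.
exact: main D1 D2 (sol u wu hu un Fu) (sol v wv hv vn Fv).
Qed.
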